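(* Let $\sigma\in\mathrm{Aut}(\mathbb C/\mathbb Q)$. If for every $\varphi\in\mathcal H_f(\omega_f,K)$ $$\sigma\big(\mathrm{tr}\,\varphi|_{L_0^2(\omega,\mathbf k)}\big)=\mathrm{tr}\,{}^\sigma\varphi|_{L_0^2({}^\sigma\omega,{}^\sigma\mathbf k)},$$ then conjugation $\pi\mapsto{}^\sigma\pi$ defines a map $\Pi_{\mathbf k}(\omega,K)\to\Pi_{{}^\sigma\mathbf k}({}^\sigma\omega,K)$.
   Context: Setting. Let $F/\mathbb Q$ be a totally real number field, Galois over $\mathbb Q$, with ring of integers $\mathcal O$, adele ring $\mathbb A$ and finite adeles $\mathbb A_f$. $S_\infty$ is the set of archimedean places; for $v\in S_\infty$ one has $F_v=\mathbb R$ canonically, and $S_\infty$ is identified with the set of embeddings $F\hookrightarrow\mathbb R\subset\mathbb C$. $G=\mathrm{GL}_2/F$, $Z$ is its center. $K=\prod_{v\notin S_\infty}K_v\le\prod_{v\notin S_\infty}G(\mathcal O_v)$ is compact open, and $\omega:F^*\backslash\mathbb A^*\to\mathbb C^*$ is an idele class character with $Z(F_v)\cap K_v\le\ker\omega_v$ for all finite $v$; $\omega_f$ is its finite part. $\mathbf k=(k_v)_{v\in S_\infty}$ is a weight, $k_v\in\mathbb N$, $k_v\ge2$. Standing assumptions: there is $w\in\mathbb Z$ with $\omega_v(x)=\pm|x|_v^w$ and $\omega_v(-1)=(-1)^{k_v}$ for all $v\in S_\infty$, and the algebraicity condition (Alg): $k_v\equiv w\pmod 2$ for all $v\in S_\infty$.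 Consequently $\omega_v(x)=x^w$ for $v\in S_\infty$. Hilbert modular forms. For $k\ge2$, $D_{k,w}$ is the irreducible discrete series representation of $\mathrm{GL}_2(\mathbb R)$ with lowest $\mathrm{SO}_2(\mathbb R)$-type $\delta_k$ and central character $x\mapsto x^w$ on positive scalars, where $\delta_n$ sends $\begin{pmatrix}\cos\Theta&\sin\Theta\\-\sin\Theta&\cos\Theta\end{pmatrix}$ to $e^{in\Theta}$. Put $D_{\mathbf k,w}=\otimes_{v\in S_\infty}D_{k_v,w}$ and $\delta_{\mathbf k}=\otimes_{v\in S_\infty}\delta_{k_v}$. $L_0^2(\omega)$ is the space of cusp forms in $L^2(G(F)\backslash G(\mathbb A),\omega)$ (functions with central character $\omega$, square integrable modulo center), and $$L_0^2(\omega,\mathbf k)=\bigoplus_{(\pi,V_\pi)\le L_0^2(\omega),\ \pi_\infty\cong D_{\mathbf k,w}}V_\pi(\delta_{\mathbf k}),$$ where $V_\pi(\delta_{\mathbf k})$ is the $\delta_{\mathbf k}$-isotypic subspace. $\Pi_{\mathbf k}(\omega,K)$ is the set of (isomorphism classes of) irreducible representations $\pi$ of $G(\mathbb A_f)$ such that $\pi^K\neq0$ appears in $L_0^2(\omega,\mathbf k)^K$. Hecke algebras. For finite $v$, $\mathcal H_v(\omega_v,K_v)$ is the algebra of $K_v$-bi-invariant functions on $G(F_v)$, compactly supported modulo center, with $\varphi(zx)=\omega_v^{-1}(z)\varphi(x)$ for $z\in Z(F_v)$; $\mathcal H_f(\omega_f,K)=\otimes_{v\nmid\infty}\mathcal H_v(\omega_v,K_v)$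 (restricted tensor product). It acts by $\pi(\varphi)=\int_{G(\mathbb A_f)/Z(\mathbb A_f)}\varphi(g)\pi(g)\,dg$, the Haar measure giving the image of $\prod_{v\notin S_\infty}G(\mathcal O_v)$ volume $1$. Conjugation. For $\sigma\in\mathrm{Aut}(\mathbb C/\mathbb Q)$: $({}^\sigma\varphi)(x)=\sigma(\varphi(x))$; ${}^\sigma\mathbf k=(k_{\sigma^{-1}(v)})_{v\in S_\infty}$, with $\sigma$ acting on $S_\infty$ by composition with embeddings $F\hookrightarrow\mathbb C$; ${}^\sigma\omega$ is the idele class character with finite part $\sigma\circ\omega_f$ and the same archimedean components $x\mapsto x^w$. For a representation $(\pi,W)$ of $G(\mathbb A_f)$, ${}^\sigma\pi$ acts on ${}^\sigma W=W$ (same abelian group, scalar multiplication $\alpha\cdot_\sigma v=\sigma^{-1}(\alpha)v$) by the same operators ${}^\sigma\pi(g)=\pi(g)$. *)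

(* Defs.v *)
Set Warnings "-notation-overridden,-ambiguous-paths,-notation-incompatible-prefix".
Set Warnings "-redundant-canonical-projection".
From HB Require Import structures.
From mathcomp Require Import all_boot all_order all_algebra all_field.
From mathcomp Require Import complex.
From mathcomp Require Import all_classical all_reals all_analysis.
Set Implicit Arguments.
Unset Strict Implicit.
Unset Printing Implicit Defensive.
Import Order.TTheory GRing.Theory Num.Theory.
Import numFieldNormedType.Exports.
Local Open Scope classical_set_scope.
Local Open Scope ring_scope.

#[short(type="preTopGroupType")]
HB.structure Definition PreTopGroup := {G of Group G & PointedTopological G}.


Section QuotientMeasure.
Variables (R : realType) (G : preTopGroupType).

Definition borel : set (set G) := <<s @open G >>.

(* Functions on, and Borel subsets of, the quotient <Gam>\G are represented by
   the Gam-invariant functions on, and Borel subsets of, G. *)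
Definition qborel (Gam : set G) : set (set G) :=
  [set B | borel B /\ forall c x, Gam c -> (B (c * x)%g <-> B x)].

Definition qmeasure (Gam : set G) :=
  {measure set (g_sigma_algebraType (qborel Gam)) -> \bar R}.

(* For Gam contained in the closed subgroup H: the nonzero locally finite
   Borel measures on <Gam>\H invariant under right translations by H, viewed
   as measures on <Gam>\G supported on <Gam>\H; by uniqueness of invariant
   measures such a mu is determined up to a positive scalar. *)
Definition invariant_measure (Gam H : set G) (mu : qmeasure Gam) : Prop :=
  [/\ forall h B, H h -> qborel Gam B -> mu [set x | B (x * h)%g] = mu B,
      (forall B, qborel Gam B -> B `<=` ~` H -> mu B = 0%E),
      forall g, exists U, [/\ open U, qborel Gam U, U g & (mu U < +oo)%E]
    & mu setT != 0%E].

Definition cintegral (Gam : set G) (mu : qmeasure Gam) (H : set G)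
    (f : G -> R[i]) : R[i] :=
  Complex (Rintegral mu H (fun x => complex.Re (f x)))
          (Rintegral mu H (fun x => complex.Im (f x))).

Definition cmeasurable (f : G -> R[i]) : Prop :=
  measurable_fun setT
    ((fun x => complex.Re (f x)) : g_sigma_algebraType (@open G) -> R) /\
  measurable_fun setT
    ((fun x => complex.Im (f x)) : g_sigma_algebraType (@open G) -> R).

End QuotientMeasure.

Record rep (R : realType) (G : groupType) := Rep {
  rsp :> lmodType R[i];
  act : G -> rsp -> rsp;
  act_lin : forall g (a : R[i]) x y,
    act g (a *: x + y) = a *: act g x + act g y;
  act1 : forall x, act 1%g x = x;
  actM : forall g h x, act (g * h)%g x = act g (act h x) }.

Section LinearNotions.
Variables (R : realType) (E : lmodType R[i]).
Local Notation C := R[i].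

Definition subspace_of (Y : set E) : Prop :=
  Y 0 /\ forall (a : C) x y, Y x -> Y y -> Y (a *: x + y).

Definition algebraic_dual : set (E -> C) :=
  [set l | forall (a : C) x y, l (a *: x + y) = a * l x + l y].

(* The finite rank operator T, given by its graph, on the subspace X modulo
   null vectors has trace t: the range of T is contained in the span of the
   linearly independent vectors b, on which T acts by the matrix A. *)
Definition has_trace (null X : set E) (T : E -> E -> Prop) (t : C) : Prop :=
  exists (n : nat) (b : 'I_n -> E) (A : 'M[C]_n),
    [/\ forall i, X (b i),
        forall c : 'I_n -> C, null (\sum_i c i *: b i) -> forall i, c i = 0,
        forall x, X x -> exists c : 'I_n -> C, T x (\sum_i c i *: b i),
        forall i, T (b i) (\sum_j A i j *: b j)
      & t = \tr A].

(* ip is linear in the first variable, and semidefinite: vectors are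
   identified when their difference is null. *)
Variable ip : E -> E -> C.

Definition ipnull : set E := [set x | ip x x = 0].

Definition ipcvg (u : nat -> E) (x : E) : Prop :=
  (fun n => complex.Re (ip (u n - x) (u n - x))) @ \oo --> (0 : R).

Definition ipcauchy (u : nat -> E) : Prop :=
  forall e : R, 0 < e -> exists N, forall m n, (N <= m)%N -> (N <= n)%N ->
    complex.Re (ip (u m - u n) (u m - u n)) < e.

Definition hilbert : Prop :=
  [/\ forall (a : C) x y z, ip (a *: x + y) z = a * ip x z + ip y z,
      forall x y, ip y x = (ip x y)^*%C,
      forall x, 0 <= ip x x,
      ipnull `<=` [set 0]
    & forall u, ipcauchy u -> exists x, ipcvg u x].

Variables (G : groupType) (rho : G -> E -> E).

(* y = \int phi(g) rho(g) x dg in the weak sense, I being the integral. *)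
Definition weak_action (dual : set (E -> C)) (I : (G -> C) -> C)
    (phi : G -> C) (x y : E) : Prop :=
  forall l, dual l -> l y = I (fun g => phi g * l (rho g x)).

(* Y is a subspace of X, closed in X for the seminorm defined by ip. *)
Definition closed_subspace (X Y : set E) : Prop :=
  [/\ Y `<=` X, subspace_of Y
    & forall u x, X x -> (forall n, Y (u n)) -> ipcvg u x -> Y x].

Definition closed_subrep (X Y : set E) : Prop :=
  closed_subspace X Y /\ forall g y, Y y -> Y (rho g y).

Definition top_irreducible (X : set E) : Prop :=
  (exists2 x, X x & ~ ipnull x) /\
  forall Y, closed_subrep X Y -> (exists2 y, Y y & ~ ipnull y) -> Y = X.

End LinearNotions.

Section AlgebraicRep.
Variables (R : realType) (G : preTopGroupType).

Definition smooth (V : rep R G) : Prop :=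
  forall x : V, \forall g \near (1%g : G), act g x = x.

Definition irreducible (V : rep R G) : Prop :=
  (exists x : V, x <> 0) /\
  forall Y : set V, subspace_of Y -> (forall g y, Y y -> Y (act g y)) ->
    (exists2 y, Y y & y <> 0) -> Y = setT.

Definition rep_iso (V W : rep R G) : Prop :=
  exists f : V -> W, [/\ bijective f,
    forall (a : R[i]) x y, f (a *: x + y) = a *: f x + f y
  & forall g x, f (act g x) = act g (f x)].

End AlgebraicRep.

Record autC (R : realType) := AutC {
  sig : {rmorphism R[i] -> R[i]};
  sigV : {rmorphism R[i] -> R[i]};
  sigK : cancel sig sigV;
  sigVK : cancel sigV sig }.

Section Conj.
Variables (R : realType) (s : autC R).

Definition conj_mod (W : lmodType R[i]) : Type := W.

Section Mod.
Variable W : lmodType R[i].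
HB.instance Definition _ := GRing.Zmodule.on (conj_mod W).
Definition conj_scale (a : R[i]) (x : conj_mod W) : conj_mod W :=
  sigV s a *: (x : W).
Lemma conj_scaleA a b x :
  conj_scale a (conj_scale b x) = conj_scale (a * b) x.
Proof. by rewrite /conj_scale scalerA rmorphM. Qed.
Lemma conj_scale1 : left_id 1 conj_scale.
Proof. by move=> x; rewrite /conj_scale rmorph1 scale1r. Qed.
Lemma conj_scaleDr : right_distributive conj_scale +%R.
Proof. by move=> a x y; rewrite /conj_scale scalerDr. Qed.
Lemma conj_scaleDl x : {morph conj_scale^~ x : a b / a + b}.
Proof. by move=> a b; rewrite /conj_scale rmorphD scalerDl. Qed.
Definition conj_lmod : lmodType R[i] := HB.pack (conj_mod W)
  (GRing.Zmodule_isLmodule.Build R[i] (conj_mod W)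
    conj_scaleA conj_scale1 conj_scaleDr conj_scaleDl).
End Mod.

Variable G : groupType.

Lemma conj_act_lin (V : rep R G) g (a : R[i]) (x y : conj_lmod V) :
  act g (a *: x + y : conj_lmod V) =
  (a *: (act g x : conj_lmod V) + (act g y : conj_lmod V)) :> conj_lmod V.
Proof. exact: (@act_lin _ _ V g (sigV s a)). Qed.

Definition conj_rep (V : rep R G) : rep R G :=
  @Rep R G (conj_lmod V) (@act R G V) (@conj_act_lin V)
    (@act1 R G V) (@actM R G V).

End Conj.

Record avField (R : realType) := AVField {
  avsort :> fieldType;
  av : avsort -> R;
  av_ge0 : forall x, 0 <= av x;
  av_eq0 : forall x, av x = 0 <-> x = 0;
  avM : forall x y, av (x * y) = av x * av y;
  avD : forall x y, av (x + y) <= av x + av y }.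
Arguments av {R a} x.

Section RealField.
Variable R : realType.
Let norm (x : R) : R := `|x|.
Lemma norm_ge0_av x : 0 <= norm x. Proof. exact: normr_ge0. Qed.
Lemma norm_eq0_av x : norm x = 0 <-> x = 0.
Proof. by split=> [/normr0P/eqP|->]; rewrite /norm ?normr0. Qed.
Lemma normM_av x y : norm (x * y) = norm x * norm y. Proof. exact: normrM. Qed.
Lemma normD_av x y : norm (x + y) <= norm x + norm y.
Proof. exact: ler_normD. Qed.
Definition realAV : avField R :=
  AVField norm_ge0_av norm_eq0_av normM_av normD_av.
End RealField.

Section GL.
Variables (R : realType) (n : nat) (K : avField R).

Record GL : Type := MkGL { glmx : 'M[K]_n; glP : glmx \in unitmx }.

HB.instance Definition _ := gen_eqMixin GL.
HB.instance Definition _ := gen_choiceMixin GL.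

Lemma glmx_inj : injective glmx.
Proof.
by case=> A hA [B hB] /= eAB; subst B; congr MkGL; exact: bool_irrelevance.
Qed.

Definition gl1 : GL := MkGL (unitmx1 K n).
Lemma glM_subproof (g h : GL) : glmx g *m glmx h \in unitmx.
Proof. by rewrite unitmx_mul !glP. Qed.
Definition glM g h : GL := MkGL (glM_subproof g h).
Lemma glV_subproof (g : GL) : invmx (glmx g) \in unitmx.
Proof. by rewrite unitmx_inv glP. Qed.
Definition glV g : GL := MkGL (glV_subproof g).
Lemma glMA : associative glM.
Proof. by move=> x y z; apply: glmx_inj; rewrite /= mulmxA. Qed.
Lemma gl1M : left_id gl1 glM.
Proof. by move=> x; apply: glmx_inj; rewrite /= mul1mx. Qed.
Lemma glM1 : right_id gl1 glM.
Proof. by move=> x; apply: glmx_inj; rewrite /= mulmx1. Qed.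
Lemma glVM : left_inverse gl1 glV glM.
Proof. by move=> x; apply: glmx_inj; rewrite /= mulVmx// glP. Qed.
Lemma glMV : right_inverse gl1 glV glM.
Proof. by move=> x; apply: glmx_inj; rewrite /= mulmxV// glP. Qed.
HB.instance Definition _ := isGroup.Build GL glMA gl1M glM1 glVM glMV.
HB.instance Definition _ := isPointed.Build GL gl1.

(* The subspace topology of M_n(K), which for a field K is the usual one. *)
Definition gl_balls : set (set GL) :=
  [set B | exists (A : 'M[K]_n) (e : R), 0 < e /\
     B = [set g | forall i j, av (glmx g i j - A i j) < e]].
HB.instance Definition _ :=
  @isSubBaseTopological.Build GL (set GL) gl_balls id.

Definition gl_integral : set GL :=
  [set g | forall i j, av (glmx g i j) <= 1 /\ av (invmx (glmx g) i j) <= 1].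

Lemma gl_scal_subproof (a : K) : a != 0 -> (a%:M : 'M[K]_n) \in unitmx.
Proof. by move=> a0; rewrite unitmxE det_scalar unitfE expf_neq0. Qed.

End GL.

Section GLmorphisms.
Variables (R : realType) (n : nat) (K : avField R).

(* K^* is GL 1 K. *)
Definition gl1val (z : GL 1 K) : K := glmx z ord0 ord0.

Lemma gl1val_neq0 z : gl1val z != 0.
Proof. by have := glP z; rewrite unitmxE unitfE det_mx11. Qed.

Definition gl_scal (z : GL 1 K) : GL n K :=
  MkGL (gl_scal_subproof n (gl1val_neq0 z)).

Lemma gl_unit_subproof (a : K) : a != 0 -> (a%:M : 'M[K]_1) \in unitmx.
Proof. exact: gl_scal_subproof. Qed.

Lemma gl_det_neq0 (g : GL n K) : \det (glmx g) != 0.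
Proof. by have := glP g; rewrite unitmxE unitfE. Qed.

Definition gl_det (g : GL n K) : GL 1 K :=
  MkGL (gl_unit_subproof (gl_det_neq0 g)).

End GLmorphisms.

Section DiscreteSeries.
Variable R : realType.
Local Notation C := R[i].
Local Notation G := (GL 2 (realAV R)).

Definition rot_mx (t : R) : 'M[R]_2 :=
  \matrix_(i, j) if i == j then cos t else if i == ord0 then sin t else - sin t.
Lemma rot_subproof t : rot_mx t \in unitmx.
Proof.
rewrite unitmxE (expand_det_row _ ord0) !big_ord_recl big_ord0 /cofactor.
rewrite !det_mx11 !mxE /= addr0 !expr0 !expr1 !mul1r mulN1r opprK.
by rewrite -!expr2 cos2Dsin2 unitr1.
Qed.
Definition rot (t : R) : G := @MkGL R 2 (realAV R) (rot_mx t) (rot_subproof t).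

(* exp(i n t) *)
Definition expi (n : int) (t : R) : C :=
  Complex (cos (n%:~R * t)) (sin (n%:~R * t)).

Definition has_type (V : rep R G) (n : int) : Prop :=
  exists2 x : V, x <> 0 & forall t, act (rot t) x = expi n t *: x.

Definition detR (g : G) : R := \det (glmx g).

(* The form ip is normalized to be
   invariant up to |det|^w, i.e. to be invariant for the unitary twist of V
   by |det|^(-w/2). *)
Record is_Dkw (k : nat) (w : int) (V : rep R G) (ip : V -> V -> C) : Prop := {
  Dkw_hilbert : hilbert ip;
  Dkw_continuous : forall (g : G) (x : V) (e : R), 0 < e ->
    \forall h \near g,
      complex.Re (ip (act h x - act g x) (act h x - act g x)) < e;
  Dkw_unitary : forall g x y,
    ip (act g x) (act g y) = (`|detR g| ^ w)%:C%C * ip x y;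
  Dkw_irreducible : top_irreducible ip (@act R G V) setT;
  Dkw_central : forall (z : GL 1 (realAV R)) (x : V), 0 < (gl1val z : R) ->
    act (gl_scal 2 z) x = ((gl1val z : R) ^ w)%:C%C *: x;
  Dkw_discrete : forall eta : qmeasure R (range (@gl_scal R 2 (realAV R))),
    invariant_measure setT eta -> forall x y,
    (\int[eta]_(g in setT)
      (Normc.normc (ip (act g x) y) ^+ 2 / `|detR g| ^ w)%:E < +oo)%E;
  Dkw_lowest : has_type V k%:Z /\
    forall n : int, has_type V n -> (k <= `|n|)%N }.

End DiscreteSeries.

Section GLIntegral.
Variables (R : realType) (K : avField R).
Hypothesis avU : forall x y : K, av (x + y) <= Num.max (av x) (av y).

Let OK (x : K) := av x <= 1.

Lemma av1 : av (1 : K) = 1.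
Proof.
have /eqP := avM (1 : K) 1; rewrite mulr1 -subr_eq0 -{1}(mulr1 (av 1)) -mulrBr.
rewrite mulf_eq0 => /orP[/eqP/av_eq0/eqP|]; first by rewrite oner_eq0.
by rewrite subr_eq0 => /eqP.
Qed.
Lemma avN (x : K) : av (- x) = av x.
Proof.
suff h : av (-1 : K) = 1 by rewrite -mulN1r avM h mul1r.
have /eqP : av (-1 : K) ^+ 2 = 1 by rewrite expr2 -avM mulrNN mulr1 av1.
rewrite sqrf_eq1 => /orP[/eqP//|/eqP h].
by have := av_ge0 (-1 : K); rewrite h oppr_ge0 ler10.
Qed.
Lemma int0_subproof : OK 0.
Proof. by rewrite /OK (av_eq0 (0 : K)).2. Qed.
Lemma int1_subproof : OK 1. Proof. by rewrite /OK av1. Qed.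
Lemma intD_subproof x y : OK x -> OK y -> OK (x + y).
Proof. by move=> hx hy; apply: le_trans (avU x y) _; rewrite ge_max; apply/andP. Qed.
Lemma intM_subproof x y : OK x -> OK y -> OK (x * y).
Proof. by move=> hx hy; rewrite /OK avM mulr_ile1 ?av_ge0. Qed.
Lemma int_sum_subproof (I : finType) (F : I -> K) :
  (forall i, OK (F i)) -> OK (\sum_i F i).
Proof.
by move=> h; apply: (big_ind OK) => //; [exact: int0_subproof|exact: intD_subproof].
Qed.
Lemma int_prod_subproof (I : finType) (F : I -> K) :
  (forall i, OK (F i)) -> OK (\prod_i F i).
Proof.
by move=> h; apply: (big_ind OK) => //; [exact: int1_subproof|exact: intM_subproof].
Qed.
Lemma int_det_subproof n (A : 'M[K]_n) : (forall i j, OK (A i j)) -> OK (\det A).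
Proof.
move=> h; apply: int_sum_subproof => s; apply: intM_subproof.
  by rewrite /OK; case: (perm.odd_perm s); rewrite ?expr1 ?expr0 ?avN av1.
by apply: int_prod_subproof => i.
Qed.

Lemma gl_integral1 n : gl_integral (1%g : GL n K).
Proof.
have h i j : OK ((1%:M : 'M[K]_n) i j).
  by rewrite mxE; case: eqP => _; [exact: int1_subproof|exact: int0_subproof].
by move=> i j; rewrite invmx1; split; exact: h.
Qed.
Lemma gl_integralM n (g h : GL n K) :
  gl_integral g -> gl_integral h -> gl_integral (g * h)%g.
Proof.
move=> hg hh i j; split.
  by rewrite mxE; apply: int_sum_subproof => k; apply: intM_subproof;
    [have [] := hg i k|have [] := hh k j].
have -> : invmx (glmx (g * h)%g) = invmx (glmx h) *m invmx (glmx g).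
  exact: (congr1 (@glmx _ _ _) (invgM g h)).
by rewrite mxE; apply: int_sum_subproof => k; apply: intM_subproof;
  [have [] := hh i k|have [] := hg k j].
Qed.
Lemma gl_integralV n (g : GL n K) : gl_integral g -> gl_integral (g^-1)%g.
Proof.
move=> hg i j; have -> : glmx (g^-1)%g = invmx (glmx g) by [].
by rewrite invmxK; have [? ?] := hg i j.
Qed.
Lemma gl_integral_scal n (z : GL 1 K) :
  gl_integral z -> gl_integral (gl_scal n z).
Proof.
move=> hz i j; have [h1 h2] := hz ord0 ord0.
rewrite /= invmx_scalar !mxE; move: h2; rewrite {1}(mx11_scalar (glmx z)).
rewrite invmx_scalar mxE eqxx mulr1n => h2.
by case: (i == j); rewrite ?mulr1n ?mulr0n; split=> //; exact: int0_subproof.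
Qed.
Lemma gl_integral_det n (g : GL n K) :
  gl_integral g -> gl_integral (gl_det g).
Proof.
move=> hg i j; rewrite !ord1 /= invmx_scalar !mxE eqxx !mulr1n -det_inv.
by split; apply: int_det_subproof => k l; have [] := hg k l.
Qed.
End GLIntegral.

Record rpfam (I : Type) := RPFam {
  rfac :> I -> preTopGroupType;
  rint : forall i, set (rfac i);
  rint1 : forall i, @rint i 1%g;
  rintM : forall i x y, @rint i x -> @rint i y -> @rint i (x * y)%g;
  rintV : forall i x, @rint i x -> @rint i (x^-1)%g }.
Arguments rint {I} r i.

Section RProd.
Variables (I : Type) (X : rpfam I).

Record rprod : Type := RProd {
  rval :> forall i, X i;
  rvalP : finite_set [set i | ~ rint X i (rval i)] }.

HB.instance Definition _ := gen_eqMixin rprod.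
HB.instance Definition _ := gen_choiceMixin rprod.

Lemma rval_inj x y : (forall i, rval x i = rval y i) -> x = y.
Proof.
case: x y => x hx [y hy] /= exy.
have e : x = y by exact: functional_extensionality_dep.
by subst y; congr RProd; exact: Prop_irrelevance.
Qed.

Lemma rprod1_subproof :
  finite_set [set i | ~ rint X i ((fun i => 1%g : X i) i)].
Proof.
by rewrite (_ : [set _ | _] = set0) // -subset0 => i /=; apply; exact: rint1.
Qed.
Definition rprod1 := RProd rprod1_subproof.
Lemma rprodM_subproof (x y : rprod) :
  finite_set [set i | ~ rint X i (x i * y i)%g].
Proof.
have : finite_set
    ([set i | ~ rint X i (x i)] `|` [set i | ~ rint X i (y i)]).
  by rewrite finite_setU; split; exact: rvalP.
apply: sub_finite_set => i /= nxy.
by have [hx|] := pselect (rint X i (x i)); [right => hy; apply/nxy/rintM|left].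
Qed.
Definition rprodM x y := RProd (rprodM_subproof x y).
Lemma rprodV_subproof (x : rprod) : finite_set [set i | ~ rint X i (x i)^-1%g].
Proof.
by apply: sub_finite_set (rvalP x) => i /= nx hx; apply/nx/rintV.
Qed.
Definition rprodV x := RProd (rprodV_subproof x).
Lemma rprodMA : associative rprodM.
Proof. by move=> x y z; apply: rval_inj => i; exact: mulgA. Qed.
Lemma rprod1M : left_id rprod1 rprodM.
Proof. by move=> x; apply: rval_inj => i; exact: mul1g. Qed.
Lemma rprodM1 : right_id rprod1 rprodM.
Proof. by move=> x; apply: rval_inj => i; exact: mulg1. Qed.
Lemma rprodVM : left_inverse rprod1 rprodV rprodM.
Proof. by move=> x; apply: rval_inj => i; exact: mulVg. Qed.
Lemma rprodMV : right_inverse rprod1 rprodV rprodM.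
Proof. by move=> x; apply: rval_inj => i; exact: mulgV. Qed.
HB.instance Definition _ :=
  isGroup.Build rprod rprodMA rprod1M rprodM1 rprodVM rprodMV.
HB.instance Definition _ := isPointed.Build rprod rprod1.

Definition rprod_boxes : set (set rprod) :=
  [set B : set rprod | exists U : forall i, set (X i),
     [/\ forall i, open (U i),
         finite_set [set i | U i <> rint X i]
       & B = [set x | forall i, U i (x i)]]].
HB.instance Definition _ :=
  @isSubBaseTopological.Build rprod (set rprod) rprod_boxes id.

End RProd.

Lemma rmap_subproof (I : Type) (X Y : rpfam I) (f : forall i, X i -> Y i)
    (hf : forall i x, rint X i x -> rint Y i (f i x)) (x : rprod X) :
  finite_set [set i | ~ rint Y i (f i (x i))].
Proof. by apply: sub_finite_set (rvalP x) => i /= nx /hf. Qed.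
Definition rmap (I : Type) (X Y : rpfam I) (f : forall i, X i -> Y i)
    (hf : forall i x, rint X i x -> rint Y i (f i x)) (x : rprod X) : rprod Y :=
  RProd (rmap_subproof hf x).

Section NumberField.
Variables (R : realType) (F : fieldExtType rat).
Local Notation C := R[i].

Definition totally_real : Prop :=
  forall (t : {rmorphism F -> C}) x, complex.Im (t x) = 0.

Definition intring : set F :=
  [set x | integralOver (intr : int -> F) x].

(* For F totally real the completion at t is R, with embedding Re \o t. *)
Definition infPlace : Type := {rmorphism F -> C}.
HB.instance Definition _ := gen_eqMixin infPlace.
HB.instance Definition _ := gen_choiceMixin infPlace.

Record finPlace : Type := FinPlace {
  pideal :> set F;
  pideal_sub : pideal `<=` intring;
  pideal0 : pideal 0;
  pidealD : forall x y, pideal x -> pideal y -> pideal (x + y);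
  pidealM : forall a x, intring a -> pideal x -> pideal (a * x);
  pideal_proper : ~ pideal 1;
  pideal_prime : forall a b, intring a -> intring b ->
    pideal (a * b) -> pideal a \/ pideal b;
  pideal_neq0 : exists2 x, pideal x & x != 0 }.
HB.instance Definition _ := gen_eqMixin finPlace.
HB.instance Definition _ := gen_choiceMixin finPlace.

(* The completion of F at v, with some absolute value defining its topology
   (the normalization plays no role); it is unique up to a unique topological
   isomorphism over F. *)
Record completion (v : finPlace) : Type := Completion {
  cfield :> avField R;
  cemb : {rmorphism F -> cfield};
  c_ultra : forall x y : cfield, av (x + y) <= Num.max (av x) (av y);
  c_int : forall x, intring x -> av (cemb x) <= 1;
  c_prime : forall x, intring x -> (av (cemb x) < 1 <-> pideal v x);
  c_dense : forall (y : cfield) (e : R), 0 < e ->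
    exists x, av (y - cemb x) < e;
  c_complete : forall u : nat -> cfield,
    (forall e : R, 0 < e -> exists N, forall m n, (N <= m)%N -> (N <= n)%N ->
       av (u m - u n) < e) ->
    exists l : cfield, forall e : R, 0 < e -> exists N, forall n,
      (N <= n)%N -> av (u n - l) < e }.

End NumberField.

Section Adelic.
Variables (R : realType) (F : fieldExtType rat).
Variable Fhat : forall v : finPlace F, completion R v.
Local Notation C := R[i].

Definition place : Type := (infPlace R F + finPlace F)%type.
HB.instance Definition _ := Choice.on place.

Definition lfield (v : place) : avField R :=
  match v with inl _ => realAV R | inr v => Fhat v end.

Definition lemb (v : place) : F -> lfield v :=
  match v return F -> lfield v with
  | inl t => fun x => complex.Re ((t : {rmorphism F -> C}) x)
  | inr v => cemb (Fhat v)
  end.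

Section Groups.
Variable n : nat.

Definition fin_fam : rpfam (finPlace F) :=
  @RPFam _ (fun v => GL n (Fhat v)) (fun v => @gl_integral R n (Fhat v))
    (fun v => @gl_integral1 R (Fhat v) n)
    (fun v => @gl_integralM R (Fhat v) (@c_ultra _ _ _ (Fhat v)) n)
    (fun v => @gl_integralV R (Fhat v) n).

Definition all_int (v : place) : set (GL n (lfield v)) :=
  match v return set (GL n (lfield v)) with
  | inl _ => setT
  | inr v => @gl_integral R n (Fhat v)
  end.
Lemma all_int1 v : @all_int v 1%g.
Proof. by case: v => // v; apply: (rint1 fin_fam). Qed.
Lemma all_intM v x y : @all_int v x -> @all_int v y -> @all_int v (x * y)%g.
Proof. by case: v x y => // v x y; apply: (@rintM _ fin_fam v). Qed.
Lemma all_intV v x : @all_int v x -> @all_int v (x^-1)%g.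
Proof. by case: v x => // v x; apply: (@rintV _ fin_fam v). Qed.
Definition all_fam : rpfam place :=
  @RPFam _ (fun v => GL n (lfield v)) all_int all_int1 all_intM all_intV.

(* GL_n of the finite adeles and of the adeles; GA 1 is the idele group. *)
Definition GAf := rprod fin_fam.
Definition GA := rprod all_fam.
HB.instance Definition _ := PreTopGroup.on GAf.
HB.instance Definition _ := PreTopGroup.on GA.

Definition GAf_int : set GAf := [set g | forall v, gl_integral (g v)].

Definition of_fin_fun (g : GAf) (v : place) : GL n (lfield v) :=
  match v return GL n (lfield v) with inl _ => 1%g | inr v => g v end.
Lemma of_fin_subproof g : finite_set [set v | ~ all_int (of_fin_fun g v)].
Proof.
apply: sub_finite_set (finite_image (inr : _ -> place) (rvalP g)).
by case=> [v /(_ I)|v nv]; last exists v.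
Qed.
Definition of_fin (g : GAf) : GA := @RProd _ all_fam _ (of_fin_subproof g).

Definition of_inf_fun (g : infPlace R F -> GL n (realAV R)) (v : place) :
    GL n (lfield v) :=
  match v return GL n (lfield v) with inl t => g t | inr v => 1%g end.
Lemma of_inf_subproof g : finite_set [set v | ~ all_int (of_inf_fun g v)].
Proof.
rewrite (_ : [set _ | _] = set0) // -subset0 => -[v /(_ I)//|v] /=; apply.
exact: (rint1 fin_fam).
Qed.
Definition of_inf (g : infPlace R F -> GL n (realAV R)) : GA :=
  @RProd _ all_fam _ (of_inf_subproof g).

Lemma fin_part_subproof (g : GA) :
  finite_set [set v | ~ rint fin_fam v (g (inr v))].
Proof.
apply: (@finite_preimage _ _ [set v | ~ rint all_fam v (g v)]
  (inr : finPlace F -> place)) => [v w _ _ []//|]; exact: rvalP.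
Qed.
Definition fin_part (g : GA) : GAf :=
  @RProd _ fin_fam (fun v => g (inr v)) (fin_part_subproof g).
Definition inf_part (g : GA) : infPlace R F -> GL n (realAV R) :=
  fun t => g (inl t).

Definition at_place_fun v (x : GL n (lfield v)) (w : place) :
    GL n (lfield w) :=
  @dfwith place (fun w => GL n (lfield w)) (fun w => 1%g) v x w.
Lemma at_place_subproof v x :
  finite_set [set w | ~ all_int (@at_place_fun v x w)].
Proof.
apply: (@sub_finite_set _ _ [set v]) (finite_set1 v) => w /=.
by rewrite /at_place_fun; case: dfwithP => // w' _ /(_ (@all_int1 w')).
Qed.
Definition at_place v (x : GL n (lfield v)) : GA :=
  @RProd _ all_fam _ (at_place_subproof x).

(* The diagonal image of GL_n(F). *)
Definition GF : set GA :=
  [set g | exists2 A : 'M[F]_n, A \in unitmx &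
     forall v, glmx (g v) = map_mx (lemb v) A].

End Groups.
Arguments GF n _ : clear implicits.

Lemma all_int_scal n v z :
  @all_int 1 v z -> @all_int n v (gl_scal n z).
Proof. by case: v z => // v z; exact: gl_integral_scal. Qed.
Lemma fin_int_scal n v z :
  rint (fin_fam 1) v z -> rint (fin_fam n) v (gl_scal n z).
Proof. exact: gl_integral_scal. Qed.
Lemma all_int_det n v g : @all_int n v g -> @all_int 1 v (gl_det g).
Proof.
by case: v g => // v g; exact: (gl_integral_det (@c_ultra _ _ _ (Fhat v))).
Qed.

Definition scal n : GA 1 -> GA n :=
  @rmap _ (all_fam 1) (all_fam n) (fun v => @gl_scal R n (lfield v))
    (@all_int_scal n).
Definition fscal n : GAf 1 -> GAf n :=
  @rmap _ (fin_fam 1) (fin_fam n) (fun v => @gl_scal R n (Fhat v))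
    (@fin_int_scal n).
Definition adet n : GA n -> GA 1 :=
  @rmap _ (all_fam n) (all_fam 1) (fun v => @gl_det R n (lfield v))
    (@all_int_det n).

Definition local_char (omega : GA 1 -> C) (v : place) (z : GL 1 (lfield v)) :
  C := omega (at_place z).
Arguments local_char omega v z : clear implicits.

Definition idele_class_character (omega : GA 1 -> C) : Prop :=
  [/\ omega 1%g = 1,
      forall x y, omega (x * y)%g = omega x * omega y,
      continuous (fun x => complex.Re (omega x)) /\
      continuous (fun x => complex.Im (omega x))
    & forall x, GF 1 x -> omega x = 1].

Definition conj_char (s : autC R) (omega : GA 1 -> C) (x : GA 1) : C :=
  sig s (omega (of_fin (fin_part x))) * omega (of_inf (inf_part x)).

(* The weight (k_{s^-1(v)})_v. *)
Definition conj_weight (s : autC R) (k : infPlace R F -> nat)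
    (v : infPlace R F) : nat :=
  k ([the {rmorphism F -> C} of sigV s \o (v : {rmorphism F -> C})]).

Section Hecke.
Variables (omega : GA 1 -> C) (K : forall v : finPlace F, set (GL 2 (Fhat v))).

Definition level : set (GAf 2) := [set g | forall v, K (g v)].

Definition omega_at (v : finPlace F) : GL 1 (Fhat v) -> C :=
  local_char omega (inr v).

Definition local_hecke (v : finPlace F) : set (GL 2 (Fhat v) -> C) :=
  [set phi |
    [/\ forall k k' x, K k -> K k' -> phi (k * x * k')%g = phi x,
        forall z x, phi (gl_scal 2 z * x)%g = (omega_at z)^-1 * phi x
      & exists D : set (GL 2 (Fhat v)), compact D /\
          forall x, phi x != 0 -> exists z d, D d /\ x = (gl_scal 2 z * d)%g]].

(* At almost all v one has K_v = GL_2(O_v), Z K_v / Z has volume 1, and this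
   is the unit element of the local Hecke algebra. *)
Definition local_hecke_unit (v : finPlace F) (phi : GL 2 (Fhat v) -> C) : Prop :=
  (forall z k, K k -> phi (gl_scal 2 z * k)%g = (omega_at z)^-1) /\
  (forall x, phi x != 0 -> exists z k, K k /\ x = (gl_scal 2 z * k)%g).

(* The restricted tensor product of the local Hecke algebras, as an algebra
   of functions on GL_2 of the finite adeles. *)
Definition hecke : set (GAf 2 -> C) :=
  [set phi | exists (n : nat)
      (Phi : 'I_n -> forall v : finPlace F, GL 2 (Fhat v) -> C),
    [/\ forall i v, local_hecke (Phi i v),
        forall i, finite_set [set v | ~ local_hecke_unit (Phi i v)]
      & forall g : GAf 2, phi g =
          \sum_i \big[*%R/1]_(v \in [set: finPlace F]) Phi i v (g v)]].

End Hecke.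

Definition adelic_center : set (GA 2) := range (@scal 2).
Definition fcenter : set (GAf 2) := range (@fscal 2).
Definition unipotent : set (GA 2) :=
  [set g | forall v, [/\ glmx (g v) ord0 ord0 = 1,
    glmx (g v) ord_max ord_max = 1 & glmx (g v) ord_max ord0 = 0]].

(* mu : Z(A)GL_2(F)\GL_2(A); nu : N(F)\N(A), with N the unipotent radical;
   lam : GL_2(A_f)/Z(A_f). *)
Variables (mu : qmeasure R (adelic_center `|` GF 2))
          (nu : qmeasure R (GF 2 `&` unipotent))
          (lam : qmeasure R fcenter).

Definition fcenter_haar : Prop :=
  invariant_measure setT lam /\
  lam [set g | exists z k, GAf_int k /\ g = (fscal 2 z * k)%g] = 1%E.

Definition form : lmodType C := (GA 2 -> C^o).

Definition rtrans (g : GA 2) (f : form) : form := fun x => f (x * g)%g.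
Definition frtrans (g : GAf 2) (f : form) : form := rtrans (of_fin g) f.

Section Forms.
Variable omega : GA 1 -> C.

(* As omega need not be unitary, |f|^2 is divided by |omega o det| to get a
   function on Z(A)GL_2(F)\GL_2(A). *)
Definition L2 : set form :=
  [set f : GA 2 -> C |
    [/\ cmeasurable f,
        forall c x, GF 2 c -> f (c * x)%g = f x,
        forall z x, f (scal 2 z * x)%g = omega z * f x
      & (\int[mu]_(x in setT)
          (Normc.normc (f x) ^+ 2 / Normc.normc (omega (adet x)))%:E < +oo)%E]].

Definition ip (f h : form) : C :=
  cintegral mu setT
    (fun x => f x * (h x)^*%C / (Normc.normc (omega (adet x)))%:C%C).

Definition cuspidal (f : form) : Prop :=
  {ae mu, forall g, cintegral nu unipotent (fun n => f (n * g)%g) = 0}.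

Definition L20 : set form := [set f | L2 f /\ cuspidal f].

Definition L2_dual : set (form -> C) :=
  [set l | exists2 h, L2 h & l = fun f => ip f h].

Variables (k : infPlace R F -> nat) (w : int).

(* V is isomorphic to D_{k,w} \hat\otimes U for some representation U of
   GL_2(A_f), where D_{k,w} is the Hilbert tensor product of the D v: tau is
   the map (d, u) |-> (\otimes_v d_v) \otimes u. *)
Definition arch_type (V : set form) : Prop :=
  exists (D : infPlace R F -> rep R (GL 2 (realAV R)))
    (ipD : forall v, D v -> D v -> C)
    (U : rep R (GAf 2)) (ipU : U -> U -> C)
    (tau : (forall v, D v) -> U -> form),
    [/\ (forall v, is_Dkw (k v) w (ipD v)) /\ hilbert ipU,
        forall d u, V (tau d u),
        forall d d' u u', ip (tau d u) (tau d' u') =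
          (\big[*%R/1]_(v \in [set: infPlace R F]) ipD v (d v) (d' v)) *
          ipU u u',
        forall g h d u, ipnull ip
          (tau (fun v => act (g v) (d v)) (act h u) -
           rtrans (of_inf g * of_fin h)%g (tau d u))
      & forall Y, closed_subspace ip V Y -> (forall d u, Y (tau d u)) -> Y = V].

Definition isotypic (V : set form) : set form :=
  [set f | V f /\ forall t : infPlace R F -> R, ipnull ip
    (rtrans (of_inf (fun v => rot (t v))) f -
     (\big[*%R/1]_(v \in [set: infPlace R F]) expi (k v) (t v)) *: f)].

(* The Hilbert (completed) sum of the isotypic subspaces. *)
Definition L20k : set form :=
  [set f | L20 f /\ forall Y, closed_subspace ip L20 Y ->
    (forall V, closed_subrep ip rtrans L20 V -> top_irreducible ip rtrans V ->
       arch_type V -> isotypic V `<=` Y) -> Y f].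

Definition hecke_form (phi : GAf 2 -> C) (f h : form) : Prop :=
  weak_action frtrans L2_dual (cintegral lam setT) phi f h.

Definition hecke_trace (phi : GAf 2 -> C) (t : C) : Prop :=
  has_trace (ipnull ip) L20k (hecke_form phi) t.

Variable K : forall v : finPlace F, set (GL 2 (Fhat v)).

Definition L20kK : set form :=
  [set f | L20k f /\ forall g, level K g -> ipnull ip (frtrans g f - f)].

Definition fixed (V : rep R (GAf 2)) : set V :=
  [set x | forall g, level K g -> act g x = x].

Definition hecke_act (V : rep R (GAf 2)) (phi : GAf 2 -> C) (x y : V) : Prop :=
  weak_action (@act R (GAf 2) V) (@algebraic_dual R V)
    (cintegral lam setT) phi x y.

(* V^K embeds in L20kK, as a module over the Hecke algebra. *)
Definition appears (V : rep R (GAf 2)) : Prop :=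
  exists j : V -> form,
    [/\ forall x, fixed x -> L20kK (j x),
        forall (a : C) x y, fixed x -> fixed y ->
          ipnull ip (j (a *: x + y) - (a *: j x + j y)),
        forall x, fixed x -> ipnull ip (j x) -> x = 0
      & forall phi x y, hecke omega K phi -> fixed x -> fixed y ->
          hecke_act phi x y -> hecke_form phi (j x) (j y)].

(* The isomorphism-invariant predicate defining Pi_k(omega, K). The central
   character is fixed so that the Hecke algebra acts on V^K. *)
Definition in_Pi (V : rep R (GAf 2)) : Prop :=
  [/\ smooth V /\ irreducible V,
      forall z (x : V), act (fscal 2 z) x = omega (of_fin z) *: x,
      exists2 x : V, fixed x & x <> 0
    & appears V].

End Forms.

End Adelic.

Arguments GF {R F} Fhat n _.
Arguments adelic_center {R F} Fhat _.
Arguments fcenter {R F} Fhat _.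
Arguments unipotent {R F} Fhat _.
Arguments local_char {R F} Fhat omega v z.

(* Main.v *)
Require Import Defs.
From HB Require Import structures.
From mathcomp Require Import all_boot all_order all_algebra all_fingroup all_field.
From mathcomp Require Import finmap complex zify ring lra.
From mathcomp Require Import all_classical all_reals all_analysis.
From mathcomp Require Import measurable_realfun.
Import Order.TTheory GRing.Theory Num.Theory.
Import numFieldNormedType.Exports.
Set Implicit Arguments.
Unset Strict Implicit.
Unset Printing Implicit Defensive.
Local Open Scope classical_set_scope.
Local Open Scope ring_scope.

(** The conjugate of an irreducible representation is irreducible for formal
    reasons. What has to be shown is that its space of invariants under the
    level, a simple module over the Hecke algebra, occurs in the conjugate space
    of cusp forms. The proof compares traces.

    Let [M] be the space of forms of the given weight that are invariant under
    the level, and [M'] its conjugate. Hecke operators map into [M]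
    ([hecke_form_level]); since they have traces, [M] has finite dimension modulo
    null forms ([onb_M]), and the trace of an operator is, up to a common nonzero
    factor, that of its matrix on [M] ([trace_hecke_mx]). These matrices multiply
    like convolutions and are closed under adjoints ([hecke_mx_mul],
    [hecke_mx_star]). Let [V] be a representation occurring in [M]. If an element
    of the Hecke algebra killing [M'] acted nontrivially on the conjugate of the
    invariants of [V], then, these being simple ([invariants_simple]), some
    multiple of it would fix a nonzero vector; its conjugate would have the
    eigenvalue 1 on [M], while by hypothesis all its powers have trace 0 there.
    This is impossible ([trace_powers_eigenvalue1]). So the annihilator of [M']
    kills the conjugate module, and a simple module killed by the annihilator of a
    finite-dimensional representation closed under adjoints embeds into it
    ([simple_submodule_embeds]).

    Two analytic facts support this. Cusp forms have to form a vector space: the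
    constant terms of a square-integrable form are integrable almost everywhere
    ([constant_term_integrable]), by Tonelli and the compactness of the quotient of
    the unipotent group, that is, strong approximation and the cocompactness of the
    integers. And Hecke operators are defined by testing against all
    square-integrable forms, while sums over cosets need smooth ones: a form
    orthogonal to all smooth forms is null ([smooth_orth]). It is obtained from
    fundamental boxes, available because the rational points are discrete modulo
    the centre ([nearone_discrete]).

    Integrals over the finite adelic points become finite sums over cosets, whose
    measures are rational multiples of each other ([delta_rational]), so that the
    sums are compatible with field automorphisms. Finally, the functions of the
    Hecke algebra are exactly the finite sums of tensors of local functions
    ([hecke_hk], [hk_hecke]). *)

(** * Positive semidefinite forms *)

Section Conjugation.
Variable R : realType.
Implicit Types x y : R[i].

Lemma conjcM x y : (x * y)^*%C = x^*%C * y^*%C. Proof. exact: rmorphM. Qed.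
Lemma conjcB x y : (x - y)^*%C = x^*%C - y^*%C. Proof. exact: rmorphB. Qed.
Lemma conjc_sum (I : Type) (r : seq I) (P : pred I) (F : I -> R[i]) :
  (\sum_(i <- r | P i) F i)^*%C = \sum_(i <- r | P i) (F i)^*%C.
Proof. exact: rmorph_sum. Qed.

End Conjugation.

Section PsdForms.
Variables (R : realType) (E : lmodType R[i]).
Local Notation C := R[i].
Implicit Types (X Y : set E) (ip : E -> E -> C).

Record psd_on X ip : Prop := PsdOn {
  psd_sub : subspace_of X;
  psd_lin : forall (a : C) x y z, X x -> X y -> X z ->
    ip (a *: x + y) z = a * ip x z + ip y z;
  psd_herm : forall x y, X x -> X y -> ip y x = (ip x y)^*%C;
  psd_ge0 : forall x, X x -> 0 <= ip x x }.

Section Subspace.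
Variables (Y : set E).
Hypothesis hY : subspace_of Y.

Lemma subspaceZD (a : C) x y : Y x -> Y y -> Y (a *: x + y).
Proof. exact: hY.2. Qed.

Lemma subspaceZ (a : C) x : Y x -> Y (a *: x).
Proof. by move=> hx; rewrite -[a *: x]addr0; apply: hY.2 => //; exact: hY.1. Qed.

Lemma subspaceD x y : Y x -> Y y -> Y (x + y).
Proof. by move=> hx hy; rewrite -[x]scale1r; exact: hY.2. Qed.

Lemma subspaceB x y : Y x -> Y y -> Y (x - y).
Proof. by move=> hx hy; rewrite addrC -scaleN1r; exact: hY.2. Qed.

Lemma subspace_sum (I : Type) (r : seq I) (P : pred I) (F : I -> E) :
  (forall i, P i -> Y (F i)) -> Y (\sum_(i <- r | P i) F i).
Proof.
move=> h; apply: (big_ind Y) => //; [exact: hY.1|].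
by move=> x y; exact: subspaceD.
Qed.

End Subspace.

Section Theory.
Variables (X : set E) (ip : E -> E -> C).
Hypothesis h : psd_on X ip.
Let hX := psd_sub h.

Lemma ip0l z : X z -> ip 0 z = 0.
Proof.
move=> hz; have := psd_lin h 1 hX.1 hX.1 hz.
by rewrite scaler0 addr0 mul1r => /(congr1 (fun x => x - ip 0 z)); rewrite subrr addrK => <-.
Qed.

Lemma ipZl a x z : X x -> X z -> ip (a *: x) z = a * ip x z.
Proof.
by move=> hx hz; rewrite -[a *: x]addr0 (psd_lin h) ?ip0l ?addr0 //; exact: hX.1.
Qed.

Lemma ipDl x y z : X x -> X y -> X z -> ip (x + y) z = ip x z + ip y z.
Proof. by move=> hx hy hz; rewrite -[x]scale1r (psd_lin h) // scale1r mul1r. Qed.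

Lemma ipBl x y z : X x -> X y -> X z -> ip (x - y) z = ip x z - ip y z.
Proof.
by move=> hx hy hz; rewrite addrC -scaleN1r (psd_lin h) // mulN1r addrC.
Qed.

Lemma ip_suml (I : Type) (r : seq I) (P : pred I) (F : I -> E) z :
  (forall i, P i -> X (F i)) -> X z ->
  ip (\sum_(i <- r | P i) F i) z = \sum_(i <- r | P i) ip (F i) z.
Proof.
move=> hF hz; pose Q x y := X x /\ ip x z = y.
suff [] : Q (\sum_(i <- r | P i) F i) (\sum_(i <- r | P i) ip (F i) z) by [].
apply: (big_ind2 Q) => [|x1 x2 y1 y2 [h1 e1] [h2 e2]|i Pi].
- by split; [exact: hX.1|exact: ip0l].
- by split; [exact: subspaceD|rewrite ipDl // e1 e2].
- by split=> //; exact: hF.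
Qed.

Lemma ipZr a x z : X x -> X z -> ip z (a *: x) = a^*%C * ip z x.
Proof.
move=> hx hz; rewrite (psd_herm h _ hz); last exact: subspaceZ.
by rewrite ipZl // conjcM (psd_herm h hx hz).
Qed.

Lemma ipBr x y z : X x -> X y -> X z -> ip z (x - y) = ip z x - ip z y.
Proof.
move=> hx hy hz; rewrite (psd_herm h _ hz); last exact: subspaceB.
by rewrite ipBl // conjcB (psd_herm h hx hz) (psd_herm h hy hz).
Qed.

Lemma ip_sumr (I : Type) (r : seq I) (P : pred I) (F : I -> E) z :
  (forall i, P i -> X (F i)) -> X z ->
  ip z (\sum_(i <- r | P i) F i) = \sum_(i <- r | P i) ip z (F i).
Proof.
move=> hF hz; rewrite (psd_herm h _ hz); last exact: subspace_sum.
rewrite ip_suml // conjc_sum; apply: eq_bigr => i Pi.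
by rewrite (psd_herm h (hF _ Pi) hz).
Qed.

(** The Cauchy-Schwarz inequality in the only case that is used, proved by
    expanding the length of [t *: x + y]. *)
Lemma ipnull_orth x y : X x -> X y -> ip x x = 0 -> ip x y = 0.
Proof.
move=> hx hy x0; apply/eqP/negPn/negP => u0.
set u := ip x y in u0.
have e (t : R) : ip (y - (t%:C%C * u^*%C) *: x) (y - (t%:C%C * u^*%C) *: x) =
    ip y y - (2 * t)%:C%C * (u * u^*%C).
  have hs : X ((t%:C%C * u^*%C) *: x) by exact: subspaceZ.
  rewrite ipBl ?ipBr ?ipZl ?ipZr ?x0 //; try exact: subspaceB.
  rewrite conjcM conjcK conjc_real (psd_herm h hx hy) -/u !mulr0 subr0.
  rewrite rmorphM /= rmorphD /= rmorph1; ring.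
have uu : 0 < u * u^*%C by rewrite -sqr_normc exprn_gt0 // normr_gt0.
have /complex_realP[b eb] : u * u^*%C \is Num.real by rewrite realE ltW.
have /complex_realP[c ec] : ip y y \is Num.real by rewrite realE (psd_ge0 h hy).
have b0 : 0 < b by rewrite -ltcR -eb.
have := psd_ge0 h (subspaceB hX hy (subspaceZ hX (((c + 1) / (2 * b))%:C%C * u^*%C) hx)).
rewrite e eb ec -rmorphM -rmorphB /= ler0c.
rewrite (_ : 2 * _ * b = c + 1); first by lra.
by field; rewrite gt_eqF.
Qed.

Definition orthonormal d (m : 'I_d -> E) : Prop :=
  forall i j, ip (m i) (m j) = (i == j)%:R.

Definition coords d (m : 'I_d -> E) (x : E) : 'rV[C]_d := \row_i ip x (m i).
Definition lincomb d (m : 'I_d -> E) (c : 'rV[C]_d) : E := \sum_i c ord0 i *: m i.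

Lemma lincomb_in d (m : 'I_d -> E) Y c :
  subspace_of Y -> (forall i, Y (m i)) -> Y (lincomb m c).
Proof. by move=> hY hm; apply: subspace_sum => // i _; exact: subspaceZ. Qed.

Lemma coords_lincomb d (m : 'I_d -> E) c :
  orthonormal m -> (forall i, X (m i)) -> coords m (lincomb m c) = c.
Proof.
move=> om hm; apply/rowP => j; rewrite mxE ip_suml //; last first.
  by move=> i _; exact: subspaceZ.
rewrite (bigD1 j) //= ipZl // om eqxx mulr1 big1 ?addr0 // => i ij.
by rewrite ipZl // om (negPf ij) mulr0.
Qed.

Lemma residue_orth d (m : 'I_d -> E) x j :
  orthonormal m -> (forall i, X (m i)) -> X x ->
  ip (x - lincomb m (coords m x)) (m j) = 0.
Proof.
move=> om hm hx; rewrite ipBl //; last exact: lincomb_in.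
by have /rowP/(_ j) := coords_lincomb (coords m x) om hm; rewrite !mxE => ->; rewrite subrr.
Qed.

Lemma psd_normalize z : X z -> ip z z != 0 ->
  exists c : C, ip (c *: z) (c *: z) = 1.
Proof.
move=> hz z0; set r := ip z z in z0 *.
have r0 : 0 <= r := psd_ge0 h hz.
have s0 : 0 <= sqrtc r by rewrite sqrtc_ge0.
have /complex_realP[b eb] : sqrtc r \is Num.real by rewrite realE s0.
have b2 : (b * b)%:C%C = r by rewrite rmorphM /= -eb -expr2 sqr_sqrtc.
exists (b^-1)%:C%C; rewrite ipZl ?ipZr //; last exact: subspaceZ.
rewrite conjc_real mulrA -/r -b2 -!rmorphM /=.
have bn : b != 0 by apply: contraNneq z0 => b0; rewrite -b2 b0 mul0r.
by rewrite (_ : b^-1 * b^-1 * (b * b) = 1) //; field.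
Qed.

(** A maximal orthonormal family in [Y] spans [Y] up to vectors of length
    zero; it exists as soon as the size of such families is bounded. *)
Lemma onb_exists (Y : set E) n : Y `<=` X -> subspace_of Y ->
  (forall d (m : 'I_d -> E), (forall i, Y (m i)) -> orthonormal m -> (d <= n)%N) ->
  exists d (m : 'I_d -> E), [/\ forall i, Y (m i), orthonormal m
    & forall y, Y y -> ip (y - lincomb m (coords m y)) (y - lincomb m (coords m y)) = 0].
Proof.
move=> YX hY hn.
pose P d := `[< exists m : 'I_d -> E, (forall i, Y (m i)) /\ orthonormal m >].
have P0 : exists d, P d by exists 0%N; apply/asboolP; exists (fun=> 0); split=> [[]|[]].
have Pn d : P d -> (d <= n)%N by move=> /asboolP[m [hm om]]; exact: hn hm om.
case: (ex_maxnP P0 Pn) => d /asboolP[m [hm om]] dmax.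
exists d, m; split=> // y hy; set z := y - _.
have hXm i : X (m i) by exact: YX.
have hz : Y z by apply: subspaceB => //; exact: lincomb_in.
apply/eqP/negPn/negP => z0; have [c c1] := psd_normalize (YX _ hz) z0.
suff /dmax : P d.+1 by rewrite ltnn.
have zm j : ip (c *: z) (m j) = 0.
  by rewrite ipZl ?residue_orth ?mulr0 //; exact: YX.
have mz j : ip (m j) (c *: z) = 0.
  rewrite (psd_herm h _ (hXm j)) ?zm ?conjc0 //; apply: YX; exact: subspaceZ.
apply/asboolP; exists (fun i => if unlift ord_max i is Some j then m j else c *: z).
split=> [i|i j]; first by case: unliftP => //= *; exact: subspaceZ.
case: unliftP => [i'|] -> ; case: unliftP => [j'|] ->.
- by rewrite om (inj_eq lift_inj).
- by rewrite mz eq_sym (negPf (neq_lift _ _)).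
- by rewrite zm (negPf (neq_lift _ _)).
- by rewrite c1 eqxx.
Qed.

End Theory.
End PsdForms.

(** * Linear algebra *)

Section DotProduct.
Variables (R : realType) (d : nat).
Local Notation C := R[i].

Definition adjmx m n (A : 'M[C]_(m, n)) : 'M[C]_(n, m) := (map_mx conjc A)^T.
Definition dot (u v : 'rV[C]_d) : C := (u *m adjmx v) ord0 ord0.

Lemma dotE u v : dot u v = \sum_i u ord0 i * (v ord0 i)^*%C.
Proof. by rewrite /dot mxE; apply: eq_bigr => i _; rewrite !mxE. Qed.

Lemma adjmx_mul m n p (A : 'M[C]_(m, n)) (B : 'M[C]_(n, p)) :
  adjmx (A *m B) = adjmx B *m adjmx A.
Proof. by rewrite /adjmx map_mxM trmx_mul. Qed.

Lemma adjmxK m n (A : 'M[C]_(m, n)) : adjmx (adjmx A) = A.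
Proof. by apply/matrixP => i j; rewrite !mxE conjcK. Qed.

Lemma dot_adj u v (A : 'M[C]_d) : dot (u *m A) v = dot u (v *m adjmx A).
Proof. by rewrite /dot adjmx_mul adjmxK mulmxA. Qed.

Lemma dot_psd : psd_on setT dot.
Proof.
split=> [|a x y z _ _ _|x y _ _|x _] //.
- by rewrite /dot mulmxDl -scalemxAl !mxE.
- by rewrite !dotE rmorph_sum; apply: eq_bigr => i _; rewrite rmorphM /= conjcK mulrC.
- by rewrite dotE sumr_ge0 // => i _; exact: mulcJ_ge0.
Qed.

Lemma dot_eq0 x : dot x x = 0 -> x = 0.
Proof.
rewrite dotE => /eqP; rewrite psumr_eq0 => [/allP h|i _]; last exact: mulcJ_ge0.
apply/rowP => i; have := h i; rewrite mem_index_enum => /(_ isT) /=.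
by rewrite mulf_eq0 conjc_eq0 orbb mxE => /eqP.
Qed.

Lemma dot_onb_size n (m : 'I_n -> 'rV[C]_d) :
  orthonormal dot m -> (n <= d)%N.
Proof.
move=> om; apply: (@mulmx1_min _ _ _ (\matrix_i m i) (adjmx (\matrix_i m i))).
apply/matrixP => i j; rewrite [RHS]mxE -om dotE mxE.
by apply: eq_bigr => k _; rewrite !mxE.
Qed.

(** Orthogonal projection onto a subspace of C^d. *)
Lemma dot_project (Y : set 'rV[C]_d) x : subspace_of Y ->
  exists2 p, Y p & forall y, Y y -> dot (x - p) y = 0.
Proof.
move=> hY; have [n [m [hm om hy]]] := onb_exists dot_psd (@subsetT _ Y) hY
  (fun n m _ om => dot_onb_size om).
exists (lincomb m (coords dot m x)); first exact: lincomb_in.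
move=> y /hy /dot_eq0 /eqP; rewrite subr_eq0 => /eqP ->.
rewrite (ip_sumr dot_psd) // big1 // => i _.
by rewrite (ipZr dot_psd) // (residue_orth dot_psd) // mulr0.
Qed.

End DotProduct.

(** * Simple modules and traces *)

Section SimpleModule.
Variables (R : realType) (E U : lmodType R[i]) (H : set E) (mul : E -> E -> E).
Local Notation C := R[i].
Variables (Uf : set U) (a : E -> U -> U) (d : nat) (rho : E -> 'M[C]_d).
Hypotheses (HS : subspace_of H) (HM : forall f g, H f -> H g -> H (mul f g)).
Hypothesis aU : forall f x, H f -> Uf x -> Uf (a f x).
Hypothesis alin : forall (c : C) f g x, H f -> H g -> Uf x ->
  a (c *: f + g) x = c *: a f x + a g x.
Hypothesis a0 : forall f, H f -> a f 0 = 0.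
Hypothesis aM : forall f g x, H f -> H g -> Uf x -> a (mul f g) x = a f (a g x).
Hypothesis rholin : forall (c : C) f g, H f -> H g ->
  rho (c *: f + g) = c *: rho f + rho g.
Hypothesis rhoM : forall f g, H f -> H g -> rho (mul f g) = rho g *m rho f.
Hypothesis simple : forall x y, Uf x -> x <> 0 -> Uf y -> exists2 f, H f & a f x = y.

(** A nonzero element [f x] of the simple module can be brought back to [x],
    so that a left ideal not killing [x] contains an element fixing [x]. *)
Lemma simple_return f x : H f -> Uf x -> a f x <> 0 ->
  exists2 g, H g & a (mul g f) x = x.
Proof.
move=> hf hx fx; have [g hg e] := simple (aU hf hx) fx hx.
by exists g => //; rewrite aM.
Qed.

Hypothesis star : forall f, H f -> exists2 g, H g & rho g = adjmx (rho f).
Hypothesis kill : forall f x, H f -> rho f = 0 -> Uf x -> a f x = 0.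

(** Write [J k] for the elements of [H] killing the first [k] basis vectors of
    C^d.  Applied to a nonzero [u], [J 0] gives everything and [J d] nothing, so
    there is a [k] such that [J k] does not kill [u] but [J k.+1] does; then
    [f e_k |-> f u], for [f] in [J k], is a well defined map onto [U].  It is
    split by the orthogonal complement of its kernel, which is a submodule
    because the image of [rho] is closed under adjoints. *)
Theorem simple_submodule_embeds u : Uf u -> u <> 0 ->
  exists j : U -> 'rV[C]_d,
  [/\ forall f g, H f -> H g -> forall c : C,
        j (c *: a f u + a g u) = c *: j (a f u) + j (a g u),
      forall x, Uf x -> j x = 0 -> x = 0
    & forall f x, H f -> Uf x -> j (a f x) = j x *m rho f].
Proof.
move=> hu u0.
pose J k f := H f /\ forall i : 'I_d, (i < k)%N -> row i (rho f) = 0.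
pose P k := `[< forall f, J k f -> a f u = 0 >].
have Pd : P d.
  apply/asboolP => f [hf f0]; apply: kill => //.
  by apply/row_matrixP => i; rewrite row0 f0.
case: (ex_minnP (ex_intro P d Pd)) => -[|k] /asboolP Pk kmin.
  by have [f hf e] := simple hu u0 hu; case: u0; rewrite -e Pk //; split.
have {kmin} /asboolPn : ~~ P k by apply/negP => /kmin; rewrite ltnn.
move=> /existsNP[f0 /not_implyP[[hf0 Jf0] f0u]].
have kd : (k < d)%N.
  rewrite ltnNge; apply/negP => dk; apply: f0u; apply: Pk; split=> // i _.
  by apply: Jf0; exact: leq_trans (ltn_ord i) dk.
pose i0 := Ordinal kd.
have JH f : J k f -> H f by case.
have JM f g : H f -> J k g -> J k (mul f g).
  move=> hf [hg Jg]; split; first exact: HM.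
  by move=> i ik; rewrite rhoM // row_mul Jg // mul0mx.
have Jlin (c : C) f g : J k f -> J k g -> J k (c *: f + g).
  move=> [hf Jf] [hg Jg]; split; first exact: HS.2.
  by move=> i ik; rewrite rholin // linearP /= Jf // Jg // scaler0 addr0.
have J0 : J k 0.
  have [hf Jf] : J k f0 by [].
  split; first exact: HS.1.
  by move=> i ik; have [_ /(_ i ik)] := Jlin (-1) f0 f0 (conj hf Jf) (conj hf Jf);
    rewrite scaleN1r addNr.
have [g0 hg0 g0u] := simple_return hf0 hu f0u.
pose Y := [set row i0 (rho f) | f in [set f | J k f /\ a f u = 0]].
have a00 : a 0 u = 0.
  have := alin (-1) hf0 hf0 hu; rewrite !scaleN1r !addNr => ->.
  by [].
have hY : subspace_of Y.
  split.
    exists 0 => //=; have [/(_ (-1) 0 0 HS.1 HS.1)] := (rholin, I).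
    by rewrite !scaler0 addr0 scaleN1r addNr => ->; rewrite row0.
  move=> c _ _ [f [Jf fu] <-] [g [Jg gu] <-]; exists (c *: f + g).
    split; first exact: Jlin.
    by rewrite (alin _ (JH _ Jf) (JH _ Jg) hu) fu gu scaler0 addr0.
  by rewrite (rholin _ (JH _ Jf) (JH _ Jg)) linearP.
have [_ [f1 [Jf1 f1u] <-] orth] := dot_project (row i0 (rho (mul g0 f0))) hY.
pose g1 := - 1 *: f1 + mul g0 f0.
have Jg1 : J k g1 by apply: Jlin => //; apply: JM.
have hm0 : H (mul g0 f0) by exact: HM.
have hg1 := JH _ Jg1; have hf1 := JH _ Jf1.
have g1u : a g1 u = u by rewrite alin // f1u scaler0 add0r.
pose e := row i0 (rho g1).
have eY y : Y y -> dot e y = 0.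
  by move=> hy; rewrite -(orth _ hy) /e rholin // linearP /= scaleN1r addrC.
have wd f : H f -> a f u = 0 -> e *m rho f = 0.
  move=> hf fu; apply: dot_eq0; rewrite dot_adj eY //.
  have [g hg <-] := star hf.
  exists (mul g (mul f g1)).
    split; first by apply: (JM) => //; apply: (JM).
    by rewrite (aM hg (HM hf hg1) hu) (aM hf hg1 hu) g1u fu a0.
  by rewrite (rhoM hg (HM hf hg1)) (rhoM hf hg1) !row_mul.
have wd2 f g : H f -> H g -> a f u = a g u -> e *m rho f = e *m rho g.
  move=> hf hg fg; apply/eqP; rewrite -subr_eq0 -mulmxBr; apply/eqP.
  have -> : rho f - rho g = rho (-1 *: g + f) by rewrite rholin // scaleN1r addrC.
  by apply: wd; [exact: HS.2|rewrite alin // fg scaleN1r addNr].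
have /choice[c hc] : forall y, exists f, Uf y -> H f /\ a f u = y.
  move=> y; have [hy|nhy] := pselect (Uf y); last by exists 0.
  by have [f hf <-] := simple hu u0 hy; exists f.
have je f : H f -> e *m rho (c (a f u)) = e *m rho f.
  by move=> hf; have [h1 h2] := hc _ (aU hf hu); exact: wd2.
exists (fun y => e *m rho (c y)); split.
- move=> f g hf hg b; rewrite -alin // !je //; last exact: HS.2.
  by rewrite rholin // mulmxDr scalemxAr.
- move=> x hx; have [h1 h2] := hc _ hx => e0.
  have Jc : J k.+1 (mul (c x) g1).
    split; first exact: HM.
    move=> i; rewrite ltnS leq_eqVlt => /predU1P[ik|]; last exact: (JM _ _ h1 Jg1).2.
    have -> : i = i0 by exact: val_inj.
    by rewrite rhoM // row_mul.
  by have := Pk _ Jc; rewrite aM // g1u h2.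
- move=> f x hf hx; have [h1 h2] := hc _ hx.
  by rewrite -{1}h2 -aM // je ?rhoM ?mulmxA //; exact: HM.
Qed.

End SimpleModule.

Section Trace.
Variable K : numFieldType.

Lemma idempotent_trace n (P : 'M[K]_n) : P *m P = P -> \tr P = (\rank P)%:R.
Proof.
move=> PP; have e : row_base P *m col_base P = 1%:M.
  apply: (row_full_inj (col_base_full P)); rewrite mulmx1.
  apply: (row_free_inj (row_base_free P)).
  by rewrite mulmxA mulmx_base -mulmxA mulmx_base PP.
by rewrite -{1}(mulmx_base P) mxtrace_mulC e mxtrace1.
Qed.

(** If 1 is an eigenvalue of [B], some polynomial in [B] without constant term
    is a nonzero idempotent, and its trace is its rank. *)
Lemma trace_powers_eigenvalue1 n (B : 'M[K]_n) (v : 'rV[K]_n) :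
  (forall k, \tr (B ^+ k.+1) = 0) -> v *m B = v -> v = 0.
Proof.
case: n B v => [B v _ _|n B v trB vB]; first by apply/rowP => -[].
have [k [g g1 echi]] := multiplicity_XsubC (char_poly B) 1.
rewrite monic_neq0 ?char_poly_monic //= in g1.
have cop : coprimep (('X - 1%:P) ^+ k) ('X * g).
  apply: coprimep_expl; rewrite coprimep_sym coprimep_XsubC rootM negb_or g1 andbT.
  by rewrite rootX oner_eq0.
have [[u w] /= uw] := Bezout_eq1_coprimepP _ _ cop.
pose p := w * ('X * g).
have pp : p * p - p = - (u * w * 'X) * char_poly B.
  have -> : p = 1 - u * ('X - 1%:P) ^+ k by rewrite -uw addrAC subrr add0r.
  rewrite echi.
  have e1 : w * ('X * g) = 1 - u * ('X - 1%:P) ^+ k by rewrite -uw addrAC subrr add0r.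
  have -> : - (u * w * 'X) * (g * ('X - 1%:P) ^+ k) = - (u * (w * ('X * g)) * ('X - 1%:P) ^+ k).
    by ring.
  by rewrite e1; ring.
pose P := horner_mx B p.
have PP : P *m P = P.
  apply/eqP; rewrite -subr_eq0 -[X in X - _]rmorphM -rmorphB /= pp rmorphM /=.
  by rewrite Cayley_Hamilton mulr0.
have vq q : v *m horner_mx B q = q.[1] *: v.
  elim/poly_ind: q => [|q c IH]; first by rewrite rmorph0 mulmx0 horner0 scale0r.
  rewrite rmorphD rmorphM /= horner_mx_X horner_mx_C mulmxDr.
  rewrite -[horner_mx B q * B]/(horner_mx B q *m B) mulmxA IH -scalemxAl vB mul_mx_scalar.
  by rewrite hornerMXaddC mulr1 scalerDl.
have [k0|k0] := eqVneq k 0%N.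
  apply/eqP; have := vq (char_poly B); rewrite Cayley_Hamilton mulmx0 => /esym/eqP.
  by rewrite scaler_eq0 echi k0 expr0 mulr1 -[_ == 0]/(root g 1) (negPf g1).
have vP : v *m P = v.
  rewrite vq (_ : p.[1] = 1) ?scale1r //.
  have := congr1 (fun q => q.[1]) uw; rewrite hornerD hornerC.
  rewrite (hornerM u) horner_exp hornerXsubC subrr expr0n (negPf k0) /= mulr0 add0r.
  by [].
have trP : \tr P = 0.
  rewrite /P /p mulrCA; move: (w * g) => q.
  rewrite -(coefK q) poly_def mulr_sumr rmorph_sum linear_sum big1 // => i _.
  rewrite -scalerAr -exprS /= horner_mxZ rmorphXn /= horner_mx_X.
  by rewrite mxtraceZ trB mulr0.
have := idempotent_trace PP; rewrite trP => /esym/eqP; rewrite pnatr_eq0 mxrank_eq0.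
by move=> /eqP P0; rewrite -vP P0 mulmx0.
Qed.

End Trace.

(** * The ring of integers and its prime ideals *)

Section RingOfIntegers.
Variable F : fieldExtType rat.
Local Notation O := (@intring F).

Let ZtoF : {rmorphism int -> F} := intmul 1.

Lemma intF_eq0 (z : int) : ((z%:~R : F) == 0) = (z == 0).
Proof.
have -> : (z%:~R : F) = (z%:~R : rat) *: 1 by rewrite scaler_int.
by rewrite scaler_eq0 oner_eq0 orbF intr_eq0.
Qed.

Lemma natF_eq0 n : ((n%:R : F) == 0) = (n == 0%N).
Proof. by rewrite pmulrn intF_eq0. Qed.

Lemma intring0 : O 0. Proof. exact: (@mxpoly.integral0 _ _ ZtoF). Qed.
Lemma intring1 : O 1. Proof. exact: (@mxpoly.integral1 _ _ ZtoF). Qed.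
Lemma intringZ (z : int) : O z%:~R. Proof. exact: (@mxpoly.integral_id _ _ ZtoF). Qed.
Lemma intringN n : O n%:R. Proof. exact: (@mxpoly.integral_nat _ _ ZtoF). Qed.
Lemma intringD x y : O x -> O y -> O (x + y). Proof. exact: (@mxpoly.integral_add _ _ ZtoF). Qed.
Lemma intringM x y : O x -> O y -> O (x * y). Proof. exact: (@mxpoly.integral_mul _ _ ZtoF). Qed.
Lemma intringB x y : O x -> O y -> O (x - y). Proof. exact: (@mxpoly.integral_sub _ _ ZtoF). Qed.
Lemma intringX x n : O x -> O (x ^+ n).
Proof.
by move=> hx; elim: n => [|n IH]; [exact: intring1|rewrite exprS; exact: intringM].
Qed.
Lemma intring_sign (b : bool) : O ((-1) ^+ b).
Proof. by apply: intringX; exact: (intringZ (-1)). Qed.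
Lemma intring_sum (I : Type) (r : seq I) (P : pred I) (f : I -> F) :
  (forall i, P i -> O (f i)) -> O (\sum_(i <- r | P i) f i).
Proof. by move=> h; apply: (big_ind O) => //; [exact: intring0|exact: intringD]. Qed.
Lemma intring_prod (I : Type) (r : seq I) (P : pred I) (f : I -> F) :
  (forall i, P i -> O (f i)) -> O (\prod_(i <- r | P i) f i).
Proof. by move=> h; apply: (big_ind O) => //; [exact: intring1|exact: intringM]. Qed.

Lemma intring_monic_root (p : {poly F}) u :
  p \is monic -> root p u -> (forall i, O p`_i) -> O u.
Proof. by move=> mp pu hp; apply: (@mxpoly.integral_root_monic _ _ ZtoF) mp pu _; apply/mxpoly.integral_poly. Qed.

(** Multiplying the relation by a power of the leading coefficient makes it
    monic in the product. *)
Lemma intring_lead_mul n (a : nat -> F) u : (forall i, O (a i)) ->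
  \sum_(i < n.+2) a i * u ^+ i = 0 -> O (a n.+1 * u).
Proof.
move=> ha e; set b := a n.+1.
pose q := \poly_(i < n.+1) (a i * b ^+ (n - i)).
have sq : (size q < size ('X^(n.+1) : {poly F}))%N by rewrite size_polyXn ltnS size_poly.
apply: (@intring_monic_root ('X^(n.+1) + q)).
- by rewrite monicE lead_coefDl // lead_coefXn.
- rewrite /root hornerD hornerXn horner_poly; apply/eqP.
  transitivity (b ^+ n * \sum_(i < n.+2) a i * u ^+ i); last by rewrite e mulr0.
  rewrite [in RHS]big_ord_recr /= -/b mulrDr mulr_sumr addrC; congr (_ + _).
    apply: eq_bigr => i _; rewrite exprMn.
    have -> : b ^+ n = b ^+ (n - i) * b ^+ i by rewrite -exprD subnK // -ltnS.
    by ring.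
  by rewrite exprMn exprS; ring.
- move=> i; rewrite coefD coefXn coef_poly.
  apply: intringD; first exact: intringN.
  by case: ifP => _; [apply: intringM => //; apply: intringX; exact: ha|exact: intring0].
Qed.

Lemma alg_primitive_root (x : F) : exists p : {poly int},
  [/\ p != 0, zcontents p = 1 & (map_poly intr p).[x] = 0].
Proof.
have /polyOver1P[q Dq] := minPolyOver 1 x.
have q0 : q != 0.
  rewrite -(map_poly_eq0 (in_alg F)) -Dq; apply: monic_neq0; exact: monic_minPoly.
have [p [a a0 Dp]] := rat_poly_scale q.
have p0 : p != 0.
  by apply: contraNneq q0 => p0; rewrite Dp p0 rmorph0 scaler0.
exists (zprimitive p); rewrite zprimitive_eq0 zcontents_primitive p0; split=> //.
have e : (map_poly intr p : {poly F}).[x] = 0.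
  have := minPolyxx 1 x; rewrite Dq Dp map_polyZ hornerZ => /eqP.
  rewrite mulf_eq0 => /orP[|].
    by rewrite /= scaler_eq0 oner_eq0 orbF invr_eq0 intr_eq0 (negPf a0).
  rewrite -map_poly_comp => /eqP <-; congr (_.[x]).
  by apply: eq_map_poly => z /=; rewrite scaler_int.
have := e; rewrite {1}[p]zpolyEprim map_polyZ hornerZ => /eqP.
rewrite mulf_eq0 => /orP[|/eqP//].
by rewrite intF_eq0 zcontents_eq0 (negPf p0).
Qed.

Lemma intring_denominator (x : F) : exists2 N : nat, (0 < N)%N & O (N%:R * x).
Proof.
have [p [p0 _ e]] := alg_primitive_root x.
have [n sp] : exists n, size p = n.+1 by exists (size p).-1; rewrite prednK // size_poly_gt0.
have lead : p`_n != 0 by rewrite -[n]/(n.+1.-1) -sp -lead_coefE lead_coef_eq0.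
have e' : \sum_(i < n.+1) (p`_i)%:~R * x ^+ i = 0.
  rewrite -[RHS]e (@horner_coef_wide _ n.+1); last by rewrite -sp size_poly.
  by apply: eq_bigr => i _; rewrite coef_map.
have {e'} : O ((p`_n)%:~R * x).
  case: n {sp} lead e' => [|n] lead e'.
    exfalso; move: e'; rewrite big_ord_recr big_ord0 /= expr0 mulr1 add0r.
    by move/eqP; rewrite intF_eq0 (negPf lead).
  by apply: (@intring_lead_mul n (fun i => (p`_i)%:~R)) e' => i; exact: intringZ.
move=> h; exists (absz p`_n); first by rewrite absz_gt0.
have -> : ((absz p`_n)%:R : F) = (-1) ^+ (p`_n < 0)%R * (p`_n)%:~R.
  by rewrite {3}[p`_n]intEsign rmorphM /= rmorph_sign signrMK.
by rewrite -mulrA; apply: intringM => //; exact: intring_sign.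
Qed.

Section PrimeIdeal.
Variable v : finPlace F.
Local Notation V := (pideal v).

Lemma place_int x : V x -> O x. Proof. exact: pideal_sub. Qed.

Lemma placeN x : V x -> V (- x).
Proof. by move=> hx; rewrite -mulN1r; apply: pidealM => //; exact: (intringZ (-1)). Qed.

Lemma placeB x y : V x -> V y -> V (x - y).
Proof. by move=> hx /placeN; exact: pidealD. Qed.

Lemma placeX x n : O x -> V (x ^+ n) -> V x.
Proof.
move=> hx; elim: n => [/pideal_proper//|n IH].
by rewrite exprS => /pideal_prime [//| |//|]; [exact: intringX|].
Qed.

Lemma place_sum (I : Type) (r : seq I) (P : pred I) (f : I -> F) :
  (forall i, P i -> V (f i)) -> V (\sum_(i <- r | P i) f i).
Proof. by move=> h; apply: (big_ind V) => //; [exact: pideal0|exact: pidealD]. Qed.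

Lemma place_gcdn m n : V m%:R -> V n%:R -> V (gcdn m n)%:R.
Proof.
move=> hm hn; have [u [w e]] := Bezoutz m n.
have -> : ((gcdn m n)%:R : F) = u%:~R * m%:R + w%:~R * n%:R.
  have := congr1 (fun z : int => z%:~R : F) e.
  by rewrite rmorphD !rmorphM /= -!pmulrn => ->.
by apply: pidealD; apply: pidealM => //; exact: intringZ.
Qed.

(** A prime contains no two coprime integers, so it cannot contain all the
    coefficients of a primitive integral polynomial. *)
Lemma place_primitive (p : {poly int}) : zcontents p = 1 ->
  exists2 i, (i < size p)%N & ~ V (p`_i)%:~R.
Proof.
move=> c1; apply: contrapT => h.
have hv i : (i < size p)%N -> V ((absz p`_i))%:R.
  move=> ip; have : V (p`_i)%:~R by apply: contrapT => nv; apply: h; exists i.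
  rewrite {1}[p`_i]intEsign rmorphM /= rmorph_sign => hv.
  rewrite -(signrMK (p`_i < 0)%R (_ %:R)); apply: pidealM => //.
  by exact: intring_sign.
apply: (@pideal_proper _ v).
have -> : (1 : F) = (\big[gcdn/0%N]_(i < size p) absz p`_i)%:R.
  have p0 : p != 0 by apply/eqP => p0; move: c1; rewrite p0 zcontents0.
  move: c1; rewrite -lead_coef_eq0 in p0; rewrite /zcontents.
  case: sgzP p0 => // _ _; first by rewrite mul1r => -[->].
  by rewrite mulN1r => e; exfalso; lia.
apply: (big_ind (fun n => V n%:R)) => [|m n|i _]; first exact: pideal0.
- exact: place_gcdn.
- exact: hv.
Qed.

(** Each nonzero prime localizes to a valuation ring. By induction on the
    degree: the product of the leading coefficient and [u] is integral, and
    can be absorbed into the next coefficient. *)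
Lemma place_valuation_root n (a : nat -> F) u : (forall i, O (a i)) ->
  (exists2 i, (i <= n)%N & ~ V (a i)) -> \sum_(i < n.+1) a i * u ^+ i = 0 ->
  exists x y, [/\ O x, O y, ~ V y & u * y = x \/ (V x /\ u * x = y)].
Proof.
elim: n a => [|n IH] a ha [i0 i0n vi0] e.
  move: i0n vi0; rewrite leqn0 => /eqP -> va0.
  by move: e va0; rewrite big_ord_recr big_ord0 /= expr0 mulr1 add0r => ->; case; exact: pideal0.
have hb := intring_lead_mul ha e; set b := a n.+1 * u in hb.
have [va|va] := pselect (V (a n.+1)); last first.
  by exists b, (a n.+1); split=> //; left; rewrite mulrC.
pose a' i := if i == n then b + a n else a i.
have ha' i : O (a' i) by rewrite /a'; case: ifP => _ //; exact: intringD.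
have e' : \sum_(i < n.+1) a' i * u ^+ i = 0.
  rewrite -[RHS]e !big_ord_recr /= /a' eqxx mulrDl -addrA; congr (_ + _).
    by apply: eq_bigr => i _; rewrite ltn_eqF.
  by rewrite addrC exprS /b; congr (_ + _); ring.
have [[i [i1 i2]]|h] := pselect (exists i, (i <= n)%N /\ ~ V (a' i)).
  by apply: (IH a') => //; exists i.
have {}h i : (i <= n)%N -> V (a' i).
  by move=> ni; apply: contrapT => nv; apply: h; exists i.
have i0E : i0 = n.
  move: i0n; rewrite leq_eqVlt => /predU1P[i0E|]; first by rewrite i0E in vi0.
  rewrite ltnS leq_eqVlt => /predU1P[//|i0n].
  by case: vi0; have := h i0 (ltnW i0n); rewrite /a' ltn_eqF.
exists (a n.+1), b; split=> //; last by right; rewrite mulrC.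
move=> vb; apply: vi0; rewrite i0E -(addKr b (a n)) addrC; apply: placeB => //.
by have := h n (leqnn n); rewrite /a' eqxx.
Qed.

Lemma place_valuation u :
  exists x y, [/\ O x, O y, ~ V y & u * y = x \/ (V x /\ u * x = y)].
Proof.
have [p [p0 c1 e]] := alg_primitive_root u.
have [n sp] : exists n, size p = n.+1 by exists (size p).-1; rewrite prednK // size_poly_gt0.
apply: (@place_valuation_root n (fun i => (p`_i)%:~R)).
- by move=> i; exact: intringZ.
- by have [i ip nv] := place_primitive c1; exists i => //; rewrite -ltnS -sp.
- rewrite -[RHS]e (@horner_coef_wide _ n.+1) -?sp ?size_poly //.
  by apply: eq_bigr => i _; rewrite coef_map.
Qed.

Lemma place_rational_prime : exists2 l, prime l & V l%:R.
Proof.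
have [x vx x0] := pideal_neq0 v; have ox := place_int vx.
have [p [p0 _ e]] := alg_primitive_root x.
have [n n0 vn] : exists2 N : nat, (0 < N)%N & V N%:R.
  have : exists2 i, (i < size p)%N & p`_i != 0.
    exists (size p).-1; first by rewrite prednK // size_poly_gt0.
    by rewrite -lead_coefE lead_coef_eq0.
  move=> [i1 i1p pi1]; have exi : exists i, p`_i != 0 by exists i1.
  case: (ex_minnP exi) => m pm mmin.
  have vm : V (p`_m)%:~R.
    have e1 : (\sum_(i < size p) (p`_i)%:~R * x ^+ i : F) = 0.
      rewrite -[RHS]e (@horner_coef_wide _ (size p)) ?size_poly //.
      by apply: eq_bigr => i _; rewrite coef_map.
    have mp : (m < size p)%N by exact: leq_ltn_trans (mmin _ pi1) i1p.
    move: e1; rewrite -(big_mkord xpredT (fun i => (p`_i)%:~R * x ^+ i)).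
    rewrite (big_cat_nat (n := m)) //=; last exact: ltnW.
    rewrite big_nat big1 ?add0r; last first.
      move=> i /andP[_ im]; have -> : p`_i = 0; last by rewrite mul0r.
      by apply/eqP/negPn/negP => /mmin; rewrite leqNgt im.
    rewrite big_ltn // big_nat (eq_bigr (fun i => x ^+ m * (x * ((p`_i)%:~R * x ^+ (i - m.+1))))).
      rewrite -mulr_sumr [X in X + _]mulrC -mulrDr => /eqP; rewrite mulf_eq0 expf_eq0 (negPf x0) andbF.
      rewrite addr_eq0 => /eqP ->; apply: placeN; apply: place_sum => i _.
      rewrite mulrC; apply: pidealM => //; apply: intringM; [exact: intringZ|exact: intringX].
    move=> i /andP[mi _]; have -> : x ^+ i = x ^+ m * x * x ^+ (i - m.+1) by rewrite -exprSr -exprD subnKC.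
    ring.
  exists (absz p`_m); first by rewrite absz_gt0.
  move: vm; rewrite {1}[p`_m]intEsign rmorphM /= rmorph_sign => hv.
  rewrite -(signrMK (p`_m < 0)%R (_ %:R)); apply: pidealM => //.
  by exact: intring_sign.
have [N] := ubnP n; elim: N n n0 vn => [//|N IH] n n0 vn nN.
have [n1|n1] := leqP n 1.
  have n1' : n = 1%N by apply/eqP; rewrite eqn_leq n1.
  by rewrite n1' in vn; case: (pideal_proper vn).
have pn := pdiv_prime n1; have dn := pdiv_dvd n.
move: vn; rewrite -{1}(divnK dn) natrM => /pideal_prime [||h|h]; try exact: intringN.
  apply: (IH _ _ h); first by rewrite divn_gt0 ?prime_gt0 // dvdn_leq.
  by apply: leq_trans (ltn_Pdiv (prime_gt1 pn) n0) _.
by exists (pdiv n).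
Qed.

End PrimeIdeal.
End RingOfIntegers.

Lemma geometric_small (R : realType) (a C : R) : 0 <= a < 1 -> exists k : nat, a ^+ k * C <= 1.
Proof.
move=> /andP[a0 a1].
have h : geometric `|C| a @ \oo --> (0 : R) by apply: cvg_geometric; rewrite ger0_norm.
have [k _ /(_ k (leqnn k)) /=] := cvgr0_norm_lt _ h _ ltr01.
move=> /ltW hk; exists k; rewrite mulrC; apply: le_trans hk.
have ak : 0 <= a ^+ k by exact: exprn_ge0.
by rewrite normrM normr_id (ger0_norm ak) ler_wpM2r ?ler_norm.
Qed.

(** * Residues modulo a rational prime *)

Section FiniteResidue.
Variable F : fieldExtType rat.
Local Notation O := (@intring F).

(** Integers of [F] that are linearly independent modulo [l] are linearly
    independent over Q, by dividing an integral relation by [l] repeatedly. *)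
Lemma intring_mod_finite l : prime l -> exists s : seq F, (forall x, x \in s -> O x) /\
  forall y, O y -> exists x z, [/\ x \in s, O z & y = x + l%:R * z].
Proof.
move=> lp; have l0 : (l%:R : F) != 0 by rewrite natF_eq0 -lt0n prime_gt0.
have lz : (Posz l)%:~R = l%:R :> F by rewrite -pmulrn.
pose ind (s : seq F) := (forall i, O s`_i) /\ forall c : nat -> int,
  (exists2 z, O z & \sum_(i < size s) (c i)%:~R * s`_i = l%:R * z) ->
  forall i, (i < size s)%N -> (l %| c i)%Z.
have ind_le s : ind s -> (size s <= \dim {:F})%N.
  move=> [Os hs].
  have rel0 (c : nat -> int) : \sum_(i < size s) (c i)%:~R * s`_i = 0 ->
      forall m i, (i < size s)%N -> (Posz (l ^ m) %| c i)%Z.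
    move=> e m; elim: m c e => [|m IH] c e i si; first by rewrite expn0 dvd1z.
    have hd : forall i, (i < size s)%N -> (l %| c i)%Z.
      by apply: hs; exists 0; [exact: intring0|rewrite mulr0].
    have e' : \sum_(i < size s) (c i %/ l)%Z%:~R * s`_i = 0.
      apply: (mulfI l0); rewrite mulr0 -[RHS]e mulr_sumr; apply: eq_bigr => j _.
      by rewrite -{2}(divzK (hd _ (ltn_ord j))) rmorphM /= lz; ring.
    have := IH (fun i => (c i %/ l)%Z) e' i si.
    rewrite -{2}(divzK (hd _ si)) expnSr PoszM => h.
    by apply: dvdz_mul => //; exact: dvdzz.
  have fs : free (in_tuple s).
    apply/freeP => k ek i; pose D := \prod_(j < size s) denq (k j).
    have D0 : D != 0 by apply/prodf_neq0 => j _; exact: denq_neq0.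
    have /choice[c hc] : forall j : nat, exists c : int,
        forall h : (j < size s)%N, c%:~R = k (Ordinal h) * D%:~R :> rat.
      move=> j; have [h|h] := pselect (is_true (j < size s)%N); last by exists 0.
      exists (numq (k (Ordinal h)) * \prod_(j' < size s | j' != Ordinal h) denq (k j')) => h'.
      rewrite (bool_irrelevance h' h) /D [in RHS](bigD1 (Ordinal h)) //= !intrM mulrA.
      congr (_ * _); set q := k _.
      by rewrite -{2}[q]divq_num_den divfK // intr_eq0 denq_neq0.
    have e : \sum_(j < size s) (c j)%:~R * s`_j = 0.
      transitivity (D%:~R * \sum_(j < size s) k j *: s`_j); last by rewrite ek mulr0.
      rewrite mulr_sumr; apply: eq_bigr => j _.
      have := hc j (ltn_ord j); rewrite (_ : Ordinal _ = j); last exact: val_inj.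
      move=> hj; have -> : ((c j)%:~R : F) = (c j)%:~R%:A by rewrite scaler_int.
      rewrite hj -(scaler_int D (1 : F)) -scalerAl mul1r -scalerAl mul1r scalerA.
      by rewrite mulrC.
    have c0 : c i = 0.
      apply/eqP/negPn/negP => c0; have := rel0 c e (absz (c i)) i (ltn_ord i).
      rewrite /dvdz => /dvdn_leq; rewrite absz_gt0 c0 => /(_ isT).
      by rewrite leqNgt /= ltn_expl // prime_gt1.
    have := hc i (ltn_ord i); rewrite (_ : Ordinal _ = i); last exact: val_inj.
    by rewrite c0 => /esym/eqP; rewrite mulf_eq0 intr_eq0 (negPf D0) orbF => /eqP.
  by move: fs; rewrite /free => /eqP <-; apply: dimvS; exact: subvf.
pose P n := `[< exists2 s, ind s & size s = n >].
have P0 : exists n, P n.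
  exists 0%N; apply/asboolP; exists [::] => //; split=> // i.
  by rewrite nth_nil; exact: intring0.
have Pn n : P n -> (n <= \dim {:F})%N by move=> /asboolP[s hs <-]; exact: ind_le.
case: (ex_maxnP P0 Pn) => n /asboolP[s [Os hs] sn] nmax.
have key y : O y -> exists (c : nat -> int) z, O z /\
    y = \sum_(i < size s) (c i)%:~R * s`_i + l%:R * z.
  move=> Oy; have nind : ~ ind (rcons s y).
    move=> h; have /nmax : P n.+1 by apply/asboolP; exists (rcons s y); rewrite ?size_rcons ?sn.
    by rewrite ltnn.
  have Os' i : O (rcons s y)`_i.
    by rewrite nth_rcons; case: ifP => // _; case: ifP => // _; exact: intring0.
  have [c] : exists c : nat -> int, ~ ((exists2 z, O z &
      \sum_(i < size (rcons s y)) (c i)%:~R * (rcons s y)`_i = l%:R * z) ->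
      forall i, (i < size (rcons s y))%N -> (l %| c i)%Z).
    by apply/existsNP => h; apply: nind; split.
  move=> /not_implyP[[z Oz]]; rewrite size_rcons big_ord_recr /= nth_rcons ltnn eqxx.
  rewrite (eq_bigr (fun i : 'I_(size s) => (c i)%:~R * s`_i)); last first.
    by move=> i _; rewrite nth_rcons ltn_ord.
  set S := \sum_(i < _) _ => e nd.
  have ndy : ~~ (l %| c (size s))%Z.
    apply/negP => dy; apply: nd => i; rewrite ltnS leq_eqVlt => /predU1P[->//|].
    apply: hs; exists (z - (c (size s) %/ l)%Z%:~R * y).
      by apply: intringB => //; apply: intringM => //; exact: intringZ.
    rewrite -/S mulrBr -e -{1}(divzK dy) rmorphM /= lz; ring.
  have [u [w uw]] := Bezoutz (c (size s)) l.
  have {uw} uw : u * c (size s) + w * l = 1.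
    rewrite uw; congr Posz; apply/eqP; rewrite -/(coprime _ _) coprime_sym.
    by rewrite prime_coprime.
  exists (fun i => - (u * c i)), (u%:~R * z + w%:~R * y); split.
    by apply: intringD; apply: intringM => //; exact: intringZ.
  have -> : \sum_(i < size s) (- (u * c i))%:~R * s`_i = - (u%:~R * S).
    rewrite /S mulr_sumr -sumrN; apply: eq_bigr => i _.
    by rewrite rmorphN rmorphM /= mulNr mulrA.
  have e1 : u%:~R * (c (size s))%:~R + w%:~R * l%:R = 1 :> F.
    by rewrite -lz -!rmorphM -rmorphD /= uw.
  have -> : S = l%:R * z - (c (size s))%:~R * y by rewrite -e addrK.
  by rewrite -[LHS]mul1r -[X in X * y]e1; ring.
pose rep (f : {ffun 'I_(size s) -> 'I_l}) : F := \sum_i (f i)%:R * s`_i.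
exists [seq rep f | f : {ffun 'I_(size s) -> 'I_l}]; split.
  move=> _ /mapP[f _ ->]; apply: intring_sum => i _; apply: intringM => //.
  exact: intringN.
move=> y /key[c [z [Oz ->]]].
have lm i : (absz (c i %% l)%Z < l)%N.
  rewrite -ltz_nat gez0_abs ?modz_ge0 ?ltz_pmod //; first by rewrite ltz_nat prime_gt0.
  by rewrite eqz_nat -lt0n prime_gt0.
exists (rep [ffun i : 'I_(size s) => Ordinal (lm i)]),
  (z + \sum_(i < size s) (c i %/ l)%Z%:~R * s`_i); split.
- by apply/mapP; eexists; [|reflexivity]; rewrite mem_enum.
- apply: intringD => //; apply: intring_sum => i _; apply: intringM => //.
  exact: intringZ.
- rewrite /rep mulrDr mulr_sumr addrA addrAC -big_split /=; congr (_ + _).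
  apply: eq_bigr => i _; rewrite ffunE /= {1}(divz_eq (c i) l) rmorphD rmorphM /= lz.
  have -> : ((absz (c i %% l)%Z)%:R : F) = (c i %% l)%Z%:~R.
    by rewrite pmulrn gez0_abs // modz_ge0 // eqz_nat -lt0n prime_gt0.
  by ring.
Qed.

Lemma finPlace_inj (v u : finPlace F) : pideal v `<=>` pideal u -> v = u.
Proof.
move=> /seteqP; case: v => p1 a1 b1 c1 d1 e1 f1 g1; case: u => p2 a2 b2 c2 d2 e2 f2 g2 /= e.
by subst p2; f_equal; exact: Prop_irrelevance.
Qed.

End FiniteResidue.

(** * Existence and finiteness of places *)

Section Places.
Variable F : fieldExtType rat.
Local Notation O := (@intring F).

Definition proper_ideal (J : set F) : Prop :=
  [/\ J `<=` O, J 0, forall x y, J x -> J y -> J (x + y),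
      forall a x, O a -> J x -> J (a * x) & ~ J 1].

Lemma proper_ideal_chain (J : set F) (A : set (set F)) : proper_ideal J ->
  (forall X, A X -> proper_ideal (X `|` J)) -> total_on A subset ->
  proper_ideal (\bigcup_(X in A) X `|` J).
Proof.
move=> [JO J0 JD JM J1] hA tA.
have key x y : (\bigcup_(X in A) X `|` J) x -> (\bigcup_(X in A) X `|` J) y ->
    (J x /\ J y) \/ exists X, [/\ A X, (X `|` J) x & (X `|` J) y].
  move=> [[X AX Xx]|Jx] [[Y AY Yy]|Jy]; [right| | |by left].
  - have [XY|YX] := tA _ _ AX AY; [exists Y|exists X]; split=> //; left => //.
    + exact: XY.
    + exact: YX.
  - by right; exists X; split=> //; [left|right].
  - by right; exists Y; split=> //; [right|left].
have up X x : A X -> (X `|` J) x -> (\bigcup_(X in A) X `|` J) x.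
  by move=> AX [Xx|Jx]; [left; exists X|right].
split.
- by move=> x [[X AX Xx]|/JO//]; have [h _ _ _ _] := hA _ AX; apply: h; left.
- by right.
- move=> x y hx hy; have [[Jx Jy]|[X [AX Xx Xy]]] := key _ _ hx hy; first by right; exact: JD.
  by have [_ _ h _ _] := hA _ AX; apply: (up X) => //; exact: h.
- move=> a x Oa [[X AX Xx]|Jx]; last by right; exact: JM.
  by have [_ _ _ h _] := hA _ AX; apply: (up X) => //; apply: h => //; left.
- by move=> [[X AX X1]|//]; have [_ _ _ _] := hA _ AX; apply; left.
Qed.

(** A maximal proper ideal above [J], given by the lemma of Zorn, is prime. *)
Lemma place_above (J : set F) : proper_ideal J -> (exists2 x, J x & x != 0) ->
  exists v : finPlace F, J `<=` pideal v.
Proof.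
move=> hJ [x0 Jx0 x00].
have [A [hA Amax]] : exists A, proper_ideal (A `|` J) /\
    forall B, A `<` B -> ~ proper_ideal (B `|` J).
  apply: (Zorn_bigcup (P := fun A => proper_ideal (A `|` J))) => C hC tC.
  exact: proper_ideal_chain.
pose M := A `|` J; have [MO M0 MD MM M1] := hA.
have Mmax a : O a -> ~ M a -> exists m c, [/\ M m, O c & m + a * c = 1].
  move=> Oa nMa; apply: contrapT => h.
  pose B := [set y | exists m c, [/\ M m, O c & m + a * c = y]].
  have MB : M `<=` B.
    by move=> m Mm; exists m, 0; split=> //; [exact: intring0|rewrite mulr0 addr0].
  have Ba : B a.
    by exists 0, 1; split=> //; [exact: intring1|rewrite mulr1 add0r].
  apply: (Amax B).
    split; first by move=> y Ay; apply: MB; left.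
    by move=> BA; apply: nMa; left; exact: BA.
  have -> : B `|` J = B.
    by apply/seteqP; split=> [y [//|Jy]|y]; [apply: MB; right|left].
  split.
  - move=> _ [m [c [Mm Oc <-]]]; apply: intringD; first exact: MO.
    exact: intringM.
  - exact: MB.
  - move=> _ _ [m [c [Mm Oc <-]]] [m' [c' [Mm' Oc' <-]]].
    exists (m + m'), (c + c'); split; [exact: MD|exact: intringD|by ring].
  - move=> b _ Ob [m [c [Mm Oc <-]]].
    by exists (b * m), (b * c); split; [exact: MM|exact: intringM|ring].
  - by move=> [m [c [Mm Oc e]]]; apply: h; exists m, c.
have Mp a b : O a -> O b -> M (a * b) -> M a \/ M b.
  move=> Oa Ob Mab; apply: contrapT => /not_orP[nMa nMb].
  have [m [c [Mm Oc e]]] := Mmax a Oa nMa.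
  have [m' [c' [Mm' Oc' e']]] := Mmax b Ob nMb.
  apply: M1; rewrite -(mulr1 1) -{1}e -e'.
  have -> : (m + a * c) * (m' + b * c') =
      (m' + b * c') * m + (a * c * m' + c * c' * (a * b)) by ring.
  apply: (MD); first by apply: (MM) => //; rewrite e'; exact: intring1.
  by apply: (MD); apply: (MM) => //; exact: intringM.
by exists (@FinPlace F M MO M0 MD MM M1 Mp (ex_intro2 _ _ x0 (or_intror Jx0) x00)); right.
Qed.

Section Residue.
Variables (l : nat) (lp : prime l).

Let hs := cid (intring_mod_finite F lp).
Definition residues : seq F := projT1 hs.
Lemma residuesP y : O y -> exists x z, [/\ x \in residues, O z & y = x + l%:R * z].
Proof. exact: (projT2 hs).2. Qed.

Definition residue_code (v : finPlace F) : seq bool := [seq `[< pideal v x >] | x <- residues].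

Lemma place_mod (v : finPlace F) x z : pideal v l%:R -> O z ->
  pideal v (x + l%:R * z) <-> pideal v x.
Proof.
move=> vl Oz; have vlz : pideal v (l%:R * z) by rewrite mulrC; exact: pidealM.
split=> [h|h]; last exact: pidealD.
by rewrite -[x](addrK (l%:R * z)); exact: placeB.
Qed.

(** There are finitely many primes above [l]: a prime is determined by which
    members of a finite set of residues modulo [l] it contains. *)
Lemma residue_code_inj v u : pideal v l%:R -> pideal u l%:R ->
  residue_code v = residue_code u -> v = u.
Proof.
move=> vl ul e; apply: finPlace_inj.
have h x : x \in residues -> pideal v x <-> pideal u x.
  move=> xs; have /(congr1 (fun s => nth false s (index x residues))) := e.
  rewrite !(nth_map 0) ?index_mem // nth_index //; exact: asbool_eq_equiv.
have sub w w' : (forall x, x \in residues -> pideal w x <-> pideal w' x) ->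
    pideal w l%:R -> pideal w' l%:R -> pideal w `<=` pideal w'.
  move=> hw wl wl' y wy; have [x [z [xs Oz ey]]] := residuesP (place_int wy).
  by move: wy; rewrite ey place_mod // place_mod // => /hw; exact.
by split; apply: sub => // x xs; split=> /(h x xs).
Qed.

(** Nonzero primes are maximal: the powers of an element repeat modulo [l]. *)
Lemma place_maximal_mod v a : pideal v l%:R -> O a -> ~ pideal v a ->
  exists2 b, O b & pideal v (a * b - 1).
Proof.
move=> vl Oa nva.
have /choice[f hf] : forall k : nat, exists x, x \in residues /\
    exists2 z, O z & a ^+ k = x + l%:R * z.
  by move=> k; have [x [z [xs Oz e]]] := residuesP (intringX k Oa); exists x; split=> //; exists z.
pose n := size residues.
have [i [j [ij fij]]] : exists i j : 'I_n.+1, (i < j)%N /\ f i = f j.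
  have : ~~ injectiveb (fun i : 'I_n.+1 => f i).
    apply/negP => /injectiveP finj.
    have : (size (codom (fun i : 'I_n.+1 => f i)) <= n)%N.
      apply: uniq_leq_size; first by apply/injectiveP.
      by move=> _ /codomP[i ->]; exact: (hf i).1.
    by rewrite size_codom card_ord ltnn.
  move=> /injectivePn[i [j ij fij]].
  have [h|h|/val_inj h] := ltngtP i j; [by exists i, j|by exists j, i|].
  by rewrite h eqxx in ij.
have va : pideal v (a ^+ i * (1 - a ^+ (j - i))).
  rewrite mulrBr mulr1 -exprD subnKC; last exact: ltnW.
  have [_ [z Oz ->]] := hf i; have [_ [z' Oz' ->]] := hf j; rewrite fij.
  have -> : f j + l%:R * z - (f j + l%:R * z') = (z - z') * l%:R by ring.
  by apply: pidealM => //; exact: intringB.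
have [||h|h] := pideal_prime _ _ va; first exact: intringX.
- by apply: intringB; [exact: intring1|exact: intringX].
- by case: nva; exact: placeX h.
- exists (a ^+ (j - i).-1); first exact: intringX.
  by rewrite -exprS prednK ?subn_gt0 //; have := placeN h; rewrite opprB.
Qed.

End Residue.

Lemma place_maximal (v : finPlace F) a : O a -> ~ pideal v a ->
  exists2 b, O b & pideal v (a * b - 1).
Proof. by move=> Oa nva; have [l lp vl] := place_rational_prime v; exact: (place_maximal_mod lp vl Oa nva). Qed.

Lemma place_sub_eq (v u : finPlace F) : pideal v `<=` pideal u -> v = u.
Proof.
move=> vu; apply: finPlace_inj; split=> // a ua; apply: contrapT => nva.
have [b Ob h] := place_maximal (place_int ua) nva.
apply: (@pideal_proper _ u); rewrite -[1](subKr (a * b)).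
by apply: placeB; [rewrite mulrC; exact: pidealM|exact: vu].
Qed.

Lemma finPlace_countable : exists f : finPlace F -> nat, injective f.
Proof.
have /choice[l hl] : forall v : finPlace F, exists l : {l : nat | prime l}, pideal v (sval l)%:R.
  by move=> v; have [l lp vl] := place_rational_prime v; exists (exist _ l lp).
exists (fun v => choice.pickle (sval (l v), residue_code (svalP (l v)) v)).
move=> v u /(pcan_inj choice.pickleK) [e1 e2].
have elu : l v = l u by case: (l v) (l u) e1 {e2} => x px [y py] /= e; subst y; congr exist; exact: bool_irrelevance.
apply: (@residue_code_inj _ (svalP (l v))) => //; first by rewrite elu.
by rewrite e2 elu.
Qed.

Lemma finite_places_above N : (0 < N)%N -> finite_set [set v : finPlace F | pideal v N%:R].
Proof.
move=> N0; have prime_case l (lp : prime l) : finite_set [set v : finPlace F | pideal v l%:R].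
  rewrite -(eq_finite_set (@inj_card_eq _ _ _ (residue_code lp) _)); last first.
    by move=> v u /set_mem vl /set_mem ul; exact: residue_code_inj.
  have : finite_set [set val t | t in @setT ((size (residues lp)).-tuple bool)].
    by apply: finite_image; exact: finite_finset.
  apply: sub_finite_set => _ [v _ <-].
  have sz : size (residue_code lp v) == size (residues lp) by rewrite size_map.
  by exists (Tuple sz).
have [M] := ubnP N; elim: M N N0 => [//|M IH] N N0 NM.
have [N1|N1] := leqP N 1.
  have -> : N = 1%N by apply/eqP; rewrite eqn_leq N1.
  by rewrite (_ : [set _ | _] = set0) // -subset0 => v /pideal_proper.
have pn := pdiv_prime N1; have dn := pdiv_dvd N.
have : finite_set ([set v : finPlace F | pideal v (N %/ pdiv N)%:R] `|`
    [set v : finPlace F | pideal v (pdiv N)%:R]).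
  rewrite finite_setU; split; last exact: prime_case.
  apply: IH; first by rewrite divn_gt0 ?prime_gt0 // dvdn_leq.
  by apply: leq_trans (ltn_Pdiv (prime_gt1 pn) N0) _.
apply: sub_finite_set => v /=; rewrite -{1}(divnK dn) natrM.
by move=> /pideal_prime[||h|h]; [exact: intringN|exact: intringN|left|right].
Qed.

End Places.

Section Valuations.
Variables (R : realType) (K : avField R).
Lemma avX (x : K) n : av (x ^+ n) = av x ^+ n.
Proof. by elim: n => [|n IH]; rewrite ?expr0 ?av1 // !exprS avM IH. Qed.
Lemma av0 : av (0 : K) = 0. Proof. exact/av_eq0. Qed.
Lemma av_gt0 (x : K) : x != 0 -> 0 < av x.
Proof. by move=> x0; rewrite lt_neqAle av_ge0 andbT eq_sym; apply/eqP => /av_eq0/eqP; rewrite (negPf x0). Qed.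
Lemma avV (x : K) : av x^-1 = (av x)^-1.
Proof.
have [->|x0] := eqVneq x 0; first by rewrite invr0 av0 invr0.
apply: (mulfI (lt0r_neq0 (av_gt0 x0))); rewrite -avM mulfV // av1 mulfV //.
exact: lt0r_neq0 (av_gt0 x0).
Qed.
Lemma avB (x y : K) : av (x - y) = av (y - x).
Proof. by rewrite -avN opprB. Qed.
End Valuations.

(** * Strong approximation *)

Section RationalIntegers.
Variable F : fieldExtType rat.

Lemma intring_rat (q : rat) : @intring F q%:A -> exists z : int, q = z%:~R.
Proof.
case=> p mp pq.
have rq : root (map_poly intr p) q.
  rewrite -(fmorph_root (in_alg F)) -map_poly_comp.
  by rewrite (@eq_map_poly _ _ _ (intr : int -> F)) // => z /=; rewrite scaler_int.
have /dvdpP_rat_int[p1 [a a0 ea] [r er]] : 'X - q%:P %| map_poly intr p by rewrite dvdp_XsubCl.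
have lu : lead_coef p1 * lead_coef r = 1 by rewrite -lead_coefM -er (eqP mp).
have la : a * (lead_coef p1)%:~R = 1.
  have -> : (lead_coef p1)%:~R = lead_coef (map_poly intr p1) :> rat.
    by rewrite lead_coef_map_inj //; exact: intr_inj.
  by rewrite -lead_coefZ -ea lead_coefXsubC.
have ar : a = (lead_coef r)%:~R.
  transitivity (a * (lead_coef p1 * lead_coef r)%:~R); first by rewrite lu mulr1.
  by rewrite intrM mulrA la mul1r.
exists (- (lead_coef r * p1`_0)).
have := congr1 (fun s : {poly rat} => s`_0) ea.
by rewrite coefB coefX coefC eqxx sub0r coefZ coef_map /= ar rmorphN rmorphM /= => <-; rewrite opprK.
Qed.

Lemma finPlace_exists : exists v : finPlace F, True.
Proof.
have Z := @intringN F 2; pose J := [set x | exists2 a, @intring F a & x = 2 * a].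
have [] := @place_above F J; last by move=> v _; exists v.
- split.
  + by move=> _ [a Oa ->]; exact: intringM.
  + by exists 0; [exact: intring0|rewrite mulr0].
  + by move=> _ _ [a Oa ->] [b Ob ->]; exists (a + b); [exact: intringD|rewrite mulrDr].
  + by move=> c _ Oc [a Oa ->]; exists (c * a); [exact: intringM|rewrite mulrCA].
  + move=> [a Oa e]; have ea : a = (2^-1 : rat)%:A.
      have n2 : (2 : F) != 0 by rewrite natF_eq0.
      apply: (mulfI n2); rewrite -e; have -> : (2 : F) = (2 : rat)%:A.
        by rewrite scaler_nat.
      by rewrite -scalerAl mul1r scalerA mulfV // scale1r.
    move: Oa; rewrite ea => /intring_rat[z /(congr1 ( *%R 2))].
    rewrite mulfV // => /eqP; rewrite -(intrM _ 2 z) eq_sym -[1]/(1%:~R) eqr_int => /eqP.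
    by lia.
- exists 2; last by rewrite natF_eq0.
  by exists 1; [exact: intring1|rewrite mulr1].
Qed.

End RationalIntegers.

Section Completions.
Variables (R : realType) (F : fieldExtType rat).
Variable Fhat : forall v : finPlace F, completion R v.
Local Notation O := (@intring F).
Local Notation nv v x := (av (cemb (Fhat v) x)).

Lemma av_place_unit v y : O y -> ~ pideal v y -> nv v y = 1.
Proof.
move=> Oy nv; apply/eqP; rewrite eq_le c_int // leNgt.
by apply/negP => /(c_prime _ Oy).
Qed.

(** If [x] were not integral, its denominators would form a proper ideal,
    contained in some prime; but [x] is integral there, hence has a
    denominator outside that prime. *)
Lemma intring_local x : (forall v, nv v x <= 1) -> O x.
Proof.
move=> hx; apply: contrapT => nOx.
pose J := [set a | O a /\ O (a * x)].
have [N N0 ON] := intring_denominator x.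
have [] := @place_above F J.
- split.
  + by move=> a [].
  + by split; rewrite ?mul0r; exact: intring0.
  + by move=> a b [Oa Oax] [Ob Obx]; rewrite /J /= mulrDl; split; exact: intringD.
  + by move=> c a Oc [Oa Oax]; rewrite /J /= -mulrA; split; exact: intringM.
  + by move=> [_]; rewrite mul1r.
- exists N%:R; last by rewrite natF_eq0 -lt0n.
  by split=> //; exact: intringN.
move=> v Jv; have [a [b [Oa Ob nvb [e|[va e]]]]] := place_valuation v x.
  by apply: nvb; apply: Jv; split=> //; rewrite mulrC e.
have := av_place_unit Ob nvb; rewrite -e rmorphM avM => e1.
have a1 : nv v a < 1 by apply/(c_prime _ Oa).
have := hx v; rewrite leNgt => /negP; apply; rewrite ltNge; apply/negP => x1.
suff : nv v x * nv v a < 1 by rewrite e1 ltxx.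
apply: le_lt_trans a1; rewrite ler_piMl ?av_ge0 //.
Qed.

Lemma av_sum_le1 v (I : Type) (r : seq I) (P : pred I) (f : I -> Fhat v) :
  (forall i, P i -> av (f i) <= 1) -> av (\sum_(i <- r | P i) f i) <= 1.
Proof.
move=> h; apply: (big_ind (fun x => av x <= 1)) => //; first exact: int0_subproof.
by move=> x y; apply: intD_subproof; exact: c_ultra.
Qed.

Lemma avB_le1 v (x y : Fhat v) : av x <= 1 -> av y <= 1 -> av (x - y) <= 1.
Proof. by move=> hx hy; apply: (intD_subproof (@c_ultra _ _ _ _)) => //; rewrite avN. Qed.

(** The [d] for which [d * x0] can be approximated in this way form an ideal of
    integers. It is contained in no prime, so it contains 1. *)
Lemma partial_fraction v x0 : exists2 x,
  nv v (x0 - x) <= 1 & forall u, u <> v -> nv u x <= 1.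
Proof.
have [N N0 ON] := intring_denominator x0.
pose J := [set d | O d /\ exists2 x, nv v (d * x0 - x) <= 1 & forall u, u <> v -> nv u x <= 1].
have [[_]|J1] := pselect (J 1); first by rewrite mul1r.
exfalso; have [] := @place_above F J.
- split=> //.
  + by move=> d [].
  + split; first exact: intring0.
    by exists 0; rewrite ?mul0r ?subr0 ?rmorph0 ?av0 // => u _; rewrite rmorph0 av0.
  + move=> a b [Oa [x hx hx']] [Ob [y hy hy']]; split; first exact: intringD.
    exists (x + y) => [|u uv].
      rewrite mulrDl opprD addrACA rmorphD; exact: (intD_subproof (@c_ultra _ _ _ _)).
    by rewrite rmorphD; apply: (intD_subproof (@c_ultra _ _ _ _)); [exact: hx'|exact: hy'].
  + move=> a b Oa [Ob [x hx hx']]; split; first exact: intringM.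
    exists (a * x) => [|u uv].
      by rewrite -mulrA -mulrBr rmorphM; apply: intM_subproof => //; exact: c_int.
    by rewrite rmorphM; apply: intM_subproof; [exact: c_int|exact: hx'].
- exists N%:R; last by rewrite natF_eq0 -lt0n.
  split; first exact: intringN.
  by exists 0; rewrite ?subr0 ?c_int // => u _; rewrite rmorph0 av0.
move=> p Jp.
have avoid (u w : finPlace F) : u <> w -> exists2 e, pideal u e & ~ pideal w e.
  move=> uw; apply: contrapT => h; apply: uw; apply: place_sub_eq => e ue.
  by apply: contrapT => we; apply: h; exists e.
have shrink u e : pideal u e -> exists k : nat, nv u e ^+ k * nv u x0 <= 1.
  move=> ue; apply: geometric_small; rewrite av_ge0 /=.
  by apply/(c_prime _ (place_int ue)).
have [pv|/eqP pv] := eqVneq p v; last first.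
  have [e ve npe] := avoid v p (nesym pv).
  have [k hk] := shrink v e ve.
  apply: npe; apply: (@placeX _ _ _ k (place_int ve)); apply: Jp.
  split; first exact: intringX (place_int ve).
  by exists 0; rewrite ?subr0 ?rmorphM ?rmorphXn ?avM ?avX // => u _; rewrite rmorph0 av0.
have [s hs] := (@finite_seqP (finPlace F) _).1 (finite_places_above F N0).
have /choice[e he] : forall u, exists e, O e /\ (u <> v -> ~ pideal v e /\ nv u e * nv u x0 <= 1).
  move=> u; have [uv|uv] := pselect (u = v).
    by exists 0; split => //; exact: intring0.
  have [e ue nve] := avoid u v uv; have [k hk] := shrink u e ue.
  exists (e ^+ k); split; first exact: intringX (place_int ue).
  move=> _; split; last by rewrite rmorphXn avX.
  by move=> /(placeX (place_int ue)).
pose d := \prod_(u <- s | u != v) e u.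
have Od : O d by apply: intring_prod => u _; exact: (he u).1.
have nvd : ~ pideal v d.
  rewrite /d; elim: s {hs d Od} => [|u s IH]; first by rewrite big_nil => /pideal_proper.
  rewrite big_cons; case: eqP => //= uv.
  move=> /pideal_prime [||h|//]; first exact: (he u).1.
    by apply: intring_prod => w _; exact: (he w).1.
  by have [_ /(_ uv) []] := he u.
apply: nvd; rewrite -pv; apply: Jp; split=> //.
exists (d * x0); first by rewrite subrr rmorph0 av0.
move=> u uv; have [uN|uN] := pselect (pideal u N%:R).
  have us : u \in s by have : [set` s] u by rewrite -hs.
  rewrite /d (big_rem u) //=; case: eqP => //= _.
  rewrite mulrAC rmorphM; apply: intM_subproof; last first.
    by apply: c_int; apply: intring_prod => w _; exact: (he w).1.
  by rewrite rmorphM avM; have [_ /(_ uv) []] := he u.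
rewrite rmorphM; apply: intM_subproof; first exact: c_int.
have -> : nv u x0 = nv u (N%:R * x0).
  by rewrite rmorphM avM (av_place_unit _ uN) ?mul1r //; exact: intringN.
exact: c_int.
Qed.

(** Strong approximation for the additive group, by summing partial fractions
    over the finitely many places where [y] is not integral. *)
Lemma strong_approximation (y : forall v, Fhat v) :
  finite_set [set v | ~ av (y v) <= 1] ->
  exists x, forall v, av (y v - cemb (Fhat v) x) <= 1.
Proof.
move=> /finite_seqP[s hs].
have /choice[x hx] : forall v, exists x, av (y v - cemb (Fhat v) x) <= 1 /\
    forall u, u <> v -> nv u x <= 1.
  move=> v; have [x0 hx0] := @c_dense _ _ _ (Fhat v) (y v) 1 ltr01.
  have [x h1 h2] := partial_fraction v x0; exists x; split=> //.
  rewrite (_ : _ - _ = (y v - cemb (Fhat v) x0) + cemb (Fhat v) (x0 - x)).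
    by apply: (intD_subproof (@c_ultra _ _ _ _)) => //; exact: ltW.
  by rewrite rmorphB addrA subrK.
exists (\sum_(u <- undup s) x u) => v.
have [vs|vs] := boolP (v \in undup s).
  rewrite (bigD1_seq v) ?undup_uniq //= rmorphD opprD addrA.
  apply: avB_le1; first exact: (hx v).1.
  rewrite rmorph_sum; apply: av_sum_le1 => u /eqP uv.
  by apply: (hx u).2 => vu; apply: uv; rewrite vu.
apply: avB_le1.
  apply: contrapT => h; have : [set` s] v by rewrite -hs.
  by rewrite /= -mem_undup (negPf vs).
rewrite rmorph_sum big_seq; apply: av_sum_le1 => u us.
by apply: (hx u).2 => vu; rewrite vu us in vs.
Qed.

(** Dividing by [N] reduces to the preceding case. *)
Lemma strong_approximation_mod (N : nat) (y : forall v, Fhat v) : (0 < N)%N ->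
  finite_set [set v | ~ av (y v) <= 1] ->
  exists x, forall v, av (y v - cemb (Fhat v) x) <= nv v (N%:R).
Proof.
move=> N0 fy; have N0' v : cemb (Fhat v) N%:R != 0.
  by rewrite fmorph_eq0 natF_eq0 -lt0n.
have [] := @strong_approximation (fun v => y v / cemb (Fhat v) N%:R).
  have : finite_set ([set v | ~ av (y v) <= 1] `|` [set v : finPlace F | pideal v N%:R]).
    by rewrite finite_setU; split=> //; exact: finite_places_above.
  apply: sub_finite_set => v /= h; apply: contrapT => /not_orP[/contrapT yv nN].
  by apply: h; rewrite avM avV (av_place_unit (intringN _ N) nN) invr1 mulr1.
move=> x hx; exists (N%:R * x) => v.
have -> : y v - cemb (Fhat v) (N%:R * x) =
    cemb (Fhat v) N%:R * (y v / cemb (Fhat v) N%:R - cemb (Fhat v) x).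
  by rewrite mulrBr rmorphM [_ * (y v / _)]mulrC divfK ?N0'.
by rewrite avM ler_piMr // av_ge0.
Qed.

End Completions.

(** * Archimedean embeddings *)

Section Embeddings.
Variables (R : realType) (F : splittingFieldType rat).
Hypothesis hgal : galois 1%AS {:F}.
Local Notation C := R[i].
Local Notation O := (@intring F).
Local Notation gal := (gal_of {:F}).

Let x0 := separable_generator 1 {:F}.
Let ev (p : {poly rat}) : F := (map_poly (in_alg F) p).[x0].

Lemma ev_surj (y : F) : exists p, ev p = y.
Proof.
have : y \in <<1; x0>>%VS.
  rewrite -eq_adjoin_separable_generator ?memvf ?subvf //.
  by have /and3P[_ h _] := hgal.
by move=> /Fadjoin_polyP[q /polyOver1P[p ->] ->]; exists p.
Qed.

Lemma minpoly_rat : exists2 q : {poly rat}, minPoly 1 x0 = map_poly (in_alg F) q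
  & forall p, ev p = 0 -> q %| p.
Proof.
have /polyOver1P[q Dq] := minPolyOver 1 x0; exists q => // p p0.
rewrite -(dvdp_map (in_alg F)) -Dq; apply: minPoly_dvdp; last exact/eqP.
by apply/polyOver1P; exists p.
Qed.

(** A root in C of the minimal polynomial of a primitive element gives an
    embedding of the field. *)
Lemma embedding_exists : exists t : infPlace R F, True.
Proof.
have [q Dq hq] := minpoly_rat.
have [z qz] : exists z, root (map_poly (@ratr C) q) z.
  apply/closed_rootP; rewrite size_map_poly -(size_map_poly (in_alg F)) -Dq.
  by rewrite gtn_eqF // (root_size_gt1 _ (root_minPoly 1 x0)) // monic_neq0 ?monic_minPoly.
pose evz (p : {poly rat}) : C := (map_poly (@ratr C) p).[z].
have ev0 p : ev p = 0 -> evz p = 0.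
  by move=> /hq /(dvdpP _ _)[r ->]; rewrite /evz rmorphM hornerM (rootP qz) mulr0.
have evB p r : ev p = ev r -> evz p = evz r.
  move=> e; apply/eqP; rewrite -subr_eq0; apply/eqP.
  have := ev0 (p - r); rewrite /ev /evz !rmorphB !hornerD !hornerN; apply.
  by rewrite -/(ev p) e subrr.
have /choice[c hc] := ev_surj.
pose T y := evz (c y).
have TD : additive T.
  move=> a b; rewrite /T; have -> : evz (c a) - evz (c b) = evz (c a - c b).
    by rewrite /evz rmorphB hornerD hornerN.
  by apply: evB; rewrite hc /ev rmorphB hornerD hornerN -!/(ev _) !hc.
have TM : multiplicative T.
  split=> [a b|].
    rewrite /T; have -> : evz (c a) * evz (c b) = evz (c a * c b).
      by rewrite /evz rmorphM hornerM.
    by apply: evB; rewrite hc /ev rmorphM hornerM -!/(ev _) !hc.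
  have -> : 1 = evz 1 by rewrite /evz rmorph1 hornerC.
  by apply: evB; rewrite hc /ev rmorph1 hornerC.
pose aT := GRing.isAdditive.Build F C T TD.
pose mT := GRing.isMultiplicative.Build F C T TM.
by exists (HB.pack T aT mT : {rmorphism F -> C}).
Qed.

Lemma embedding_rat (t : {rmorphism F -> C}) (a : rat) : t a%:A = ratr a.
Proof. exact: (fmorph_eq_rat (t \o in_alg F : {rmorphism rat -> C}) a). Qed.

Lemma embedding_ev (t : {rmorphism F -> C}) p : t (ev p) = (map_poly (@ratr C) p).[t x0].
Proof.
rewrite /ev -horner_map -map_poly_comp; congr (_.[_]).
by apply: eq_map_poly => q /=; rewrite embedding_rat.
Qed.

(** The extension being normal, the conjugates of a primitive element lie in
    the field and are permuted transitively by the Galois group. *)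
Lemma embedding_gal (t u : {rmorphism F -> C}) : exists g : gal, forall x, u x = t (g x).
Proof.
have [q Dq _] := minpoly_rat.
have /(galois_factors (subvf _))/(_ x0 (memvf _))[r [_ _ e]] := hgal.
have : root (map_poly t (minPoly 1 x0)) (u x0).
  rewrite Dq -map_poly_comp; have -> : map_poly (t \o in_alg F) q = map_poly (u \o in_alg F) q.
    by apply: eq_map_poly => a /=; rewrite !embedding_rat.
  by rewrite map_poly_comp -Dq fmorph_root root_minPoly.
rewrite e rmorph_prod (eq_bigr (fun b => 'X - (t b)%:P)); last first.
  by move=> b _; rewrite /= rmorphB /= map_polyX map_polyC.
rewrite -(big_map t xpredT (fun b => 'X - b%:P)) root_prod_XsubC => /mapP[b /mapP[g _ ->]] ub.
exists g => x; have [p <-] := ev_surj x; rewrite embedding_ev ub.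
have -> : g (ev p) = (map_poly (in_alg F) p).[g x0].
  rewrite /ev -horner_map -map_poly_comp; congr (_.[_]).
  by apply: eq_map_poly => a /=; rewrite linearZ /= rmorph1.
rewrite -horner_map -map_poly_comp; congr (_.[_]).
by apply: eq_map_poly => a /=; rewrite embedding_rat.
Qed.

Lemma infPlace_ext (t u : infPlace R F) : t =1 u -> t = u.
Proof.
case: t u => f [[m1] [m2]] [g [[n1] [n2]]] /= fg.
have e : f = g by exact/funext.
subst g; have e1 : m1 = n1 by exact: Prop_irrelevance.
have e2 : m2 = n2 by exact: Prop_irrelevance.
by subst m1 m2.
Qed.

Definition gal_emb (t : infPlace R F) (g : gal) : infPlace R F := (t : {rmorphism F -> C}) \o g.

Lemma gal_emb_inj t : injective (gal_emb t).
Proof.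
move=> g h e; apply/eqP/gal_eqP => x _; apply: (fmorph_inj t).
exact: (congr1 (fun u : infPlace R F => u x) e).
Qed.

Lemma gal_emb_surj t u : exists g, u = gal_emb t g.
Proof. by have [g hg] := embedding_gal t u; exists g; exact: infPlace_ext. Qed.

Lemma infPlace_finite : finite_set [set: infPlace R F].
Proof.
have [t _] := embedding_exists.
have -> : [set: infPlace R F] = gal_emb t @` setT.
  by apply/seteqP; split=> // u _; have [g ->] := gal_emb_surj t u; exists g.
by apply: finite_image; exact: finite_finset.
Qed.

Lemma mem_gal1 (g : gal) : g \in 'Gal({:F} / 1)%g.
Proof. by rewrite gal_kHom ?sub1v // k1AHom. Qed.

Lemma norm_rational (a : F) : exists q : rat, \prod_(g : gal) g a = q%:A.
Proof.
have := mem_galNorm hgal (memvf a); rewrite /galNorm => /vlineP[q e]; exists q.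
by rewrite -e; apply: eq_bigl => g; rewrite mem_gal1.
Qed.

Lemma gal_int (g : gal) x : O x -> O (g x).
Proof.
move=> [p mp px]; exists p => //.
rewrite (_ : map_poly _ p = map_poly g (map_poly intr p)) ?fmorph_root //.
by rewrite -map_poly_comp; apply: eq_map_poly => z /=; rewrite rmorph_int.
Qed.

Hypothesis hreal : totally_real R F.

Lemma emb_real (t : infPlace R F) x : t x = (complex.Re (t x))%:C%C.
Proof. by case: (t x) (hreal t x) => a b /= ->. Qed.

Lemma norm_emb_real (t : infPlace R F) x : `|t x| = `|complex.Re (t x)|%:C%C.
Proof. by rewrite {1}emb_real normc_def /= expr0n addr0 sqrtr_sqr. Qed.

(** The norm of [x] is a rational integer of absolute value
    smaller than 1. *)
Lemma small_integer x : O x -> (forall t : infPlace R F, `|complex.Re (t x)| < 1) -> x = 0.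
Proof.
move=> Ox hx; have [t _] := embedding_exists.
have [q hq] := norm_rational x.
have [z qz] : exists z : int, q = z%:~R.
  by apply: (@intring_rat F); rewrite -hq; apply: intring_prod => g _; exact: gal_int.
have tz : t (\prod_(g : gal) g x) = z%:~R.
  by rewrite hq embedding_rat qz ratr_int.
have : `|z%:~R : C| < 1.
  rewrite -tz rmorph_prod normr_prod (bigD1 1%g) //=.
  apply: (@le_lt_trans _ _ (`|t ((1%g : gal) x)|)).
    rewrite ler_piMr //; apply: prodr_ile1 => g _; rewrite normr_ge0 /=.
    have := hx (gal_emb t g); rewrite -ltcR -norm_emb_real; exact: ltW.
  have := hx (gal_emb t 1%g); rewrite -ltcR -norm_emb_real; exact.
rewrite -intr_norm -[1]/(1%:~R) ltr_int => z1.
have z0 : z = 0 by lia.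
move: hq; rewrite qz z0 scale0r => /eqP/prodf_eq0[g _].
by rewrite fmorph_eq0 => /eqP.
Qed.

(** The image of the ring of integers in the product of the archimedean
    completions is cocompact: by the independence of the automorphisms it
    spans, so that one can round the coordinates in a basis. *)
Lemma integers_cobounded : exists c : nat, forall a : infPlace R F -> R,
  exists2 x, O x & forall t, `|a t - complex.Re (t x)| <= c%:R.
Proof.
have [t0 _] := embedding_exists.
pose n := \dim {:F}; pose b := vbasis {:F}.
have /choice[N hN] : forall i : 'I_n, exists N : nat, (0 < N)%N /\ O (N%:R * b`_i).
  by move=> i; have [N N0 ON] := intring_denominator b`_i; exists N.
pose e (i : 'I_n) := (N i)%:R * b`_i.
pose G := #|{: gal}|.
pose M : 'M[F]_(G, n) := \matrix_(g, i) (enum_val g : gal) (e i).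
have Mfree : row_free M.
  rewrite -kermx_eq0; apply/eqP/row_matrixP => i; rewrite row0.
  set u := row i _.
  have uM : u *m M = 0 by rewrite -row_mul mulmx_ker row0.
  have rel : forall x, x \in {:F}%VS -> \sum_(g : gal) u ord0 (enum_rank g) * g x = 0.
    have ebase (j : 'I_n) : \sum_(g : gal) u ord0 (enum_rank g) * g b`_j = 0.
      have /rowP/(_ j) := uM; rewrite !mxE => ej.
      have N0 : (N j)%:R != 0 :> F by rewrite natF_eq0 -lt0n (hN j).1.
      apply: (mulfI N0); rewrite mulr0 -[RHS]ej mulr_sumr.
      rewrite [RHS](reindex (@enum_rank gal)) /=; last first.
        by apply: onW_bij; exact: enum_rank_bij.
      apply: eq_bigr => g _; rewrite !mxE enum_rankK /e rmorphM rmorph_nat; ring.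
    move=> x xF; rewrite (coord_vbasis xF).
    under eq_bigr => g _ do rewrite rmorph_sum mulr_sumr.
    rewrite exchange_big big1 //= => j _.
    under eq_bigr => g _ do rewrite linearZ /= -scalerAr.
    by rewrite -scaler_sumr ebase scaler0.
  apply/rowP => k; rewrite [RHS]mxE -[k]enum_valK.
  exact: (gal_independent (P := xpredT) (c_ := fun g => u ord0 (enum_rank g)) rel).
have [P MP] : exists P : 'M[F]_(n, G), M *m P = 1%:M by apply/row_freeP.
pose Mt := map_mx t0 M; pose Pt := map_mx t0 P.
have MPt : Mt *m Pt = 1%:M by rewrite -map_mxM MP map_mx1.
pose B : R := \sum_(g < G) \sum_(i < n) complex.Re `|Mt g i|.
have RN (z : C) : 0 <= complex.Re `|z| by rewrite normc_def /= sqrtr_ge0.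
have B0 : 0 <= B.
  by apply: sumr_ge0 => g _; apply: sumr_ge0 => i _; exact: RN.
exists (Num.truncn B).+1 => a.
pose al : 'cV[C]_G := \col_g (a (gal_emb t0 (enum_val g)))%:C%C.
pose r (i : 'I_n) : R := complex.Re ((Pt *m al) i ord0).
exists (\sum_i (Num.floor (r i))%:~R * e i).
  apply: intring_sum => i _; apply: intringM; first exact: intringZ.
  exact: (hN i).2.
move=> t; have [g ->] := gal_emb_surj t0 t.
have realM k i : Mt k i = (complex.Re (Mt k i))%:C%C.
  by rewrite !mxE; exact: emb_real.
have realP i k : Pt i k = (complex.Re (Pt i k))%:C%C.
  by rewrite mxE; exact: emb_real.
have rE i : (Pt *m al) i ord0 = (r i)%:C%C.
  rewrite /r mxE; have -> : \sum_j Pt i j * al j ord0 =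
      (\sum_j complex.Re (Pt i j) * a (gal_emb t0 (enum_val j)))%:C%C; last by [].
  rewrite rmorph_sum; apply: eq_bigr => j _.
  by rewrite realP [al j ord0]mxE -rmorphM.
have ag : a (gal_emb t0 g) = \sum_i complex.Re (Mt (enum_rank g) i) * r i.
  apply: complexI; rewrite /=; have : (Mt *m (Pt *m al)) (enum_rank g) ord0 = al (enum_rank g) ord0.
    by rewrite mulmxA MPt mul1mx.
  rewrite [al _ _]mxE enum_rankK => <-; rewrite mxE rmorph_sum; apply: eq_bigr => i _.
  by rewrite rE realM -rmorphM.
have xg : complex.Re (gal_emb t0 g (\sum_i (Num.floor (r i))%:~R * e i)) =
    \sum_i complex.Re (Mt (enum_rank g) i) * (Num.floor (r i))%:~R.
  apply: complexI; rewrite -emb_real /= !rmorph_sum; apply: eq_bigr => i _ /=.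
  rewrite !rmorphM !rmorph_int mulrC; congr (_ * _).
  by rewrite -[RHS]/((complex.Re (Mt (enum_rank g) i))%:C%C) -realM !mxE enum_rankK /e !rmorphM.
rewrite ag xg -sumrB; apply: (@le_trans _ _ B); last exact: ltW (truncnS_gt _).
apply: le_trans (ler_norm_sum _ _ _) _.
rewrite /B (bigD1 (enum_rank g)) //= -[leLHS]addr0; apply: lerD; last first.
  by apply: sumr_ge0 => k _; apply: sumr_ge0 => i _; exact: RN.
apply: ler_sum => i _; rewrite -mulrBr normrM.
have -> : Normc.normc (Mt (enum_rank g) i) = `|complex.Re (Mt (enum_rank g) i)|.
  by rewrite {1}realM /= expr0n addr0 sqrtr_sqr.
rewrite ler_piMr //; have := Num.Theory.floor_itv (r i).
rewrite intrD; move: (r i) (_%:~R : R) => u f /andP[h1 h2].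
rewrite ler_norml; apply/andP; split; first by rewrite -subr_ge0 in h1; apply: le_trans h1; rewrite oppr_le0.
by rewrite lerBlDl addrC; apply: ltW; rewrite addrC.
Qed.

End Embeddings.

(** * Topology of linear groups and restricted products *)

Lemma finite_pos_lb (R : realType) (I : finType) (f : I -> R) :
  (forall i, 0 < f i) -> exists2 e, 0 < e & forall i, e <= f i.
Proof.
move=> f0; exists (\big[Num.min/1]_i f i).
  by apply: (big_ind (fun x => 0 < x)) => // x y x0 y0; rewrite lt_min x0.
by move=> i; rewrite (bigD1 i) //= ge_min lexx.
Qed.

Section Subbase.
Variables (T : choiceType) (I : pointedType) (D : set I) (b : I -> set T).

Lemma finI_from_ind (Q : set T -> Prop) : Q setT ->
  (forall A B, Q A -> Q B -> Q (A `&` B)) -> (forall i, D i -> Q (b i)) ->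
  forall A, finI_from D b A -> Q A.
Proof.
move=> QT QI QD A [E hE <-].
have key (s : seq I) : (forall i, i \in s -> D i) -> Q (\bigcap_(i in [set` s]) b i).
  elim: s => [|i s IH] hs; first by rewrite set_nil bigcap_set0.
  have -> : [set` i :: s] = [set i] `|` [set` s].
    apply/seteqP; split=> j /=; rewrite inE; first by move=> /predU1P[]; [left|right].
    by move=> [->|->]; rewrite ?eqxx ?orbT.
  rewrite bigcap_setU bigcap_set1; apply: QI.
    by apply: QD; apply: hs; rewrite inE eqxx.
  by apply: IH => j js; apply: hs; rewrite inE js orbT.
by apply: (key (enum_fset E)) => i iE; exact/set_mem/hE.
Qed.
End Subbase.

Section GLTopology.
Variables (R : realType) (n : nat) (K : avField R).
Local Notation G := (GL n K).

Definition glnear (x : G) (e : R) : set G :=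
  [set g | forall i j, av (glmx g i j - glmx x i j) < e].

Lemma glnear_le x (e e' : R) : e <= e' -> glnear x e `<=` glnear x e'.
Proof. by move=> ee g h i j; exact: lt_le_trans (h i j) ee. Qed.

Lemma gl_openP (U : set G) : open U <->
  forall x, U x -> exists2 e, 0 < e & glnear x e `<=` U.
Proof.
split=> [[D hD <-] x [V DV Vx]|h].
  have [e e0 he] : exists2 e, 0 < e & glnear x e `<=` V.
    move: {hD DV} (hD _ DV) x Vx.
    apply: (finI_from_ind (Q := fun V : set G =>
        forall x, V x -> exists2 e, 0 < e & glnear x e `<=` V)).
    - by move=> x _; exists 1.
    - move=> A B hA hB x [Ax Bx]; have [e e0 he] := hA x Ax; have [f f0 hf] := hB x Bx.
      exists (Num.min e f); first by rewrite lt_min e0.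
      by move=> g hg; split; [apply: he|apply: hf]; apply: glnear_le hg; rewrite ge_min lexx ?orbT.
    - move=> _ [A [e [e0 ->]]] x hx.
      have [d d0 hd] := @finite_pos_lb R _
        (fun ij : 'I_n * 'I_n => e - av (glmx x ij.1 ij.2 - A ij.1 ij.2))
        ltac:(by move=> ij; rewrite subr_gt0).
      exists d => // g hg i j.
      rewrite (_ : _ - _ = (glmx g i j - glmx x i j) + (glmx x i j - A i j)); last by rewrite addrA subrK.
      by apply: le_lt_trans (avD _ _) _; rewrite -ltrBrDr; apply: lt_le_trans (hg i j) (hd (i, j)).
  by exists e => // g hg; exists V => //; exact: he.
exists [set V | (exists x e, 0 < e /\ V = glnear x e) /\ V `<=` U].
  move=> V [[x [e [e0 ->]]] _]; exists [fset glnear x e]%fset.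
    by move=> W /fset1P ->; apply/mem_set; exists (glmx x), e.
  by rewrite set_fset1 bigcap_set1.
apply/seteqP; split=> [x [V [_ VU] Vx]|x Ux]; first exact: VU.
have [e e0 he] := h x Ux; exists (glnear x e); first by split=> //; exists x, e.
by move=> i j; rewrite subrr av0.
Qed.

Lemma glnear_refl x (e : R) : 0 < e -> glnear x e x.
Proof. by move=> e0 i j; rewrite subrr av0. Qed.

Lemma glnear_open x (e : R) : open (glnear x e).
Proof.
apply/gl_openP => g hg.
have [d d0 hd] := @finite_pos_lb R _
  (fun ij : 'I_n * 'I_n => e - av (glmx g ij.1 ij.2 - glmx x ij.1 ij.2))
  ltac:(by move=> ij; rewrite subr_gt0; exact: hg).
exists d => // k hk i j.
rewrite (_ : _ - _ = (glmx k i j - glmx g i j) + (glmx g i j - glmx x i j)); last by rewrite addrA subrK.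
by apply: le_lt_trans (avD _ _) _; rewrite -ltrBrDr; apply: lt_le_trans (hk i j) (hd (i, j)).
Qed.

Lemma gl_nbhsP (x : G) (U : set G) : nbhs x U <-> exists2 e, 0 < e & glnear x e `<=` U.
Proof.
split=> [|[e e0 he]]; rewrite nbhsE.
  by move=> [V [openV Vx] VU]; have [e e0 he] := (gl_openP V).1 openV x Vx; exists e => // g /he /VU.
by exists (glnear x e) => //; split; [exact: glnear_open|exact: glnear_refl].
Qed.

End GLTopology.

Section RProdTopology.
Variables (I : choiceType) (X : rpfam I).
Hypothesis rint_open : forall i, open (rint X i).
Local Notation P := (rprod X).

Definition box (V : forall i, set (X i)) : set P := [set y | forall i, V i (y i)].
Definition isbox (V : forall i, set (X i)) : Prop :=
  (forall i, open (V i)) /\ finite_set [set i | V i <> rint X i].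

Lemma isbox_around (x : P) : exists2 V, isbox V & box V x.
Proof.
exists (fun i => [set y | rint X i (x i) -> rint X i y]); last by move=> i.
split=> [i|].
  have [h|h] := pselect (rint X i (x i)).
    rewrite (_ : [set _ | _] = rint X i) //.
    by apply/seteqP; split=> [y /(_ h)//|y hy _].
  rewrite (_ : [set _ | _] = setT); first exact: openT.
  by apply/seteqP; split=> [//|y _ /h].
apply: sub_finite_set (rvalP x) => i /= h hx; apply: h.
by apply/seteqP; split=> [y /(_ hx)//|y hy _].
Qed.

Lemma isboxI V W : isbox V -> isbox W -> isbox (fun i => V i `&` W i).
Proof.
move=> [openV fV] [openW fW]; split=> [i|]; first exact: openI.
have : finite_set ([set i | V i <> rint X i] `|` [set i | W i <> rint X i]).
  by rewrite finite_setU.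
apply: sub_finite_set => i /= h; apply: contrapT => /not_orP[/contrapT hV /contrapT hW].
by apply: h; rewrite hV hW setIid.
Qed.

Lemma box_open V : isbox V -> open (box V).
Proof.
move=> hV; exists [set box V]; last by rewrite bigcup_set1.
move=> _ ->; exists [fset box V]%fset; last by rewrite set_fset1 bigcap_set1.
by move=> W /fset1P ->; apply/mem_set; exists V; case: hV.
Qed.

Lemma rprod_openP (U : set P) : open U <->
  forall x, U x -> exists V, [/\ isbox V, box V x & box V `<=` U].
Proof.
split=> [[D hD <-] x [V DV Vx]|h].
  have [W [hW Wx WV]] : exists W, [/\ isbox W, box W x & box W `<=` V].
    move: {hD DV} (hD _ DV) x Vx.
    apply: (finI_from_ind (Q := fun V : set P => forall x, V x ->
        exists W, [/\ isbox W, box W x & box W `<=` V])).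
    - by move=> x _; have [V0 h1 h2] := isbox_around x; exists V0.
    - move=> A B hA hB x [Ax Bx].
      have [V1 [a1 b1 c1]] := hA x Ax; have [V2 [a2 b2 c2]] := hB x Bx.
      exists (fun i => V1 i `&` V2 i); split; first exact: isboxI.
        by move=> i; split.
      by move=> y hy; split; [apply: c1|apply: c2] => i; have [] := hy i.
    - by move=> _ [V1 [op1 f1 ->]] x hx; exists V1; split.
  by exists W; split=> // y /WV Vy; exists V.
rewrite openE => x Ux; have [V [hV Vx VU]] := h x Ux.
by rewrite /interior /= nbhsE; exists (box V) => //; split=> //; exact: box_open.
Qed.

Lemma rprod_nbhsP (x : P) (U : set P) : nbhs x U <->
  exists V, [/\ isbox V, box V x & box V `<=` U].
Proof.
rewrite nbhsE; split=> [[V [openV Vx] VU]|[V [hV Vx VU]]].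
  by have [W [h1 h2 h3]] := (rprod_openP V).1 openV x Vx; exists W; split=> // y /h3 /VU.
by exists (box V) => //; split=> //; exact: box_open.
Qed.

Lemma box_nbhs V x : isbox V -> box V x -> nbhs x (box V).
Proof. by move=> hV Vx; apply/rprod_nbhsP; exists V; split. Qed.

End RProdTopology.

Lemma placewise_continuous (I : choiceType) (X Y : rpfam I)
    (hX : forall i, open (rint X i)) (hY : forall i, open (rint Y i))
    (f : forall i, X i -> Y i) (F : rprod X -> rprod Y) (x : rprod X) :
  (forall y i, F y i = f i (y i)) ->
  (forall i, {for x i, continuous (f i)}) ->
  finite_set [set i | ~ (rint X i `<=` f i @^-1` rint Y i)] ->
  {for x, continuous F}.
Proof.
move=> hF fc fin U /(rprod_nbhsP hY)[V [[openV fV] Vx VU]].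
pose bad := [set i | V i <> rint Y i] `|` [set i | ~ (rint X i `<=` f i @^-1` rint Y i)]
  `|` [set i | ~ rint X i (x i)].
have finbad : finite_set bad by rewrite !finite_setU; split; [split|exact: rvalP].
pose W i : set (X i) := interior (if pselect (bad i) then f i @^-1` V i else rint X i).
have hW i : ~ bad i -> W i = rint X i.
  rewrite /W => nb; case: pselect => [b|n] /=; first by case: nb.
  exact/interior_id/hX.
apply/(rprod_nbhsP hX); exists W; split.
- split=> [i|]; first exact: open_interior.
  by apply: sub_finite_set finbad => i /= h; apply: contrapT => /hW.
- move=> i; rewrite /W /interior; case: pselect => [b|nb] /=; last first.
    by have /not_orP[_ /contrapT h] := nb; exact: open_nbhs_nbhs.
  by apply: fc; apply: open_nbhs_nbhs; split=> //; rewrite -hF; exact: Vx.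
- move=> y Wy; apply: VU => i; rewrite hF; have := Wy i.
  have [b|nb] := pselect (bad i).
    by rewrite /W; case: pselect => [b'|//] /= h; exact: (interior_subset h).
  rewrite hW //; have := nb; move=> /not_orP[/not_orP[/contrapT -> /contrapT h] _].
  exact: h.
Qed.

Section AvContinuity.
Variables (R : realType) (T : topologicalType) (K : avField R) (x : T).
Implicit Types f g : T -> K.

(** Continuity at [x] for the absolute value of the target. *)
Definition avcont f := forall e : R, 0 < e -> \forall y \near x, av (f y - f x) < e.

Lemma avcont_cst c : avcont (fun=> c).
Proof. by move=> e e0; apply: nearW => y; rewrite subrr av0. Qed.

Lemma avcontD f g : avcont f -> avcont g -> avcont (fun y => f y + g y).
Proof.
move=> hf hg e e0; have e2 : 0 < e / 2 by rewrite divr_gt0.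
apply: filterS2 (hf _ e2) (hg _ e2) => y h1 h2.
rewrite opprD addrACA; apply: le_lt_trans (avD _ _) _.
by rewrite [e]splitr; exact: ltrD.
Qed.

Lemma avcont_bounded f : avcont f -> \forall y \near x, av (f y) < av (f x) + 1.
Proof.
move=> hf; apply: filterS (hf 1 ltr01) => y h.
rewrite -(subrK (f x) (f y)); apply: le_lt_trans (avD _ _) _.
by rewrite addrC ltrD2l.
Qed.

Lemma avcontM f g : avcont f -> avcont g -> avcont (fun y => f y * g y).
Proof.
move=> hf hg e e0.
pose A := av (g x) + 1 + av (f x).
have A0 : 0 < A by rewrite /A; have := av_ge0 (f x); have := av_ge0 (g x); lra.
have eA : 0 < e / A by rewrite divr_gt0.
apply: filterS3 (hf _ eA) (hg _ eA) (avcont_bounded hg) => y h1 h2 h3.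
have -> : f y * g y - f x * g x = (f y - f x) * g y + f x * (g y - g x) by ring.
apply: le_lt_trans (avD _ _) _; rewrite !avM.
apply: (@lt_le_trans _ _ (e / A * (av (g x) + 1) + e / A * av (f x))); last first.
  by rewrite -mulrDr -/A divfK ?lt0r_neq0.
have gx1 : 0 < av (g x) + 1 by have := av_ge0 (g x); lra.
apply: ltr_leD.
  apply: (@le_lt_trans _ _ (av (f y - f x) * (av (g x) + 1))).
    by rewrite ler_wpM2l ?av_ge0 // ltW.
  by rewrite ltr_pM2r.
by rewrite mulrC ler_wpM2r ?av_ge0 // ltW.
Qed.

Lemma avcontV f : f x != 0 -> avcont f -> avcont (fun y => (f y)^-1).
Proof.
move=> fx hf e e0; have a0 := av_gt0 fx; set a := av (f x) in a0.
have a2 : 0 < a / 2 by rewrite divr_gt0.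
have ea : 0 < e * (a / 2 * a) by rewrite !mulr_gt0.
apply: filterS2 (hf _ a2) (hf _ ea) => y h1 h2.
have ay : a / 2 < av (f y).
  have := avD (f x - f y) (f y); rewrite subrK -/a avB; lra.
have fy : f y != 0.
  by apply/eqP => fy; move: ay; rewrite fy av0 ltNge ltW.
have -> : (f y)^-1 - (f x)^-1 = (f x - f y) / (f y * f x) by field; rewrite fx fy.
rewrite avM avV avM -/a ltr_pdivrMr; last by rewrite mulr_gt0 // (lt_trans a2).
by rewrite avB; apply: lt_trans h2 _; rewrite ltr_pM2l // ltr_pM2r.
Qed.

Lemma avcont_sum (I : Type) (r : seq I) (P : pred I) (F : I -> T -> K) :
  (forall i, P i -> avcont (F i)) -> avcont (fun y => \sum_(i <- r | P i) F i y).
Proof.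
move=> h; elim: r => [|i r IH].
  have -> : (fun y => \sum_(i <- [::] | P i) F i y) = (fun=> 0) by apply/funext => y; rewrite big_nil.
  exact: avcont_cst.
have -> : (fun y => \sum_(j <- i :: r | P j) F j y) =
    (fun y => if P i then F i y + \sum_(j <- r | P j) F j y else \sum_(j <- r | P j) F j y).
  by apply/funext => y; rewrite big_cons.
by case: (P i) (h i) => [/(_ isT) hi|_] //; exact: avcontD.
Qed.

Lemma avcont_prod (I : Type) (r : seq I) (P : pred I) (F : I -> T -> K) :
  (forall i, P i -> avcont (F i)) -> avcont (fun y => \prod_(i <- r | P i) F i y).
Proof.
move=> h; elim: r => [|i r IH].
  have -> : (fun y => \prod_(i <- [::] | P i) F i y) = (fun=> 1) by apply/funext => y; rewrite big_nil.
  exact: avcont_cst.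
have -> : (fun y => \prod_(j <- i :: r | P j) F j y) =
    (fun y => if P i then F i y * \prod_(j <- r | P j) F j y else \prod_(j <- r | P j) F j y).
  by apply/funext => y; rewrite big_cons.
by case: (P i) (h i) => [/(_ isT) hi|_] //; exact: avcontM.
Qed.

Lemma avcont_near f g : (\forall y \near x, f y = g y) -> avcont f -> avcont g.
Proof.
move=> fg hf e e0; have fgx : f x = g x by exact: nbhs_singleton fg.
by apply: filterS2 fg (hf e e0) => y -> ; rewrite fgx.
Qed.

Lemma avcont_gl n (F : T -> GL n K) :
  (forall i j, avcont (fun y => glmx (F y) i j)) -> F y @[y --> x] --> F x.
Proof.
move=> h U /gl_nbhsP[e e0 he].
have : \forall y \near x, forall ij : 'I_n * 'I_n, av (glmx (F y) ij.1 ij.2 - glmx (F x) ij.1 ij.2) < e.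
  by apply: filter_forall => ij; exact: h.
by apply: filterS => y hy; apply: he => i j; exact: (hy (i, j)).
Qed.

End AvContinuity.

Section GLMaps.
Variables (R : realType) (K : avField R).

Lemma avcont_entry n (x : GL n K) i j : avcont x (fun g : GL n K => glmx g i j).
Proof. by move=> e e0; apply/gl_nbhsP; exists e. Qed.

Lemma avcont_det n (T : topologicalType) (x : T) (F : T -> 'M[K]_n) :
  (forall i j, avcont x (fun y => F y i j)) -> avcont x (fun y => \det (F y)).
Proof.
move=> h; apply: avcont_sum => s _; apply: avcontM; first exact: avcont_cst.
by apply: avcont_prod => i _; exact: h.
Qed.

Lemma gl_mull_continuous n (g : GL n K) : continuous (fun x => g * x)%g.
Proof.
move=> x; apply: avcont_gl => i j.
rewrite (_ : (fun y => _) = (fun y : GL n K => \sum_k glmx g i k * glmx y k j)); last first.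
  by apply/funext => y; rewrite mxE.
apply: avcont_sum => k _; apply: avcontM; [exact: avcont_cst|exact: avcont_entry].
Qed.

Lemma gl_mul_continuous n : continuous (fun p : GL n K * GL n K => p.1 * p.2)%g.
Proof.
move=> [x y]; apply: avcont_gl => i j.
rewrite (_ : (fun p => _) = (fun p : GL n K * GL n K => \sum_k glmx p.1 i k * glmx p.2 k j)); last first.
  by apply/funext => p; rewrite mxE.
apply: avcont_sum => k _; apply: avcontM => e e0.
  exists ([set g : GL n K | av (glmx g i k - glmx x i k) < e], setT); last by move=> [a b] [].
  by split; [exact: avcont_entry|exact: filterT].
exists (setT, [set g : GL n K | av (glmx g k j - glmx y k j) < e]); last by move=> [a b] [].
by split; [exact: filterT|exact: avcont_entry].
Qed.

Lemma gl_inv_continuous n : continuous (fun x : GL n K => x^-1)%g.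
Proof.
move=> x; apply: avcont_gl => i j.
rewrite (_ : (fun y => _) = (fun y : GL n K => (\det (glmx y))^-1 * ((-1) ^+ (j + i) *
    \det (row' j (col' i (glmx y)))))); last first.
  apply/funext => y; rewrite [glmx _]/= /invmx glP mxE; congr (_ * _).
  by rewrite mxE.
apply: avcontM.
  apply: avcontV; first exact: gl_det_neq0.
  by apply: avcont_det => k l; exact: avcont_entry.
apply: avcontM; first exact: avcont_cst.
apply: avcont_det => k l; rewrite (_ : (fun y => _) = (fun y : GL n K => glmx y (lift j k) (lift i l))).
  exact: avcont_entry.
by apply/funext => y; rewrite !mxE.
Qed.

Lemma gl_det_continuous n : continuous (@gl_det R n K).
Proof.
move=> x; apply: avcont_gl => i j; rewrite !ord1.
rewrite (_ : (fun y => _) = (fun y : GL n K => \det (glmx y))).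
  by apply: avcont_det => k l; exact: avcont_entry.
by apply/funext => y; rewrite mxE eqxx mulr1n.
Qed.

Lemma gl_scal_continuous n : continuous (@gl_scal R n K).
Proof.
move=> z; apply: avcont_gl => i j.
rewrite (_ : (fun y => _) = (fun y : GL 1 K => if i == j then glmx y ord0 ord0 else 0)).
  by case: (i == j); [exact: avcont_entry|exact: avcont_cst].
by apply/funext => y; rewrite mxE; case: (i == j).
Qed.

End GLMaps.

Section RProdMore.
Variables (I : choiceType) (X : rpfam I).
Hypothesis rint_open : forall i, open (rint X i).

Lemma rprod_mul_continuous :
  (forall i, continuous (fun p : X i * X i => p.1 * p.2)%g) ->
  continuous (fun p : rprod X * rprod X => p.1 * p.2)%g.
Proof.
move=> hc [x y] U /(rprod_nbhsP rint_open)[V [[openV fV] Vxy VU]].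
pose bad := [set i | V i <> rint X i] `|` [set i | ~ rint X i (x i)] `|` [set i | ~ rint X i (y i)].
have finbad : finite_set bad.
  by rewrite !finite_setU; split; [split=> //; exact: rvalP|exact: rvalP].
have H : forall i, exists AB : set (X i) * set (X i),
    [/\ nbhs (x i) AB.1, nbhs (y i) AB.2, forall a b, AB.1 a -> AB.2 b -> V i (a * b)%g
      & ~ bad i -> AB = (rint X i, rint X i)].
  move=> i; have [b|nb] := pselect (bad i).
    have : nbhs (x i * y i)%g (V i) by apply: open_nbhs_nbhs; split=> //; exact: Vxy.
    move=> /(hc i (x i, y i)) [[A B] /= [hA hB] h]; exists (A, B); split=> // a b' Aa Bb.
    exact: (h (a, b')).
  have /not_orP[/not_orP[/contrapT e /contrapT xi] /contrapT yi] := nb.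
  exists (rint X i, rint X i); split=> //=.
  - exact: open_nbhs_nbhs.
  - exact: open_nbhs_nbhs.
  - by move=> a b ha hb; rewrite e; exact: rintM.
pose AB i := projT1 (cid (H i)).
have hAB i : [/\ nbhs (x i) (AB i).1, nbhs (y i) (AB i).2,
    forall a b, (AB i).1 a -> (AB i).2 b -> V i (a * b)%g
    & ~ bad i -> AB i = (rint X i, rint X i)] := projT2 (cid (H i)).
have ib (P : forall i, set (X i)) : (forall i, ~ bad i -> P i = rint X i) ->
    isbox (fun i => interior (P i)).
  move=> hP; split=> [i|]; first exact: open_interior.
  apply: sub_finite_set finbad => i /= h; apply: contrapT => nb; apply: h.
  by rewrite hP //; exact/interior_id/rint_open.
exists (box (fun i => interior (AB i).1), box (fun i => interior (AB i).2)) => /=.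
  split; apply: box_nbhs => //.
  - by apply: ib => i nb; have [_ _ _ /(_ nb) ->] := hAB i.
  - by move=> i; have [] := hAB i.
  - by apply: ib => i nb; have [_ _ _ /(_ nb) ->] := hAB i.
  - by move=> i; have [] := hAB i.
move=> [a b] /= [ha hb]; apply: VU => i.
by have [_ _ h _] := hAB i; apply: h; apply: interior_subset; [exact: ha|exact: hb].
Qed.

Lemma rprod_inv_continuous : (forall i, continuous (fun p : X i => p^-1)%g) ->
  continuous (fun p : rprod X => p^-1)%g.
Proof.
move=> hc x; apply: (@placewise_continuous _ X X rint_open rint_open (fun i p => p^-1)%g) => //.
  by move=> i; exact: hc.
rewrite (_ : [set _ | _] = set0) // -subset0 => i /=; apply => y /=; exact: rintV.
Qed.

(** Boxes with finitely many sides taken from the given bases, and the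
    integral subgroup at the other indices. *)
Lemma rprod_base (f : I -> nat) (beta : forall i, nat -> set (X i)) : injective f ->
  (forall i k, open (beta i k)) ->
  (forall i (x : X i) U, nbhs x U -> exists2 k, beta i k x & beta i k `<=` U) ->
  exists B : nat -> set (rprod X), (forall k, exists V, [/\ isbox V, B k = box V
      & forall i, V i = rint X i \/ exists m, V i = beta i m]) /\
    forall x U, nbhs x U -> exists2 k, B k x & B k `<=` U.
Proof.
move=> finj bopen bbase.
pose V (s : seq (nat * nat)) i := if [seq p.2 | p <- s & p.1 == f i] is k :: _
  then beta i k else rint X i.
have hV s : isbox (V s).
  split=> [i|]; first by rewrite /V; case: [seq _ | _ <- _ & _] => // k _; exact: bopen.
  apply: (@sub_finite_set _ _ (f @^-1` [set` [seq p.1 | p <- s]])).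
    move=> i /= h; have : [seq p <- s | p.1 == f i] != [::].
      by apply/eqP => e; apply: h; rewrite /V e.
    rewrite -has_filter => /hasP[p ps /eqP <-]; exact: map_f.
  by apply: finite_preimage; [exact: in2W|exact: finite_seq].
exists (fun k => box (V (odflt [::] (choice.unpickle k)))); split.
  move=> k; exists (V (odflt [::] (choice.unpickle k))); split=> // i.
  by rewrite /V; case: [seq _ | _ <- _ & _] => [|m _]; [left|right; exists m].
move=> x U /(rprod_nbhsP rint_open)[W [[oW fW] Wx WU]].
have /choice[m hm] : forall i, exists m, beta i m (x i) /\ beta i m `<=` W i.
  move=> i; have [m h1 h2] : exists2 m, beta i m (x i) & beta i m `<=` W i.
    by apply: bbase; apply: open_nbhs_nbhs; split=> //; exact: Wx.
  by exists m.
have [s0 hs0] := (@finite_seqP I _).1 fW.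
pose s := [seq (f i, m i) | i <- s0].
have Vs i : V s i = if i \in s0 then beta i (m i) else rint X i.
  rewrite /V filter_map -map_comp; have [is0|is0] := boolP (i \in s0).
    have : all (pred1 (m i)) [seq (fun j => (f j, m j).2) j | j <- s0 & (fun j => (f j, m j).1 == f i) j].
      by apply/allP => _ /mapP[j + ->]; rewrite mem_filter /= => /andP[/eqP/finj -> _].
    have : m i \in [seq (fun j => (f j, m j).2) j | j <- s0 & (fun j => (f j, m j).1 == f i) j].
      by apply/mapP; exists i => //; rewrite mem_filter /= eqxx.
    case: [seq _ | _ <- _ & _] => // a t _ /= /andP[/eqP -> _] //.
  rewrite (_ : [seq _ <- s0 | _] = [::]) //; apply/eqP; rewrite -[_ == _]negbK -has_filter.
  by apply/hasPn => j js0 /=; apply: contra is0 => /eqP/finj <-.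
exists (choice.pickle s); rewrite choice.pickleK /=.
  move=> i; rewrite Vs; case: ifPn => is0; first by have [] := hm i.
  have -> : rint X i = W i; last exact: Wx.
  by apply: contrapT => h; move/negP: is0; apply; have : [set` s0] i by rewrite -hs0 /= => /esym.
move=> y hy; apply: WU => i; have := hy i; rewrite Vs.
case: ifPn => [is0|is0]; first by have [_] := hm i; exact.
have -> // : rint X i = W i.
by apply: contrapT => h; move/negP: is0; apply; have : [set` s0] i by rewrite -hs0 /= => /esym.
Qed.

End RProdMore.

(** A countable base of GL_n(K), by balls, from a countable dense subset of K. *)
Lemma gl_base (R : realType) (K : avField R) n (T : countType) (iota : T -> K) :
  (forall y (e : R), 0 < e -> exists t, av (y - iota t) < e) ->
  exists beta : nat -> set (GL n K), (forall k, exists (A : 'M[K]_n) (e : R), 0 < e /\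
      beta k = [set g | forall i j, av (glmx g i j - A i j) < e]) /\
    forall x U, nbhs x U -> exists2 k, beta k x & beta k `<=` U.
Proof.
move=> dense; pose D := ({ffun 'I_n * 'I_n -> T} * nat)%type.
pose b (d : D) : set (GL n K) :=
  [set g | forall i j, av (glmx g i j - iota (d.1 (i, j))) < d.2.+1%:R^-1].
pose dflt : set (GL n K) := [set g | forall i j, av (glmx g i j - 0) < 1].
exists (fun k => if choice.unpickle k is Some d then b d else dflt); split.
  move=> k; case: choice.unpickle => [d|].
    exists (\matrix_(i, j) iota (d.1 (i, j))), d.2.+1%:R^-1; split=> //.
    by apply/seteqP; split=> g h i j; have := h i j; rewrite mxE.
  exists 0, 1; split=> //; apply/seteqP.
  by split=> g h i j; have := h i j; rewrite mxE.
move=> x U /gl_nbhsP[e e0 he].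
have [m me] : exists m : nat, m.+1%:R^-1 < e / 2.
  have e2 : 0 < e / 2 by rewrite divr_gt0.
  exists (Num.truncn (e / 2)^-1); rewrite -[ltRHS]invrK ltf_pV2 ?posrE ?invr_gt0 //.
  exact: truncnS_gt.
have /choice[t ht] : forall ij : 'I_n * 'I_n, exists t, av (glmx x ij.1 ij.2 - iota t) < m.+1%:R^-1.
  by move=> ij; apply: dense; rewrite invr_gt0.
exists (choice.pickle ([ffun ij => t ij], m) : nat); rewrite choice.pickleK.
  by move=> i j; rewrite /= ffunE; exact: (ht (i, j)).
move=> g hg; apply: he => i j.
have -> : glmx g i j - glmx x i j = (glmx g i j - iota (t (i, j))) - (glmx x i j - iota (t (i, j))).
  by rewrite opprB addrA subrK.
apply: le_lt_trans (avD _ _) _; rewrite avN [e]splitr; apply: ltrD.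
  by apply: lt_trans me; have := hg i j; rewrite /= ffunE.
by apply: lt_trans (ht (i, j)) me.
Qed.

Section UltrametricMatrices.
Variables (R : realType) (K : avField R).
Hypothesis avU : forall x y : K, av (x + y) <= Num.max (av x) (av y).
Variable n : nat.

Lemma av_sum_lt (I : finType) (f : I -> K) (e : R) : 0 < e ->
  (forall i, av (f i) < e) -> av (\sum_i f i) < e.
Proof.
move=> e0 h; apply: (big_ind (fun x => av x < e)) => [|x y hx hy|i _]; rewrite ?av0 //.
by apply: le_lt_trans (avU _ _) _; rewrite gt_max hx.
Qed.

Lemma av_add_lt (x y : K) (e : R) : av x < e -> av y < e -> av (x + y) < e.
Proof. by move=> hx hy; apply: le_lt_trans (avU _ _) _; rewrite gt_max hx. Qed.

Lemma mulmx_small_r m p q (A : 'M[K]_(m, p)) (B : 'M[K]_(p, q)) (c e : R) : 0 < c -> 0 < e ->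
  (forall i j, av (A i j) <= c) -> (forall i j, av (B i j) < e / c) ->
  forall i j, av ((A *m B) i j) < e.
Proof.
move=> c0 e0 hA hB i j; rewrite mxE; apply: av_sum_lt => // k; rewrite avM.
apply: (@le_lt_trans _ _ (c * av (B k j))); first by rewrite ler_wpM2r ?av_ge0.
by rewrite mulrC -ltr_pdivlMr.
Qed.

Lemma mulmx_small_l m p q (A : 'M[K]_(m, p)) (B : 'M[K]_(p, q)) (e : R) : 0 < e ->
  (forall i j, av (A i j) < e) -> (forall i j, av (B i j) <= 1) ->
  forall i j, av ((A *m B) i j) < e.
Proof.
move=> e0 hA hB i j; rewrite mxE; apply: av_sum_lt => // k; rewrite avM.
by apply: le_lt_trans (hA i k); rewrite ler_piMr ?av_ge0.
Qed.

Lemma gl_integral_open : open (@gl_integral R n K).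
Proof.
pose A := [set g : GL n K | forall i j, av (glmx g i j) <= 1].
have oA : open A.
  apply/gl_openP => x Ax; exists 1 => // g hg i j.
  rewrite -(subrK (glmx x i j) (glmx g i j)); apply: le_trans (avU _ _) _.
  by rewrite ge_max Ax andbT ltW // hg.
rewrite (_ : @gl_integral R n K = A `&` (fun x => x^-1)%g @^-1` A).
  apply: openI => //; apply: open_comp => // x _; exact: gl_inv_continuous.
by apply/seteqP; split=> g; [move=> h; split=> i j; have [] := h i j
  |move=> [h1 h2] i j; split; [exact: h1|exact: h2]].
Qed.

(** The principal congruence subgroups of GL_n of the ring of integers. *)
Definition congr (e : R) : set (GL n K) := [set w | gl_integral w /\ glnear 1%g e w].

Section Congr.
Variable e : R.
Hypothesis e0 : 0 < e.

Let near_mx (g h : GL n K) : glnear g e h <-> forall i j, av ((glmx h - glmx g) i j) < e.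
Proof. by split=> H i j; have := H i j; rewrite !mxE. Qed.

Lemma congr_open : open (congr e).
Proof.
rewrite (_ : congr e = @gl_integral R n K `&` glnear 1%g e) //.
by apply: openI; [exact: gl_integral_open|exact: glnear_open].
Qed.

Lemma congr_1 : congr e 1%g.
Proof. by split; [exact: gl_integral1|exact: glnear_refl]. Qed.

Lemma congrM g h : congr e g -> congr e h -> congr e (g * h)%g.
Proof.
move=> [ig ng] [ih nh]; split; first exact: gl_integralM.
apply/near_mx; have -> : glmx (g * h)%g - glmx (1%g : GL n K) =
    (glmx g - 1%:M) *m glmx h + (glmx h - 1%:M) by rewrite mulmxBl mul1mx addrA subrK.
move=> i j; rewrite mxE; apply: av_add_lt; last exact: ((near_mx _ _).1 nh).
by apply: mulmx_small_l => // [k l|k l]; [exact: ((near_mx _ _).1 ng)|have [] := ih k l].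
Qed.

Lemma congr_conj k g : gl_integral k -> congr e g -> congr e (k * g * k^-1)%g.
Proof.
move=> ik [ig ng]; split.
  by apply: gl_integralM => //; [exact: gl_integralM|exact: gl_integralV].
apply/near_mx; have -> : glmx (k * g * k^-1)%g - glmx (1%g : GL n K) =
    (glmx k *m (glmx g - 1%:M)) *m invmx (glmx k).
  by rewrite mulmxBr mulmxBl mulmx1 mulmxV ?glP.
apply: mulmx_small_l => // [|i j]; last by have [] := ik i j.
apply: (@mulmx_small_r _ _ _ _ _ 1) => // [i j|i j]; first by have [] := ik i j.
by rewrite divr1; exact: ((near_mx _ _).1 ng).
Qed.

Lemma congrV g : congr e g -> congr e (g^-1)%g.
Proof.
move=> [ig ng]; split; first exact: gl_integralV.
apply/near_mx; have -> : glmx (g^-1)%g - glmx (1%g : GL n K) =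
    (1%:M - glmx g) *m invmx (glmx g) by rewrite mulmxBl mul1mx mulmxV ?glP.
apply: mulmx_small_l => // [i j|i j]; last by have [] := ig i j.
by have := (near_mx _ _).1 ng i j; rewrite !mxE avB.
Qed.

End Congr.

Lemma ball_smooth (A : 'M[K]_n) (e : R) : 0 < e -> exists2 d, 0 < d & forall x w : GL n K,
  (forall i j, av (glmx x i j - A i j) < e) -> glnear 1%g d w ->
  forall i j, av (glmx (x * w)%g i j - A i j) < e.
Proof.
move=> e0; pose c := e + 1 + \sum_i \sum_j av (A i j).
have A0 : 0 <= \sum_i \sum_j av (A i j).
  by apply: sumr_ge0 => i _; apply: sumr_ge0 => j _; exact: av_ge0.
have c0 : 0 < c by rewrite /c; lra.
have Ac i j : av (A i j) <= c.
  rewrite /c (bigD1 i) //= (bigD1 j) //=.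
  have h1 : 0 <= \sum_(k < n | k != j) av (A i k) by apply: sumr_ge0 => *; exact: av_ge0.
  have h2 : 0 <= \sum_(k < n | k != i) \sum_l av (A k l).
    by apply: sumr_ge0 => k _; apply: sumr_ge0 => l _; exact: av_ge0.
  by lra.
exists (e / c); first by rewrite divr_gt0.
move=> x w hx hw i j.
have -> : glmx (x * w)%g i j - A i j = (glmx x *m (glmx w - 1%:M)) i j + (glmx x i j - A i j).
  by rewrite mulmxBr mulmx1 [X in _ = X + _]mxE [X in _ = (_ + X) + _]mxE addrA subrK.
apply: av_add_lt => //; apply: (mulmx_small_r c0 e0) => [k l|k l].
  rewrite -(subrK (A k l) (glmx x k l)); apply: le_trans (avU _ _) _.
  by rewrite ge_max Ac andbT ltW // (lt_le_trans (hx k l)) // /c; lra.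
by rewrite mxE [X in _ + X]mxE; exact: hw.
Qed.

End UltrametricMatrices.

Import VectorInternalTheory.

(** * The adelic groups *)

Section AdelicGroups.
Variables (R : realType) (F : splittingFieldType rat).
Variable Fhat : forall v : finPlace F, completion R v.
Hypothesis hgal : galois 1%AS {:F}.
Hypothesis hreal : totally_real R F.
Local Notation GA n := (GA Fhat n).
Local Notation GAf n := (GAf Fhat n).
Local Notation GF n := (GF Fhat n).
Local Notation place := (place R F).

Lemma fin_rint_open n v : open (rint (fin_fam Fhat n) v).
Proof. by apply: gl_integral_open; exact: c_ultra. Qed.

Lemma all_rint_open n v : open (rint (all_fam Fhat n) v).
Proof. by case: v => [t|v]; [exact: openT|exact: (fin_rint_open n v)]. Qed.

Lemma GA_ext n (x y : GA n) : (forall v, x v = y v) -> x = y.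
Proof. exact: rval_inj. Qed.

Lemma GAf_ext n (x y : GAf n) : (forall v, x v = y v) -> x = y.
Proof. exact: rval_inj. Qed.

Lemma of_finM n (x y : GAf n) : of_fin (x * y)%g = (of_fin x * of_fin y)%g.
Proof. by apply: GA_ext => -[t|v] //=; exact/esym/mulg1. Qed.

Lemma of_fin1 n : of_fin (1%g : GAf n) = 1%g.
Proof. by apply: GA_ext => -[t|v]. Qed.

Lemma of_finV n (x : GAf n) : of_fin (x^-1)%g = ((of_fin x)^-1)%g.
Proof. by apply: (mulIg (of_fin x)); rewrite -of_finM !mulVg of_fin1. Qed.

Lemma of_infM n (a b : infPlace R F -> GL n (realAV R)) :
  of_inf Fhat (fun t => (a t * b t)%g) = (of_inf Fhat a * of_inf Fhat b)%g :> GA n.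
Proof. by apply: GA_ext => -[t|v] //=; exact/esym/mulg1. Qed.

Lemma fin_partM n (x y : GA n) : fin_part (x * y)%g = (fin_part x * fin_part y)%g.
Proof. exact: GAf_ext. Qed.

Lemma fin_partV n (x : GA n) : fin_part (x^-1)%g = ((fin_part x)^-1)%g.
Proof. exact: GAf_ext. Qed.

Lemma fin_part_of_fin n (x : GAf n) : fin_part (of_fin x) = x.
Proof. exact: GAf_ext. Qed.

Lemma inf_fin_decomp n (x : GA n) : x = (of_inf Fhat (inf_part x) * of_fin (fin_part x))%g.
Proof.
by apply: GA_ext => -[t|v]; [exact/esym/mulg1|exact/esym/mul1g].
Qed.

Lemma gl_scalM m (K : avField R) (y z : GL 1 K) : gl_scal m (y * z)%g = (gl_scal m y * gl_scal m z)%g.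
Proof.
apply: glmx_inj => /=; rewrite -scalar_mxM; congr (_%:M).
by rewrite /gl1val /= mxE big_ord1.
Qed.

Lemma gl_scalC m (K : avField R) (z : GL 1 K) (x : GL m K) : (gl_scal m z * x)%g = (x * gl_scal m z)%g.
Proof. by apply: glmx_inj => /=; rewrite scalar_mxC. Qed.

Lemma gl_scal1 m (K : avField R) : gl_scal m (1%g : GL 1 K) = 1%g.
Proof. by apply: glmx_inj; rewrite /= /gl1val mxE eqxx. Qed.

Lemma scalM m (y z : GA 1) : scal m (y * z)%g = (scal m y * scal m z)%g.
Proof. by apply: GA_ext => v; exact: gl_scalM. Qed.
Lemma scal1 m : scal m (1%g : GA 1) = 1%g.
Proof. by apply: GA_ext => v; exact: gl_scal1. Qed.
Lemma scalV m (z : GA 1) : scal m (z^-1)%g = ((scal m z)^-1)%g.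
Proof. by apply: (mulIg (scal m z)); rewrite -scalM !mulVg scal1. Qed.
Lemma scalC m (z : GA 1) (x : GA m) : (scal m z * x)%g = (x * scal m z)%g.
Proof. by apply: GA_ext => v; exact: gl_scalC. Qed.
Lemma fscalM m (y z : GAf 1) : fscal m (y * z)%g = (fscal m y * fscal m z)%g.
Proof. by apply: GAf_ext => v; exact: gl_scalM. Qed.
Lemma fscal1 m : fscal m (1%g : GAf 1) = 1%g.
Proof. by apply: GAf_ext => v; exact: gl_scal1. Qed.
Lemma fscalV m (z : GAf 1) : fscal m (z^-1)%g = ((fscal m z)^-1)%g.
Proof. by apply: (mulIg (fscal m z)); rewrite -fscalM !mulVg fscal1. Qed.
Lemma fscalC m (z : GAf 1) (x : GAf m) : (fscal m z * x)%g = (x * fscal m z)%g.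
Proof. by apply: GAf_ext => v; exact: gl_scalC. Qed.
Lemma scal_of_fin m (z : GAf 1) : scal m (of_fin z) = of_fin (fscal m z).
Proof. by apply: GA_ext => -[t|v] //; exact: gl_scal1. Qed.
Lemma fin_part_scal m (z : GA 1) : fin_part (scal m z) = fscal m (fin_part z).
Proof. exact: GAf_ext. Qed.

Lemma gl_detM m (K : avField R) (x y : GL m K) : gl_det (x * y)%g = (gl_det x * gl_det y)%g.
Proof. by apply: glmx_inj => /=; rewrite det_mulmx scalar_mxM. Qed.
Lemma adetM m (x y : GA m) : adet (x * y)%g = (adet x * adet y)%g.
Proof. by apply: GA_ext => v; exact: gl_detM. Qed.
Lemma adet1 m : adet (1%g : GA m) = 1%g.
Proof. by apply: (mulIg (adet (1%g : GA m))); rewrite -adetM !mul1g. Qed.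
Lemma adet_scal (z : GA 1) : adet (scal 2 z) = (z * z)%g.
Proof.
apply: GA_ext => v; apply: glmx_inj => /=; rewrite det_scalar [RHS]mx11_scalar.
by rewrite mxE big_ord1 expr2.
Qed.

(** ** The rational points *)

Lemma lemb_rmorph (v : place) : exists f : {rmorphism F -> lfield Fhat v}, lemb Fhat v =1 f.
Proof.
case: v => [t|v]; last by exists (cemb (Fhat v)).
have tB : additive (lemb Fhat (inl t)).
  by move=> x y; rewrite /lemb /= rmorphB; case: (t x) (t y) => a b [c d].
have tM : multiplicative (lemb Fhat (inl t)).
  split=> [x y|]; last by rewrite /lemb /= rmorph1.
  by rewrite /lemb /= rmorphM (emb_real hreal t x) (emb_real hreal t y) /= mulr0 subr0.
pose aT := GRing.isAdditive.Build F R (lemb Fhat (inl t)) tB.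
pose mT := GRing.isMultiplicative.Build F R (lemb Fhat (inl t)) tM.
by exists (HB.pack (lemb Fhat (inl t) : F -> R) aT mT : {rmorphism F -> R}).
Qed.

Definition lembR (v : place) : {rmorphism F -> lfield Fhat v} := projT1 (cid (lemb_rmorph v)).
Lemma lembRE (v : place) : lemb Fhat v =1 lembR v.
Proof. exact: (projT2 (cid (lemb_rmorph v))). Qed.

Lemma GFP n (g : GA n) : GF n g <->
  exists2 A : 'M[F]_n, A \in unitmx & forall v, glmx (g v) = map_mx (lembR v) A.
Proof.
have e A v : map_mx (lemb Fhat v) A = map_mx (lembR v) A.
  by apply/matrixP => i j; rewrite !mxE lembRE.
by split=> -[A uA h]; exists A => // v; rewrite h e.
Qed.

Lemma GF1 n : GF n 1%g.
Proof. by apply/GFP; exists 1%:M; [exact: unitmx1|move=> v; rewrite map_mx1]. Qed.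

Lemma GFM n (x y : GA n) : GF n x -> GF n y -> GF n (x * y)%g.
Proof.
move=> /GFP[A uA hA] /GFP[B uB hB]; apply/GFP; exists (A *m B).
  by rewrite unitmx_mul uA.
by move=> v; rewrite map_mxM -hA -hB.
Qed.

Lemma GFV n (x : GA n) : GF n x -> GF n (x^-1)%g.
Proof.
move=> /GFP[A uA hA]; apply/GFP; exists (invmx A); first by rewrite unitmx_inv.
by move=> v; rewrite map_invmx -hA.
Qed.

Lemma GF_det n (x : GA n) : GF n x -> GF 1 (adet x).
Proof.
move=> /GFP[A uA hA]; apply/GFP; exists (\det A)%:M.
  by rewrite unitmxE det_scalar1 -unitmxE.
by move=> v /=; rewrite hA det_map_mx map_scalar_mx.
Qed.

(** ** Congruence subgroups *)

Definition cgood (d : finPlace F -> R) : Prop :=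
  (forall v, 0 < d v) /\ finite_set [set v | d v <= 1].

Definition cong n (d : finPlace F -> R) : set (GAf n) :=
  [set w | forall v, congr (d v) (w v : GL n (Fhat v))].

Arguments cong n d : clear implicits.

Section Cong.
Variables (n : nat) (d : finPlace F -> R).
Hypothesis hd : cgood d.

Lemma congr_large v : 1 < d v -> congr (d v) = rint (fin_fam Fhat n) v.
Proof.
move=> d1; apply/seteqP; split=> [w []//|w hw]; split=> // i j.
apply: le_lt_trans d1; apply: avB_le1; first by have [] := hw i j.
by have [] := gl_integral1 (Fhat v) i j.
Qed.

Lemma cong_box : isbox (X := fin_fam Fhat n) (fun v => congr (d v)).
Proof.
split=> [v|]; first by apply: congr_open; exact: c_ultra.
apply: sub_finite_set hd.2 => v /= h; rewrite leNgt; apply/negP => /congr_large; exact: h.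
Qed.

Lemma cong_open : open (cong n d).
Proof. exact: (box_open (X := fin_fam Fhat n) cong_box). Qed.

Lemma cong1 : cong n d 1%g.
Proof. by move=> v; apply: congr_1; exact: hd.1. Qed.

Lemma congM x y : cong n d x -> cong n d y -> cong n d (x * y)%g.
Proof. by move=> hx hy v; apply: (congrM (@c_ultra _ _ _ _) (hd.1 v)); [exact: hx|exact: hy]. Qed.

Lemma congV x : cong n d x -> cong n d (x^-1)%g.
Proof. by move=> hx v; apply: (congrV (@c_ultra _ _ _ _) (hd.1 v)); exact: hx. Qed.

Lemma cong_conj k x : GAf_int k -> cong n d x -> cong n d (k * x * k^-1)%g.
Proof.
by move=> hk hx v; apply: (congr_conj (@c_ultra _ _ _ _) (hd.1 v)); [exact: hk|exact: hx].
Qed.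

End Cong.

Lemma cong_nbhs n d : cgood d -> nbhs (1%g : GAf n) (cong n d).
Proof. by move=> hd; apply: open_nbhs_nbhs; split; [exact: cong_open|exact: cong1]. Qed.

Lemma cong_base n (U : set (GAf n)) : nbhs 1%g U -> exists2 d, cgood d & cong n d `<=` U.
Proof.
move=> /(rprod_nbhsP (fin_rint_open n))[V [[oV fV] V1 VU]].
have h v : exists e : R, [/\ 0 < e, congr e `<=` V v & V v = rint (fin_fam Fhat n) v -> 1 < e].
  have [e|ne] := pselect (V v = rint (fin_fam Fhat n) v).
    by exists 2; split=> [//|w [hw _]|_]; [rewrite e|lra].
  have [e e0 he] := (gl_nbhsP _ _).1 (open_nbhs_nbhs (conj (oV v) (V1 v))).
  by exists e; split=> // w [_ hw]; exact: he.
have /choice[d hd] := h; exists d.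
  split=> [v|]; first by have [] := hd v.
  by apply: sub_finite_set fV => v /= d1 e; have [_ _ /(_ e)] := hd v; rewrite ltNge d1.
by move=> w hw; apply: VU => v; have [_ h2 _] := hd v; apply: h2; exact: hw.
Qed.

Lemma cgood_min d e : cgood d -> cgood e -> cgood (fun v => Num.min (d v) (e v)).
Proof.
move=> [d0 fd] [e0 fe]; split=> [v|]; first by rewrite lt_min d0 e0.
have : finite_set ([set v | d v <= 1] `|` [set v | e v <= 1]) by rewrite finite_setU.
by apply: sub_finite_set => v /=; rewrite ge_min => /orP.
Qed.

Lemma cong_min n d e : cong n (fun v => Num.min (d v) (e v)) `<=` cong n d `&` cong n e.
Proof.
by move=> w hw; split=> v; have [h1 h2] := hw v; split=> //;
  apply: glnear_le h2; rewrite ge_min lexx ?orbT.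
Qed.

(** ** Bases of the topologies *)

Lemma place_countable : exists f : place -> nat, injective f.
Proof.
have [f finj] := @finPlace_countable F.
have /countable_injP[g ginj] : countable [set: infPlace R F].
  by apply: finite_set_countable; exact: (infPlace_finite R hgal).
exists (fun v => match v with inl t => (g t).*2 | inr v => (f v).*2.+1 end).
move=> [t|v] [u|w]; rewrite ?doubleS //.
- by move=> /double_inj/ginj ->//; exact: mem_set.
- by move=> e; have := congr1 odd e; rewrite /= !odd_double.
- by move=> e; have := congr1 odd e; rewrite /= !odd_double.
- by move=> [] /double_inj/finj ->.
Qed.

Lemma F_dense_base n v : exists beta : nat -> set (GL n (Fhat v)),
  (forall k, exists (A : 'M[_]_n) (e : R), 0 < e /\
      beta k = [set g | forall i j, av (glmx g i j - A i j) < e]) /\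
    forall x U, nbhs x U -> exists2 k, beta k x & beta k `<=` U.
Proof.
apply: (@gl_base R (Fhat v) n _ (fun r => cemb (Fhat v) (r2v r : F))).
by move=> y e e0; have [x hx] := c_dense y e0; exists (v2r x); rewrite v2rK.
Qed.

Lemma R_dense_base n : exists beta : nat -> set (GL n (realAV R)),
  (forall k, exists (A : 'M[_]_n) (e : R), 0 < e /\
      beta k = [set g | forall i j, av (glmx g i j - A i j) < e]) /\
    forall x U, nbhs x U -> exists2 k, beta k x & beta k `<=` U.
Proof.
apply: (@gl_base R (realAV R) n rat (fun q : rat => (ratr q : R))) => y e e0.
have [q] : exists q : rat, (ratr q : R) \in `](y - e), (y + e)[.
  by apply: rat_in_itvoo; rewrite ltrBlDr -addrA ltrDl addr_gt0.
rewrite in_itv /= => /andP[h1 h2]; exists q; rewrite /av /= ltr_norml.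
by apply/andP; split; lra.
Qed.

Lemma ball_open n (L : avField R) (A : 'M[L]_n) (e : R) : 0 < e ->
  open [set g : GL n L | forall i j, av (glmx g i j - A i j) < e].
Proof.
move=> e0.
exists [set [set g : GL n L | forall i j, av (glmx g i j - A i j) < e]]; last by rewrite bigcup_set1.
move=> W ->; exists [fset [set g : GL n L | forall i j, av (glmx g i j - A i j) < e]]%fset; last by rewrite set_fset1 bigcap_set1.
by move=> W' /fset1P ->; apply/mem_set; exists A, e.
Qed.

Lemma GAf_base n : exists B : nat -> set (GAf n), (forall k, open (B k)) /\
  forall x U, nbhs x U -> exists2 k, B k x & B k `<=` U.
Proof.
have [f finj] := @finPlace_countable F.
pose beta v := projT1 (cid (F_dense_base n v)).
have hb v := projT2 (cid (F_dense_base n v)).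
have bo v k : open (beta v k).
  by have [A [e [e0 E]]] := (hb v).1 k; rewrite /beta E; exact: ball_open.
have [B [hB1 hB2]] := rprod_base (X := fin_fam Fhat n) (fin_rint_open n) finj bo (fun v => (hb v).2).
by exists B; split=> // k; have [V [hV -> _]] := hB1 k; exact: (box_open (X := fin_fam Fhat n) hV).
Qed.

(** The boxes with balls as sides; by the ultrametric inequality each is
    stable under right translation by a congruence subgroup. *)
Lemma GA_base n : exists B : nat -> set (GA n), [/\ forall k, open (B k),
  forall k, exists2 d, cgood d & forall x w, B k x -> cong n d w -> B k (x * of_fin w)%g
  & forall x U, nbhs x U -> exists2 k, B k x & B k `<=` U].
Proof.
have [f finj] := place_countable.
pose base (v : place) (beta : nat -> set (GL n (lfield Fhat v))) :=
  (forall k, exists (A : 'M[_]_n) (e : R), 0 < e /\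
      beta k = [set g | forall i j, av (glmx g i j - A i j) < e]) /\
    forall x U, nbhs x U -> exists2 k, beta k x & beta k `<=` U.
have hbase v : exists beta, base v beta.
  by case: v => [t|v]; [exact: R_dense_base|exact: F_dense_base].
pose beta v := projT1 (cid (hbase v)).
have hb v : base v (beta v) := projT2 (cid (hbase v)).
have bo v k : open (beta v k).
  by have [A [e [e0 E]]] := (hb v).1 k; rewrite E; exact: ball_open.
have [B [hB1 hB2]] := rprod_base (X := all_fam Fhat n) (all_rint_open n) finj bo (fun v => (hb v).2).
exists B; split=> // k; have [V [hV -> Vb]] := hB1 k.
  exact: (box_open (X := all_fam Fhat n) hV).
have /choice[d hd] : forall v : finPlace F, exists e : R, [/\ 0 < e,
    V (inr v) = rint (all_fam Fhat n) (inr v) -> 1 < e &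
    forall x w, V (inr v) x -> congr e w -> V (inr v) (x * w)%g].
  move=> v; have [e|[m em]] := Vb (inr v).
    exists 2; rewrite e; split=> [//|_|x w hx [hw _]]; first by lra.
    exact: (rintM (r := fin_fam Fhat n)).
  have [A [e [e0 eb]]] := (hb (inr v)).1 m; rewrite em eb.
  have [e' e'0 he'] := ball_smooth (@c_ultra _ _ _ (Fhat v)) A e0.
  have [eq|neq] := pselect ([set g | forall i j, av (glmx g i j - A i j) < e] = rint (all_fam Fhat n) (inr v)).
    exists 2; split=> [//|_|x w]; first by lra.
    by rewrite eq => hx [hw _]; exact: (rintM (r := fin_fam Fhat n)).
  by exists e'; split=> // x w hx [_ hw]; exact: he'.
exists d.
  split=> [v|]; first by have [] := hd v.
  apply: (@sub_finite_set _ _ [set v | V (inr v) <> rint (all_fam Fhat n) (inr v)]).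
    by move=> v /= d1 e; have [_ /(_ e)] := hd v; rewrite ltNge d1.
  apply: (@finite_preimage _ _ [set v | V v <> rint (all_fam Fhat n) v] (inr : finPlace F -> place)).
    by move=> ? ? _ _ [].
  exact: hV.2.
move=> x w Vx hw [t|v]; first by rewrite (_ : (x * of_fin w)%g (inl t) = x (inl t)); [exact: Vx|exact: mulg1].
by have [_ _ h] := hd v; apply: (h _ _ (Vx (inr v))); exact: hw.
Qed.

(** ** Continuity *)

Lemma GA_mul_continuous n : continuous (fun p : GA n * GA n => p.1 * p.2)%g.
Proof.
apply: (rprod_mul_continuous (X := all_fam Fhat n) (all_rint_open n)) => v.
exact: gl_mul_continuous.
Qed.

Lemma GA_inv_continuous n : continuous (fun p : GA n => p^-1)%g.
Proof.
apply: (rprod_inv_continuous (X := all_fam Fhat n) (all_rint_open n)) => v.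
exact: gl_inv_continuous.
Qed.

Lemma GAf_mul_continuous n : continuous (fun p : GAf n * GAf n => p.1 * p.2)%g.
Proof.
apply: (rprod_mul_continuous (X := fin_fam Fhat n) (fin_rint_open n)) => v.
exact: gl_mul_continuous.
Qed.

Lemma GAf_mull_continuous n (c : GAf n) : continuous (fun y => c * y)%g.
Proof.
move=> y; apply: (@continuous_comp _ _ _ (fun y => (c, y)) (fun p : GAf n * GAf n => (p.1 * p.2)%g)).
  by move=> U [[P Q] [/= hP hQ] PQ]; apply: filterS hQ => z hz; apply: PQ; split=> //=; exact: nbhs_singleton hP.
exact: GAf_mul_continuous.
Qed.

Lemma GA_mull_continuous n (c : GA n) : continuous (fun y => c * y)%g.
Proof.
move=> y; apply: (@continuous_comp _ _ _ (fun y => (c, y)) (fun p : GA n * GA n => (p.1 * p.2)%g)).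
  by move=> U [[P Q] [/= hP hQ] PQ]; apply: filterS hQ => z hz; apply: PQ; split=> //=; exact: nbhs_singleton hP.
exact: GA_mul_continuous.
Qed.

Lemma GA_mulr_continuous n (c : GA n) : continuous (fun y => y * c)%g.
Proof.
move=> y; apply: (@continuous_comp _ _ _ (fun y => (y, c)) (fun p : GA n * GA n => (p.1 * p.2)%g)).
  by move=> U [[P Q] [/= hP hQ] PQ]; apply: filterS hP => z hz; apply: PQ; split=> //=; exact: nbhs_singleton hQ.
exact: GA_mul_continuous.
Qed.

Lemma scal_continuous n : continuous (@scal R F Fhat n).
Proof.
move=> x; apply: (placewise_continuous (X := all_fam Fhat 1) (Y := all_fam Fhat n)
  (all_rint_open 1) (all_rint_open n) (f := fun v => @gl_scal R n (lfield Fhat v))) => //.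
  by move=> v; exact: gl_scal_continuous.
by rewrite (_ : [set _ | _] = set0) // -subset0 => v /=; apply => y /=; exact: all_int_scal.
Qed.

Lemma adet_continuous n : continuous (@adet R F Fhat n).
Proof.
move=> x; apply: (placewise_continuous (X := all_fam Fhat n) (Y := all_fam Fhat 1)
  (all_rint_open n) (all_rint_open 1) (f := fun v => @gl_det R n (lfield Fhat v))) => //.
  by move=> v; exact: gl_det_continuous.
by rewrite (_ : [set _ | _] = set0) // -subset0 => v /=; apply => y /=; exact: all_int_det.
Qed.

Lemma of_fin_continuous n : continuous (@of_fin R F Fhat n).
Proof.
move=> x U /(rprod_nbhsP (all_rint_open n))[V [[oV fV] Vx VU]].
apply/(rprod_nbhsP (fin_rint_open n)); exists (fun v => V (inr v)); split.
- split=> [v|]; first exact: (oV (inr v)).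
  apply: (@finite_preimage _ _ [set v | V v <> rint (all_fam Fhat n) v] (inr : finPlace F -> place)) => //.
  by move=> ? ? _ _ [].
- by move=> v; exact: (Vx (inr v)).
- by move=> y hy; apply: VU => -[t|v]; [exact: (Vx (inl t))|exact: hy].
Qed.

Lemma fin_part_continuous n : continuous (@fin_part R F Fhat n).
Proof.
move=> x U /(rprod_nbhsP (fin_rint_open n))[V [[oV fV] Vx VU]].
pose W (v : place) : set (GL n (lfield Fhat v)) :=
  match v return set (GL n (lfield Fhat v)) with inl _ => setT | inr v => V v end.
apply/(rprod_nbhsP (all_rint_open n)); exists W; split.
- split=> [[t|v]|]; [exact: openT|exact: oV|].
  apply: sub_finite_set (finite_image (inr : _ -> place) fV) => -[t|v] /= h //.
  by exists v.
- by case=> [t|v] //; exact: Vx.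
- by move=> y hy; apply: VU => v; exact: (hy (inr v)).
Qed.

Lemma inf_proj_continuous n : continuous (fun x : GA n => of_inf Fhat (inf_part x) : GA n).
Proof.
move=> x; apply: (placewise_continuous (X := all_fam Fhat n) (Y := all_fam Fhat n)
  (all_rint_open n) (all_rint_open n) (f := fun v : place => match v return
    GL n (lfield Fhat v) -> GL n (lfield Fhat v) with inl _ => id | inr _ => fun=> 1%g end)).
- by move=> y [t|v].
- case=> [t|v] U hU //; rewrite /nbhs /=; apply: (filterS _ (@filterT _ _ (nbhs_filter (x (inr v))))) => z _; exact: nbhs_singleton hU.
rewrite (_ : [set _ | _] = set0) // -subset0 => -[t|v] /=; apply => y //= _.
exact: (rint1 (fin_fam Fhat n)).
Qed.

End AdelicGroups.

Arguments cong {R F} Fhat n d _.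

(** * Discreteness of the rational points *)

(** The bounds 1/50 and 1/9 are such that the ratios of products of entries,
    later shown to be integral, differ by less than 1 from those of the
    identity. *)
Lemma near_identity_ratio (R : realFieldType) (q00 q01 q10 q11 p00 p01 p10 p11 n00 n01 n10 n11 : R) :
  let b := 1 / 50%:R in
  `|q00 - 1| < b -> `|q01| < b -> `|q10| < b -> `|q11 - 1| < b ->
  `|p00 - 1| < b -> `|p01| < b -> `|p10| < b -> `|p11 - 1| < b ->
  n00 * q00 + n01 * q10 = p00 -> n00 * q01 + n01 * q11 = p01 ->
  n10 * q00 + n11 * q10 = p10 -> n10 * q01 + n11 * q11 = p11 ->
  [/\ `|n00 - 1| < 1/9%:R, `|n01| < 1/9%:R, `|n10| < 1/9%:R & `|n11 - 1| < 1/9%:R].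
Proof.
move=> b; rewrite !ltr_norml /b {b} => /andP[a1 a2] /andP[a3 a4] /andP[a5 a6] /andP[a7 a8].
move=> /andP[c1 c2] /andP[c3 c4] /andP[c5 c6] /andP[c7 c8] e1 e2 e3 e4.
have bil (x y u v : R) : -u < x < u -> -v < y < v -> -(u * v) < x * y < u * v by move=> /andP[? ?] /andP[? ?]; apply/andP; split; nra.
have [d1 d2] : 95/100 < q00 * q11 - q01 * q10 /\ q00 * q11 - q01 * q10 < 105/100.
  have /andP[? ?] := bil q01 q10 (1/50) (1/50) ltac:(by apply/andP; split; lra) ltac:(by apply/andP; split; lra).
  by split; nra.
set d := q00 * q11 - q01 * q10 in d1 d2.
have f1 : n00 * d = p00 * q11 - p01 * q10 by rewrite -e1 -e2 /d; ring.
have f2 : n01 * d = p01 * q00 - q01 * p00 by rewrite -e1 -e2 /d; ring.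
have f3 : n10 * d = p10 * q11 - q10 * p11 by rewrite -e3 -e4 /d; ring.
have f4 : n11 * d = p11 * q00 - p10 * q01 by rewrite -e3 -e4 /d; ring.
have diag (p q u v : R) : -(1/50) < p - 1 -> p - 1 < 1/50 -> -(1/50) < q - 1 -> q - 1 < 1/50 ->
    -(1/50) < u -> u < 1/50 -> -(1/50) < v -> v < 1/50 -> 95/100 < p * q - u * v /\ p * q - u * v < 105/100.
  clear -bil; move=> h1 h2 h3 h4 *; have /andP[? ?] := bil u v (1/50) (1/50) ltac:(by apply/andP; split; lra) ltac:(by apply/andP; split; lra).
  by split; nra.
have off (p q u v : R) : -(1/50) < p - 1 -> p - 1 < 1/50 -> -(1/50) < q - 1 -> q - 1 < 1/50 ->
    -(1/50) < u -> u < 1/50 -> -(1/50) < v -> v < 1/50 -> - (42/1000) < u * p - v * q /\ u * p - v * q < 42/1000.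
  by clear; move=> *; split; nra.
have divd (n a : R) : n * d = a -> 95/100 < a /\ a < 105/100 -> - (1/9) < n - 1 < 1/9.
  by clear -d1 d2; move=> e [*]; apply/andP; split; nra.
have divo (n a : R) : n * d = a -> - (42/1000) < a /\ a < 42/1000 -> - (1/9) < n < 1/9.
  by clear -d1 d2; move=> e [*]; apply/andP; split; nra.
split.
- exact: divd f1 (diag _ _ _ _ c1 c2 a7 a8 c3 c4 a5 a6).
- exact: divo f2 (off _ _ _ _ a1 a2 c1 c2 c3 c4 a3 a4).
- exact: divo f3 (off _ _ _ _ a7 a8 c7 c8 c5 c6 a5 a6).
- exact: divd f4 (diag _ _ _ _ c7 c8 a1 a2 c5 c6 a3 a4).
Qed.

Lemma det2 (K : comRingType) (A : 'M[K]_2) :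
  \det A = A ord0 ord0 * A ord_max ord_max - A ord0 ord_max * A ord_max ord0.
Proof.
rewrite (expand_det_row _ ord0) !big_ord_recl big_ord0 /cofactor !det_mx11 !mxE /=.
rewrite !expr0 !expr1 !mul1r mulN1r addr0 mulrN.
by congr (_ * A _ _ - A _ _ * A _ _); apply: val_inj.
Qed.

Lemma ord2P (P : 'I_2 -> Prop) : P ord0 -> P ord_max -> forall i, P i.
Proof.
by move=> h0 h1 [[|[|//]] hi]; [rewrite (_ : Ordinal hi = ord0) //|rewrite (_ : Ordinal hi = ord_max) //];
  apply: val_inj.
Qed.

Lemma sum2 (K : nmodType) (f : 'I_2 -> K) : \sum_i f i = f ord0 + f ord_max.
Proof. by rewrite !big_ord_recl big_ord0 addr0; congr (_ + f _); apply: val_inj. Qed.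

Lemma near_identity_mx (R : realFieldType) (P Q N : 'M[R]_2) :
  (forall i j, `|P i j - (1%:M : 'M[_]_2) i j| < 1/50%:R) ->
  (forall i j, `|Q i j - (1%:M : 'M[_]_2) i j| < 1/50%:R) -> N *m Q = P ->
  forall i j k l, `|N i j * N k l / \det N - (1%:M : 'M[_]_2) i j * (1%:M : 'M[_]_2) k l| < 1.
Proof.
move=> hP hQ e.
have [h00 h01 h10 h11] : [/\ `|N ord0 ord0 - 1| < 1/9%:R, `|N ord0 ord_max| < 1/9%:R,
    `|N ord_max ord0| < 1/9%:R & `|N ord_max ord_max - 1| < 1/9%:R].
  have E i j : N i ord0 * Q ord0 j + N i ord_max * Q ord_max j = P i j.
    by rewrite -e mxE sum2.
  have hP' i j := hP i j; have hQ' i j := hQ i j.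
  have:= hP' ord0 ord0; have:= hP' ord0 ord_max; have:= hP' ord_max ord0; have:= hP' ord_max ord_max.
  have:= hQ' ord0 ord0; have:= hQ' ord0 ord_max; have:= hQ' ord_max ord0; have:= hQ' ord_max ord_max.
  rewrite !mxE /= !mulr1n !mulr0n !subr0 => *.
  by apply: (near_identity_ratio (q00 := Q ord0 ord0) (q01 := Q ord0 ord_max) (q10 := Q ord_max ord0)
    (q11 := Q ord_max ord_max) (p00 := P ord0 ord0) (p01 := P ord0 ord_max) (p10 := P ord_max ord0)
    (p11 := P ord_max ord_max)); rewrite ?E.
move: h00 h01 h10 h11; rewrite !ltr_norml => /andP[a1 a2] /andP[a3 a4] /andP[a5 a6] /andP[a7 a8].
rewrite det2; set D := _ - _.
have D0 : 6/10%:R < D by rewrite /D; nra.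
have D1 : D < 13/10%:R by rewrite /D; nra.
have goal x y : - D < x - y * D -> x - y * D < D -> - 1 < x / D - y < 1.
  move=> h1 h2; have Dp : 0 < D by lra.
  by rewrite ltrBrDr ltr_pdivlMr // ltrBlDr ltr_pdivrMr //; apply/andP; split; lra.
by apply: ord2P; apply: ord2P; apply: ord2P; apply: ord2P; rewrite ltr_norml; apply: goal;
  rewrite !mxE /= ?mulr1n ?mulr0n ?mulr0 ?mul0r ?mulr1 ?mul1r /D; nra.
Qed.

Section Discrete.
Variables (R : realType) (F : splittingFieldType rat).
Variable Fhat : forall v : finPlace F, completion R v.
Hypothesis hgal : galois 1%AS {:F}.
Hypothesis hreal : totally_real R F.
Local Notation GA n := (GA Fhat n).
Local Notation GF n := (GF Fhat n).

(** At the archimedean places a fixed small distance suffices: it only has to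
    separate integers. *)
Definition nearone (d : finPlace F -> R) : set (GA 2) := [set q |
  cong Fhat 2 d (fin_part q) /\
  forall t i j, `|glmx (q (inl t)) i j - (1%:M : 'M[R]_2) i j| < 1/50%:R].

(** A rational matrix whose product with an adelic scalar is close to the
    identity has ratios A_ij A_kl / det A which are integral and, at the
    archimedean places, close to those of the identity: hence they are equal
    to those, so that A is scalar. *)
Lemma nearone_discrete g z q q' d : GF 2 g -> nearone d q -> nearone d q' ->
  (g * scal 2 z * q)%g = q' -> exists2 c, GF 1 c & g = scal 2 c.
Proof.
move=> /(GFP hreal)[A uA hA] [hq qi] [hq' qi'] e.
have dA : \det A != 0 by rewrite -unitfE -unitmxE.
pose N v : 'M[lfield Fhat v]_2 := glmx ((q' * q^-1)%g v).
have NE v : N v = gl1val (z v) *: map_mx (lembR Fhat hreal v) A.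
  rewrite /N -e -mulgA mulgV mulg1 -hA.
  rewrite (_ : glmx _ = glmx (g v) *m (gl1val (z v))%:M) //; exact: mul_mx_scalar.
have ratio v i j k l : lembR Fhat hreal v (A i j * A k l / \det A) =
    N v i j * N v k l / \det (N v).
  have z0 := gl1val_neq0 (z v); have dv : \det (map_mx (lembR Fhat hreal v) A) != 0.
    by rewrite det_map_mx fmorph_eq0.
  rewrite NE detZ !mxE fmorph_div rmorphM -det_map_mx; move: (\det _) dv => D D0.
  by field; rewrite z0 D0.
have key i j k l : A i j * A k l / \det A = (1%:M : 'M[_]_2) i j * (1%:M : 'M[_]_2) k l.
  have Oid m n : intring ((1%:M : 'M[F]_2) m n).
    by rewrite mxE; case: eqP => _; [exact: intring1|exact: intring0].
  apply/eqP; rewrite -subr_eq0; apply/eqP; apply: (@small_integer R F hgal hreal).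
    apply: intringB; last by apply: intringM; exact: Oid.
    apply: (@intring_local R F Fhat) => v.
    rewrite (_ : cemb (Fhat v) _ = lembR Fhat hreal (inr v) (A i j * A k l / \det A)); last first.
      by rewrite -lembRE.
    rewrite ratio; have iN : gl_integral ((q' * q^-1)%g (inr v) : GL 2 (Fhat v)).
      apply: (gl_integralM (@c_ultra _ _ _ (Fhat v))); first by have [] := hq' v.
      by apply: gl_integralV; have [] := hq v.
    rewrite -det_inv; apply: (intM_subproof (K := Fhat v)); first apply: (intM_subproof (K := Fhat v)).
    - by have [] := iN i j.
    - by have [] := iN k l.
    - by apply: (int_det_subproof (@c_ultra _ _ _ (Fhat v))) => m n; have [] := iN m n.
  move=> t; have -> : complex.Re (t (A i j * A k l / \det A - (1%:M : 'M[_]_2) i j * (1%:M : 'M[_]_2) k l)) =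
     lembR Fhat hreal (inl t) (A i j * A k l / \det A) - (1%:M : 'M[_]_2) i j * (1%:M : 'M[_]_2) k l.
    have h1 m n : lembR Fhat hreal (inl t) ((1%:M : 'M[_]_2) m n) = (1%:M : 'M[_]_2) m n.
      by rewrite !mxE rmorph_nat.
    rewrite -(h1 i j) -(h1 k l) -rmorphM -rmorphB -lembRE //.
  rewrite ratio; apply: (@near_identity_mx R (glmx (q' (inl t))) (glmx (q (inl t)))); [exact: qi'|exact: qi|].
  have NQ : N (inl t) = glmx (q' (inl t)) *m invmx (glmx (q (inl t))) by [].
  by rewrite -/(N (inl t)) NQ; exact: (mulmxKV (glP (q (inl t)))).
have o01 : A ord0 ord_max = 0.
  have := key ord0 ord_max ord0 ord_max; rewrite !mxE /= mulr0 => /eqP.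
  by rewrite !mulf_eq0 invr_eq0 (negPf dA) orbF orbb => /eqP.
have o10 : A ord_max ord0 = 0.
  have := key ord_max ord0 ord_max ord0; rewrite !mxE /= mulr0 => /eqP.
  by rewrite !mulf_eq0 invr_eq0 (negPf dA) orbF orbb => /eqP.
have a0 : A ord0 ord0 != 0.
  by apply: contra dA => /eqP h; rewrite det2 h o01 !mul0r subrr.
have o11 : A ord0 ord0 = A ord_max ord_max.
  have := key ord0 ord0 ord0 ord0; have := key ord0 ord0 ord_max ord_max.
  rewrite !mxE /= !mulr1n mulr1 => <- /(mulIf (invr_neq0 dA)); exact: mulfI.
have AE : A = (A ord0 ord0)%:M.
  by apply/matrixP; apply: ord2P; apply: ord2P; rewrite [RHS]mxE /= ?mulr1n ?mulr0n // -o11.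
have uc v : (lembR Fhat hreal v (A ord0 ord0))%:M \in @unitmx (lfield Fhat v) 1.
  by rewrite unitmxE det_scalar1 unitfE fmorph_eq0.
pose c0 v : GL 1 (lfield Fhat v) := gl_det (g v).
pose c : GA 1 := (z^-1 * @rmap _ (all_fam Fhat 2) (all_fam Fhat 1) (fun v => @gl_det R 2 (lfield Fhat v)) (@all_int_det R F Fhat 2) g * z)%g.
have [c' hc'] : exists c' : GA 1, forall v, glmx (c' v) = (lembR Fhat hreal v (A ord0 ord0))%:M.
  have fin : finite_set [set v | ~ rint (all_fam Fhat 1) v (MkGL (uc v))].
    apply: sub_finite_set (rvalP g) => -[t|v] /= h hg; apply: h => // i j.
    rewrite !ord1 /= invmx_scalar !mxE eqxx !mulr1n; have [h1 _] := hg ord0 ord0.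
    have [_ h2] := hg ord0 ord0; split.
      by move: h1; rewrite (hA (inr v)) mxE.
    by move: h2; rewrite (hA (inr v)) AE map_scalar_mx /= invmx_scalar !mxE.
  by exists (@RProd _ (all_fam Fhat 1) _ fin).
exists c'.
  by apply/(GFP hreal); exists (A ord0 ord0)%:M => [|v]; [rewrite unitmxE det_scalar1 unitfE|rewrite hc' map_scalar_mx].
apply: GA_ext => v; apply: glmx_inj; rewrite hA AE map_scalar_mx /=; congr (_%:M).
by rewrite /gl1val hc' !mxE eqxx mulr1n.
Qed.

Lemma nearone_scal z q q' d : cgood d -> nearone d q -> nearone d q' ->
  (scal 2 z * q)%g = q' ->
  cong Fhat 2 d (fscal 2 (fin_part z)) /\ forall t, 0 < gl1val (z (inl t)) :> R.
Proof.
move=> hd [hq qi] [hq' qi'] e.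
have E : scal 2 z = (q' * q^-1)%g by rewrite -e mulgK.
split.
  rewrite -fin_part_scal E fin_partM fin_partV.
  by apply: congM => //; apply: congV.
move=> t; have := qi t ord0 ord0; have := qi' t ord0 ord0.
rewrite -e (_ : glmx _ = (gl1val (z (inl t)))%:M *m glmx (q (inl t))) // mul_scalar_mx !mxE /= mulr1n.
have real (a b : R) : `|a * b - 1| < 1/50%:R -> `|b - 1| < 1/50%:R -> 0 < a.
  by rewrite !ltr_norml => /andP[h1 h2] /andP[h3 h4]; nra.
exact: real.
Qed.

End Discrete.

(** * Characters *)

Section Characters.
Variables (R : realType) (F : splittingFieldType rat).
Variable Fhat : forall v : finPlace F, completion R v.
Hypothesis hgal : galois 1%AS {:F}.
Hypothesis hreal : totally_real R F.
Local Notation C := R[i].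
Local Notation GA n := (GA Fhat n).
Local Notation GAf n := (GAf Fhat n).
Local Notation GF n := (GF Fhat n).
Local Notation place := (place R F).
Variable K : forall v : finPlace F, set (GL 2 (Fhat v)).
Arguments K : clear implicits.

(** What the argument uses of the central character. *)
Record goodchar (chi : GA 1 -> C) : Prop := {
  gc1 : chi 1%g = 1;
  gcM : forall x y, chi (x * y)%g = chi x * chi y;
  gc_Re : continuous (fun x => complex.Re (chi x));
  gc_Im : continuous (fun x => complex.Im (chi x));
  gc_GF : forall x, GF 1 x -> chi x = 1;
  gc_pos : forall z : GA 1, (forall t, 0 < gl1val (z (inl t)) :> R) ->
    0 < chi (of_inf Fhat (inf_part z));
  gc_small : exists2 d, cgood d & forall z, cong Fhat 1 d z -> chi (of_fin z) = 1;
  gc_K : forall z, level K (fscal 2 z) -> chi (of_fin z) = 1 }.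

Definition strip v (z : GA 1) : GA 1 := ((at_place (z v))^-1 * z)%g.
Arguments strip : simpl never.
Definition strips s z := foldr strip z s.

Lemma at_placeE v (x : GL 1 (lfield Fhat v)) : at_place x v = x.
Proof. exact: dfwithin. Qed.
Lemma at_placeN v w (x : GL 1 (lfield Fhat v)) : v != w -> at_place x w = 1%g.
Proof. exact: dfwithout. Qed.

Lemma stripE v z w : strip v z w = if w == v then 1%g else z w.
Proof.
rewrite /strip; case: eqP => [->|/eqP n].
  by rewrite (_ : rval _ v = ((at_place (z v) v)^-1 * z v)%g) // at_placeE mulVg.
rewrite (_ : rval _ w = ((at_place (z v) w)^-1 * z w)%g) // at_placeN; last by rewrite eq_sym.
by rewrite (_ : (1^-1)%g = 1%g); [exact: mul1g|exact: invg1].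
Qed.

Lemma stripsE s z w : strips s z w = if w \in s then 1%g else z w.
Proof.
elim: s => [//|v s IH]; rewrite (_ : strips (v :: s) z = strip v (strips s z)) // stripE inE IH.
by case: eqP.
Qed.

Section Mult.
Variable chi : GA 1 -> C.
Hypothesis chi1 : chi 1%g = 1.
Hypothesis chiM : forall x y, chi (x * y)%g = chi x * chi y.

Lemma chi_neq0 x : chi x != 0.
Proof.
apply/eqP => h; have := chiM x (x^-1)%g; rewrite mulgV chi1 h mul0r => /eqP.
by rewrite oner_eq0.
Qed.

Lemma chiV x : chi (x^-1)%g = (chi x)^-1.
Proof. by apply: (mulIf (chi_neq0 x)); rewrite mulVf ?chi_neq0 // -chiM mulVg chi1. Qed.

(** Separating finitely many places reduces a character to its local
    components and its value on a point that is trivial there. *)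
Lemma char_split s z : uniq s ->
  chi z = (\prod_(v <- s) local_char Fhat chi v (z v)) * chi (strips s z).
Proof.
elim: s => [|v s IH] /=; first by rewrite big_nil mul1r.
move=> /andP[vs /IH e]; rewrite big_cons e [_ * \prod_(_ <- _) _]mulrC -mulrA; congr (_ * _).
rewrite /strip chiM stripsE (negPf vs) mulrA -chiM mulgV chi1 mul1r //.
Qed.

Lemma char_prod (s : seq place) (z : GA 1) : uniq s -> (forall v, v \notin s -> z v = 1%g) ->
  chi z = \prod_(v <- s) local_char Fhat chi v (z v).
Proof.
move=> us h; rewrite (char_split z us) (_ : strips s z = 1%g) ?chi1 ?mulr1 //.
by apply: GA_ext => v; rewrite stripsE; case: ifP => // /negbT/h.
Qed.

Lemma at_placeM v (x y : GL 1 (lfield Fhat v)) : at_place (x * y)%g = (at_place x * at_place y)%g.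
Proof.
apply: GA_ext => w; rewrite (_ : rval (_ * _)%g w = (at_place x w * at_place y w)%g) //.
have [<-|n] := eqVneq v w; first by rewrite !at_placeE.
by rewrite !at_placeN //; exact/esym/mulg1.
Qed.

Hypothesis chi_small : exists2 d, cgood d & forall z, cong Fhat 1 d z -> chi (of_fin z) = 1.
Hypothesis chi_K : forall v (z : GL 1 (Fhat v)), K v (gl_scal 2 z) -> omega_at chi z = 1.
Hypothesis Kint : forall v, K v `<=` @gl_integral R 2 (Fhat v).

Lemma scal_integral v (z : GL 1 (Fhat v)) : gl_integral (gl_scal 2 z) -> gl_integral z.
Proof.
move=> h i j; have [h1 h2] := h ord0 ord0; rewrite !ord1; move: h1 h2.
by rewrite [in X in _ -> _ -> _ /\ X](mx11_scalar (glmx z)) /= !invmx_scalar !mxE eqxx !mulr1n.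
Qed.

Lemma char_level z : level K (fscal 2 z) -> chi (of_fin z) = 1.
Proof.
move=> hz; have [d hd h] := chi_small.
have /finite_seqP[s0 es] := hd.2.
pose s := map (inr : finPlace F -> place) (undup s0).
have us : uniq s by rewrite map_inj_uniq ?undup_uniq // => ? ? [].
have zi v : gl_integral (z v) by apply: scal_integral; apply: (Kint (v := v)); exact: (hz v).
rewrite (char_split (of_fin z) us) big1_seq ?mul1r; last first.
  by move=> v /= /mapP[u _ ->]; exact: (chi_K (hz u)).
have -> : strips s (of_fin z) = of_fin (fin_part (strips s (of_fin z))).
  by apply: GA_ext => -[t|v] //=; rewrite stripsE; case: ifP.
apply: h => v; rewrite (_ : fin_part _ v = strips s (of_fin z) (inr v)) // stripsE.
rewrite mem_map; last by move=> ? ? [].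
rewrite mem_undup; case: ifP => [_|/negbT vs]; first by apply: congr_1; exact: hd.1.
have d1 : 1 < d v.
  rewrite ltNge; apply/negP => dv; have h' : [set` s0] v by rewrite -es.
  by move: vs; rewrite (h' : v \in s0).
by rewrite congr_large //; exact: zi.
Qed.

End Mult.

(** The powers of a complex number other than 1 leave the disc of radius 1/2
    around 1. *)
Lemma no_small_subgroups (u : C) : (forall n, Normc.normc (u ^+ n - 1) < 1/2%:R) -> u = 1.
Proof.
move=> h; apply/eqP; rewrite -subr_eq0; apply/negPn/negP => u1.
pose N (z : C) : R := Normc.normc z.
have N0 : 0 < N (u - 1).
  rewrite lt_neqAle; apply/andP; split; last by rewrite /N; case: (u - 1) => a b /=; exact: sqrtr_ge0.
  by apply/eqP => e; case/eqP: u1; exact: Normc.eq0_normc.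
have N2 : N (1 + 1) = 2.
  by rewrite /N /= addr0 expr0n addr0 sqrtr_sqr ger0_norm.
have step z : N (z - 1) < 1/2%:R -> 3/2%:R * N (z - 1) <= N (z ^+ 2 - 1).
  move=> hz; rewrite (_ : z ^+ 2 - 1 = (z + 1) * (z - 1)); last by ring.
  rewrite /N Normc.normcM ler_wpM2r //; first by case: (z - 1) => a b /=; exact: sqrtr_ge0.
  have : N (1 + 1) <= N (z + 1) + N (- (z - 1)).
    by rewrite (_ : 1 + 1 = (z + 1) + (- (z - 1)) :> C); [exact: le_normcD|ring].
  by move: hz; rewrite N2 /N normcN; move: (Normc.normc _) (Normc.normc _) => a b; lra.
have grow m : (1 + m%:R / 2%:R) * N (u - 1) <= N (u ^+ (2 ^ m) - 1).
  elim: m => [|m IH]; first by rewrite expn0 expr1 mul0r addr0 mul1r.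
  have := step _ (h (2 ^ m)%N); rewrite -exprM -expnSr => st.
  apply: le_trans st; have : 0 <= m%:R * N (u - 1) by rewrite mulr_ge0 ?ler0n // ltW.
  have real (p a y : R) : 0 < a -> (1 + p / 2%:R) * a <= y -> 0 <= p * a -> (1 + (p + 1) / 2%:R) * a <= 3/2%:R * y.
    by clear; move=> *; lra.
  by rewrite -[m.+1%:R]natr1; apply: real.
have [m hm] : exists m : nat, 1 / N (u - 1) < m%:R.
  by exists (Num.truncn (1 / N (u - 1))).+1; exact: truncnS_gt.
have := grow m; have := h (2 ^ m)%N; rewrite -/(N _).
move: hm; rewrite ltr_pdivrMr //; nra.
Qed.

(** A small congruence subgroup is mapped into a neighbourhood of 1 in C,
    which contains no nontrivial subgroup. *)
Lemma continuous_char_small (chi : GA 1 -> C) : chi 1%g = 1 ->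
  (forall x y, chi (x * y)%g = chi x * chi y) ->
  continuous (fun x => complex.Re (chi x)) -> continuous (fun x => complex.Im (chi x)) ->
  exists2 d, cgood d & forall z, cong Fhat 1 d z -> chi (of_fin z) = 1.
Proof.
move=> chi1 chiM cRe cIm.
have nbh (f : GA 1 -> R) : continuous f -> nbhs (1%g : GAf 1) [set z | `|f (of_fin z) - f 1%g| < 1/4%:R].
  move=> fc; have c : {for (1%g : GAf 1), continuous (fun z => f (of_fin z))}.
    by apply: (@continuous_comp _ _ _ (@of_fin R F Fhat 1)); [exact: of_fin_continuous|rewrite of_fin1; exact: fc].
  have /cvgrPdist_lt/(_ (1/4%:R) ltac:(lra)) := c.
  by apply: filterS => z /=; rewrite of_fin1 distrC.
have [d hd hU] := cong_base (filterI (nbh _ cRe) (nbh _ cIm)).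
exists d => // z hz; apply: no_small_subgroups => n.
have zn : cong Fhat 1 d (z ^+ n)%g.
  by elim: n => [|n IH]; rewrite ?expg0 ?expgS; [exact: cong1|exact: congM].
have <- : chi (of_fin (z ^+ n)%g) = chi (of_fin z) ^+ n.
  elim: n {zn} => [|n IH]; first by rewrite expg0 of_fin1 chi1.
  by rewrite expgS of_finM chiM IH exprS.
have [] := hU _ zn; rewrite /= chi1 /=; case: (chi _) => a b /=.
rewrite !subr0 !ltr_norml => /andP[? ?] /andP[? ?].
rewrite [ltRHS](_ : _ = Num.sqrt ((1/2%:R)^+2)); last by rewrite sqrtr_sqr ger0_norm //; lra.
by rewrite ltr_sqrt; nra.
Qed.

(** ** The central character and its conjugate *)

Variables (omega : GA 1 -> C) (k : infPlace R F -> nat) (w : int).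
Hypothesis homega : idele_class_character omega.
Hypothesis Kint : forall v, K v `<=` @gl_integral R 2 (Fhat v).
Hypothesis hKomega : forall v (z : GL 1 (Fhat v)),
     K v (gl_scal 2 z) -> omega_at omega z = 1.
Hypothesis hw : forall (v : infPlace R F) (z : GL 1 (realAV R)),
     local_char Fhat omega (inl v) z = (`|gl1val z : R| ^ w)%:C%C \/
     local_char Fhat omega (inl v) z = - (`|gl1val z : R| ^ w)%:C%C.
Hypothesis hsign : forall (v : infPlace R F) (z : GL 1 (realAV R)),
     (gl1val z : R) = -1 -> local_char Fhat omega (inl v) z = (-1) ^+ k v.
Hypothesis hAlg : forall v, ((k v)%:Z = w %[mod 2])%Z.

Let omega1 : omega 1%g = 1. Proof. by case: homega. Qed.
Let omegaM x y : omega (x * y)%g = omega x * omega y. Proof. by case: homega. Qed.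

Lemma gl1E (L : avField R) (x y : GL 1 L) : gl1val x = gl1val y -> x = y.
Proof. by move=> e; apply: glmx_inj; rewrite (mx11_scalar (glmx x)) (mx11_scalar (glmx y)) -/(gl1val x) e. Qed.

Lemma gl1valM (L : avField R) (x y : GL 1 L) : gl1val (x * y)%g = gl1val x * gl1val y.
Proof. by rewrite /gl1val mxE big_ord1. Qed.

Definition gl1mk (L : avField R) (a : L) (a0 : a != 0) : GL 1 L := MkGL (gl_unit_subproof a0).
Lemma gl1mkE (L : avField R) (a : L) (a0 : a != 0) : gl1val (gl1mk a0) = a.
Proof. by rewrite /gl1val mxE eqxx mulr1n. Qed.

Lemma local_char_pos t (z : GL 1 (realAV R)) : 0 < gl1val z :> R ->
  local_char Fhat omega (inl t) z = ((gl1val z : R) ^ w)%:C%C.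
Proof.
move=> z0; have s0 : (Num.sqrt (gl1val z : R) : realAV R) != 0.
  by apply: lt0r_neq0; rewrite sqrtr_gt0.
have sp : 0 < Num.sqrt (gl1val z : R) by rewrite sqrtr_gt0.
have ez : z = (gl1mk s0 * gl1mk s0)%g.
  by apply: gl1E; rewrite gl1valM gl1mkE -[RHS]/(Num.sqrt (gl1val z : R) * _) -expr2 sqr_sqrtr // ltW.
have eM (x : R) : x != 0 -> (x ^ w)%:C%C * (x ^ w)%:C%C = ((x * x) ^ w)%:C%C.
  by move=> x0; rewrite -rmorphM exprzMl // unitfE.
rewrite ez /local_char at_placeM omegaM -/(local_char Fhat omega (inl t) (gl1mk s0)).
have [] := hw t (gl1mk s0) => ->; rewrite ?mulrNN; rewrite gl1mkE gl1valM gl1mkE ger0_norm ?(ltW sp) //;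
  by rewrite eM // gt_eqF.
Qed.

Lemma local_charE t (z : GL 1 (realAV R)) :
  local_char Fhat omega (inl t) z = ((gl1val z : R) ^ w)%:C%C.
Proof.
have [z0|z0] := ltP 0 (gl1val z : R); first exact: local_char_pos.
have zn0 : (gl1val z : R) != 0 := gl1val_neq0 z.
have N1 : (- 1 : realAV R) != 0 by rewrite oppr_eq0 oner_eq0.
have zN0 : (- gl1val z : realAV R) != 0 by rewrite oppr_eq0.
have ez : z = (gl1mk N1 * gl1mk zN0)%g by apply: gl1E; rewrite gl1valM !gl1mkE mulrNN mul1r.
have zp : 0 < gl1val (gl1mk zN0) :> R by rewrite gl1mkE oppr_gt0 lt_neqAle zn0.
have e1 : (-1) ^+ k t = ((-1 : R) ^ w)%:C%C.
  have e2 : ((-1 : R) ^ w) = (-1) ^+ k t.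
    have [d hd] : exists d : int, w = (k t)%:Z + d * 2.
      by exists ((w - (k t)%:Z) %/ 2)%Z; have := hAlg t; lia.
    rewrite hd expfzDr ?oppr_eq0 ?oner_eq0 // [d * 2]mulrC -exprz_exp.
    by rewrite (_ : (-1 : R) ^ 2 = 1) ?exp1rz ?mulr1 // -exprnP sqrrN expr1n.
  by rewrite e2 rmorphXn rmorphN rmorph1.
rewrite {1}ez /local_char at_placeM omegaM -!/(local_char Fhat omega (inl t) _).
rewrite hsign ?gl1mkE // (local_char_pos t zp) e1 gl1mkE -rmorphM -exprMz_comm.
- by rewrite mulN1r opprK.
- by rewrite unitfE oppr_eq0 oner_eq0.
- by rewrite unitfE oppr_eq0.
- exact: mulrC.
Qed.

Lemma omega_infE (z : GA 1) : exists s : seq (infPlace R F),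
  [/\ uniq s, forall t, t \in s & omega (of_inf Fhat (inf_part z)) =
      (\prod_(t <- s) (gl1val (z (inl t)) : R) ^ w)%:C%C].
Proof.
have /finite_seqP[s0 es] := infPlace_finite R hgal.
exists (undup s0); split; [exact: undup_uniq|by move=> t; rewrite mem_undup; have : [set` s0] t by rewrite -es|].
rewrite (@char_prod omega omega1 omegaM (map inl (undup s0))).
- rewrite big_map rmorph_prod; apply: eq_bigr => t _; exact: local_charE.
- by rewrite map_inj_uniq ?undup_uniq // => ? ? [].
- move=> [t|v] //; rewrite mem_map; last by move=> ? ? [].
  by rewrite mem_undup; have -> : t \in s0 by have : [set` s0] t by rewrite -es.
Qed.

Lemma omega_good : goodchar omega.
Proof.
have [_ _ [cRe cIm] hF] := homega.
have small := continuous_char_small omega1 omegaM cRe cIm.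
split=> //.
- move=> z hz; have [s [us hs ->]] := omega_infE z.
  by rewrite ltcR; apply: prodr_gt0 => t _; apply: exprz_gt0.
- exact: (char_level omega1 omegaM small hKomega Kint).
Qed.

Variable s : autC R.
Let omega' := conj_char s omega.

Lemma conj_char_fin z : omega' (of_fin z) = sig s (omega (of_fin z)).
Proof.
rewrite /omega' /conj_char fin_part_of_fin (_ : of_inf Fhat _ = 1%g) ?omega1 ?mulr1 //.
by apply: GA_ext => -[t|v].
Qed.

Lemma conj_char_inf (z : GA 1) : omega' (of_inf Fhat (inf_part z)) = omega (of_inf Fhat (inf_part z)).
Proof.
rewrite /omega' /conj_char (_ : of_fin _ = 1%g) ?omega1 ?rmorph1 ?mul1r //.
by apply: GA_ext => -[t|v].
Qed.

(** The finite part of a rational point has a rational archimedean complement: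
    by algebraicity, the archimedean part of the character takes a power of
    the norm as its value, which is a rational number and so is fixed by [s]. *)
Lemma conj_char_rational (x : GA 1) : GF 1 x -> omega' x = 1.
Proof.
move=> hx; have [_ _ _ hF] := homega; have hx1 := hF x hx.
have /(GFP hreal)[A uA hA] := hx; set a := A ord0 ord0.
have xa t : gl1val (x (inl t)) = complex.Re (t a) :> R.
  by rewrite /gl1val hA mxE -lembRE.
have [s0 [us0 hs0 e]] := omega_infE x.
have [q eq] : exists q : rat, omega (of_inf Fhat (inf_part x)) = ratr q.
  have [q hq] := norm_rational hgal a; have [t0 _] := embedding_exists R hgal.
  exists (q ^ w); rewrite e (_ : ratr (q ^ w) = t0 (\prod_(g : gal_of {:F}) g a) ^ w); last first.
    by rewrite hq embedding_rat -fmorphXz.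
  have pw (I : Type) (r : seq I) (P : pred I) (f : I -> C) : (\prod_(i <- r | P i) f i) ^ w = \prod_(i <- r | P i) f i ^ w.
    elim: r => [|i r IH]; first by rewrite !big_nil exp1rz.
    by rewrite !big_cons; case: ifP => _ //; rewrite expfzMl IH.
  rewrite [t0 _]rmorph_prod pw rmorph_prod -[RHS]big_enum -[RHS](big_map (gal_emb t0) xpredT (fun t : infPlace R F => t a ^ w)) /=.
  rewrite (perm_big (map (gal_emb t0) (enum {: gal_of {:F}}))); last first.
    apply: uniq_perm => //; first by rewrite map_inj_uniq ?enum_uniq //; exact: gal_emb_inj.
    move=> t; rewrite hs0; apply/esym/mapP; have [g ->] := gal_emb_surj hgal t0 t.
    by exists g => //; rewrite mem_enum.
  by apply: eq_bigr => t _; rewrite xa (emb_real hreal t a) fmorphXz.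
rewrite /omega' /conj_char eq.
have : omega (of_inf Fhat (inf_part x)) * omega (of_fin (fin_part x)) = 1.
  by rewrite -omegaM -inf_fin_decomp.
rewrite eq => h; have : sig s (ratr q * omega (of_fin (fin_part x))) = 1 by rewrite h rmorph1.
by rewrite rmorphM fmorph_rat mulrC.
Qed.

Lemma conj_char_good : goodchar omega'.
Proof.
have g := omega_good; have [d hd hs] := gc_small g.
have oM x y : omega' (x * y)%g = omega' x * omega' y.
  rewrite /omega' /conj_char fin_partM of_finM omegaM rmorphM.
  rewrite (_ : of_inf Fhat (inf_part (x * y)%g) = (of_inf Fhat (inf_part x) * of_inf Fhat (inf_part y))%g).
    by rewrite omegaM mulrACA.
  by rewrite -of_infM; apply: GA_ext => -[t|v].
have cont (x0 : GA 1) (f : C -> R) (a b : R) : (forall z, f (sig s (omega (of_fin (fin_part x0))) * z) = a * complex.Re z + b * complex.Im z) ->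
    {for x0, continuous (fun x => f (omega' x))}.
  move=> hf.
  have near : \forall x \near x0, a * complex.Re (omega (of_inf Fhat (inf_part x))) +
      b * complex.Im (omega (of_inf Fhat (inf_part x))) = f (omega' x).
    have cn : nbhs x0 [set x | cong Fhat 1 d ((fin_part x0)^-1 * fin_part x)%g].
      have c : {for x0, continuous (fun x : GA 1 => ((fin_part x0)^-1 * fin_part x)%g)}.
        by apply: (@continuous_comp _ _ _ (@fin_part R F Fhat 1)); [exact: fin_part_continuous|exact: GAf_mull_continuous].
      apply: c; rewrite mulVg; exact: cong_nbhs.
    apply: filterS cn => x /= hx; rewrite -hf /omega' /conj_char; congr (f (sig s _ * _)).
    rewrite -[LHS]mulr1 -(hs _ hx) -omegaM -of_finM mulgA mulgV mul1g //.
  have [_ _ [cRe cIm] _] := homega.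
  have c1 : {for x0, continuous (fun x : GA 1 => a * complex.Re (omega (of_inf Fhat (inf_part x))) +
      b * complex.Im (omega (of_inf Fhat (inf_part x))))}.
    have c1 : {for x0, continuous (fun x : GA 1 => complex.Re (omega (of_inf Fhat (inf_part x))))}.
      by apply: (@continuous_comp _ _ _ (fun x : GA 1 => of_inf Fhat (inf_part x) : GA 1) (fun z => complex.Re (omega z))); [exact: inf_proj_continuous|exact: cRe].
    have c2 : {for x0, continuous (fun x : GA 1 => complex.Im (omega (of_inf Fhat (inf_part x))))}.
      by apply: (@continuous_comp _ _ _ (fun x : GA 1 => of_inf Fhat (inf_part x) : GA 1) (fun z => complex.Im (omega z))); [exact: inf_proj_continuous|exact: cIm].
    have cs (c : R) : {for x0, continuous (fun=> c : R)} by exact: cst_continuous.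
    exact: (continuousD (continuousM (cs a) c1) (continuousM (cs b) c2)).
  rewrite /prop_for /continuous_at -(nbhs_singleton near).
  move=> U hU; have hc := c1 U hU; apply: filterS2 near hc => y /= -> //.
have o1 : omega' 1%g = 1 by rewrite -of_fin1 conj_char_fin of_fin1 omega1 rmorph1.
have small : exists2 d, cgood d & forall z, cong Fhat 1 d z -> omega' (of_fin z) = 1.
  by exists d => // z hz; rewrite conj_char_fin hs // rmorph1.
split=> //.
- move=> x0; pose c := sig s (omega (of_fin (fin_part x0))).
  apply: (cont x0 (@complex.Re R) (complex.Re c) (- complex.Im c)) => z; rewrite -/c.
  by case: c z => p q [u v] /=; rewrite mulNr.
- move=> x0; pose c := sig s (omega (of_fin (fin_part x0))).
  apply: (cont x0 (@complex.Im R) (complex.Im c) (complex.Re c)) => z; rewrite -/c.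
  by case: c z => p q [u v] /=; rewrite addrC.
- exact: conj_char_rational.
- by move=> z hz; rewrite conj_char_inf; exact: (gc_pos g).
- by move=> z hz; rewrite conj_char_fin (gc_K g) // rmorph1.
Qed.

End Characters.

(** * Complex-valued integrals *)

Section ComplexIntegral.
Context d (T : measurableType d) (R : realType) (mu : {measure set T -> \bar R}) (D : set T).
Hypothesis mD : measurable D.
Local Notation C := R[i].
Implicit Types (f g : T -> R) (u v : T -> C).

Definition cint u : C :=
  Complex (Rintegral mu D (fun x => complex.Re (u x))) (Rintegral mu D (fun x => complex.Im (u x))).

Local Notation I f := (mu.-integrable D (EFin \o f)).
Definition cintegrable u := I (fun x => complex.Re (u x)) /\ I (fun x => complex.Im (u x)).

Lemma iD f g : I f -> I g -> I (fun x => f x + g x).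
Proof. exact: integrableD. Qed.
Lemma iZ k f : I f -> I (fun x => k * f x).
Proof. exact: integrableZl. Qed.
Lemma iN f : I f -> I (fun x => - f x).
Proof. by move=> /(iZ (-1)); rewrite (_ : (fun x => -1 * f x) = (fun x => - f x)) //; apply/funext => x; rewrite mulN1r. Qed.
Lemma RiD f g : I f -> I g -> Rintegral mu D (fun x => f x + g x) = Rintegral mu D f + Rintegral mu D g.
Proof. exact: RintegralD. Qed.
Lemma RiZ k f : I f -> Rintegral mu D (fun x => k * f x) = k * Rintegral mu D f.
Proof. exact: RintegralZl. Qed.
Lemma RiN f : I f -> Rintegral mu D (fun x => - f x) = - Rintegral mu D f.
Proof.
move=> hf; rewrite (_ : (fun x => - f x) = (fun x => -1 * f x)); last by apply/funext => x; rewrite mulN1r.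
by rewrite RiZ // mulN1r.
Qed.

Lemma cintegrable_lin a u v : cintegrable u -> cintegrable v -> cintegrable (fun x => a * u x + v x).
Proof.
move=> [u1 u2] [v1 v2]; split.
  rewrite (_ : (fun x => _) = (fun x => (complex.Re a * complex.Re (u x) + - (complex.Im a * complex.Im (u x))) + complex.Re (v x))).
    by apply: iD => //; apply: iD; [exact: iZ|apply: iN; exact: iZ].
  by apply/funext => x; case: a (u x) (v x) => a1 a2 [x1 x2] [y1 y2].
rewrite (_ : (fun x => _) = (fun x => (complex.Re a * complex.Im (u x) + (complex.Im a * complex.Re (u x))) + complex.Im (v x))).
  by apply: iD => //; apply: iD; exact: iZ.
by apply/funext => x; case: a (u x) (v x) => a1 a2 [x1 x2] [y1 y2].
Qed.

Lemma cint_lin a u v : cintegrable u -> cintegrable v ->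
  cint (fun x => a * u x + v x) = a * cint u + cint v.
Proof.
move=> [u1 u2] [v1 v2]; rewrite /cint.
rewrite (_ : (fun x => complex.Re _) = (fun x => (complex.Re a * complex.Re (u x) + - (complex.Im a * complex.Im (u x))) + complex.Re (v x))); last first.
  by apply/funext => x; case: a (u x) (v x) => a1 a2 [x1 x2] [y1 y2].
rewrite (_ : (fun x => complex.Im (a * u x + v x)) = (fun x => (complex.Re a * complex.Im (u x) + (complex.Im a * complex.Re (u x))) + complex.Im (v x))); last first.
  by apply/funext => x; case: a (u x) (v x) => a1 a2 [x1 x2] [y1 y2].
rewrite !RiD ?RiN ?RiZ //; try exact: iZ; try (apply: iN; exact: iZ); try (apply: iD; [exact: iZ|]).
- by case: a.
- exact: iZ.
- by apply: iN; exact: iZ.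
Qed.

Lemma cint_conj u : cintegrable u -> cint (fun x => (u x)^*%C) = (cint u)^*%C.
Proof.
move=> [u1 u2]; rewrite /cint /=; rewrite -RiN //; congr Complex; congr Rintegral; apply/funext => x; by case: (u x).
Qed.

Lemma normc_ge0 (z : C) : 0 <= Normc.normc z.
Proof. by case: z => a b /=; exact: sqrtr_ge0. Qed.
Lemma Re_le_normc (z : C) : `|complex.Re z| <= Normc.normc z.
Proof. by case: z => a b /=; rewrite -sqrtr_sqr ler_sqrt ?lerDl ?sqr_ge0 // addr_ge0 ?sqr_ge0. Qed.
Lemma Im_le_normc (z : C) : `|complex.Im z| <= Normc.normc z.
Proof. by case: z => a b /=; rewrite -sqrtr_sqr ler_sqrt ?lerDr ?sqr_ge0 // addr_ge0 ?sqr_ge0. Qed.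
Lemma sqr_normcE (z : C) : Normc.normc z ^+ 2 = complex.Re z ^+ 2 + complex.Im z ^+ 2.
Proof. by case: z => a b /=; rewrite sqr_sqrtr // addr_ge0 ?sqr_ge0. Qed.

Lemma cintegrable_le u g : measurable_fun D (fun x => complex.Re (u x)) ->
  measurable_fun D (fun x => complex.Im (u x)) ->
  (forall x, D x -> Normc.normc (u x) <= g x) -> I g -> cintegrable u.
Proof.
move=> m1 m2 h hg; split; apply: (le_integrable mD _ _ hg).
- exact/measurable_EFinP.
- by move=> x Dx /=; rewrite lee_fin; apply: le_trans (Re_le_normc _) (le_trans (h x Dx) (ler_norm _)).
- exact/measurable_EFinP.
- by move=> x Dx /=; rewrite lee_fin; apply: le_trans (Im_le_normc _) (le_trans (h x Dx) (ler_norm _)).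
Qed.

End ComplexIntegral.

(** * Borel sets of a quotient *)

Section Quotient.
Variables (R : realType) (G : preTopGroupType).

Lemma borel_sigma : sigma_algebra [set: G] (@borel G).
Proof. exact: smallest_sigma_algebra. Qed.

Lemma borel_open (U : set G) : open U -> borel U.
Proof. exact: sub_gen_smallest. Qed.

Lemma borelC (A : set G) : borel A -> borel (~` A).
Proof. by have [_ h _] := borel_sigma; move=> /h; rewrite setTD. Qed.
Lemma borel0 : borel (set0 : set G). Proof. by have [] := borel_sigma. Qed.
Lemma borel_bigcup (A : nat -> set G) : (forall n, borel (A n)) -> borel (\bigcup_n A n).
Proof. by have [_ _ h] := borel_sigma; exact: h. Qed.
Lemma borelU (A B : set G) : borel A -> borel B -> borel (A `|` B).
Proof. by move=> hA hB; rewrite -bigcup2E; apply: borel_bigcup => -[|[|n]] //=; exact: borel0. Qed.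

Variable Gam : set G.

Lemma qborel_sigma : sigma_algebra setT (qborel Gam).
Proof.
split.
- by split; [exact: borel0|].
- by move=> A [bA iA]; split; [rewrite setTD; exact: borelC|move=> c x hc; split=> -[_ h]; split=> // hx; apply: h; apply/(iA c x hc)].
- move=> A hA; split; first by apply: borel_bigcup => n; have [] := hA n.
  by move=> c x hc; split=> -[n _ h]; exists n => //; have [_ /(_ c x hc) [h1 h2]] := hA n; [exact: h1|exact: h2].
Qed.

Lemma qmeasurableE (A : set (g_sigma_algebraType (qborel Gam))) : measurable A = qborel Gam A.
Proof. by rewrite /measurable /=; rewrite (sigma_algebra_id qborel_sigma). Qed.

Lemma qmeasurable_fun d (T : measurableType d) (f : G -> T) :
  measurable_fun setT (f : g_sigma_algebraType (@open G) -> T) ->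
  (forall c x, Gam c -> f (c * x)%g = f x) ->
  measurable_fun setT (f : g_sigma_algebraType (qborel Gam) -> T).
Proof.
move=> mf h _ Y mY; rewrite qmeasurableE; split; first exact: (mf measurableT Y mY).
by move=> c x hc; rewrite !setTI /= h.
Qed.

Lemma borel_continuous (f : G -> R) : continuous f ->
  measurable_fun setT (f : g_sigma_algebraType (@open G) -> R).
Proof.
move=> cf; apply: (measurability _ (RGenOpens.measurableE R)).
move=> _ [_ [a [b ->] <-]]; rewrite setTI; apply: borel_open.
by move/continuousP: cf; apply; exact: interval_open.
Qed.

Lemma borel_preimage (H : preTopGroupType) (f : H -> G) B : continuous f -> borel B -> borel (f @^-1` B).
Proof.
move=> cf; have sa := sigma_algebra_image f (@smallest_sigma_algebra H setT (@open H)).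
have : <<s @open G >> `<=` image_set_system setT f <<s @open H >>.
  apply: smallest_sub => // U oU; rewrite /image_set_system /= setTI.
  by apply: sub_gen_smallest; move/continuousP: cf; exact.
by move=> h /h; rewrite /image_set_system /= setTI.
Qed.

Hypothesis mulr_cont : forall h : G, continuous (fun x => x * h)%g.
Variable mu : qmeasure R Gam.
Hypothesis mu_inv : forall h B, qborel Gam B -> mu [set x | B (x * h)%g] = mu B.

Local Notation Q := (g_sigma_algebraType (qborel Gam)).

Lemma qborel_rtrans (h : G) (B : set G) : qborel Gam B -> qborel Gam [set x | B (x * h)%g].
Proof.
move=> [bB iB]; split; first exact: (borel_preimage (f := fun x => (x * h)%g) (@mulr_cont h) bB).
by move=> c x hc /=; rewrite -mulgA; exact: iB.
Qed.

Lemma rtrans_measurable (h : G) : measurable_fun setT ((fun x => x * h)%g : Q -> Q).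
Proof.
by move=> _ Y; rewrite qmeasurableE => mY; rewrite qmeasurableE setTI; exact: qborel_rtrans.
Qed.

Lemma integral_rtrans (h : G) (f : G -> \bar R) : measurable_fun setT (f : Q -> \bar R) -> (forall x, 0 <= f x)%E ->
  (\int[mu]_(x in setT) f (x * h)%g = \int[mu]_(x in setT) f x)%E.
Proof.
move=> mf f0; have mr := rtrans_measurable h.
pose p : {mfun Q >-> Q} := HB.pack ((fun x => x * h)%g : Q -> Q) (isMeasurableFun.Build _ _ _ _ _ mr).
rewrite -(@ge0_integral_pushforward _ _ _ _ R _ mr mu setT f) //.
apply: (@eq_measure_integral _ _ _ setT mu (pushforward mu p)) => A mA _.
by rewrite /pushforward; apply: mu_inv; rewrite -qmeasurableE.
Qed.

Lemma integrable_rtrans (h : G) (f : G -> R) : mu.-integrable setT (EFin \o f : Q -> \bar R) ->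
  mu.-integrable setT (EFin \o (fun x => f (x * h)%g) : Q -> \bar R) /\
  Rintegral mu setT (fun x : Q => f (x * h)%g) = Rintegral mu setT (f : Q -> R).
Proof.
move=> /integrableP[mf hf].
have e := @integral_rtrans h.
split.
  apply/integrableP; split.
    exact: (measurableT_comp mf (rtrans_measurable h)).
  by rewrite (e (fun x => `|(f x)%:E|%E)) //; exact: measurableT_comp.
have E1 := e (funepos (EFin \o f)) (measurable_funepos mf) (funepos_ge0 _).
have E2 := e (funeneg (EFin \o f)) (measurable_funeneg mf) (funeneg_ge0 _).
have P1 : (EFin \o (fun x => f (x * h)%g) : Q -> \bar R)^\+%E = (fun x => (EFin \o f)^\+%E (x * h)%g).
  by apply/funext => x; rewrite funepos.unlock.
have P2 : (EFin \o (fun x => f (x * h)%g) : Q -> \bar R)^\-%E = (fun x => (EFin \o f)^\-%E (x * h)%g).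
  by apply/funext => x; rewrite funeneg.unlock.
by rewrite /Rintegral [in RHS]integralE -E1 -E2 [in LHS]integralE -P1 -P2.
Qed.

End Quotient.

(** * Square-integrable functions *)

Section L2.
Variables (R : realType) (F : splittingFieldType rat).
Variable Fhat : forall v : finPlace F, completion R v.
Hypothesis hgal : galois 1%AS {:F}.
Hypothesis hreal : totally_real R F.
Local Notation C := R[i].
Local Notation GA n := (GA Fhat n).
Local Notation GF n := (GF Fhat n).
Variable K : forall v : finPlace F, set (GL 2 (Fhat v)).
Arguments K : clear implicits.
Variable mu : qmeasure R (adelic_center Fhat `|` GF 2).
Hypothesis hmu : invariant_measure setT mu.
Variable omega : GA 1 -> C.
Hypothesis gom : goodchar K omega.
Local Notation Gam := (adelic_center Fhat `|` GF 2).
Local Notation Q := (g_sigma_algebraType (qborel Gam)).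
Local Notation B := (g_sigma_algebraType (@open (GA 2))).
Local Notation L2 := (L2 mu omega).
Local Notation ip := (ip mu omega).
Local Notation form := (Defs.form Fhat).

Lemma rcM (a b : R) : (a * b)%:C%C = a%:C%C * b%:C%C :> C.
Proof. by rewrite rmorphM. Qed.

Definition wt (x : GA 2) : R := Normc.normc (omega (adet x)).

Lemma omega_neq0 z : omega z != 0.
Proof. exact: (chi_neq0 (gc1 gom) (gcM gom)). Qed.

Lemma normc_eq0 (z : C) : (Normc.normc z == 0) = (z == 0).
Proof. by apply/eqP/eqP => [/Normc.eq0_normc//|->]; rewrite /= expr0n addr0 sqrtr0. Qed.

Lemma wt_gt0 x : 0 < wt x.
Proof. by rewrite lt_neqAle normc_ge0 andbT eq_sym normc_eq0 omega_neq0. Qed.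

Lemma wtM x y : wt (x * y)%g = wt x * wt y.
Proof. by rewrite /wt adetM (gcM gom) Normc.normcM. Qed.

Lemma wt_scal z : wt (scal 2 z) = Normc.normc (omega z) ^+ 2.
Proof. by rewrite /wt adet_scal (gcM gom) Normc.normcM expr2. Qed.

Lemma wt_GF g : GF 2 g -> wt g = 1.
Proof. by move=> /(GF_det hreal) hg; rewrite /wt (gc_GF gom) //= expr0n addr0 expr1n sqrtr1. Qed.

Lemma normc_continuous (T : topologicalType) (f : T -> C) :
  continuous (fun x => complex.Re (f x)) -> continuous (fun x => complex.Im (f x)) ->
  continuous (fun x => Normc.normc (f x)).
Proof.
move=> h1 h2 x; rewrite (_ : (fun x => _) = (fun x => Num.sqrt (complex.Re (f x) * complex.Re (f x) + complex.Im (f x) * complex.Im (f x)))); last first.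
  by apply/funext => y; case: (f y) => a b /=; rewrite !expr2.
apply: (@continuous_comp _ _ _ (fun x => complex.Re (f x) * complex.Re (f x) + complex.Im (f x) * complex.Im (f x)) Num.sqrt).
  exact: (continuousD (continuousM (h1 x) (h1 x)) (continuousM (h2 x) (h2 x))).
exact: sqrt_continuous.
Qed.

Lemma wt_continuous : continuous wt.
Proof.
move=> x; apply: (@continuous_comp _ _ _ (@adet R F Fhat 2) (fun z => Normc.normc (omega z))).
  exact: adet_continuous.
apply: normc_continuous; [exact: gc_Re gom|exact: gc_Im gom].
Qed.

Lemma wtV_continuous : continuous (fun x => (wt x)^-1).
Proof. by move=> x; apply: continuousV; rewrite ?gt_eqF ?wt_gt0 //; exact: wt_continuous. Qed.

(** The sesquilinear density whose integral is the scalar product. *)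
Definition dens (f h : form) (x : GA 2) : C := f x * (h x)^*%C / (wt x)%:C%C.

Lemma densE f h x : dens f h x = Complex
  ((complex.Re (f x) * complex.Re (h x) + complex.Im (f x) * complex.Im (h x)) * (wt x)^-1)
  ((complex.Im (f x) * complex.Re (h x) - complex.Re (f x) * complex.Im (h x)) * (wt x)^-1).
Proof.
rewrite /dens -fmorphV; case: (f x) (h x) => a b [c d].
by apply/eqP; rewrite eq_complex /=; apply/andP; split; apply/eqP; ring.
Qed.

Lemma normc_conj (z : C) : Normc.normc (z^*)%C = Normc.normc z.
Proof. by case: z => a b /=; rewrite sqrrN. Qed.

Lemma normc_real (a : R) : Normc.normc (a%:C)%C = `|a|.
Proof. by rewrite /= expr0n addr0 sqrtr_sqr. Qed.

Lemma normcV (z : C) : Normc.normc z^-1 = (Normc.normc z)^-1.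
Proof. exact: Normc.normcV. Qed.

Lemma normc_dens f h x : Normc.normc (dens f h x) <=
  Normc.normc (f x) ^+ 2 / wt x + Normc.normc (h x) ^+ 2 / wt x.
Proof.
rewrite /dens !Normc.normcM Normc.normcV normc_conj normc_real ger0_norm ?(ltW (wt_gt0 x)) // -mulrDl.
rewrite ler_pM2r ?invr_gt0 ?wt_gt0 //.
by have := normc_ge0 (f x); have := normc_ge0 (h x); nra.
Qed.

Lemma L2_inv (f : form) : L2 f -> forall c x, GF 2 c -> f (c * x)%g = f x. Proof. by case. Qed.
Lemma L2_center (f : form) : L2 f -> forall z x, f (scal 2 z * x)%g = omega z * f x. Proof. by case. Qed.
Lemma L2_Re (f : form) : L2 f -> measurable_fun setT (fun x : B => complex.Re (f x)). Proof. by case=> -[]. Qed.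
Lemma L2_Im (f : form) : L2 f -> measurable_fun setT (fun x : B => complex.Im (f x)). Proof. by case=> -[]. Qed.

Lemma dens_inv f h : L2 f -> L2 h -> forall c x, Gam c -> dens f h (c * x)%g = dens f h x.
Proof.
move=> hf hh c x [[z _ <-]|hc]; rewrite /dens.
  rewrite (L2_center hf) (L2_center hh) wtM wt_scal.
  have e : omega z * (omega z)^*%C = ((Normc.normc (omega z)) ^+ 2)%:C%C.
    rewrite sqr_normcE; case: (omega z) => a b.
    by apply/eqP; rewrite eq_complex /=; apply/andP; split; apply/eqP; ring.
  have n0 : ((Normc.normc (omega z)) ^+ 2)%:C%C != 0 :> C by rewrite -e mulf_neq0 ?omega_neq0 // conjc_eq0 omega_neq0.
  have w0 : (wt x)%:C%C != 0 :> C by rewrite fmorph_eq0 gt_eqF // wt_gt0.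
  rewrite conjcM rcM mulrACA e; move: (_%:C)%C n0 (_%:C)%C w0 => A A0 W W0.
  by field; rewrite A0 W0.
by rewrite (L2_inv hf) // (L2_inv hh) // wtM wt_GF // mul1r.
Qed.

Lemma dens_Re_measurable f h : L2 f -> L2 h -> measurable_fun setT (fun x : Q => complex.Re (dens f h x)).
Proof.
move=> hf hh; apply: (qmeasurable_fun (f := fun x => complex.Re (dens f h x))); last by move=> c x hc; rewrite dens_inv.
rewrite (_ : (fun x => _) = (fun x => (complex.Re (f x) * complex.Re (h x) + complex.Im (f x) * complex.Im (h x)) * (wt x)^-1)).
  apply: measurable_funM; last exact: (borel_continuous wtV_continuous).
  by apply: measurable_funD; apply: measurable_funM; [exact: L2_Re|exact: L2_Re|exact: L2_Im|exact: L2_Im].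
by apply/funext => x; rewrite densE.
Qed.

Lemma dens_Im_measurable f h : L2 f -> L2 h -> measurable_fun setT (fun x : Q => complex.Im (dens f h x)).
Proof.
move=> hf hh; apply: (qmeasurable_fun (f := fun x => complex.Im (dens f h x))); last by move=> c x hc; rewrite dens_inv.
rewrite (_ : (fun x => _) = (fun x => (complex.Im (f x) * complex.Re (h x) - complex.Re (f x) * complex.Im (h x)) * (wt x)^-1)).
  apply: measurable_funM; last exact: (borel_continuous wtV_continuous).
  by apply: measurable_funB; apply: measurable_funM; [exact: L2_Im|exact: L2_Re|exact: L2_Re|exact: L2_Im].
by apply/funext => x; rewrite densE.
Qed.

Definition sqn (f : form) (x : GA 2) : R := Normc.normc (f x) ^+ 2 / wt x.

Lemma sqn_ge0 f x : 0 <= sqn f x.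
Proof. by rewrite divr_ge0 ?sqr_ge0 // ltW // wt_gt0. Qed.

Lemma dens_sqn f x : dens f f x = (sqn f x)%:C%C.
Proof.
rewrite densE /sqn sqr_normcE.
by apply/eqP; rewrite eq_complex /=; apply/andP; split; apply/eqP; ring.
Qed.

Lemma sqn_measurable f : L2 f -> measurable_fun setT (fun x : Q => sqn f x).
Proof.
move=> hf; have := dens_Re_measurable hf hf.
by under eq_fun do rewrite dens_sqn.
Qed.

Lemma sqn_integrable f : L2 f -> mu.-integrable setT (EFin \o (fun x : Q => sqn f x)).
Proof.
move=> hf; apply/integrableP; split; first by apply/measurable_EFinP; exact: sqn_measurable.
case: (hf) => _ _ _; rewrite (_ : (\int[mu]_(x in setT) _)%E = (\int[mu]_x `|(EFin \o (fun x : Q => sqn f x)) x|)%E) //.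
by apply: eq_integral => x _ /=; rewrite ger0_norm ?sqn_ge0.
Qed.

Lemma dens_integrable f h : L2 f -> L2 h -> cintegrable mu setT (fun x : Q => dens f h x).
Proof.
move=> hf hh; apply: (@cintegrable_le _ _ _ _ _ _ _ (fun x : Q => sqn f x + sqn h x)) => //.
- exact: dens_Re_measurable.
- exact: dens_Im_measurable.
- by move=> x _; exact: normc_dens.
- by apply: iD => //; exact: sqn_integrable.
Qed.

Lemma ipE f h : ip f h = cint mu setT (fun x : Q => dens f h x). Proof. by []. Qed.

Lemma L2_intro (f : form) : cmeasurable f -> (forall c x, GF 2 c -> f (c * x)%g = f x) ->
  (forall z x, f (scal 2 z * x)%g = omega z * f x) ->
  forall g : GA 2 -> R, mu.-integrable setT (EFin \o (g : Q -> R)) -> (forall x, sqn f x <= g x) -> L2 f.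
Proof.
move=> mf f1 f2 g hg hle; split=> //; have /integrableP[mg ig] := hg.
have ms : measurable_fun setT (fun x : Q => sqn f x).
  apply: (qmeasurable_fun (f := fun x => sqn f x)).
    rewrite (_ : (fun x => _) = (fun x => (complex.Re (f x) ^+ 2 + complex.Im (f x) ^+ 2) * (wt x)^-1)).
      apply: measurable_funM; last exact: (borel_continuous wtV_continuous).
      by case: mf => m1 m2; apply: measurable_funD; exact: measurable_funX.
    by apply/funext => x; rewrite /sqn sqr_normcE.
  move=> c x [[z _ <-]|hc]; rewrite /sqn.
    rewrite f2 wtM wt_scal Normc.normcM exprMn.
    have A0 : Normc.normc (omega z) ^+ 2 != 0 by rewrite expf_neq0 // normc_eq0 omega_neq0.
    have w0 : wt x != 0 by rewrite gt_eqF // wt_gt0.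
    by move: (wt x) (Normc.normc (omega z) ^+ 2) w0 A0 => u A u0 A0; field; rewrite u0 A0.
  by rewrite f1 // wtM wt_GF // mul1r.
apply: le_lt_trans ig; apply: ge0_le_integral => //.
- by move=> x _; rewrite lee_fin; exact: sqn_ge0.
- exact/measurable_EFinP.
- exact: measurableT_comp.
- by move=> x _ /=; rewrite lee_fin; apply: le_trans (hle x) (ler_norm _).
Qed.

Lemma cmeasurable_lin (a : C) (f h : form) : cmeasurable f -> cmeasurable h -> cmeasurable (a *: f + h : form).
Proof.
move=> [f1 f2] [h1 h2]; split.
  rewrite (_ : (fun x => _) = (fun x => (complex.Re a * complex.Re (f x) - complex.Im a * complex.Im (f x)) + complex.Re (h x))).
    by apply: measurable_funD => //; apply: measurable_funB; apply: measurable_funM => //; exact: measurable_cst.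
  by apply/funext => x; rewrite /GRing.add /= /GRing.scale /=; case: a (f x) (h x) => a1 a2 [x1 x2] [y1 y2].
rewrite (_ : (fun x => _) = (fun x => (complex.Re a * complex.Im (f x) + complex.Im a * complex.Re (f x)) + complex.Im (h x))).
  by apply: measurable_funD => //; apply: measurable_funD; apply: measurable_funM => //; exact: measurable_cst.
by apply/funext => x; rewrite /GRing.add /= /GRing.scale /=; case: a (f x) (h x) => a1 a2 [x1 x2] [y1 y2].
Qed.

Lemma formE (a : C) (f h : form) x : (a *: f + h : form) x = a * f x + h x.
Proof. by []. Qed.

Lemma L2_lin (a : C) f h : L2 f -> L2 h -> L2 (a *: f + h).
Proof.
move=> hf hh; apply: (@L2_intro _ _ _ _ (fun x => 2 * Normc.normc a ^+ 2 * sqn f x + 2 * sqn h x)).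
- by apply: cmeasurable_lin; [case: hf|case: hh].
- by move=> c x hc; rewrite !formE (L2_inv hf) // (L2_inv hh).
- by move=> z x; rewrite !formE (L2_center hf) // (L2_center hh) // mulrDr !mulrA [a * _]mulrC.
- by apply: iD => //; apply: iZ => //; exact: sqn_integrable.
- move=> x; rewrite /sqn formE !mulrA -mulrDl ler_pM2r ?invr_gt0 ?wt_gt0 //.
  have := le_normcD (a * f x) (h x); rewrite Normc.normcM.
  have := normc_ge0 (a * f x + h x); have := normc_ge0 a; have := normc_ge0 (f x); have := normc_ge0 (h x).
  move: (Normc.normc (_ + _)) (Normc.normc a) (Normc.normc (f x)) (Normc.normc (h x)) => s p q r *.
  have h1 : s ^+ 2 <= (p * q + r) ^+ 2 by rewrite ler_sqr ?nnegrE ?addr_ge0 ?mulr_ge0.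
  by have h2 := sqr_ge0 (p * q - r); apply: le_trans h1 _; nra.
Qed.

Lemma L2_0 : L2 0.
Proof.
apply: (@L2_intro _ _ _ _ (fun=> 0)) => //.
- by have z0 y : (0 : form) y = 0 by []; move=> z x; rewrite !z0 mulr0.
- exact: integrable0.
- by move=> x; rewrite /sqn /= !expr0n /= addr0 sqrtr0 expr0n mul0r.
Qed.

Lemma L2_subspace : subspace_of L2.
Proof. by split; [exact: L2_0|move=> a x y; exact: L2_lin]. Qed.

Lemma ip_sqn f : ip f f = (Rintegral mu setT (fun x : Q => sqn f x))%:C%C.
Proof.
rewrite ipE /cint; congr Complex; first by congr Rintegral; apply/funext => x; rewrite dens_sqn.
by rewrite (_ : (fun x => _) = cst 0) ?/Rintegral ?integral0 //; apply/funext => x; rewrite dens_sqn.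
Qed.

Lemma L2_psd : psd_on L2 ip.
Proof.
split; first exact: L2_subspace.
- move=> a x y z hx hy hz; rewrite !ipE -(cint_lin measurableT); try exact: dens_integrable.
  by congr cint; apply/funext => t; rewrite /dens formE !mulrDl !mulrA.
- move=> x y hx hy; rewrite !ipE -(cint_conj measurableT); last exact: dens_integrable.
  congr cint; apply/funext => t; rewrite /dens !conjcM conjcK [_ * y t]mulrC; congr (_ * _).
  by rewrite -fmorphV conjc_real.
- by move=> x hx; rewrite ip_sqn ler0c; apply: Rintegral_ge0 => t _; exact: sqn_ge0.
Qed.

Lemma L2_rtrans g f : L2 f -> L2 (rtrans g f).
Proof.
move=> hf; apply: (@L2_intro _ _ _ _ (fun x => wt g * sqn f (x * g)%g)).
- split; [have := L2_Re hf|have := L2_Im hf] => h; have bt := @borel_preimage (GA 2) (GA 2) (fun x => x * g)%g.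
    move=> _ Y mY; rewrite setTI; have := h measurableT Y mY; rewrite setTI.
    by apply: bt; exact: GA_mulr_continuous.
  move=> _ Y mY; rewrite setTI; have := h measurableT Y mY; rewrite setTI.
  by apply: bt; exact: GA_mulr_continuous.
- by move=> c x hc; rewrite /rtrans -mulgA; exact: L2_inv.
- by move=> z x; rewrite /rtrans -mulgA; exact: L2_center.
- apply: iZ => //; case: (hmu) => inv _ _ _.
  by have [] := integrable_rtrans (@GA_mulr_continuous R F Fhat 2) (fun h B => @inv h B I) g (sqn_integrable hf).
- move=> x; rewrite /sqn wtM /rtrans [leRHS](_ : _ = Normc.normc (f (x * g)%g) ^+ 2 / wt x) //.
  by have := wt_gt0 g; have := wt_gt0 x => h1 h2; field; rewrite !gt_eqF.
Qed.

(** The scalar product divides by [wt], so a right translation is an isometry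
    up to the value of [wt] at the translating element. *)
Lemma ip_rtrans g f h : L2 f -> L2 h -> ip (rtrans g f) (rtrans g h) = (wt g)%:C%C * ip f h.
Proof.
move=> hf hh; rewrite !ipE; have [i1 i2] := dens_integrable hf hh; case: (hmu) => inv _ _ _.
have [r1 e1] := integrable_rtrans (@GA_mulr_continuous R F Fhat 2) (fun h B => @inv h B I) g (f := fun x => complex.Re (dens f h x)) i1.
have [r2 e2] := integrable_rtrans (@GA_mulr_continuous R F Fhat 2) (fun h B => @inv h B I) g (f := fun x => complex.Im (dens f h x)) i2.
have dE x : dens (rtrans g f) (rtrans g h) x = (wt g)%:C%C * dens f h (x * g)%g.
  rewrite /dens wtM rcM /rtrans; have h1 : (wt g)%:C%C != 0 :> C by rewrite fmorph_eq0 gt_eqF // wt_gt0.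
  have h2 : (wt x)%:C%C != 0 :> C by rewrite fmorph_eq0 gt_eqF // wt_gt0.
  by move: (wt g)%:C%C (wt x)%:C%C h1 h2 => u v u0 v0; field; rewrite u0 v0.
rewrite /cint -e1 -e2 /=; rewrite [RHS](_ : _ = Complex (wt g * Rintegral mu setT (fun x : Q => complex.Re (dens f h (x * g)%g)))
   (wt g * Rintegral mu setT (fun x : Q => complex.Im (dens f h (x * g)%g)))); last first.
  by rewrite /GRing.mul /= !mul0r subr0 addr0.
rewrite -!RiZ //; congr Complex; congr Rintegral; apply/funext => x; rewrite dE.
  by case: (dens _ _ _) => a b /=; rewrite mul0r subr0.
by case: (dens _ _ _) => a b /=; rewrite mul0r addr0.
Qed.

Lemma rtransM g h (f : form) : rtrans (g * h)%g f = rtrans g (rtrans h f).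
Proof. by apply/funext => x; rewrite /rtrans mulgA. Qed.
Lemma rtrans1 (f : form) : rtrans 1%g f = f.
Proof. by apply/funext => x; rewrite /rtrans mulg1. Qed.

End L2.

(** * A section of the quotient by the centre *)

Lemma pair_continuous (T U V : topologicalType) (f : T -> U) (g : T -> V) x :
  {for x, continuous f} -> {for x, continuous g} -> {for x, continuous (fun y => (f y, g y))}.
Proof.
move=> cf cg W [[P Q] /= [hP hQ] PQ]; have h1 : nbhs x (f @^-1` P) := cf _ hP.
have h2 : nbhs x (g @^-1` Q) := cg _ hQ.
have h3 : nbhs x (f @^-1` P `&` g @^-1` Q) by exact: filterI h1 h2.
suff : nbhs x ((fun y => (f y, g y)) @^-1` W) by [].
by apply: filterS h3 => y [Py Qy]; exact: PQ.
Qed.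

Section ColumnPick.
Variables (R : realType) (L : avField R).
Local Notation e00 x := (glmx x ord0 ord0).
Local Notation e10 x := (glmx x ord_max ord0).
Implicit Types x y : GL 2 L.

(** The first entry of maximal absolute value in the first column: it is
    homogeneous in the matrix, hence a local section of the quotient by the
    scalar matrices. *)
Definition colmax x : L := if av (e10 x) <= av (e00 x) then e00 x else e10 x.

Lemma colmax_neq0 x : colmax x != 0.
Proof.
rewrite /colmax; case: ifPn => [h|h]; apply/eqP => e.
  have e1 : e10 x = 0 by apply/av_eq0/eqP; rewrite eq_le av_ge0 andbT -(av0 L) -e.
  by have := gl_det_neq0 x; rewrite det2 e e1 mul0r mulr0 subrr eqxx.
by move: h; rewrite e av0 av_ge0.
Qed.

Definition colpick x : GL 1 L := gl1mk (colmax_neq0 x).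

Lemma colpick_scal z x : colpick (gl_scal 2 z * x)%g = (z * colpick x)%g.
Proof.
apply: gl1E; rewrite gl1valM !gl1mkE /colmax.
have E i : glmx (gl_scal 2 z * x)%g i ord0 = gl1val z * glmx x i ord0.
  by rewrite (_ : glmx _ = (gl1val z)%:M *m glmx x) // mul_scalar_mx mxE.
by rewrite !E !avM ler_pM2l ?av_gt0 ?gl1val_neq0 //; case: ifP.
Qed.

Lemma colpick_near x i : (\forall y \near x, colmax y = glmx y i ord0) -> {for x, continuous colpick}.
Proof.
move=> h; apply: avcont_gl => k j; rewrite !ord1.
apply: (@avcont_near _ _ _ _ (fun y => glmx y i ord0)); last exact: avcont_entry.
by apply: filterS h => y h; rewrite mxE eqxx mulr1n h.
Qed.

Lemma colpick_continuous_lt x : av (e10 x) < av (e00 x) -> {for x, continuous colpick}.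
Proof.
move=> h; apply: (@colpick_near x ord0); set e := (av (e00 x) - av (e10 x)) / 2.
have e0 : 0 < e by rewrite divr_gt0 // subr_gt0.
apply: filterS2 (@avcont_entry R L 2 x ord0 ord0 _ e0) (@avcont_entry R L 2 x ord_max ord0 _ e0) => y h1 h2.
rewrite /colmax; case: ifPn => //; rewrite -ltNge => h3; exfalso.
have a1 : av (e00 x) <= av (e00 y) + av (e00 y - e00 x).
  by have := avD (e00 y) (e00 x - e00 y); rewrite addrC subrK -(avN (e00 y - e00 x)) opprB.
have a2 : av (e10 y) <= av (e10 x) + av (e10 y - e10 x) by have := avD (e10 x) (e10 y - e10 x); rewrite addrC subrK.
by move: h1 h2 h3 a1 a2; rewrite /e => *; lra.
Qed.

Hypothesis avU : forall x y : L, av (x + y) <= Num.max (av x) (av y).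

Lemma av_near_eq (a b : L) : av (b - a) < av a -> av b = av a.
Proof.
move=> h; apply/eqP; rewrite eq_le; apply/andP; split.
  by rewrite -(subrK a b); apply: le_trans (avU _ _) _; rewrite ge_max (ltW h) lexx.
rewrite leNgt; apply/negP => hb.
suff : av a < av a by rewrite ltxx.
rewrite -{1}(subKr b a); apply: le_lt_trans (avU _ _) _; rewrite gt_max hb avN //.
Qed.

(** By the ultrametric inequality the choice between the two entries is the
    same at all points near a given one. *)
Lemma colpick_continuous : continuous colpick.
Proof.
move=> x; have c0 := colmax_neq0 x; move: c0; rewrite /colmax; case: ifPn => h c0.
  apply: (@colpick_near x ord0); have a0 := av_gt0 c0.
  apply: filterS2 (@avcont_entry R L 2 x ord0 ord0 _ a0) (@avcont_entry R L 2 x ord_max ord0 _ a0) => y h1 h2.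
  rewrite /colmax (av_near_eq h1) (_ : _ <= _) // -(subrK (e10 x) (e10 y)).
  by apply: le_trans (avU _ _) _; rewrite ge_max h (ltW h2).
apply: (@colpick_near x ord_max); have a0 := av_gt0 c0; rewrite -ltNge in h.
apply: filterS2 (@avcont_entry R L 2 x ord0 ord0 _ a0) (@avcont_entry R L 2 x ord_max ord0 _ a0) => y h1 h2.
rewrite /colmax (av_near_eq h2) ifF //; apply/negbTE; rewrite -ltNge -(subrK (e00 x) (e00 y)).
by apply: le_lt_trans (avU _ _) _; rewrite gt_max h1 h.
Qed.

Lemma colpick_integral x : gl_integral x -> gl_integral (colpick x).
Proof.
move=> ix; have c0 := colmax_neq0 x.
have c1 : av (colmax x) <= 1 by rewrite /colmax; case: ifP => _; [have [] := ix ord0 ord0|have [] := ix ord_max ord0].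
have cm : Num.max (av (e00 x)) (av (e10 x)) = av (colmax x).
  by rewrite /colmax maxEle; case: leP => h1; case: leP => h2 //; [apply/eqP; rewrite eq_le h1 h2|move: (lt_trans h1 h2); rewrite ltxx].
have d1 : 1 <= av (\det (glmx x)).
  have /(_ ord0 ord0)[_] := gl_integral_det avU ix; rewrite /= invmx_scalar mxE eqxx mulr1n avV.
  by rewrite invf_le1 // av_gt0 // gl_det_neq0.
have h : 1 <= av (colmax x).
  apply: le_trans d1 _; rewrite det2 -cm; apply: le_trans (avU _ _) _; rewrite avN !avM ge_max; apply/andP; split.
    by rewrite le_max ler_piMr ?av_ge0 //; have [] := ix ord_max ord_max.
  by rewrite le_max [X in _ || X]ler_piMl ?av_ge0 ?orbT //; have [] := ix ord0 ord_max.
move=> i j; rewrite !ord1 /= invmx_scalar !mxE eqxx !mulr1n avV; split=> //.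
by rewrite invf_le1 // av_gt0.
Qed.

End ColumnPick.

(** * Fundamental sets *)

Section Boxes.
Variables (R : realType) (F : splittingFieldType rat).
Variable Fhat : forall v : finPlace F, completion R v.
Hypothesis hgal : galois 1%AS {:F}.
Hypothesis hreal : totally_real R F.
Local Notation GA n := (GA Fhat n).
Local Notation GF n := (GF Fhat n).
Local Notation place := (place R F).
Local Notation Gam := (adelic_center Fhat `|` GF 2).

Lemma fin_colpick_int v x : @all_int R F Fhat 2 v x -> @all_int R F Fhat 1 v (colpick x).
Proof. by case: v x => // v x; exact: (colpick_integral (@c_ultra _ _ _ (Fhat v))). Qed.

Definition col : GA 2 -> GA 1 :=
  @rmap _ (all_fam Fhat 2) (all_fam Fhat 1) (fun v => @colpick R (lfield Fhat v)) fin_colpick_int.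

Lemma col_scal z x : col (scal 2 z * x)%g = (z * col x)%g.
Proof. by apply: GA_ext => v; exact: colpick_scal. Qed.

Lemma col_continuous (x : GA 2) :
  (forall t, av (glmx (x (inl t)) ord_max ord0) < av (glmx (x (inl t)) ord0 ord0)) ->
  {for x, continuous col}.
Proof.
move=> hx; apply: (@placewise_continuous _ (all_fam Fhat 2) (all_fam Fhat 1)
  (@all_rint_open R F Fhat 2) (@all_rint_open R F Fhat 1) (fun v => @colpick R (lfield Fhat v)) col x) => //.
  by case=> [t|v]; [exact: colpick_continuous_lt|apply: colpick_continuous; exact: c_ultra].
by rewrite (_ : [set _ | _] = set0) // -subset0 => v /=; apply => y /=; exact: fin_colpick_int.
Qed.

Definition sat (E : set (GA 2)) : set (GA 2) :=
  [set x | exists g z, GF 2 g /\ E (g * scal 2 z * x)%g].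

Lemma Gam_inv c : Gam c -> Gam (c^-1)%g.
Proof. by move=> [[z _ <-]|h]; [left; exists (z^-1)%g => //; exact: scalV|right; exact: GFV]. Qed.

Lemma invariantP (E : set (GA 2)) : (forall c x, Gam c -> E x -> E (c * x)%g) ->
  forall c x, Gam c -> (E (c * x)%g <-> E x).
Proof.
move=> h c x hc; split=> [hx|]; last exact: h.
by rewrite -(mulKg c x); apply: h => //; exact: Gam_inv.
Qed.

Lemma sat_invariant E c x : Gam c -> (sat E (c * x)%g <-> sat E x).
Proof.
move: c x; apply: invariantP => c x [[z0 _ <-]|hc] [g [z [hg h]]].
  exists g, (z * z0^-1)%g; split=> //.
  by rewrite scalM scalV -!mulgA mulKg mulgA.
exists (g * c^-1)%g, z; split; first by apply: GFM => //; exact: GFV.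
rewrite (_ : (g * c^-1 * scal 2 z * (c * x))%g = (g * scal 2 z * x)%g) //.
by rewrite -!mulgA [(c^-1 * (scal 2 z * _))%g]mulgA -scalC -mulgA mulKg.
Qed.

Lemma sub_sat E : E `<=` sat E.
Proof. by move=> x Ex; exists 1%g, 1%g; rewrite scal1 !mul1g; split=> //; exact: GF1. Qed.

Lemma sat_sub E U : (forall c x, Gam c -> (U (c * x)%g <-> U x)) -> E `<=` U -> sat E `<=` U.
Proof.
move=> iU EU x [g [z [hg /EU]]]; rewrite -mulgA iU; last by right.
by rewrite iU //; left; exists z.
Qed.

Lemma gz_cancel g g' z z' x :
  (g * g'^-1 * scal 2 (z * z'^-1) * (g' * scal 2 z' * x))%g = (g * scal 2 z * x)%g :> GA 2.
Proof.
rewrite -[(g' * scal 2 z')%g]scalC scalM scalV -!mulgA mulKg.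
by rewrite [(scal 2 z * (g' * x))%g]mulgA [(scal 2 z * g')%g]scalC -mulgA mulKg.
Qed.

Lemma sat_open E : open E -> open (sat E).
Proof.
move=> oE; have -> : sat E = \bigcup_(p in [set p : GA 2 * GA 1 | GF 2 p.1]) ((fun x => p.1 * scal 2 p.2 * x)%g @^-1` E).
  apply/seteqP; split=> [x [g [z [hg h]]]|x [[g z] /= hg h]]; first by exists (g, z).
  by exists g, z.
by apply: bigcup_open => -[g z] /= _; apply: open_comp oE => x _; exact: GA_mull_continuous.
Qed.

(** Stability under a congruence subgroup is what makes the test forms built
    from such a set smooth. *)
Definition smooth_set (E : set (GA 2)) : Prop :=
  exists2 d, cgood d & forall x w, E x -> cong Fhat 2 d w -> E (x * of_fin w)%g.

Lemma sat_smooth E : smooth_set E -> smooth_set (sat E).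
Proof.
move=> [d hd h]; exists d => // x w [g [z [hg Ex]]] hw; exists g, z; split=> //.
by rewrite mulgA; exact: h.
Qed.

Definition smooth_open : set (set (GA 2)) :=
  [set P | [/\ open P, forall c x, Gam c -> (P (c * x)%g <-> P x) & smooth_set P]].

Lemma smooth_openI : setI_closed smooth_open.
Proof.
move=> A B [oA iA [d hd sA]] [oB iB [e he sB]]; split; first exact: openI.
  by move=> c x hc; split=> -[hA hB]; split; [apply/(iA c x hc)|apply/(iB c x hc)|apply/(iA c x hc)|apply/(iB c x hc)].
exists (fun v => Num.min (d v) (e v)); first exact: cgood_min.
by move=> x w [hA hB] /cong_min[h1 h2]; split; [exact: sA|exact: sB].
Qed.

Lemma smooth_openT : smooth_open setT.
Proof. by split=> //; [exact: openT|exists (fun=> 2%:R) => //; split=> [v|]; [|rewrite (_ : [set _ | _] = set0) // -subset0 => v /=; rewrite leNgt; apply/negP; rewrite negbK]; lra]. Qed.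

Definition Bk : nat -> set (GA 2) := projT1 (cid (@GA_base R F Fhat hgal 2)).
Lemma BkP : [/\ forall k, open (Bk k), forall k, smooth_set (Bk k)
  & forall x U, nbhs x U -> exists2 k, Bk k x & Bk k `<=` U].
Proof. exact: (projT2 (cid (@GA_base R F Fhat hgal 2))). Qed.

Lemma satBk_smooth_open k : smooth_open (sat (Bk k)).
Proof.
have [oB sB _] := BkP.
by split; [apply: sat_open; exact: oB|move=> c x hc; exact: sat_invariant|apply: sat_smooth; exact: sB].
Qed.

(** Every invariant open set is a countable union of smooth ones. *)
Lemma open_smooth_gen U : open U -> (forall c x, Gam c -> (U (c * x)%g <-> U x)) -> <<s smooth_open >> U.
Proof.
move=> oU iU; have [oB sB hB] := BkP.
pose A n := if pselect (Bk n `<=` U) then sat (Bk n) else set0.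
have -> : U = \bigcup_n A n.
  apply/seteqP; split=> [x Ux|x [n _]].
    have [n Bx BU] := hB x U (open_nbhs_nbhs (conj oU Ux)); exists n => //.
    by rewrite /A; case: pselect => [h|h] /=; [exact: sub_sat|case: h].
  by rewrite /A; case: pselect => [h /(sat_sub iU h)//|_ []].
apply: sigma_algebra_bigcup => n; rewrite /A; case: pselect => [h|h] /=; last exact: sigma_algebra0.
by apply: sub_gen_smallest; exact: satBk_smooth_open.
Qed.

Lemma nearone_nbhs d : cgood d -> nbhs (1%g : GA 2) (nearone d).
Proof.
move=> hd; pose V (v : place) : set (GL 2 (lfield Fhat v)) :=
  match v return set (GL 2 (lfield Fhat v)) with
  | inl t => glnear 1%g (1/50%:R : R) | inr v => congr (d v) end.
apply/(rprod_nbhsP (@all_rint_open R F Fhat 2)); exists V; split.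
- split=> [[t|v]|]; [exact: glnear_open|apply: congr_open; exact: c_ultra|].
  have : finite_set ((inl @` [set: infPlace R F] : set place) `|` inr @` [set v | congr (d v) <> rint (fin_fam Fhat 2) v]).
    rewrite finite_setU; split; first exact: finite_image (infPlace_finite R hgal).
    by apply: finite_image; have [_ h] := @cong_box R F Fhat 2 d hd.
  by apply: sub_finite_set => -[t|v] /= h; [left; exists t|right; exists v].
- case=> [t|v]; first by apply: glnear_refl; lra.
  by apply: congr_1; exact: hd.1.
- by move=> q hq; split=> [v|t i j]; [exact: (hq (inr v))|exact: (hq (inl t))].
Qed.

Variable d0 : finPlace F -> R.
Hypothesis hd0 : cgood d0.

(** A box so small that the rational points carrying one of its points to
    another one are scalar. *)
Definition near_box (g0 : GA 2) (B : set (GA 2)) :=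
  forall x, B x -> nearone d0 (x * g0^-1)%g.

Section OneBox.
Variables (g0 : GA 2) (B : set (GA 2)).
Hypothesis oB : open B.
Hypothesis nB : near_box g0 B.

Lemma box_discrete g z b b' : GF 2 g -> B b -> B b' -> (g * scal 2 z * b)%g = b' ->
  exists2 c, GF 1 c & g = scal 2 c.
Proof.
move=> hg hb hb' e; apply: (nearone_discrete hgal hreal hg (nB hb) (nB hb') (z := z)).
by rewrite mulgA e.
Qed.

Definition ZB : set (GA 2) := [set y | exists z, B (scal 2 z * y)%g].

Lemma ZB_open : open ZB.
Proof.
have -> : ZB = \bigcup_z ((fun x => scal 2 z * x)%g @^-1` B).
  by apply/seteqP; split=> [x [z h]|x [z _ h]]; exists z.
by apply: bigcup_open => z _; apply: open_comp oB => x _; exact: GA_mull_continuous.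
Qed.

Lemma ZB_scal z y : ZB y -> ZB (scal 2 z * y)%g.
Proof. by move=> [z' h]; exists (z' * z^-1)%g; rewrite scalM scalV -mulgA mulKg. Qed.

Definition sect (y : GA 2) : GA 2 := (scal 2 ((col (y * g0^-1)%g)^-1) * y)%g.

Lemma sect_scal z y : sect (scal 2 z * y)%g = sect y.
Proof.
rewrite /sect -mulgA col_scal mulgA -scalM invMg -mulgA mulVg mulg1 //.
Qed.

Lemma sect_continuous y : ZB y -> {for y, continuous sect}.
Proof.
move=> [z hz]; have c1 : {for y, continuous (fun y => col (y * g0^-1)%g)}.
  apply: (@continuous_comp _ _ _ (fun y => y * g0^-1)%g col); first exact: GA_mulr_continuous.
  apply: col_continuous => t; have [_ /(_ t) h] := nB hz.
  have E i : glmx ((scal 2 z * y * g0^-1)%g (inl t)) i ord0 = gl1val (z (inl t)) * glmx ((y * g0^-1)%g (inl t)) i ord0.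
    rewrite (_ : glmx _ = (gl1val (z (inl t)))%:M *m glmx ((y * g0^-1)%g (inl t))); last by rewrite /= mulmxA.
    by rewrite mul_scalar_mx mxE.
  have z0 := av_gt0 (gl1val_neq0 (z (inl t))).
  rewrite -(ltr_pM2l z0) -!avM -!E; have := h ord0 ord0; have := h ord_max ord0.
  have real (a b : R) : `|a - 0| < 1/50%:R -> `|b - 1| < 1/50%:R -> `|a| < `|b|.
    by rewrite subr0 => h1; rewrite ltr_norml => /andP[h2 h3]; rewrite (gtr0_norm (x := b)); lra.
  by rewrite ![(1%:M : 'M[R]_2) _ _]mxE /= mulr0n mulr1n; exact: real.
apply: (@continuous_comp _ _ _ (fun y => (scal 2 ((col (y * g0^-1))^-1)%g, y)) (fun p : GA 2 * GA 2 => (p.1 * p.2)%g)).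
  apply: pair_continuous; last by move=> U; exact.
  apply: (@continuous_comp _ _ _ (fun y => ((col (y * g0^-1)%g)^-1)%g) (@scal R F Fhat 2)); last exact: scal_continuous.
  by apply: (@continuous_comp _ _ _ (fun y => (col (y * g0^-1)%g)) (fun x : GA 1 => x^-1)%g); [exact: c1|exact: GA_inv_continuous].
exact: GA_mul_continuous.
Qed.

(** The invariant set obtained from [E] by the section. It is compatible with
    countable set operations, so that the case of open sets carries over to
    Borel sets. *)
Definition transp (E : set (GA 2)) : set (GA 2) :=
  [set x | exists g, [/\ GF 2 g, ZB (g * x)%g & E (sect (g * x)%g)]].

Lemma transp_open E : open E -> open (transp E).
Proof.
move=> oE; rewrite openE => x [g [hg Zx Ex]].
have c : {for x, continuous (fun y => sect (g * y)%g)}.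
  by apply: (@continuous_comp _ _ _ (fun y => g * y)%g sect); [exact: GA_mull_continuous|exact: sect_continuous].
have n1 : nbhs x [set y | ZB (g * y)%g].
  by apply: (GA_mull_continuous (c := g)); apply: open_nbhs_nbhs; split=> //; exact: ZB_open.
have n2 : nbhs x [set y | E (sect (g * y)%g)] by apply: c; apply: open_nbhs_nbhs.
by apply: filterS2 n1 n2 => y h1 h2; exists g.
Qed.

Lemma transp_invariant E c x : Gam c -> (transp E (c * x)%g <-> transp E x).
Proof.
move: c x; apply: invariantP => c x [[z0 _ <-]|hc] [g [hg Zx Ex]].
  have e : (g * (scal 2 z0 * x))%g = (scal 2 z0 * (g * x))%g by rewrite !mulgA scalC.
  by exists g; rewrite e sect_scal; split=> //; exact: ZB_scal.
by exists (g * c^-1)%g; rewrite -mulgA mulKg; split=> //; apply: GFM => //; exact: GFV.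
Qed.

Lemma satE x : sat B x <-> exists2 g, GF 2 g & ZB (g * x)%g.
Proof.
split=> [[g [z [hg h]]]|[g hg [z h]]]; last by exists g, z; rewrite -scalC -mulgA.
by exists g => //; exists z; rewrite mulgA scalC.
Qed.

Lemma transpC E : transp (~` E) = sat B `\` transp E.
Proof.
apply/seteqP; split=> [x [g [hg Zx Ex]]|x [/satE[g hg Zx] nE]]; last first.
  by exists g; split=> // h; apply: nE; exists g.
split; first by apply/satE; exists g.
move=> [g' [hg' Zx' Ex']]; apply: Ex.
have [z Bz] := Zx; have [z' Bz'] := Zx'.
have gg : GF 2 (g' * g^-1)%g by apply: GFM => //; exact: GFV.
have [|c hc ec] := box_discrete (z := (z' * z^-1)%g) gg Bz Bz'.
  rewrite -scalC -!mulgA [(scal 2 z * (g * x))%g]mulgA [(scal 2 z * g)%g]scalC -mulgA mulKg.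
  rewrite [(g' * (scal 2 z * x))%g]mulgA -scalC -[(scal 2 z * g' * x)%g]mulgA mulgA -scalM.
  by rewrite mulgKV.
by rewrite (_ : (g * x)%g = (scal 2 (c^-1) * (g' * x))%g) ?sect_scal // scalV -ec invMg invgK -!mulgA mulKg.
Qed.

Lemma transp_gen E : borel E -> <<s smooth_open >> (transp E).
Proof.
have sa : sigma_algebra setT [set E | <<s smooth_open >> (transp E)].
  split=> /=.
  - rewrite (_ : transp set0 = set0); first exact: sigma_algebra0.
    by rewrite -subset0 => x [g [_ _ []]].
  - move=> A hA; rewrite setTD transpC.
    apply: (@measurableD _ (g_sigma_algebraType smooth_open)); last exact: hA.
    by apply: open_smooth_gen; [exact: sat_open|move=> c x hc; exact: sat_invariant].
  - move=> A hA; rewrite (_ : transp _ = \bigcup_n transp (A n)).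
      by apply: sigma_algebra_bigcup => n; exact: hA.
    apply/seteqP; split=> [x [g [hg Zx [n _ An]]]|x [n _ [g [hg Zx An]]]].
      by exists n => //; exists g.
    by exists g; split=> //; exists n.
move: E; apply: smallest_sub => // U oU /=.
by apply: open_smooth_gen; [exact: transp_open|move=> c x hc; exact: transp_invariant].
Qed.

Lemma transp_qborel E : qborel Gam E -> transp E = E `&` sat B.
Proof.
move=> [_ iE]; have eE g x : GF 2 g -> (E (sect (g * x)%g) <-> E x).
  move=> hg; rewrite /sect iE; last by left; exists (col (g * x * g0^-1)%g)^-1%g.
  by rewrite iE //; right.
apply/seteqP; split=> [x [g [hg Zx Ex]]|x [Ex /satE[g hg Zx]]].
  by split; [apply/(eE g x hg)|apply/satE; exists g].
by exists g; split=> //; apply/(eE g x hg).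
Qed.

End OneBox.

Variable mu : qmeasure R Gam.
Hypothesis hmu : invariant_measure setT mu.

Definition goodbox (k : nat) := exists2 g0, near_box g0 (Bk k) & (mu (sat (Bk k)) < +oo)%E.

Lemma goodbox_at (g0 : GA 2) U : nbhs g0 U -> exists k, [/\ goodbox k, Bk k g0 & Bk k `<=` U].
Proof.
move=> hU; have [_ _ /(_ g0)[V [oV [bV iV] Vg Vfin]] _] := hmu; have [oB sB hB] := BkP.
have nV : nbhs g0 V by apply: open_nbhs_nbhs.
have nn : nbhs g0 [set x | nearone d0 (x * g0^-1)%g].
  have c : {for g0, continuous (fun x => x * g0^-1)%g} by exact: GA_mulr_continuous.
  by apply: c; rewrite mulgV; exact: nearone_nbhs.
have [k Bg Bs] := hB g0 _ (filterI hU (filterI nV nn)); exists k; split=> //; last by move=> x /Bs[].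
exists g0; first by move=> x /Bs[_ []].
apply: le_lt_trans Vfin; apply: le_measure; rewrite ?inE ?qmeasurableE.
- split; first by apply: borel_open; apply: sat_open; exact: oB.
  by move=> c x hc; exact: sat_invariant.
- by split.
- by apply: sat_sub => // x /Bs[_ []].
Qed.

Lemma qborel_gen E : qborel Gam E -> <<s smooth_open >> E.
Proof.
move=> hE; pose A n := if pselect (goodbox n) then E `&` sat (Bk n) else set0.
have -> : E = \bigcup_n A n.
  apply/seteqP; split=> [x Ex|x [n _]]; last by rewrite /A; case: pselect => [_ []|_ []].
  have [k [gk Bx _]] := goodbox_at (@filterT _ (nbhs x) _); exists k => //.
  by rewrite /A; case: pselect => [h|h] /=; [split=> //; exact: sub_sat|case: h].
apply: sigma_algebra_bigcup => n; rewrite /A; case: pselect => [gb|h] /=; last exact: sigma_algebra0.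
have [g0 nb _] := gb.
have [oB _ _] := BkP; rewrite -(@transp_qborel g0 (Bk n) E hE).
by apply: transp_gen => //; case: hE.
Qed.

Lemma smooth_open_qborel P : smooth_open P -> qborel Gam P.
Proof. by move=> [oP iP _]; split=> //; exact: borel_open. Qed.

(** Every measurable set of the quotient is glued from its traces on countably
    many good boxes, where the section of the centre reduces it to a Borel set
    of the adelic group. *)
Lemma qborel_smooth_gen : qborel Gam = <<s smooth_open >>.
Proof.
apply/seteqP; split; first by move=> E; exact: qborel_gen.
by apply: smallest_sub; [exact: qborel_sigma|exact: smooth_open_qborel].
Qed.

End Boxes.

(** * Forms orthogonal to all smooth forms *)

Section AePi.
Context d (T : measurableType d) (R : realType) (mu : {measure set T -> \bar R}).

(** The sets over which the integral of [f] vanishes form a Dynkin class. *)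
Lemma ae_zero_pi (G : set (set T)) (f : T -> R) : measurable = <<s G>> -> setI_closed G -> G setT ->
  mu.-integrable setT (EFin \o f) -> (forall S, G S -> (\int[mu]_(x in S) (f x)%:E = 0)%E) ->
  ae_eq mu setT (EFin \o f) (cst 0%E).
Proof.
move=> mG GI GT fint h0; have iS S : measurable S -> mu.-integrable S (EFin \o f).
  by move=> mS; apply: (integrableS measurableT mS _ fint).
apply: (integral_ae_eq measurableT fint (measurable_cst _)) => E _ mE; rewrite integral_cst // mul0e.
move: (mE); rewrite {1}mG; apply: (@dynkin_induction _ T G (fun S => (\int[mu]_(x in S) (f x)%:E = 0)%E)) => //.
- exact: h0.
- move=> S mS hS; have mC := measurableC mS.
  have dS : [disjoint S & ~` S]%classic by apply/disj_setPS; rewrite setICr.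
  have := @Rintegral_setU _ T R mu S (~` S) f mS mC _ dS; rewrite setUv => /(_ fint); rewrite /Rintegral hS h0 //= add0r => e.
  have fin : (\int[mu]_(x in ~` S) (f x)%:E)%E \is a fin_num by apply: integrable_fin_num => //; exact: iS.
  by rewrite -(fineK fin) -e.
- move=> A mA tA hA; rewrite integral_bigcup //; last by apply: iS; exact: bigcup_measurable.
  by apply: eseries0 => i _ _; exact: hA.
Qed.

End AePi.

Section Smooth.
Variables (R : realType) (F : splittingFieldType rat).
Variable Fhat : forall v : finPlace F, completion R v.
Hypothesis hgal : galois 1%AS {:F}.
Hypothesis hreal : totally_real R F.
Local Notation C := R[i].
Local Notation GA n := (GA Fhat n).
Local Notation GAf n := (GAf Fhat n).
Local Notation GF n := (GF Fhat n).
Variable K : forall v : finPlace F, set (GL 2 (Fhat v)).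
Arguments K : clear implicits.
Variable mu : qmeasure R (adelic_center Fhat `|` GF 2).
Hypothesis hmu : invariant_measure setT mu.
Variable omega : GA 1 -> C.
Hypothesis gom : goodchar K omega.
Local Notation Gam := (adelic_center Fhat `|` GF 2).
Local Notation Q := (g_sigma_algebraType (qborel Gam)).
Local Notation B := (g_sigma_algebraType (@open (GA 2))).
Local Notation L2 := (L2 mu omega).
Local Notation ip := (ip mu omega).
Local Notation form := (Defs.form Fhat).
Local Notation wt := (wt omega).
Local Notation sqno := (sqn omega).
Local Notation denso := (dens omega).

Lemma d0_exists : exists d : finPlace F -> R, cgood d /\ forall z, cong Fhat 1 d z -> omega (of_fin z) = 1.
Proof. by have [d hd h] := gc_small gom; exists d. Qed.
Definition d0 := projT1 (cid d0_exists).
Lemma hd0 : cgood d0. Proof. by have [] := projT2 (cid d0_exists). Qed.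
Lemma d0P z : cong Fhat 1 d0 z -> omega (of_fin z) = 1. Proof. by have [_] := projT2 (cid d0_exists); exact. Qed.

Lemma congr_scal (L : avField R) e (z : GL 1 L) : congr e (gl_scal 2 z) -> congr e z.
Proof.
move=> [ih nh]; split.
  move=> i j; have [h1 h2] := ih ord0 ord0; rewrite !ord1; move: h1 h2.
  by rewrite [in X in _ -> _ -> _ /\ X](mx11_scalar (glmx z)) /= !invmx_scalar !mxE eqxx !mulr1n.
by move=> i j; have := nh ord0 ord0; rewrite !ord1 !mxE eqxx !mulr1n.
Qed.

(** On the stabilizers of a small box the central character is positive, so
    that it disappears from phases. *)
Lemma omega_pos (g : GA 2) z (g0 : GA 2) k b b' : near_box d0 g0 (Bk hgal k) -> GF 2 g -> Bk hgal k b -> Bk hgal k b' ->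
  (g * scal 2 z * b)%g = b' -> 0 < omega z.
Proof.
move=> nb hg hb hb' e; have [c hc ec] := box_discrete hgal hreal nb hg hb hb' e.
have e' : (scal 2 (c * z)%g * (b * g0^-1))%g = (b' * g0^-1)%g by rewrite scalM -ec mulgA e.
have [h1 h2] := nearone_scal hd0 (nb _ hb) (nb _ hb') e'.
have -> : omega z = omega (c * z)%g by rewrite (gcM gom) (gc_GF gom hc) mul1r.
rewrite (inf_fin_decomp (c * z)%g) (gcM gom) d0P ?mulr1; last by move=> v; apply: congr_scal; exact: h1.
exact: (gc_pos gom).
Qed.

Definition smooth_form (l : form) := exists2 d, cgood d & forall w, cong Fhat 2 d w -> frtrans w l = l.

Lemma wt_small : exists2 d, cgood d & forall w, cong Fhat 2 d w -> wt (of_fin w) = 1.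
Proof.
have n : nbhs (1%g : GAf 2) [set w | cong Fhat 1 d0 (fin_part (adet (of_fin w)))].
  have c : {for (1%g : GAf 2), continuous (fun w => fin_part (adet (of_fin w)))}.
    apply: (@continuous_comp _ _ _ (fun w : GAf 2 => adet (of_fin w)) (@fin_part R F Fhat 1)); last exact: fin_part_continuous.
    by apply: (@continuous_comp _ _ _ (@of_fin R F Fhat 2) (@adet R F Fhat 2)); [exact: of_fin_continuous|exact: adet_continuous].
  apply: c; rewrite of_fin1 adet1 (_ : fin_part 1%g = 1%g); first exact: (cong_nbhs Fhat 1 hd0).
  exact: GAf_ext.
have [d hd h] := cong_base n; exists d => // w hw; rewrite /wt.
rewrite (_ : adet (of_fin w) = of_fin (fin_part (adet (of_fin w)))).
  by rewrite d0P; [rewrite /= expr0n addr0 expr1n sqrtr1|exact: h].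
by apply: GA_ext => -[t|v] //; apply: glmx_inj; rewrite /= det1.
Qed.

Lemma locconst_measurable (V : set (GA 2)) (f : GA 2 -> R) : open V -> (forall x, ~ V x -> f x = 0) ->
  (forall x, V x -> \forall y \near x, f y = f x) -> measurable_fun setT (f : B -> R).
Proof.
move=> oV f0 fc _ Y mY; rewrite setTI.
have oW : open (V `&` f @^-1` Y).
  rewrite openE => x [Vx Yx]; have n : nbhs x V by apply: open_nbhs_nbhs.
  by apply: filterS2 n (fc x Vx) => y Vy e; split=> //; rewrite /preimage /= e.
have [Y0|Y0] := pselect (Y 0).
  rewrite (_ : f @^-1` Y = (V `&` f @^-1` Y) `|` ~` V).
    by apply: borelU; [exact: borel_open|apply: borelC; exact: borel_open].
  apply/seteqP; split=> [x hx|x [[]//|nV]]; last by rewrite /preimage /= f0.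
  by have [Vx|nV] := pselect (V x); [left|right].
rewrite (_ : f @^-1` Y = V `&` f @^-1` Y); first exact: borel_open.
apply/seteqP; split=> [x hx|x []//]; split=> //.
by apply: contrapT => nV; apply: Y0; rewrite -(f0 x nV).
Qed.

Section TestForm.
Variables (k : nat) (g0 : GA 2).
Hypothesis nb : near_box d0 g0 (Bk hgal k).
Hypothesis fb : (mu (sat (Bk hgal k)) < +oo)%E.
Local Notation E := (sat (Bk hgal k)).

Let ex x := exists p : GA 2 * GA 1, GF 2 p.1 /\ Bk hgal k (p.1 * scal 2 p.2 * x)%g.
Lemma exE x : E x <-> ex x.
Proof. by split=> [[g [z h]]|[[g z] h]]; [exists (g, z)|exists g, z]. Qed.

(** The phase of the scalar moving a point into the box does not depend on the
    scalar, since the central character is positive on the scalars joining two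
    points of the box. *)
Definition phase (x : GA 2) : C := if pselect (ex x) is left e
  then (omega (projT1 (cid e)).2)^-1 * (Normc.normc (omega (projT1 (cid e)).2))%:C%C else 0.

Lemma rcV (a : R) : (a^-1)%:C%C = (a%:C%C)^-1 :> C.
Proof. by rewrite fmorphV. Qed.

Lemma normc_pos (z : C) : 0 < z -> (Normc.normc z)%:C%C = z.
Proof.
case: z => a b; rewrite ltcE /= => /andP[/eqP -> a0].
by rewrite expr0n addr0 sqrtr_sqr gtr0_norm.
Qed.

Lemma phaseE g z x : GF 2 g -> Bk hgal k (g * scal 2 z * x)%g ->
  phase x = (omega z)^-1 * (Normc.normc (omega z))%:C%C.
Proof.
move=> hg hb; rewrite /phase; case: pselect => [e|[]] /=; last by exists (g, z).
case: (cid e) => -[g' z'] /= [hg' hb'].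
have gg : GF 2 (g * g'^-1)%g by apply: GFM => //; exact: GFV.
have := omega_pos (z := (z * z'^-1)%g) nb gg hb' hb.
have -> : (g * g'^-1 * scal 2 (z * z'^-1) * (g' * scal 2 z' * x))%g = (g * scal 2 z * x)%g.
  exact: gz_cancel.
move=> /(_ erefl); rewrite (gcM gom) (chiV (gc1 gom) (gcM gom)).
have z0 := omega_neq0 gom z; have z'0 := omega_neq0 gom z'.
move=> h; have := normc_pos h; rewrite Normc.normcM Normc.normcV rcM rcV => e1.
have n0 : (Normc.normc (omega z'))%:C%C != 0 :> C by rewrite fmorph_eq0 normc_eq0.
have -> : (Normc.normc (omega z))%:C%C = omega z / omega z' * (Normc.normc (omega z'))%:C%C by rewrite -e1 mulfVK.
by move: (omega z) (omega z') (_%:C%C) z0 z'0 n0 => a b c a0 b0 c0; field; rewrite a0 b0.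
Qed.

Lemma phase0 x : ~ E x -> phase x = 0.
Proof. by move=> nE; rewrite /phase; case: pselect => [e|//]; case: nE; apply/exE. Qed.

Lemma phase_near x : E x -> \forall y \near x, phase y = phase x.
Proof.
move=> [g [z [hg h]]]; have [oB _ _] := BkP Fhat hgal.
have n : nbhs x [set y | Bk hgal k (g * scal 2 z * y)%g].
  by apply: (GA_mull_continuous (c := (g * scal 2 z)%g)); apply: open_nbhs_nbhs; split=> //; exact: oB.
by apply: filterS n => y hy; rewrite (phaseE hg h) (phaseE hg hy).
Qed.

Lemma phase_norm x : E x -> Normc.normc (phase x) = 1.
Proof.
move=> [g [z [hg h]]]; rewrite (phaseE hg h) Normc.normcM Normc.normcV normc_real ger0_norm ?normc_ge0 //.
by rewrite mulVf // normc_eq0 (omega_neq0 gom).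
Qed.

Lemma phase_GF c x : GF 2 c -> phase (c * x)%g = phase x.
Proof.
move=> hc; have [[g [z [hg h]]]|nE] := pselect (E x); last first.
  by rewrite !phase0 // => h; apply: nE; apply/(sat_invariant hreal (Bk hgal k) (c := c)) => //; right.
have h' : Bk hgal k (g * c^-1 * scal 2 z * (c * x))%g.
  rewrite (_ : (g * c^-1 * scal 2 z * (c * x))%g = (g * scal 2 z * x)%g) //.
  by rewrite -!mulgA [(c^-1 * (scal 2 z * _))%g]mulgA -scalC -mulgA mulKg.
by rewrite (phaseE hg h) (phaseE _ h') //; apply: GFM => //; exact: GFV.
Qed.

Lemma phase_scal z0 x : phase (scal 2 z0 * x)%g = omega z0 / (Normc.normc (omega z0))%:C%C * phase x.
Proof.
have [[g [z [hg h]]]|nE] := pselect (E x); last first.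
  rewrite !phase0 ?mulr0 // => h; apply: nE.
  by apply/(sat_invariant hreal (Bk hgal k) (c := scal 2 z0)) => //; left; exists z0.
have h' : Bk hgal k (g * scal 2 (z * z0^-1) * (scal 2 z0 * x))%g by rewrite scalM scalV -!mulgA mulKg mulgA.
rewrite (phaseE hg h) (phaseE hg h') (gcM gom) (chiV (gc1 gom) (gcM gom)) Normc.normcM Normc.normcV rcM rcV.
have n0 : (Normc.normc (omega z0))%:C%C != 0 :> C by rewrite fmorph_eq0 normc_eq0 (omega_neq0 gom).
have z0' := omega_neq0 gom z; have z00 := omega_neq0 gom z0.
by move: (omega z) (omega z0) (_%:C%C) (_%:C%C) z0' z00 n0 => a b c d a0 b0 d0'; field; rewrite a0 b0 d0'.
Qed.

Lemma phase_smooth : exists2 d, cgood d & forall x w, cong Fhat 2 d w -> phase (x * of_fin w)%g = phase x.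
Proof.
have [_ /(_ k)[d hd sB] _] := BkP Fhat hgal; exists d => // x w hw.
have [[g [z [hg h]]]|nE] := pselect (E x).
  by rewrite (phaseE hg h) (phaseE (g := g) (z := z)) // mulgA; exact: sB.
rewrite !phase0 // => -[g [z [hg h]]]; apply: nE; exists g, z; split=> //.
by have := sB _ _ h (congV hd hw); rewrite of_finV -!mulgA mulgV mulg1.
Qed.

(** A form with absolute value [Num.sqrt (wt x)] on the part of [P] in the
    saturated box, so that pairing with it computes integrals over [P]. *)
Definition testform (P : set (GA 2)) : form := fun x => if x \in P then phase x * (Num.sqrt (wt x))%:C%C else 0.

Lemma sqr_sqrt_wt x : Num.sqrt (wt x) ^+ 2 = wt x.
Proof. by rewrite sqr_sqrtr // ltW // (wt_gt0 gom). Qed.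

Lemma normc_testform P x : Normc.normc (testform P x) <= \1_E x * Num.sqrt (wt x).
Proof.
have s0 : 0 <= Num.sqrt (wt x) by exact: sqrtr_ge0.
rewrite /testform indicE; have [Ex|nE] := pselect (E x); last first.
  rewrite phase0 // mul0r if_same /= expr0n addr0 sqrtr0; by rewrite mulr_ge0 // ler0n.
rewrite (mem_set Ex) mul1r; case: ifP => _; last by rewrite /= expr0n addr0 sqrtr0.
by rewrite Normc.normcM phase_norm // mul1r normc_real ger0_norm.
Qed.

Lemma satE_qborel : qborel Gam E.
Proof. exact: (smooth_open_qborel (satBk_smooth_open Fhat hgal hreal k)). Qed.

Lemma testform_L2 P : smooth_open P -> L2 (testform P).
Proof.
move=> [oP iP _]; have [oB _ _] := BkP Fhat hgal.
have mpart (f : C -> R) : f 0 = 0 -> measurable_fun setT ((fun x => f (if x \in P then phase x else 0)) : B -> R).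
  move=> f0; apply: (@locconst_measurable (E `&` P)); first by apply: openI => //; apply: sat_open; exact: oB.
    move=> x nEP; case: ifP => // /set_mem Px; rewrite phase0 // => Ex; exact: nEP.
  move=> x [Ex Px]; have n : nbhs x P by apply: open_nbhs_nbhs.
  by apply: filterS2 n (phase_near Ex) => y Py e; rewrite (mem_set Px) (mem_set Py) e.
have msq : measurable_fun setT ((fun x => Num.sqrt (wt x)) : B -> R).
  apply: borel_continuous => x; apply: (@continuous_comp _ _ _ wt Num.sqrt); first exact: (wt_continuous gom).
  exact: sqrt_continuous.
apply: (@L2_intro R F Fhat hreal K mu omega gom (testform P) _ _ _ (\1_E : GA 2 -> R)).
- split.
    rewrite (_ : (fun x => _) = (fun x => complex.Re (if x \in P then phase x else 0) * Num.sqrt (wt x))).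
      by apply: measurable_funM => //; exact: mpart.
    by apply/funext => x; rewrite /testform; case: ifP => _; [case: (phase x) => a b /=; rewrite mulr0 subr0|rewrite /= mul0r].
  rewrite (_ : (fun x => _) = (fun x => complex.Im (if x \in P then phase x else 0) * Num.sqrt (wt x))).
    by apply: measurable_funM => //; exact: mpart.
  by apply/funext => x; rewrite /testform; case: ifP => _; [case: (phase x) => a b /=; rewrite mulr0 add0r|rewrite /= mul0r].
- move=> c x hc; rewrite /testform phase_GF // (wtM gom) (wt_GF hreal gom) // mul1r.
  by rewrite (_ : ((c * x)%g \in P) = (x \in P)) //; apply/idP/idP => /set_mem h; apply/mem_set; apply/(iP c x _) => //; right.
- move=> z x; rewrite /testform phase_scal (wtM gom) (wt_scal gom).
  have Gz : Gam (scal 2 z) by left; exists z.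
  rewrite (_ : ((scal 2 z * x)%g \in P) = (x \in P)); last by apply/idP/idP => /set_mem h; apply/mem_set; apply/(iP _ x Gz).
  case: ifP => _; last by rewrite mulr0.
  rewrite sqrtrM ?sqr_ge0 // sqrtr_sqr ger0_norm ?normc_ge0 // rcM.
  have n0 : (Normc.normc (omega z))%:C%C != 0 :> C by rewrite fmorph_eq0 normc_eq0 (omega_neq0 gom).
  by move: (_%:C%C) (_%:C%C) (phase x) n0 => a b c a0; field.
- apply/integrableP; have mE : measurable (E : set Q) by rewrite qmeasurableE; exact: satE_qborel.
  split; first by apply/measurable_EFinP; exact: measurable_indic.
  rewrite (_ : (fun x => _) = (fun x => (\1_E x)%:E)); last first.
    by apply/funext => x /=; rewrite indicE ger0_norm // ler0n.
  by rewrite integral_indic // setIT.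
- move=> x; rewrite /sqn ler_pdivrMr ?(wt_gt0 gom) //.
  have := normc_testform P x; have := normc_ge0 (testform P x); rewrite -{2}sqr_sqrt_wt indicE.
  case: (x \in E) => /= h1 h2; first by rewrite mul1r ler_sqr ?nnegrE ?sqrtr_ge0 //; rewrite mul1r in h2.
  by move: h2; rewrite !mul0r => h2; rewrite (_ : Normc.normc _ = 0) ?expr0n //; apply/eqP; rewrite eq_le h2 h1.
Qed.

Lemma testform_smooth P : smooth_open P -> smooth_form (testform P).
Proof.
move=> [_ _ [dP hdP sP]]; have [d1 hd1 sph] := phase_smooth; have [d2 hd2 swt] := wt_small.
exists (fun v => Num.min (dP v) (Num.min (d1 v) (d2 v))); first by do 2!apply: cgood_min => //.
move=> w hw; have [h1 h23] := cong_min hw; have [h2 h3] := cong_min h23.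
apply/funext => x; rewrite /frtrans /rtrans /testform sph // (wtM gom) swt // mulr1.
rewrite (_ : ((x * of_fin w)%g \in P) = (x \in P)) //; apply/idP/idP => /set_mem h; apply/mem_set; last exact: sP.
by have := sP _ _ h (congV hdP h1); rewrite of_finV mulgK.
Qed.

Lemma orth_box y : L2 y -> (forall l, L2 l -> smooth_form l -> ip y l = 0) ->
  mu.-negligible [set x : Q | E x /\ sqno y x != 0].
Proof.
move=> hy h0; have hT := testform_L2 (smooth_openT Fhat).
pose phi x := denso y (testform setT) x.
have dE P x : denso y (testform P) x = if x \in P then phi x else 0.
  by rewrite /phi /dens /testform in_setT; case: ifP => // _; rewrite conjc0 mulr0 mul0r.
have [i1 i2] := dens_integrable hreal gom hy hT.
have z P : smooth_open P -> (\int[mu]_(x in P) complex.Re (phi x) = 0 /\ \int[mu]_(x in P) complex.Im (phi x) = 0)%R.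
  move=> hP; have := h0 _ (testform_L2 hP) (testform_smooth hP); rewrite ipE /cint => -[e1 e2].
  have eR : (fun x => complex.Re (denso y (testform P) x)) = (fun x : Q => complex.Re (phi x)) \_ P.
    by apply/funext => x; rewrite dE /patch; case: ifP.
  have eI : (fun x => complex.Im (denso y (testform P) x)) = (fun x : Q => complex.Im (phi x)) \_ P.
    by apply/funext => x; rewrite dE /patch; case: ifP.
  split.
    exact: (etrans (Rintegral_mkcond mu P _) (etrans (f_equal (fun f : Q -> R => Rintegral mu setT f) (esym eR)) e1)).
  exact: (etrans (Rintegral_mkcond mu P _) (etrans (f_equal (fun f : Q -> R => Rintegral mu setT f) (esym eI)) e2)).
have mG : @measurable _ Q = <<s smooth_open (Fhat := Fhat) >>.
  apply/seteqP; split=> A; rewrite -[X in <<s X >>]/(smooth_open (Fhat := Fhat)) qmeasurableE; rewrite (qborel_smooth_gen hgal hreal hd0 hmu) //.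
have ae f : mu.-integrable setT (EFin \o (f : Q -> R)) -> (forall P, smooth_open P -> \int[mu]_(x in P) f x = 0) ->
    mu.-negligible [set x : Q | f x != 0].
  move=> fi hf; have := @ae_zero_pi _ Q R mu (smooth_open (Fhat := Fhat)) f mG (@smooth_openI R F Fhat) (smooth_openT Fhat) fi.
  have h S : smooth_open S -> (\int[mu]_(x in S) (f x)%:E = 0)%E.
    move=> hS; have mS : measurable (S : set Q) by rewrite qmeasurableE; exact: smooth_open_qborel.
    by rewrite -(fineK (integrable_fin_num mS (integrableS measurableT mS (@subsetT _ _) fi))) -/(Rintegral _ _ _) hf.
  by move=> /(_ h); apply: negligibleS => x /= /eqP fx; apply: contra_not fx => /(_ I) [].
have := negligibleU (ae _ i1 (fun P hP => (z P hP).1)) (ae _ i2 (fun P hP => (z P hP).2)).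
apply: negligibleS => x [Ex sx] /=.
apply: contrapT => /not_orP[/negP/negPn/eqP h1 /negP/negPn/eqP h2]; case/negP: sx.
have phi0 : phi x = 0 by move: h1 h2; rewrite -/(phi x); case: (phi x) => a b /= -> ->.
have w0 : (wt x)%:C%C != 0 :> C by rewrite fmorph_eq0 gt_eqF // (wt_gt0 gom).
have s0 : (Num.sqrt (wt x))%:C%C != 0 :> C by rewrite fmorph_eq0 gt_eqF // sqrtr_gt0 (wt_gt0 gom).
have p0 : phase x != 0 by rewrite -normc_eq0 phase_norm // oner_eq0.
have y0 : y x = 0.
  apply/eqP; apply: contraT => yn.
  have : phi x != 0 by rewrite /phi /dens /testform in_setT mulf_neq0 ?invr_eq0 // mulf_neq0 // conjc_eq0 mulf_neq0.
  by rewrite phi0 eqxx.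
by rewrite /sqn y0 /= expr0n addr0 sqrtr0 expr0n mul0r.
Qed.

End TestForm.

(** Pairing with all test forms shows that the integrals of [y] times a fixed
    phase vanish on all smooth open subsets of a good box; these generate the
    measurable sets, and countably many good boxes cover the quotient. *)
Lemma smooth_orth y : L2 y -> (forall l, L2 l -> smooth_form l -> ip y l = 0) -> ipnull ip y.
Proof.
move=> hy h0; rewrite /ipnull /= (ip_sqn mu omega).
have neg : mu.-negligible [set x : Q | sqno y x != 0].
  pose A k : set Q := if pselect (goodbox hgal d0 mu k) then [set x : Q | sat (Bk hgal k) x /\ sqno y x != 0] else set0.
  have : mu.-negligible (\bigcup_k A k).
    apply: negligible_bigcup => k; rewrite /A; case: pselect => [[g0 nb fb]|n] /=; last exact: negligible_set0.
    exact: orth_box nb fb _ hy h0.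
  apply: negligibleS => x sx; have [k [gk Bx _]] := goodbox_at hgal hreal hd0 hmu (@filterT _ (nbhs (x : GA 2)) _).
  by exists k => //; rewrite /A; case: pselect => [h|h] /=; [split=> //; exact: sub_sat|case: h].
have ms := sqn_measurable hreal gom hy.
have : (\int[mu]_(x in setT) `|(sqno y (x : Q))%:E|)%E = 0%E.
  have [_ h] := @ae_eq_integral_abs _ Q R mu setT measurableT (fun x : Q => (sqno y x)%:E) (proj2 (measurable_EFinP _ _) ms).
  by apply: h; apply: negligibleS neg => x /= h; apply/eqP => e; apply: h => _; rewrite /= e.
rewrite (eq_integral (fun x : Q => (sqno y x)%:E)); last by move=> x _ /=; rewrite ger0_norm // (sqn_ge0 gom).
by rewrite /Rintegral => ->.
Qed.

End Smooth.

(** * Compactness of the unipotent quotient *)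

Section Upper.
Variables (R : realType) (L : avField R).

Definition upper_mx (x : L) : 'M[L]_2 :=
  \matrix_(i, j) if (i == ord0) && (j == ord_max) then x else (i == j)%:R.
Lemma upper_unit x : upper_mx x \in unitmx.
Proof. by rewrite unitmxE det2 !mxE /= mulr0 subr0 mulr1 unitr1. Qed.
Definition upper x : GL 2 L := MkGL (upper_unit x).

Lemma upperM x y : (upper x * upper y)%g = upper (x + y).
Proof.
apply: glmx_inj; rewrite (_ : glmx (_ * _)%g = upper_mx x *m upper_mx y) //.
by apply/matrixP; apply: ord2P; apply: ord2P; rewrite [LHS]mxE sum2 !mxE /= ?mul0r ?mulr0 ?mul1r ?mulr1 ?addr0 ?add0r // addrC.
Qed.

Lemma upper0 : upper 0 = 1%g.
Proof. by apply: glmx_inj; apply/matrixP; apply: ord2P; apply: ord2P; rewrite !mxE. Qed.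

Lemma upperV x : ((upper x)^-1)%g = upper (- x).
Proof. by apply: (mulgI (upper x)); rewrite mulgV upperM subrr upper0. Qed.

Lemma upper_integral x : av x <= 1 -> gl_integral (upper x).
Proof.
have h y : av y <= 1 -> forall i j, av (upper_mx y i j) <= 1.
  by move=> hy; apply: ord2P; apply: ord2P; rewrite mxE /= ?av0 ?av1 ?ler01.
move=> hx i j; split; first exact: h.
by rewrite (_ : invmx _ = glmx ((upper x)^-1)%g) // upperV; apply: h; rewrite avN.
Qed.

Lemma upper_near x e : 0 < e -> av x < e -> glnear 1%g e (upper x).
Proof.
by move=> e0 hx; apply: ord2P; apply: ord2P; rewrite !mxE /= ?mulr1n ?mulr0n ?subr0 ?subrr ?av0.
Qed.

End Upper.

Section Unipotent.
Variables (R : realType) (F : splittingFieldType rat).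
Variable Fhat : forall v : finPlace F, completion R v.
Hypothesis hgal : galois 1%AS {:F}.
Hypothesis hreal : totally_real R F.
Local Notation GA n := (GA Fhat n).
Local Notation GF n := (GF Fhat n).
Local Notation place := (place R F).
Local Notation unip := (unipotent Fhat).

Definition uval (g : GA 2) v : lfield Fhat v := glmx (g v) ord0 ord_max.

Lemma unipE g : unip g -> forall v, g v = upper (uval g v).
Proof.
move=> h v; apply: glmx_inj; have [h1 h2 h3] := h v.
by apply/matrixP; apply: ord2P; apply: ord2P; rewrite !mxE /= ?h1 ?h2 ?h3.
Qed.

Lemma unip_upper (g : GA 2) (a : forall v, lfield Fhat v) : (forall v, g v = upper (a v)) ->
  unip g /\ forall v, uval g v = a v.
Proof. by move=> h; split=> v; rewrite /uval ?h /= ?mxE //=; split; rewrite h mxE. Qed.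

Lemma unip_mulE g h : unip g -> unip h -> forall v, (g * h)%g v = upper (uval g v + uval h v).
Proof. by move=> hg hh v; rewrite -upperM -!unipE. Qed.
Lemma unipM g h : unip g -> unip h -> unip (g * h)%g.
Proof. by move=> hg hh; have [] := unip_upper (unip_mulE hg hh). Qed.
Lemma uvalM g h v : unip g -> unip h -> uval (g * h)%g v = uval g v + uval h v.
Proof. by move=> hg hh; have [_ ->] := unip_upper (unip_mulE hg hh). Qed.
Lemma unip_invE g : unip g -> forall v, (g^-1)%g v = upper (- uval g v).
Proof. by move=> hg v; rewrite -upperV -unipE. Qed.
Lemma unipV g : unip g -> unip (g^-1)%g.
Proof. by move=> hg; have [] := unip_upper (unip_invE hg). Qed.
Lemma uvalV g v : unip g -> uval (g^-1)%g v = - uval g v.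
Proof. by move=> hg; have [_ ->] := unip_upper (unip_invE hg). Qed.
Lemma unip1 : unip 1%g.
Proof. by have [] := @unip_upper 1%g (fun=> 0) (fun v => esym (upper0 _)). Qed.
Lemma unipC g h : unip g -> unip h -> (g * h = h * g)%g.
Proof.
by move=> hg hh; apply: GA_ext => v; rewrite (unip_mulE hg hh) (unip_mulE hh hg) addrC.
Qed.

Lemma small_multiple (s : seq (finPlace F)) (e : finPlace F -> R) : (forall v, 0 < e v) ->
  exists N : nat, (0 < N)%N /\ forall v, v \in s -> av (cemb (Fhat v) N%:R) < e v.
Proof.
move=> e0; elim: s => [|v s [N [N0 IH]]]; first by exists 1%N.
have [l pl vl] := place_rational_prime v.
have lt1 : av (cemb (Fhat v) l%:R) < 1 by apply/(c_prime (Fhat v)) => //; exact: intringN.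
have [m hm] := @geometric_small R (av (cemb (Fhat v) l%:R)) (2 / e v) ltac:(by rewrite av_ge0 lt1).
exists (N * l ^ m)%N; split; first by rewrite muln_gt0 N0 expn_gt0 prime_gt0.
have le1 w (k : nat) : av (cemb (Fhat w) k%:R) <= 1 by apply: c_int; exact: intringN.
move=> w; rewrite natrM rmorphM avM inE => /orP[/eqP ->|/IH h].
  rewrite natrX rmorphXn avX; apply: le_lt_trans (_ : av (cemb (Fhat v) l%:R) ^+ m < _).
    by rewrite ler_piMl // exprn_ge0 // av_ge0.
  move: hm; rewrite mulrA ler_pdivrMr // mul1r; have := exprn_ge0 m (av_ge0 (cemb (Fhat v) l%:R)).
  by have := e0 v; lra.
by apply: le_lt_trans h; rewrite ler_piMr ?av_ge0.
Qed.

Lemma unip_rational (x : F) : finite_set [set v | ~ av (cemb (Fhat v) x) <= 1] ->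
  exists g, [/\ GF 2 g, unip g & forall v, uval g v = lembR Fhat hreal v x].
Proof.
move=> fx; have fin : finite_set [set v | ~ rint (all_fam Fhat 2) v (upper (lembR Fhat hreal v x))].
  apply: sub_finite_set (finite_image (inr : _ -> place) fx) => -[t|v] /= h; first by case: h.
  exists v => // h1; apply: h; apply: upper_integral; rewrite -lembRE //.
pose g : GA 2 := @RProd _ (all_fam Fhat 2) _ fin.
have [ug eg] := @unip_upper g _ (fun v => erefl); exists g; split=> //.
apply/(GFP hreal); exists (\matrix_(i, j) if (i == ord0) && (j == ord_max) then x else (i == j)%:R).
  by rewrite unitmxE det2 !mxE /= mulr0 subr0 mulr1 unitr1.
by move=> v; apply/matrixP => i j; rewrite !mxE; case: ifP => // _; rewrite rmorph_nat.
Qed.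

(** Modulo the rational points and an arbitrarily small neighbourhood, the
    unipotent adelic points are finite in number: by strong approximation one
    can make the finite components small, and then the archimedean components
    bounded because the integers are cocompact. *)
Lemma unipotent_cover (U : set (GA 2)) : nbhs (1%g : GA 2) U ->
  exists (J : finType) (nj : J -> GA 2), (forall j, unip (nj j)) /\
    forall n, unip n -> exists g j o, [/\ GF 2 g, unip g, unip o, U o & n = (g * nj j * o)%g].
Proof.
move=> /(rprod_nbhsP (@all_rint_open R F Fhat 2))[V [[oV fV] V1 VU]].
have /choice[e he] : forall v, exists e : R, 0 < e /\ glnear 1%g e `<=` V v.
  by move=> v; have [e e0 h] := (gl_nbhsP _ _).1 (open_nbhs_nbhs (conj (oV v) (V1 v))); exists e.
have fS : finite_set [set v : finPlace F | V (inr v) <> rint (all_fam Fhat 2) (inr v)].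
  by apply: (@finite_preimage _ _ [set v | V v <> rint (all_fam Fhat 2) v] (inr : finPlace F -> place)) => // ? ? _ _ [].
have /finite_seqP[S eS] := fS.
have [N [N0 hN]] := small_multiple S (fun v => (he (inr v)).1).
have /finite_seqP[ts ets] := infPlace_finite R hgal.
have hts t : t \in ts by have : [set` ts] t by rewrite -ets.
have [eps eps0 heps] : exists2 eps, 0 < eps & forall t, eps <= e (inl t).
  have [eps eps0 h] := @finite_pos_lb R (seq_sub ts) (fun i => e (inl (ssval i))) (fun i => (he _).1).
  by exists eps => // t; have := h (SeqSub (hts t)).
have [c hc] := integers_cobounded hgal hreal.
pose L := (Num.truncn (c%:R * N%:R / eps : R)).+2.
pose grid (j : {ffun seq_sub ts -> 'I_(2 * L).+1}) t : realAV R := eps * ((j (SeqSub (hts t)))%:R - L%:R).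
pose nj j : GA 2 := of_inf Fhat (fun t => upper (grid j t)).
have njE j : forall v, nj j v = upper (match v return lfield Fhat v with inl t => grid j t | inr v => 0 end).
  by case=> [t|v] //=; rewrite upper0.
exists _, nj; split=> [j|n hn]; first by have [] := unip_upper (njE j).
have fn : finite_set [set v | ~ av (uval n (inr v)) <= 1].
  apply: sub_finite_set (@finite_preimage _ _ _ (inr : finPlace F -> place) _ (rvalP n)); last by move=> ? ? _ _ [].
  by move=> v /= h hh; apply: h; have [] := hh ord0 ord_max.
have [x hx] := strong_approximation_mod N0 fn.
have [y Oy hy] := hc (fun t => (uval n (inl t) - complex.Re (t x)) / N%:R).
pose X := x + N%:R * y.
have N1 v : av (cemb (Fhat v) N%:R) <= 1 by apply: c_int; exact: intringN.
have XN v : av (uval n (inr v) - cemb (Fhat v) X) <= av (cemb (Fhat v) N%:R).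
  rewrite /X rmorphD rmorphM opprD addrA; apply: le_trans (c_ultra _ _) _.
  by rewrite ge_max hx avN avM ler_piMr ?av_ge0 // c_int.
have fX : finite_set [set v | ~ av (cemb (Fhat v) X) <= 1].
  apply: sub_finite_set fn => v /= h hu; apply: h.
  rewrite -(subKr (uval n (inr v)) (cemb (Fhat v) X)); apply: le_trans (c_ultra _ _) _.
  by rewrite ge_max hu avN (le_trans (XN v)).
have [g [gF gu gE]] := unip_rational fX.
pose s (t : infPlace R F) : R := uval n (inl t) - complex.Re (t X).
have sb t : `|s t| <= c%:R * N%:R.
  have := hy t; rewrite -(ler_pM2r (x := N%:R : R)) ?ltr0n // -{2}(gtr0_norm (x := N%:R : R)) ?ltr0n // -normrM mulrBl.
  rewrite mulfVK ?pnatr_eq0 -?lt0n //; congr (`| _ | <= _).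
  have lR z : complex.Re (t z) = lembR Fhat hreal (inl t) z by rewrite -lembRE.
  rewrite /s !lR /X rmorphD rmorphM rmorph_nat; ring.
pose m t : int := Num.floor (s t / eps).
have fl t : (m t)%:~R <= s t / eps < (m t)%:~R + 1 by have := Num.Theory.floor_itv (s t / eps); rewrite intrD.
have small t : `|s t - eps * (m t)%:~R| < eps.
  have /andP[] := fl t; rewrite ler_pdivlMr // ltr_pdivrMr // mulrDl mul1r [_ * eps]mulrC => h1 h2.
  by rewrite ger0_norm; lra.
have mL t : (- L%:Z <= m t) /\ (m t <= L%:Z).
  have h1 : `|s t / eps| < (Num.truncn (c%:R * N%:R / eps : R)).+1%:R.
    rewrite normrM normfV (gtr0_norm eps0); apply: le_lt_trans (truncnS_gt _).
    by rewrite ler_pM2r ?invr_gt0.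
  have h2 : `|s t / eps| < (L%:R - 1 : R) by rewrite /L -natr1 addrK.
  move: h2; have /andP[] := fl t; rewrite ltr_norml => h3 h4 /andP[h5 h6].
  split; rewrite -(ler_int R) ?mulrNz -?pmulrn; [lra|lra].
pose pt t : nat := absz (m t + L%:Z).
have ptE t : (pt t)%:Z = m t + L%:Z by rewrite /pt; have := mL t; lia.
have ptl t : (pt t < (2 * L).+1)%N.
  by have [h1 h2] := mL t; have h3 := ptE t; lia.
pose j : {ffun seq_sub ts -> 'I_(2 * L).+1} := [ffun i => inord (pt (ssval i))].
have gE' t : grid j t = eps * (m t)%:~R :> R.
  rewrite /grid ffunE inordK; last exact: ptl.
  by rewrite (_ : (pt t)%:R = (m t)%:~R + L%:R) ?addrK // -[LHS]/((pt t)%:Z%:~R : R) ptE intrD.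
have [nju njv] := unip_upper (njE j).
pose o := ((nj j)^-1 * (g^-1 * n))%g.
have gu' := unipV gu; have nju' := unipV nju; have gn := unipM gu' hn.
have ou : unip o by exact: unipM.
have oE v : uval o v = (- (match v return lfield Fhat v with inl t => grid j t | inr v => 0 end)) + (- lembR Fhat hreal v X + uval n v).
  by rewrite /o uvalM // uvalM // !uvalV // njv gE.
exists g, j, o; split=> //; last by rewrite /o -mulgA mulKVg mulKVg.
apply: VU => v; rewrite (unipE ou) oE; case: v => [t|v].
  have [e0 hV] := he (inl t); apply: hV; apply: upper_near => //; apply: lt_le_trans (heps t).
  rewrite gE' -lembRE; apply: le_lt_trans (small t); rewrite le_eqVlt; apply/orP; left; apply/eqP; congr (`| _ |).
  by rewrite /s -[lemb _ _ _]/(complex.Re (t X)); ring.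
have av' : av (- 0 + (- lembR Fhat hreal (inr v) X + uval n (inr v)) : Fhat v) <= av (cemb (Fhat v) N%:R).
  by rewrite oppr0 add0r addrC -lembRE; exact: XN.
have [eV|nV] := pselect (V (inr v) = rint (all_fam Fhat 2) (inr v)).
  by rewrite eV; apply: (upper_integral (L := Fhat v)); exact: le_trans av' (N1 v).
have [e0 hV] := he (inr v); apply: hV; apply: (upper_near (L := Fhat v)) => //; apply: le_lt_trans av' _.
apply: hN; have h : [set` S] v by rewrite -eS.
exact: h.
Qed.

End Unipotent.

(** * Integrability along the unipotent group *)

Section SigmaFinite.
Variables (d : measure_display) (T : measurableType d) (R : realType) (m : {measure set T -> \bar R}).
Definition sfm of sigma_finite [set: T] m : set T -> \bar R := m.
Hypothesis h : sigma_finite [set: T] m.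
HB.instance Definition _ := Measure.copy (sfm h) m.
HB.instance Definition _ := Measure_isSigmaFinite.Build _ _ _ (sfm h) h.
End SigmaFinite.

Section Constant.
Variables (R : realType) (F : splittingFieldType rat).
Variable Fhat : forall v : finPlace F, completion R v.
Hypothesis hgal : galois 1%AS {:F}.
Hypothesis hreal : totally_real R F.
Local Notation C := R[i].
Local Notation GA n := (GA Fhat n).
Local Notation GF n := (GF Fhat n).
Local Notation unip := (unipotent Fhat).
Local Notation Gam := (adelic_center Fhat `|` GF 2).
Local Notation GamN := (GF 2 `&` unipotent Fhat).
Local Notation Q := (g_sigma_algebraType (qborel Gam)).
Local Notation QN := (g_sigma_algebraType (qborel GamN)).
Variable mu : qmeasure R Gam.
Hypothesis hmu : invariant_measure setT mu.
Variable nu : qmeasure R GamN.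
Hypothesis hnu : invariant_measure unip nu.
Variable d0 : finPlace F -> R.
Hypothesis hd0 : cgood d0.
Local Notation Bk := (@Bk R F Fhat hgal).
Local Notation gbox := (goodbox hgal d0 mu).

Lemma sat_measurable k : measurable (sat (Bk k) : set Q).
Proof. by rewrite qmeasurableE; exact: (smooth_open_qborel (satBk_smooth_open Fhat hgal hreal k)). Qed.

Lemma box_at (g0 : GA 2) U : nbhs g0 U -> exists k, [/\ gbox k, Bk k g0 & Bk k `<=` U].
Proof. exact: (goodbox_at hgal hreal hd0 hmu). Qed.

Lemma Bk_open k : open (Bk k : set (GA 2)).
Proof. by have [h _ _] := BkP Fhat hgal; exact: h. Qed.

Lemma mu_sigma_finite : sigma_finite [set: Q] mu.
Proof.
exists (fun k => if pselect (gbox k) then sat (Bk k) else set0).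
  apply/seteqP; split=> // x _; have [k [gk Bx _]] := box_at (@filterT _ (nbhs (x : GA 2)) _).
  by exists k => //=; case: pselect => [h|h] /=; [exact: sub_sat|case: h].
move=> k; case: pselect => [[g0 _ fin]|_] /=; first by split; [exact: sat_measurable|].
by rewrite measure0.
Qed.

Definition muS : {sigma_finite_measure set Q -> \bar R} := sfm mu_sigma_finite.

(** Nonempty open sets have positive measure, as countably many translates of
    such a set cover the group. *)
Lemma box_pos k (b0 : GA 2) : Bk k b0 -> (0 < mu (sat (Bk k)))%E.
Proof.
move=> hb0; rewrite lt0e measure_ge0 andbT; apply/eqP => m0.
case: hmu => inv _ _ /negP; apply; apply/eqP.
pose A (l : nat) : set Q := if pselect (exists g : GA 2, Bk l `<=` (fun x => x * g)%g @^-1` Bk k) then sat (Bk l) else set0.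
have A0 l : mu.-negligible (A l).
  rewrite /A; case: pselect => [[g hg]|_] /=; last exact: negligible_set0.
  exists ([set x | sat (Bk k) (x * g)%g] : set Q); split.
  - by rewrite qmeasurableE; apply: qborel_rtrans; [exact: GA_mulr_continuous|rewrite -qmeasurableE; exact: sat_measurable].
  - by rewrite inv //; rewrite -qmeasurableE; exact: sat_measurable.
  - by move=> x [c [z [hc /hg h]]]; exists c, z; rewrite mulgA.
have := negligible_bigcup A0.
rewrite (_ : \bigcup_l A l = setT).
  by move=> [N [mN N0 TN]]; apply/eqP; rewrite -measure_le0 -N0; apply: le_measure; rewrite ?inE.
apply/seteqP; split=> // x _; pose g := ((x : GA 2)^-1 * b0)%g.
have n : nbhs (x : GA 2) [set y | Bk k (y * g)%g].
  apply: (GA_mulr_continuous (c := g)); apply: open_nbhs_nbhs; split; first exact: Bk_open.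
  by rewrite /g mulKVg.
have [l [_ Bx Bl]] := box_at n; exists l => //; rewrite /A; case: pselect => [h|h] /=; first exact: sub_sat.
by case: h; exists g.
Qed.

(** ** Representatives in a box *)

Let ex k (x : GA 2) := exists b, Bk k b /\ exists g z, GF 2 g /\ b = (g * scal 2 z * x)%g.
(** A representative in the box of a point of its saturation. It is unique up
    to a rational scalar, so an invariant function takes a well defined value
    at [y * (brep k x)^-1]. *)
Definition brep k (x : GA 2) : GA 2 := if pselect (ex k x) is left e then projT1 (cid e) else 1%g.

Lemma brepP k x : sat (Bk k) x -> Bk k (brep k x) /\ exists g z, GF 2 g /\ brep k x = (g * scal 2 z * x)%g.
Proof.
move=> [g [z [hg h]]]; rewrite /brep; case: pselect => [e|[]] /=; last by exists (g * scal 2 z * x)%g; split=> //; exists g, z.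
exact: (projT2 (cid e)).
Qed.

Lemma brep_uniq k b x g z : gbox k -> Bk k b -> GF 2 g -> b = (g * scal 2 z * x)%g ->
  exists z', brep k x = (scal 2 z' * b)%g.
Proof.
move=> [g0 nb _] hb hg e; have sx : sat (Bk k) x by exists g, z; rewrite -e.
have [hb' [g' [z' [hg' e']]]] := brepP sx.
have gg : GF 2 (g' * g^-1)%g by apply: GFM => //; exact: GFV.
have e2 : (g' * g^-1 * scal 2 (z' * z^-1) * b)%g = brep k x by rewrite e' e gz_cancel.
have [c hc ec] := box_discrete hgal hreal nb gg hb hb' e2.
by exists (c * (z' * z^-1))%g; rewrite scalM -ec e2.
Qed.

Definition Ginv (T : Type) (f : GA 2 -> T) := forall c x, Gam c -> f (c * x)%g = f x.

Lemma Ginv_r T (f : GA 2 -> T) z x : Ginv f -> f (x * scal 2 z)%g = f x.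
Proof. by move=> h; rewrite -scalC h //; left; exists z. Qed.

Lemma Ginv_l T (f : GA 2 -> T) z x : Ginv f -> f (scal 2 z * x)%g = f x.
Proof. by move=> h; rewrite h //; left; exists z. Qed.

Lemma brep_div T (f : GA 2 -> T) k b x g z y : Ginv f -> gbox k -> Bk k b -> GF 2 g -> b = (g * scal 2 z * x)%g ->
  f (y * (brep k x)^-1)%g = f (y * b^-1)%g.
Proof.
move=> hf gk hb hg /(brep_uniq gk hb hg)[z' ->].
by rewrite invMg mulgA -scalV Ginv_r.
Qed.

(** ** Joint measurability *)

Definition satN (E : set (GA 2)) : set (GA 2) := [set x | exists g, [/\ GF 2 g, unip g & E (g * x)%g]].

Lemma satN_measurable k : measurable (satN (Bk k) : set QN).
Proof.
rewrite qmeasurableE; split.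
  apply: borel_open; rewrite (_ : satN _ = \bigcup_(g in [set g | GF 2 g /\ unip g]) ((fun x => g * x)%g @^-1` Bk k)).
    by apply: bigcup_open => g _; apply: open_comp (Bk_open k) => x _; exact: GA_mull_continuous.
  by apply/seteqP; split=> [x [g [h1 h2 h3]]|x [g [h1 h2] h3]]; exists g.
move=> c x [hc uc]; split=> -[g [h1 h2 h3]].
  by exists (g * c)%g; split; [exact: GFM|exact: unipM|rewrite -mulgA].
by exists (g * c^-1)%g; split; [apply: GFM => //; exact: GFV|apply: unipM => //; exact: unipV|rewrite -mulgA mulKg].
Qed.

Lemma Qmeas d (T : measurableType d) (D : set T) (phi : T -> GA 2) :
  (forall E, smooth_open E -> measurable (D `&` phi @^-1` E)) -> measurable_fun D (phi : T -> Q).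
Proof.
move=> h; have mG : @measurable _ Q = <<s smooth_open (Fhat := Fhat) >>.
  by apply/seteqP; split=> A; rewrite qmeasurableE (qborel_smooth_gen hgal hreal hd0 hmu).
by apply: (measurability _ mG) => _ [E hE <-]; exact: h.
Qed.

Lemma smooth_open_Ginv (E : set (GA 2)) : smooth_open E -> Ginv (fun x => x \in E).
Proof.
by move=> [_ iE _] c x hc; apply/idP/idP => /set_mem h; apply/mem_set; apply/(iE c x hc).
Qed.

Lemma mul3_near (a b c : GA 2) E : open E -> E (a * b * c^-1)%g -> exists i j l,
  [/\ Bk i a, Bk j b, Bk l c & forall a' b' c', Bk i a' -> Bk j b' -> Bk l c' -> E (a' * b' * c'^-1)%g].
Proof.
move=> oE hE; have c1 : {for (a, b, c), continuous (fun p : GA 2 * GA 2 * GA 2 => p.1.1 * p.1.2 * p.2^-1)%g}.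
  apply: (@continuous_comp _ _ _ (fun p : GA 2 * GA 2 * GA 2 => (p.1.1 * p.1.2, p.2^-1)%g) (fun p : GA 2 * GA 2 => (p.1 * p.2)%g)); last exact: GA_mul_continuous.
  apply: pair_continuous.
    apply: (@continuous_comp _ _ _ fst (fun p : GA 2 * GA 2 => (p.1 * p.2)%g)); last exact: GA_mul_continuous.
    exact: cvg_fst.
  apply: (@continuous_comp _ _ _ snd (fun p : GA 2 => (p^-1)%g)); last exact: GA_inv_continuous.
  exact: cvg_snd.
have : nbhs (a, b, c) [set p | E (p.1.1 * p.1.2 * p.2^-1)%g] by apply: c1; apply: open_nbhs_nbhs.
move=> [[P S] /= [[[P1 P2] /= [n1 n2] P12] nS] h].
have [i [_ hi Pi]] := box_at n1; have [j [_ hj Pj]] := box_at n2; have [l [_ hl Pl]] := box_at nS.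
exists i, j, l; split=> // a' b' c' h1 h2 h3; apply: (h (a', b', c')); split=> /=; last exact: Pl.
by apply: (P12 (a', b')); split; [exact: Pi|exact: Pj].
Qed.

Lemma mul2_near (a c : GA 2) E : open E -> E (a * c^-1)%g -> exists i l,
  [/\ Bk i a, Bk l c & forall a' c', Bk i a' -> Bk l c' -> E (a' * c'^-1)%g].
Proof.
move=> oE hE; rewrite -[a]mulg1 in hE; have [i [j [l [h1 h2 h3 h]]]] := mul3_near oE hE.
by exists i, l; split=> // a' c' ha hc; rewrite -[a']mulg1; exact: h.
Qed.

Lemma count_bigcup_measurable d (T : measurableType d) (I : countType) (P : set I) (A : I -> set T) :
  (forall i, measurable (A i)) -> measurable (\bigcup_(i in P) A i).
Proof.
move=> mA; rewrite bigcup_mkcond; apply: countable_bigcupT_measurable.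
  exact: countableP.
by move=> i; case: ifP.
Qed.

Lemma phi2_measurable k : gbox k ->
  measurable_fun ([set: Q] `*` (sat (Bk k) : set Q)) ((fun p : Q * Q => (p.1 : GA 2) * (brep k p.2)^-1)%g : Q * Q -> Q).
Proof.
move=> gk; apply: Qmeas => E hE; have [oE iE _] := hE; have GE := smooth_open_Ginv hE.
pose W : set (nat * nat) := [set p | Bk p.2 `<=` Bk k /\
   forall a c, Bk p.1 a -> Bk p.2 c -> E (a * c^-1)%g].
pose A (p : nat * nat) : set (Q * Q) := (sat (Bk p.1) : set Q) `*` (sat (Bk p.2) : set Q).
have mA p : measurable (A p) by apply: measurableX; exact: sat_measurable.
suff -> : ([set: Q] `*` (sat (Bk k) : set Q)) `&` (fun p : Q * Q => ((p.1 : GA 2) * (brep k p.2)^-1)%g : Q) @^-1` E =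
  \bigcup_(p in W) A p by exact: (count_bigcup_measurable W mA).
apply/seteqP; split=> [[y x] [[_ /= sx] Eyx]|[y x] [[i l] /= [Bl h] [/= sy sx]]].
  have [hb [g [z [hg e]]]] := brepP sx.
  have [i [l [h1 h2 h]]] := mul2_near oE Eyx.
  have n : nbhs (brep k x) (Bk l `&` Bk k) by apply: filterI; apply: open_nbhs_nbhs; split=> //; exact: Bk_open.
  have [m [_ hm ms]] := box_at n.
  exists (i, m) => /=; first by split=> [w /ms[]//|a c ha /ms[hc _]]; exact: h.
  by split=> /=; [exact: sub_sat|exists g, z; rewrite -e].
have [g [z [hg hb]]] := sx; have [g' [z' [hg' hb']]] := sy.
have Ex := h _ _ hb' hb.
split; first by split=> //=; exists g, z; split=> //; exact: Bl.
rewrite /preimage /=; apply/set_mem; rewrite (brep_div y GE gk (Bl _ hb) hg erefl).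
move/mem_set: Ex; rewrite -mulgA -[(g' * scal 2 z')%g]scalC -mulgA -mulgA (Ginv_l _ _ GE) GE //; first by right.
Qed.

Lemma phi3_measurable k' k : gbox k' -> gbox k ->
  measurable_fun (((sat (Bk k') : set Q) `*` (sat (Bk k) : set Q)) `*` [set: QN])
    ((fun p : Q * Q * QN => (p.2 : GA 2) * brep k' p.1.1 * (brep k p.1.2)^-1)%g : Q * Q * QN -> Q).
Proof.
move=> gk' gk; apply: Qmeas => E hE; have [oE iE _] := hE; have GE := smooth_open_Ginv hE.
pose W : set (nat * nat * nat) := [set p | [/\ Bk p.1.2 `<=` Bk k', Bk p.2 `<=` Bk k &
   forall a b c, Bk p.1.1 a -> Bk p.1.2 b -> Bk p.2 c -> E (a * b * c^-1)%g]].
pose A (p : nat * nat * nat) : set (Q * Q * QN) :=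
  ((sat (Bk p.1.2) : set Q) `*` (sat (Bk p.2) : set Q)) `*` (satN (Bk p.1.1) : set QN).
have mA p : measurable (A p).
  apply: measurableX; last exact: satN_measurable.
  by apply: measurableX; exact: sat_measurable.
suff -> : (((sat (Bk k') : set Q) `*` (sat (Bk k) : set Q)) `*` [set: QN]) `&`
    (fun p : Q * Q * QN => ((p.2 : GA 2) * brep k' p.1.1 * (brep k p.1.2)^-1)%g : Q) @^-1` E =
  \bigcup_(p in W) A p by exact: (count_bigcup_measurable W mA).
apply/seteqP; split=> [[[x' x] n] [[[/= sx' sx] _] Enx]|[[x' x] n] [[[i j] l] /= [Bj Bl h] [[/= sx' sx] sn]]].
  have [hb [g [z [hg e]]]] := brepP sx; have [hb' [g' [z' [hg' e']]]] := brepP sx'.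
  have [i [j [l [h1 h2 h3 h]]]] := mul3_near oE Enx.
  have n1 : nbhs (brep k x) (Bk l `&` Bk k) by apply: filterI; apply: open_nbhs_nbhs; split=> //; exact: Bk_open.
  have n2 : nbhs (brep k' x') (Bk j `&` Bk k') by apply: filterI; apply: open_nbhs_nbhs; split=> //; exact: Bk_open.
  have [m [_ hm ms]] := box_at n1; have [m' [_ hm' ms']] := box_at n2.
  exists (i, m', m) => /=; first by split=> [w /ms'[]//|w /ms[]//|a b c ha /ms'[hb1 _] /ms[hc _]]; exact: h.
  split=> /=; first by split; [exists g', z'; rewrite -e'|exists g, z; rewrite -e].
  by exists 1%g; split; [exact: GF1|exact: unip1|rewrite mul1g].
have [g [z [hg hb]]] := sx; have [g' [z' [hg' hb']]] := sx'; have [c [hc uc hn]] := sn.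
have Ex := h _ _ _ hn hb' hb.
split; first by split=> //=; split; [exists g', z'; split=> //; exact: Bj|exists g, z; split=> //; exact: Bl].
rewrite /preimage /=; apply/set_mem; rewrite (brep_div _ GE gk (Bl _ hb) hg erefl).
have [w ->] := brep_uniq gk' (Bj _ hb') hg' erefl.
rewrite [(n * (scal 2 w * _))%g]mulgA -[(n * scal 2 w)%g]scalC -!mulgA (Ginv_l _ _ GE).
by move/mem_set: Ex; rewrite -!mulgA GE //; right.
Qed.

(** ** The measure along the unipotent group *)

Lemma unip_closed : open (~` (unip : set (GA 2))).
Proof.
have far v (i j : 'I_2) (a : lfield Fhat v) : open [set g : GA 2 | glmx (g v) i j <> a].
  have -> : [set g : GA 2 | glmx (g v) i j <> a] = (fun g : GA 2 => g v) @^-1` [set y | glmx y i j <> a] by [].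
  rewrite openE => g /= hg; have e0 : 0 < av (glmx (g v) i j - a).
    by rewrite lt_neqAle av_ge0 andbT; apply/eqP => /esym/av_eq0/eqP; rewrite subr_eq0 => /eqP.
  apply/(rprod_nbhsP (@all_rint_open R F Fhat 2)).
  have [V [oV fV] Vg] := isbox_around (@all_rint_open R F Fhat 2) g.
  pose W u : set (GL 2 (lfield Fhat u)) := V u `&` [set y | forall e : v = u, glmx y i j <> ecast u (lfield Fhat u) e a].
  exists W; split; last by move=> y /(_ v)[_ /(_ erefl)].
  - split=> [u|]; last first.
      apply: (@sub_finite_set _ _ ([set u | V u <> rint (all_fam Fhat 2) u] `|` [set v])); last by rewrite finite_setU.
      move=> u /= nu'; case: (pselect (v = u)) => [->|ne]; [by right|left].
      move=> e; apply: nu'; rewrite -e /W; apply/seteqP; split=> y; first by case.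
      by move=> h; split=> // e'; case: ne.
    apply: openI; first exact: oV.
    case: (pselect (v = u)) => [e|ne]; last first.
      by rewrite (_ : mkset _ = setT); [exact: openT|apply/seteqP; split=> // y _ e; case: ne].
    case: _ / e; rewrite openE => y /= hy; have e1 : 0 < av (glmx y i j - a).
      rewrite lt_neqAle av_ge0 andbT; apply/eqP => /esym/av_eq0/eqP; rewrite subr_eq0 => /eqP h.
      exact: (hy erefl).
    apply/gl_nbhsP; exists (av (glmx y i j - a)) => // t ht e /=.
    rewrite (_ : e = erefl) /=; last exact: Prop_irrelevance.
    by move=> ta; have := ht i j; rewrite ta -[X in X < _]avN opprB ltxx.
  - move=> u; split; first exact: Vg.
    by move=> e; case: _ / e.
rewrite (_ : ~` _ = \bigcup_(v in [set: place R F]) ([set g : GA 2 | glmx (g v) ord0 ord0 <> 1] `|`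
   [set g | glmx (g v) ord_max ord_max <> 1] `|` [set g | glmx (g v) ord_max ord0 <> 0])).
  by apply: bigcup_open => v _; apply: openU; [apply: openU|]; exact: far.
apply/seteqP; split=> [g h|g [v _ h] /(_ v)[h1 h2 h3]]; last by case: h => [[]|].
apply: contrapT => n; apply: h => v; split; apply: contrapT => h; apply: n; exists v => //.
- by left; left.
- by left; right.
- by right.
Qed.

Lemma unip_measurable : measurable (unip : set QN).
Proof.
rewrite qmeasurableE; split; first by rewrite -[unip]setCK; apply: borelC; apply: borel_open; exact: unip_closed.
move=> c x [_ hc]; split=> h; last exact: unipM.
by rewrite -(mulKg c x); apply: unipM => //; exact: unipV.
Qed.

(** The unipotent group is covered, modulo rational points, by finitely many
    translates of a set of finite measure. *)
Lemma nu_fin : (nu setT < +oo)%E.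
Proof.
have [inv vanish fin _] := hnu; have [U [oU qU U1 Ufin]] := fin 1%g.
have [J [nj [nju cov]]] := unipotent_cover hgal hreal (open_nbhs_nbhs (conj oU U1)).
pose A (j : J) : set QN := [set x | U (x * (nj j)^-1)%g].
have mA j : measurable (A j).
  by rewrite qmeasurableE; apply: qborel_rtrans => //; exact: GA_mulr_continuous.
have nA j : nu (A j) = nu U by apply: inv => //; apply: unipV; exact: nju.
have mC : measurable (~` unip : set QN) by apply: measurableC; exact: unip_measurable.
have sub : [set: QN] `<=` (~` unip) `|` \big[setU/set0]_(j <- enum J) A j.
  move=> n _; case: (pselect (unip n)) => [un|nn]; [right|by left].
  have [g [j [q [hg ug uo Uo e]]]] := cov n un.
  rewrite -bigcup_seq; exists j; first by rewrite /= mem_enum.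
  have [_ iU] := qU; rewrite /A /= e -!mulgA (iU g) ?mulgA; last by split.
  by rewrite (unipC (nju j) uo) mulgK.
apply: (le_lt_trans (le_measure _ _ _ sub)); rewrite ?inE //.
  by apply: measurableU => //; apply: bigsetU_measurable.
apply: (le_lt_trans (measureU2 _ mC _)); first by apply: bigsetU_measurable.
have n0 : nu (~` unip) = 0%E by apply: vanish => //; rewrite -qmeasurableE.
rewrite [X in (X + _ < _)%E]n0.
rewrite add0e; elim: (enum J) => [|j s IH]; first by rewrite big_nil measure0.
rewrite big_cons; apply: (le_lt_trans (measureU2 _ (mA j) _)); first exact: bigsetU_measurable.
move: (nA j) => h; apply: lte_add_pinfty => //; apply: (le_lt_trans _ Ufin).
by rewrite le_eqVlt; apply/orP; left; apply/eqP.
Qed.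

Lemma nu_sigma_finite : sigma_finite [set: QN] nu.
Proof.
exists (fun=> setT); first by rewrite bigcup_const.
by move=> _; split=> //; exact: nu_fin.
Qed.
Definition nuS : {sigma_finite_measure set QN -> \bar R} := sfm nu_sigma_finite.

(** ** Averages over a box *)

Section Average.
Variable f : GA 2 -> \bar R.
Hypothesis f0 : forall x, (0 <= f x)%E.
Hypothesis Gf : Ginv f.
Hypothesis mf : measurable_fun [set: Q] (f : Q -> \bar R).
Hypothesis intf : (\int[mu]_x f x < +oo)%E.

Definition H2 k : Q * Q -> \bar R :=
  (fun p : Q * Q => f ((p.1 : GA 2) * (brep k p.2)^-1)%g) \_ ([set: Q] `*` (sat (Bk k) : set Q)).
(** The average of [f] over the inverse of the box, translated by [y]; unlike
    [f], it is bounded on compact sets. *)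
Definition J k (y : GA 2) : \bar R := (\int[muS]_x H2 k (y, x))%E.

Lemma H2E k y x : H2 k (y, x) = if pselect (sat (Bk k) x) then f (y * (brep k x)^-1)%g else 0%E.
Proof.
rewrite /H2 patchE; case: pselect => h; first by rewrite mem_set.
by rewrite memNset // => -[].
Qed.

Lemma H2_ge0 k p : (0 <= H2 k p)%E.
Proof. by case: p => y x; rewrite H2E; case: pselect => h /=. Qed.

Lemma H2_measurable k : gbox k -> measurable_fun [set: Q * Q] (H2 k).
Proof.
have mD : measurable ([set: Q] `*` (sat (Bk k) : set Q)) by apply: measurableX => //; exact: sat_measurable.
move=> gk; apply/(measurable_restrictT _ mD).
exact: (measurableT_comp mf (phi2_measurable gk)).
Qed.

Lemma J_inv k g z y : GF 2 g -> J k (g * scal 2 z * y)%g = J k y.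
Proof.
move=> hg; apply: eq_integral => x _; rewrite !H2E; case: pselect => h //=.
by rewrite -!mulgA (Gf (c := g)); [rewrite (Gf (c := scal 2 z)) //; left; exists z|right].
Qed.

(** Integrating in the other order, the invariance of the measure under right
    translation makes the inner integral constant. *)
Lemma int_J k : gbox k -> (\int[mu]_y J k y = mu (sat (Bk k)) * \int[mu]_x f x)%E.
Proof.
move=> gk; have [inv _ _ _] := hmu; rewrite /J.
rewrite -[LHS]/(\int[muS]_y \int[muS]_x H2 k (y, x))%E.
rewrite (@fubini_tonelli _ _ _ _ _ muS muS) //; [|exact: H2_measurable|exact: H2_ge0].
rewrite (eq_integral (fun x : Q => (\1_(sat (Bk k)) x)%:E * \int[mu]_x f x)%E); last first.
  move=> x _; rewrite indicE; case: (pselect (sat (Bk k) x)) => h.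
    rewrite mem_set //= mul1e -(integral_rtrans (@GA_mulr_continuous R F Fhat 2) (mu := mu) _ (brep k x)^-1%g mf f0); last first.
      by move=> h' B qB; apply: inv.
    by apply: eq_integral => y _; rewrite H2E; case: pselect.
  rewrite memNset //= mul0e; apply: integral0_eq => y _; rewrite H2E; case: pselect => //.
rewrite ge0_integralZr //; last 2 first.
- by apply/measurable_EFinP; apply: measurable_indic; exact: sat_measurable.
- by apply: integral_ge0.
by rewrite integral_indic //; [rewrite setIT|exact: sat_measurable].
Qed.

(** For [p] near [y] the average at [y] is at most the average at [p] over a
    larger box; integrating over those [p] gives a bound. *)
Lemma J_le k k1 l y : gbox k -> gbox k1 ->
  (forall p, Bk l p -> exists d, p = (y * d)%g /\ forall b, Bk k b -> Bk k1 (b * d)%g) ->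
  (mu (sat (Bk l)) * J k y <= mu (sat (Bk k1)) * \int[mu]_x f x)%E.
Proof.
move=> gk gk1 h; have [inv _ _ _] := hmu; rewrite -int_J //.
have mJ : measurable_fun [set: Q] (J k1 : Q -> \bar R).
  exact: (@measurable_fun_fubini_tonelli_F _ _ _ _ _ muS _ (H2_measurable gk1) (@H2_ge0 k1)).
have J0 x : (0 <= J k1 x)%E by apply: integral_ge0 => t _; exact: H2_ge0.
have J0' x : (0 <= J k x)%E by apply: integral_ge0 => t _; exact: H2_ge0.
apply: (@le_trans _ _ (\int[mu]_(y' in sat (Bk l)) J k1 y')%E); last first.
  by apply: ge0_subset_integral => //; exact: sat_measurable.
apply: (@le_trans _ _ (\int[mu]_(y' in sat (Bk l)) J k y)%E).
  by rewrite integral_cst; [rewrite muleC|exact: sat_measurable].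
apply: ge0_le_integral => //; first exact: sat_measurable.
  exact: measurable_funTS.
move=> y' [g [z [hg /h[d [e hd]]]]]; rewrite -(J_inv k1 z y' hg) e.
have ms k2 (u : GA 2) : gbox k2 -> measurable_fun [set: Q] (fun x : Q => H2 k2 (u : Q, x)).
  by move=> gk2; apply: (measurableT_comp (H2_measurable gk2)); exact: pair1_measurable.
rewrite /J -[leRHS]/(\int[mu]_x H2 k1 ((y * d)%g, x))%E.
rewrite -(integral_rtrans (@GA_mulr_continuous R F Fhat 2) (mu := mu) _ d (ms k1 _ gk1)); last 2 first.
- by move=> h' B qB; apply: inv.
- by move=> x; exact: H2_ge0.
apply: ge0_le_integral => //=.
- by move=> x _; exact: H2_ge0.
- exact: ms.
- exact: (measurableT_comp (ms k1 _ gk1) (rtrans_measurable (@GA_mulr_continuous R F Fhat 2) d)).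
move=> x _; rewrite !H2E; case: pselect => [sx|h'] /=; last by case: pselect => h'' /=.
have [hb [g' [z' [hg' e']]]] := brepP sx; have hb1 := hd _ hb.
have e1 : (brep k x * d)%g = (g' * scal 2 z' * (x * d))%g by rewrite e' !mulgA.
case: pselect => [h'|[]] /=; last by exists g', z'; rewrite -e1.
by rewrite (brep_div (y * d)%g Gf gk1 hb1 hg' e1) invMg mulgA mulgK.
Qed.

(** The unipotent group is compact modulo rational points, so that the local
    bounds of [J_le] give a uniform one. *)
Lemma J_bounded k k1 D y0 : gbox k -> gbox k1 -> nbhs (1%g : GA 2) D ->
  (forall b d, Bk k b -> D d -> Bk k1 (b * d)%g) ->
  exists M : R, forall n, unip n -> (J k (n * y0)%g <= M%:E)%E.
Proof.
move=> gk gk1 nD hD; have J0 x : (0 <= J k x)%E by apply: integral_ge0 => t _; exact: H2_ge0.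
have c1 : {for (1%g, y0), continuous (fun p : GA 2 * GA 2 => (p.1 * y0)^-1 * p.2)%g}.
  apply: (@continuous_comp _ _ _ (fun p : GA 2 * GA 2 => ((p.1 * y0)^-1, p.2)%g) (fun p : GA 2 * GA 2 => (p.1 * p.2)%g)); last exact: GA_mul_continuous.
  apply: pair_continuous; last exact: cvg_snd.
  apply: (@continuous_comp _ _ _ (fun p : GA 2 * GA 2 => (p.1 * y0)%g) (fun p : GA 2 => (p^-1)%g)); last exact: GA_inv_continuous.
  apply: (@continuous_comp _ _ _ fst (fun p : GA 2 => (p * y0)%g)); last exact: GA_mulr_continuous.
  exact: cvg_fst.
have : nbhs (1%g, y0) [set p : GA 2 * GA 2 | D ((p.1 * y0)^-1 * p.2)%g].
  by apply: c1; rewrite /= mul1g mulVg.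
move=> [[U V] /= [nU nV] UV].
have [I [nj [nju cov]]] := unipotent_cover hgal hreal nU.
have bd j : exists m : R, 0 <= m /\ forall o, unip o -> U o -> (J k (nj j * o * y0)%g <= m%:E)%E.
  have nj' : nbhs (nj j * y0)%g [set p : GA 2 | V ((nj j)^-1 * p)%g].
    by apply: (GA_mull_continuous (c := (nj j)^-1%g)); rewrite /= mulKg.
  have [l [gl hl lV]] := box_at nj'; have [g0 _ fl] := gl.
  have pl := box_pos hl; have [g1 _ f1] := gk1.
  pose c := (mu (sat (Bk k1)) * \int[mu]_x f x)%E.
  have cf : c \is a fin_num.
    by rewrite fin_numM // ge0_fin_numE //; apply: integral_ge0.
  have mf' : mu (sat (Bk l)) \is a fin_num by rewrite ge0_fin_numE.
  have m0 : 0 < fine (mu (sat (Bk l))) by rewrite -lte_fin fineK.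
  exists ((fine (mu (sat (Bk l))))^-1 * fine c); split.
    rewrite mulr_ge0 ?invr_ge0 ?fine_ge0 // mule_ge0 //; exact: integral_ge0.
  move=> o uo Uo; rewrite EFinM lee_pdivlMl // !fineK //; apply: J_le => // p /lV hp.
  exists ((nj j * o * y0)^-1 * p)%g; rewrite mulKVg; split=> // b hb; apply: hD => //.
  by rewrite -!mulgA invMg -mulgA; apply: (UV (o, _)); split.
have [m hm] := choice bd.
exists (\sum_j m j) => n un; have [g [j [q [hg ug uo Uo ->]]]] := cov n un.
have := J_inv k 1%g (nj j * q * y0)%g hg; rewrite scal1 mulg1 !mulgA => ->.
have [_ h] := hm j; apply: (le_trans (h q uo Uo)); rewrite lee_fin (bigD1 j) //= lerDl.
by apply: sumr_ge0 => i _; have [] := hm i.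
Qed.

(** ** Almost every unipotent orbit *)

Definition H3 k' k : Q * Q * QN -> \bar R :=
  (fun p : Q * Q * QN => f ((p.2 : GA 2) * brep k' p.1.1 * (brep k p.1.2)^-1)%g) \_
    (((sat (Bk k') : set Q) `*` (sat (Bk k) : set Q)) `*` (unip : set QN)).

Lemma H3E k' k x' x n : H3 k' k (x', x, n) =
  if pselect [/\ sat (Bk k') x', sat (Bk k) x & unip n] then f (n * brep k' x' * (brep k x)^-1)%g else 0%E.
Proof.
rewrite /H3 patchE; case: pselect => [[h1 h2 h3]|h]; first by rewrite mem_set.
by rewrite memNset // => -[[h1 h2] h3]; apply: h.
Qed.

Lemma H3_ge0 k' k p : (0 <= H3 k' k p)%E.
Proof. by case: p => -[x' x] n; rewrite H3E; case: pselect => h /=. Qed.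

Lemma H3_measurable k' k : gbox k' -> gbox k -> measurable_fun [set: Q * Q * QN] (H3 k' k).
Proof.
have mD : measurable (((sat (Bk k') : set Q) `*` (sat (Bk k) : set Q)) `*` (unip : set QN)).
  by apply: measurableX; [apply: measurableX; exact: sat_measurable|exact: unip_measurable].
move=> gk' gk; apply/(measurable_restrictT _ mD).
apply: (measurable_funS _ (_ : _ `<=` ((sat (Bk k') : set Q) `*` (sat (Bk k) : set Q)) `*` [set: QN])).
- by apply: measurableX => //; apply: measurableX; exact: sat_measurable.
- by move=> p [].
exact: (measurableT_comp mf (phi3_measurable gk' gk)).
Qed.

Definition S3 k' k (p : Q * Q) : \bar R := (\int[nuS]_n H3 k' k (p, n))%E.

Lemma S3_measurable k' k : gbox k' -> gbox k -> measurable_fun [set: Q * Q] (S3 k' k).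
Proof. move=> g1 g2; exact: (@measurable_fun_fubini_tonelli_F _ _ _ _ _ nuS _ (H3_measurable g1 g2) (@H3_ge0 k' k)). Qed.

(** Exchanging the integrals leaves the integral over the unipotent quotient,
    which has finite measure, of the averages, which are bounded there. *)
Lemma S3_fin k' k k1 D x' : gbox k' -> gbox k -> gbox k1 -> nbhs (1%g : GA 2) D ->
  (forall b d, Bk k b -> D d -> Bk k1 (b * d)%g) ->
  (\int[mu]_x S3 k' k (x', x) < +oo)%E.
Proof.
move=> gk' gk gk1 nD hD; have [M hM] := J_bounded (brep k' x') gk gk1 nD hD.
have J0 x : (0 <= J k x)%E by apply: integral_ge0 => t _; exact: H2_ge0.
rewrite -[X in (X < _)%E]/(\int[muS]_x \int[nuS]_n (fun p : Q * QN => H3 k' k ((x', p.1), p.2)) (x, n))%E.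
have m3 : measurable_fun [set: Q * QN] (fun p : Q * QN => H3 k' k ((x', p.1), p.2)).
  apply: (measurableT_comp (H3_measurable gk' gk)).
  apply: measurable_fun_pair; last exact: measurable_snd.
  by apply: measurable_fun_pair; [exact: measurable_cst|exact: measurable_fst].
rewrite (_ : (\int[muS]_x _)%E = (\int[nuS]_n \int[muS]_x H3 k' k ((x', x), n))%E); last first.
  exact: (@fubini_tonelli _ _ _ _ _ muS nuS _ m3 (fun p => H3_ge0 _ _ _)).
apply: (@le_lt_trans _ _ (\int[nuS]_n (maxe 0 M%:E))%E); last first.
  rewrite integral_cst //; apply: lte_mul_pinfty => //; first by rewrite le_max lexx.
    by rewrite /maxe; case: ifP.
  exact: nu_fin.
apply: ge0_le_integral => //.
- by move=> n _; apply: integral_ge0 => x _; exact: H3_ge0.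
- exact: (@measurable_fun_fubini_tonelli_G _ _ _ _ _ muS _ m3 (fun p => H3_ge0 _ _ _)).
move=> n _; case: (pselect (sat (Bk k') x' /\ unip n)) => [[sx' un]|h]; last first.
  rewrite integral0_eq ?le_max ?lexx // => x _ /=; rewrite H3E; case: pselect => // -[h1 h2 h3].
  by case: h.
rewrite le_max; apply/orP; right; apply: le_trans (hM n un); rewrite le_eqVlt; apply/orP; left; apply/eqP.
apply: eq_integral => x _ /=; rewrite H3E H2E; case: pselect => [[h1 h2 h3]|h] /=; first by case: pselect.
by case: pselect => // sx; case: h.
Qed.

(** The points through which the integral over the unipotent orbit diverges. *)
Definition Bad : set (GA 2) := [set g | (\int[nu]_(n in unip) f (n * g)%g)%E = +oo%E].

(** By [S3_fin] and Tonelli there is a [y] such that, for almost every [x],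
    the orbit through the quotient of the representatives of [x] and [y] is
    good. Translating by the representative of [y] shows that almost every
    point near [g0] is good. *)
Lemma Bad_local g0 : exists l, [/\ gbox l, Bk l g0 & mu.-negligible (sat (Bk l `&` Bad) : set Q)].
Proof.
have [k' [gk' hk' _]] := box_at (@filterT _ (nbhs (g0 : GA 2)) _).
have [k1 [gk1 hk1 _]] := box_at (@filterT _ (nbhs (1%g : GA 2)) _).
have : nbhs (g0, 1%g) [set p : GA 2 * GA 2 | Bk k' (p.1 * p.2)%g].
  by apply: GA_mul_continuous; rewrite /= mulg1; apply: open_nbhs_nbhs; split=> //; exact: Bk_open.
move=> [[L B1] /= [nL nB1] LB].
have : nbhs (1%g, 1%g) [set p : GA 2 * GA 2 | Bk k1 (p.1 * p.2)%g].
  by apply: GA_mul_continuous; rewrite /= mulg1; apply: open_nbhs_nbhs; split=> //; exact: Bk_open.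
move=> [[B2 D] /= [nB2 nD] BD].
have [k [gk hk kB]] := box_at (filterI nB1 nB2); have [l [gl hl lL]] := box_at nL.
have hD b d : Bk k b -> D d -> Bk k1 (b * d)%g by move=> /kB[_ h2] hd; exact: (BD (b, d)).
exists l; split=> //.
pose E : set (Q * Q) := [set p | S3 k' k p = +oo%E].
have mE : measurable E.
  have -> : E = [set: Q * Q] `&` S3 k' k @^-1` [set +oo%E] by rewrite setTI.
  by apply: S3_measurable => //; exact: emeasurable_set1.
pose e : Q * Q -> \bar R := fun p => (\1_E p)%:E.
have me : measurable_fun [set: Q * Q] e by apply/measurable_EFinP; exact: measurable_indic.
have e0 p : (0 <= e p)%E by rewrite lee_fin indicE; case: (p \in E).
have z1 x' : (\int[muS]_x e (x', x))%E = 0%E.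
  have ms : measurable_fun [set: Q] (fun x : Q => S3 k' k (x', x)).
    by apply: (measurableT_comp (S3_measurable gk' gk)); exact: pair1_measurable.
  have is3 : mu.-integrable [set: Q] (fun x => S3 k' k (x', x)).
    apply/integrableP; split=> //; rewrite (eq_integral (fun x : Q => S3 k' k (x', x))).
      exact: (S3_fin x' gk' gk gk1 nD hD).
    by move=> x _; rewrite gee0_abs //; apply: integral_ge0 => n _; exact: H3_ge0.
  have := integrable_ae measurableT is3 => ae.
  have m1 : measurable_fun [set: Q] (fun x : Q => e (x', x)).
    by apply: (measurableT_comp me); exact: pair1_measurable.
  transitivity (\int[mu]_x `|e (x', x)|)%E; first by apply: eq_integral => x _; rewrite gee0_abs.
  apply/(ae_eq_integral_abs _ measurableT m1); apply: filterS ae => x h _ /=.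
  rewrite /e indicE memNset // /E /= => h'; have := h I; rewrite h' //.
have z2 : (\int[muS]_x \int[muS]_x' e (x', x))%E = 0%E.
  rewrite -(@fubini_tonelli _ _ _ _ _ muS muS e me e0); apply: integral0_eq => x' _; exact: z1.
have mG := @measurable_fun_fubini_tonelli_G _ _ _ _ _ muS _ me e0.
have G0 x : (0 <= fubini_G muS e x)%E by apply: integral_ge0.
have ae : {ae mu, forall x, [set: Q] x -> fubini_G muS e x = 0%E}.
  apply/(ae_eq_integral_abs _ measurableT mG); rewrite -[RHS]z2.
  by apply: eq_integral => x _; rewrite gee0_abs.
have [x0 sx0 Gx0] : exists2 x0, sat (Bk k) x0 & fubini_G muS e x0 = 0%E.
  apply: contrapT => no; have := box_pos hk; rewrite ltNge => /negP; apply.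
  case: ae => N [mN N0 sN]; rewrite -N0; apply: le_measure; rewrite ?inE //; first exact: sat_measurable.
  by move=> x sx; apply: sN => /= h; apply: no; exists x => //; exact: h.
pose Z : set Q := [set x' | E (x', x0)].
have mZ : measurable Z.
  have -> : Z = ysection E x0 by apply/seteqP; split=> t; rewrite /ysection /= in_setE.
  exact: measurable_ysection.
have Z0 : mu Z = 0%E.
  rewrite -Gx0 /fubini_G [RHS](eq_integral (fun x : Q => (\1_Z x)%:E)); first by rewrite integral_indic // setIT.
  by move=> x _; rewrite /e !indicE; congr (_%:R%:E); apply/idP/idP => /set_mem h; apply/mem_set.
have [inv _ _ _] := hmu; pose b := brep k x0; have [hb _] := brepP sx0.
exists ([set x | Z (x * b)%g] : set Q); split.
- by rewrite qmeasurableE; apply: qborel_rtrans; [exact: GA_mulr_continuous|rewrite -qmeasurableE].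
- by rewrite inv // -qmeasurableE.
move=> x [g [z [hg [hp badp]]]]; rewrite /Z /E /=.
set p := (g * scal 2 z * x)%g in hp badp.
have epb : (p * b)%g = (g * scal 2 z * (x * b))%g by rewrite /p !mulgA.
have hpb : Bk k' (p * b)%g by apply: (LB (p, b)); split; [exact: lL|have [] := kB _ hb].
have [z' ez'] := brep_uniq gk' hpb hg epb.
have sxb : sat (Bk k') (x * b)%g by exists g, z; rewrite -epb.
rewrite -[RHS]badp [RHS]integral_mkcond; apply: (@eq_integral _ _ _ nu setT _ (fun n : QN => H3 k' k ((x * b)%g, x0, n))) => n _; rewrite H3E patchE.
case: pselect => [[h1 h2 un]|h] /=; last first.
  by rewrite memNset // => un; case: h.
have en : ((n : GA 2) * brep k' (x * b) * (brep k x0)^-1)%g = (scal 2 z' * ((n : GA 2) * p))%g.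
  by rewrite ez' -/b !mulgA mulgK scalC.
by rewrite mem_set // en (Ginv_l _ _ Gf).
Qed.

Lemma Bad_negligible : {ae mu, forall g, ~ Bad g}.
Proof.
pose A l : set Q := if pselect (mu.-negligible (sat (Bk l `&` Bad) : set Q)) then sat (Bk l `&` Bad) else set0.
have hA l : mu.-negligible (A l) by rewrite /A; case: pselect => //= _; exact: negligible_set0.
apply: (negligibleS _ (negligible_bigcup hA)) => g /contrapT hg.
have [l [_ hl hn]] := Bad_local g; exists l => //; rewrite /A; case: pselect => //= _.
by exists 1%g, 1%g; rewrite scal1 !mul1g; split; [exact: GF1|].
Qed.

End Average.

(** ** Forms along unipotent orbits *)

Variable K : forall v : finPlace F, set (GL 2 (Fhat v)).
Variable omega : GA 1 -> C.
Hypothesis gom : goodchar K omega.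
Local Notation L2 := (L2 mu omega).

Lemma adet_unip n : unip n -> adet n = 1%g.
Proof.
move=> un; apply: GA_ext => v; apply: glmx_inj; apply/matrixP => i j.
by have [h1 h2 h3] := un v; rewrite !ord1 /= !mxE /= det2 h1 h2 h3 !mulr0 subr0 mulr1.
Qed.

(** The square of a form has finite integrals along almost every unipotent
    orbit, and the orbit space has finite measure, so that the form itself is
    integrable there. *)
Theorem constant_term_integrable (f : Defs.form Fhat) : L2 f ->
  {ae mu, forall g, cintegrable nu unip (fun n : GA 2 => f (n * g)%g)}.
Proof.
move=> hf; pose F1 (x : GA 2) := (sqn omega f x)%:E.
have F0 x : (0 <= F1 x)%E by rewrite lee_fin (sqn_ge0 gom).
have GF1' : Ginv F1.
  move=> c x hc; rewrite /F1; congr (_%:E); apply: (@complexI R).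
  by rewrite -!dens_sqn; exact: (dens_inv hreal gom hf hf).
have mF1 : measurable_fun [set: Q] (F1 : Q -> \bar R).
  by apply/measurable_EFinP; exact: (sqn_measurable hreal gom hf).
have iF1 : (\int[mu]_x F1 x < +oo)%E by apply: integrable_lty => //; exact: (sqn_integrable hreal gom hf).
apply: (negligibleS _ (Bad_negligible F0 GF1' mF1 iF1)) => g /= np hg; apply: np.
have mR (h : GA 2 -> R) : measurable_fun setT (h : g_sigma_algebraType (@open (GA 2)) -> R) ->
    (forall c x, GF 2 c -> h (c * x)%g = h x) -> measurable_fun (unip : set QN) (fun n : QN => h (n * g)%g).
  move=> mh ih; apply: measurable_funTS; apply: qmeasurable_fun; last by move=> c x [hc _]; rewrite -mulgA ih.
  move=> _ Y mY; rewrite setTI; have := mh measurableT Y mY; rewrite setTI => hB.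
  by rewrite /measurable /=; apply: (borel_preimage (f := fun x => (x * g)%g) (@GA_mulr_continuous R F Fhat 2 g) hB).
have wn n : unip n -> wt omega (n * g)%g = wt omega g.
  by move=> un; rewrite /wt adetM adet_unip // mul1g.
have mRe := mR _ (L2_Re hf) (fun c x hc => f_equal (@complex.Re R) (L2_inv hf x hc)).
have mIm := mR _ (L2_Im hf) (fun c x hc => f_equal (@complex.Im R) (L2_inv hf x hc)).
pose h n : R := 1 + wt omega g * sqn omega f (n * g)%g.
have msq : measurable_fun (unip : set QN) (fun n : QN => sqn omega f (n * g)%g).
  apply: (eq_measurable_fun (fun n : QN => (complex.Re (f (n * g)%g) ^+ 2 + complex.Im (f (n * g)%g) ^+ 2) / wt omega g)).
    by move=> n /set_mem un; rewrite /sqn sqr_normcE wn.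
  by apply: measurable_funM => //; apply: measurable_funD; exact: measurable_funX.
apply: (cintegrable_le unip_measurable (g := h)) => //.
  move=> n un; rewrite /h /sqn wn // mulrCA divff ?mulr1; last by rewrite gt_eqF // (wt_gt0 gom).
  have real (a : R) : a <= 1 + a ^+ 2 by have := sqr_ge0 (a - 1); have := sqr_ge0 a; rewrite !expr2; lra.
  exact: real.
have fu : (nu (unip : set QN) < +oo)%E by apply: le_lt_trans nu_fin; apply: le_measure; rewrite ?inE //; exact: unip_measurable.
apply: (@iD _ _ _ nu unip unip_measurable (fun=> 1) (fun n : QN => wt omega g * sqn omega f (n * g)%g)).
  apply/integrableP; split; first exact: measurable_cst.
  rewrite (eq_integral (cst 1%E)); last by move=> x _; rewrite /= normr1.
  by rewrite integral_cst ?mul1e //; exact: unip_measurable.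
apply: (@iZ _ _ _ nu unip unip_measurable (wt omega g) (fun n : QN => sqn omega f (n * g)%g)).
apply/integrableP; split; first exact/measurable_EFinP.
rewrite ltey; apply/eqP => bad; apply: hg; rewrite /Bad /= -[RHS]bad; apply: eq_integral => n _.
by rewrite /= ger0_norm // (sqn_ge0 gom).
Qed.

End Constant.

(** * The space of forms generated by the given archimedean type *)

Section CuspForms.
Variables (R : realType) (F : splittingFieldType rat).
Variable Fhat : forall v : finPlace F, completion R v.
Hypothesis hgal : galois 1%AS {:F}.
Hypothesis hreal : totally_real R F.
Local Notation C := R[i].
Local Notation GA n := (GA Fhat n).
Local Notation GF n := (GF Fhat n).
Local Notation unip := (unipotent Fhat).
Variable mu : qmeasure R (adelic_center Fhat `|` GF 2).
Hypothesis hmu : invariant_measure setT mu.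
Variable nu : qmeasure R (GF 2 `&` unip).
Hypothesis hnu : invariant_measure unip nu.
Variable K : forall v : finPlace F, set (GL 2 (Fhat v)).
Variable omega : GA 1 -> C.
Hypothesis gom : goodchar K omega.
Variables (k : infPlace R F -> nat) (w : int).
Local Notation ip := (ip mu omega).

Lemma L20_sub : L20 mu nu omega `<=` L2 mu omega.
Proof. by move=> f []. Qed.

(** Vanishing of an integral is stable under sums only for integrable
    functions: this is where the integrability of constant terms is used. *)
Lemma L20_subspace : subspace_of (L20 mu nu omega).
Proof.
have hd0 := hd0 gom.
have CT := constant_term_integrable hgal hreal hmu hnu hd0 gom.
have mD := unip_measurable (Fhat := Fhat).
split=> [|a f h [hf cf] [hh ch]].
  split; first exact: (L2_0 hreal mu gom).
  rewrite /cuspidal; apply: (negligibleS _ (negligible_set0 mu)) => g /= np; apply: np.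
  by rewrite /cintegral /Rintegral !integral0_eq.
split; first exact: (L2_lin hreal gom).
have := negligibleU (negligibleU cf ch) (negligibleU (CT f hf) (CT h hh)).
apply: negligibleS => g /= np; apply: contrapT => n; apply: np.
have [c1 c2 c3 c4] : [/\ cintegral nu unip (fun n => f (n * g)%g) = 0,
  cintegral nu unip (fun n => h (n * g)%g) = 0, cintegrable nu unip (fun n : GA 2 => f (n * g)%g)
  & cintegrable nu unip (fun n : GA 2 => h (n * g)%g)].
  by split; apply: contrapT => h'; apply: n; [left; left|left; right|right; left|right; right].
apply: (etrans (cint_lin mD a c3 c4)); apply: (etrans (f_equal2 (fun x y => a * x + y) c1 c2)).
by rewrite mulr0 addr0.
Qed.

Lemma L20k_sub : L20k mu nu omega k w `<=` L2 mu omega.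
Proof. by move=> f [/L20_sub]. Qed.

Lemma L20k_subspace : subspace_of (L20k mu nu omega k w).
Proof.
have [z0 lin] := L20_subspace.
split=> [|a f h [hf cf] [hh ch]].
  by split=> // Y [_ [Y0 _] _] _.
split; first exact: lin.
move=> Y cY hY; have [_ [_ Yl] _] := cY.
by apply: Yl; [exact: cf|exact: ch].
Qed.

Lemma frtrans_lin g (a : C) (f h : Defs.form Fhat) : frtrans g (a *: f + h) = a *: frtrans g f + frtrans g h.
Proof. by []. Qed.

Lemma L2_frtrans g f : L2 mu omega f -> L2 mu omega (frtrans g f).
Proof. exact: (L2_rtrans hreal hmu gom). Qed.

Lemma null_lin (a : C) (u v : Defs.form Fhat) : L2 mu omega u -> L2 mu omega v -> ipnull ip u -> ipnull ip v ->
  ipnull ip (a *: u + v).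
Proof.
move=> hu hv nu' nv; have h := L2_psd hreal mu gom.
have huv := L2_lin hreal gom a hu hv.
have e1 := ipnull_orth h hu huv nu'; have e2 := ipnull_orth h hv huv nv.
by apply: (etrans (psd_lin h a hu hv huv)); rewrite e1 e2 mulr0 addr0.
Qed.

Lemma L20kK_sub : L20kK mu nu omega k w K `<=` L2 mu omega.
Proof. by move=> f [/L20k_sub]. Qed.

Lemma L20kK_subspace : subspace_of (L20kK mu nu omega k w K).
Proof.
have [z0 lin] := L20k_subspace; have h := L2_psd hreal mu gom.
split=> [|a f e [hf cf] [he ce]].
  split=> // g _; rewrite (_ : frtrans g 0 = 0) ?subr0; last by [].
  exact: (ip0l h (L2_0 hreal mu gom)).
split; first exact: lin.
move=> g hg; rewrite frtrans_lin opprD addrACA -scalerBr.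
have f2 := L20k_sub hf; have e2 := L20k_sub he; have hX := psd_sub h.
by apply: null_lin; [apply: (subspaceB hX) => //; exact: L2_frtrans|apply: (subspaceB hX) => //; exact: L2_frtrans|exact: cf|exact: ce].
Qed.

End CuspForms.

(** * Sums over cosets *)

Section CosetSums.
Variables (G : groupType) (P : set G).
Hypothesis P1 : P 1%g.
Hypothesis PM : forall x y, P x -> P y -> P (x * y)%g.
Hypothesis PV : forall x, P x -> P (x^-1)%g.

Definition rp (g : G) : G := xget 1%g [set h | P (g^-1 * h)%g].

Lemma rpP g : P (g^-1 * rp g)%g.
Proof. by rewrite /rp; case: xgetP => [x _ h //|/(_ g)[]] /=; rewrite mulVg. Qed.

Lemma rp_eq g h : rp g = rp h <-> P (g^-1 * h)%g.
Proof.
split=> [e|e].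
  have := PM (rpP g) (PV (rpP h)); rewrite e invMg invgK -mulgA.
  by rewrite mulKVg.
rewrite /rp (_ : [set _ | _] = [set x | P (h^-1 * x)%g]) //.
apply/seteqP; split=> x /= hx.
  by have := PM (PV e) hx; rewrite invMg invgK -mulgA mulKVg.
by have := PM e hx; rewrite -mulgA mulKVg.
Qed.

Lemma rpK g : rp (rp g) = rp g.
Proof. by apply/esym/rp_eq; exact: rpP. Qed.

Definition pinv (T : Type) (f : G -> T) := forall g p, P p -> f (g * p)%g = f g.
Definition distinct (L : seq G) := uniq (map rp L).
Definition covers (L : seq G) (V : nmodType) (f : G -> V) :=
  forall g, f g <> 0 -> exists2 x, x \in L & P (x^-1 * g)%g.
(** The summand is evaluated at the chosen representative of each coset; sums
    are used only for functions that do not depend on this choice. *)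
Definition csum (V : nmodType) (f : G -> V) : V := \sum_(g \in [set g | rp g = g]) f g.

Lemma pinv_rp T (f : G -> T) g : pinv f -> f (rp g) = f g.
Proof. by move=> h; rewrite -(mulKVg g (rp g)) h //; exact: rpP. Qed.

Lemma csumE (V : nmodType) L (f : G -> V) : pinv f -> distinct L -> covers L f -> csum f = \sum_(x <- L) f x.
Proof.
move=> hf dL cL; transitivity (\sum_(x <- map rp L) f x); last first.
  by rewrite big_map; apply: eq_bigr => x _; rewrite pinv_rp.
rewrite (fsbig_seq _ _ dL) /csum; apply/esym; apply: fsbig_widen.
  by move=> x /= /mapP[y _ ->]; rewrite rpK.
move=> x /= [ex nx]; apply: contrapT => fx; have [y yL hy] := cL x fx.
by apply: nx; apply/mapP; exists y => //; rewrite -ex; apply/esym/rp_eq.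
Qed.

Lemma csum_list (L : seq G) : exists L', distinct L' /\
  forall (V : nmodType) (f : G -> V), pinv f -> covers L f -> covers L' f /\ csum f = \sum_(x <- L') f x.
Proof.
have dd : distinct (undup (map rp L)).
  rewrite /distinct map_inj_in_uniq ?undup_uniq // => x y; rewrite !mem_undup.
  by move=> /mapP[a _ ->] /mapP[b _ ->]; rewrite !rpK.
exists (undup (map rp L)); split=> // V f hf cL.
suff c' : covers (undup (map rp L)) f by split=> //; exact: csumE.
move=> g /cL[x xL hx]; exists (rp x); first by rewrite mem_undup map_f.
by apply/rp_eq; rewrite rpK; apply/rp_eq.
Qed.

Definition fsup (V : nmodType) (f : G -> V) := pinv f /\ exists L, covers L f.

Lemma fsup_list (V : nmodType) (f : G -> V) : fsup f ->
  exists L, [/\ distinct L, covers L f & csum f = \sum_(x <- L) f x].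
Proof. by move=> [hf [L cL]]; have [L' [dL' h]] := csum_list L; have [] := h V f hf cL; exists L'. Qed.

Lemma distinct_map (t : G -> G) L : (forall x y, P ((t x)^-1 * t y)%g -> P (x^-1 * y)%g) ->
  distinct L -> distinct (map t L).
Proof.
move=> h; elim: L => //= x L IH; rewrite /distinct /= => /andP[nx dL]; rewrite [X in _ && X](IH dL) andbT.
apply: contra nx => /mapP[y /mapP[z zL ->] /rp_eq/h/rp_eq ->]; exact: map_f.
Qed.

(** A bijection of the cosets reindexes the sum. *)
Lemma csum_reindex (V : nmodType) (f : G -> V) (t t' : G -> G) : fsup f ->
  (forall x y, P ((t x)^-1 * t y)%g <-> P (x^-1 * y)%g) -> cancel t t' -> cancel t' t ->
  fsup (f \o t) /\ csum (f \o t) = csum f.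
Proof.
move=> ff ht tK t'K; have [L [dL cL ->]] := fsup_list ff; have [hf _] := ff.
have hp : pinv (f \o t).
  move=> g p hp /=; rewrite -(mulKVg (t g) (t (g * p)%g)) hf //; apply/ht; by rewrite mulKg.
have c' : covers (map t' L) (f \o t).
  move=> g /= /cL[x xL hx]; exists (t' x); first exact: map_f.
  by apply/ht; rewrite t'K.
split; first by split=> //; exists (map t' L).
rewrite (csumE hp _ c'); last by apply: distinct_map => // x y /ht; rewrite !t'K.
by rewrite big_map; apply: eq_bigr => x _ /=; rewrite t'K.
Qed.

Lemma csum_mull (V : nmodType) (f : G -> V) a : fsup f ->
  fsup (fun g => f (a * g)%g) /\ csum (fun g => f (a * g)%g) = csum f.
Proof.
move=> ff; apply: (@csum_reindex V f (fun g => a * g)%g (fun g => a^-1 * g)%g ff).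
- by move=> x y; rewrite invMg -mulgA mulKg.
- by move=> x; rewrite mulKg.
- by move=> x; rewrite mulKVg.
Qed.

Lemma csum_mulr (V : nmodType) (f : G -> V) a : fsup f -> (forall p, P (a^-1 * p * a)%g <-> P p) ->
  fsup (fun g => f (g * a)%g) /\ csum (fun g => f (g * a)%g) = csum f.
Proof.
move=> ff ha; apply: (@csum_reindex V f (fun g => g * a)%g (fun g => g * a^-1)%g ff).
- by move=> x y; rewrite invMg -(ha (x^-1 * y)%g) !mulgA.
- by move=> x; rewrite mulgK.
- by move=> x; rewrite mulgKV.
Qed.

Lemma csum_morph (V W : nmodType) (f : G -> V) (h : V -> W) : fsup f -> h 0 = 0 ->
  (forall x y, h (x + y) = h x + h y) -> fsup (h \o f) /\ csum (h \o f) = h (csum f).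
Proof.
move=> ff h0 hD; have [L [dL cL ->]] := fsup_list ff; have [hf _] := ff.
have hp : pinv (h \o f) by move=> g p /hf /= ->.
have c' : covers L (h \o f) by move=> g /= hg; apply: cL => e; apply: hg; rewrite /= e.
split; first by split=> //; exists L.
by rewrite (csumE hp dL c') (big_morph h hD h0).
Qed.

Lemma csum_add (V : nmodType) (f g : G -> V) : fsup f -> fsup g ->
  fsup (fun x => f x + g x) /\ csum (fun x => f x + g x) = csum f + csum g.
Proof.
move=> [hf [L cL]] [hg [M cM]]; have [L' [dL' h]] := csum_list (L ++ M).
have cf : covers (L ++ M) f by move=> x /cL[y yL hy]; exists y => //; rewrite mem_cat yL.
have cg : covers (L ++ M) g by move=> x /cM[y yL hy]; exists y => //; rewrite mem_cat yL orbT.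
have cfg : covers (L ++ M) (fun x => f x + g x).
  move=> x hx; case: (pselect (f x = 0)) => [fx|/cf //]; apply: cg => gx; apply: hx.
  by rewrite fx gx addr0.
have hp : pinv (fun x => f x + g x) by move=> x p h'; rewrite hf // hg.
split; first by split=> //; exists (L ++ M).
by have [_ ->] := h V _ hf cf; have [_ ->] := h V _ hg cg; have [_ ->] := h V _ hp cfg; rewrite big_split.
Qed.

Lemma csum_sum (V : nmodType) (I : Type) (r : seq I) (f : I -> G -> V) : (forall i, fsup (f i)) ->
  fsup (fun x => \sum_(i <- r) f i x) /\ csum (fun x => \sum_(i <- r) f i x) = \sum_(i <- r) csum (f i).
Proof.
move=> h; elim: r => [|i r [IH1 IH2]].
  have e : (fun x : G => \sum_(i <- [::]) f i x) = (fun=> 0) by apply/funext => x; rewrite big_nil.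
  rewrite e big_nil; have ff : fsup (fun=> 0 : V) by split=> [g p _ //|]; exists [::] => g [].
  by split=> //; have [hf _] := ff; rewrite (@csumE V [::]) ?big_nil // => g [].
rewrite big_cons -IH2; have [h1 <-] := csum_add (h i) IH1.
rewrite (_ : (fun x => \sum_(j <- i :: r) f j x) = (fun x => f i x + \sum_(j <- r) f j x)) //.
by apply/funext => x; rewrite big_cons.
Qed.

Lemma csum_one (V : nmodType) (f : G -> V) a : pinv f -> (forall g, f g <> 0 -> P (a^-1 * g)%g) -> csum f = f a.
Proof.
move=> hf h; rewrite (@csumE V [:: a]) ?big_seq1 // => g /h hg; exists a => //; exact: mem_head.
Qed.

Lemma eq_csum (V : nmodType) (f g : G -> V) : f =1 g -> csum f = csum g.
Proof. by move=> /funext ->. Qed.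

End CosetSums.

Lemma csum_exchange (G : groupType) (P Q : set G) (hP : P 1%g) (PM : forall x y, P x -> P y -> P (x * y)%g)
  (PV : forall x, P x -> P (x^-1)%g) (hQ : Q 1%g) (QM : forall x y, Q x -> Q y -> Q (x * y)%g)
  (QV : forall x, Q x -> Q (x^-1)%g) (V : nmodType) (f : G -> G -> V) L M :
  (forall y, pinv P (fun x => f x y)) -> (forall x, pinv Q (f x)) ->
  (forall y, covers P L (fun x => f x y)) -> (forall x, covers Q M (f x)) ->
  csum P (fun x => csum Q (f x)) = csum Q (fun y => csum P (fun x => f x y)).
Proof.
move=> p1 p2 c1 c2; have [L' [dL hL]] := csum_list hP PM PV L; have [M' [dM hM]] := csum_list hQ QM QV M.
have e1 x : csum Q (f x) = \sum_(y <- M') f x y by have [] := hM V _ (p2 x) (c2 x).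
have e2 y : csum P (fun x => f x y) = \sum_(x <- L') f x y by have [] := hL V _ (p1 y) (c1 y).
rewrite (eq_csum _ e1) (eq_csum _ e2).
have f1 y : fsup P (fun x => f x y) by split=> //; exists L.
have f2 x : fsup Q (f x) by split=> //; exists M.
have [_ ->] := csum_sum hP PM PV M' f1; have [_ ->] := csum_sum hQ QM QV L' (f := fun x y => f x y) f2.
under eq_bigr do rewrite e2; under [RHS]eq_bigr do rewrite e1; exact: exchange_big.
Qed.

(** * Integration over the finite adelic points modulo the center *)

Section FiniteMeasure.
Variables (R : realType) (F : splittingFieldType rat).
Variable Fhat : forall v : finPlace F, completion R v.
Local Notation C := R[i].
Local Notation Gf := (GAf Fhat 2).
Local Notation QL := (g_sigma_algebraType (qborel (fcenter Fhat))).
Variable lam : qmeasure R (fcenter Fhat).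
Hypothesis hlam : fcenter_haar lam.
Variable K : forall v : finPlace F, set (GL 2 (Fhat v)).
Arguments K : clear implicits.
Hypothesis hK1 : forall v, K v 1%g.
Hypothesis hKM : forall v g h, K v g -> K v h -> K v (g * h)%g.
Hypothesis hKV : forall v g, K v g -> K v (g^-1)%g.
Hypothesis hKint : forall v, K v `<=` @gl_integral R 2 (Fhat v).
Hypothesis hKopen : open (level K).
Hypothesis hKcompact : compact (level K).

Lemma GAf_mulr_continuous (c : Gf) : continuous (fun x : Gf => x * c)%g.
Proof.
move=> x; have c0 := @GAf_mul_continuous R F Fhat 2 (x, c).
apply: (@continuous_comp _ _ _ (fun x : Gf => (x, c)) (fun p : Gf * Gf => p.1 * p.2)%g) => //.
apply: pair_continuous; first exact: cvg_id.
exact: cst_continuous.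
Qed.

Lemma indic_iff (T U : Type) (A : set T) (B : set U) x y : (A x <-> B y) -> \1_A x = \1_B y :> R.
Proof.
move=> h; rewrite !indicE; congr (nat_of_bool _)%:R; apply/idP/idP => /set_mem h'; apply/mem_set; exact/h.
Qed.

Definition ZS (S : set Gf) : set Gf := [set g | exists z k, S k /\ g = (fscal 2 z * k)%g].

Section Subgroup.
Variable S : set Gf.
Hypothesis S1 : S 1%g.
Hypothesis SM : forall x y, S x -> S y -> S (x * y)%g.
Hypothesis SV : forall x, S x -> S (x^-1)%g.
Hypothesis So : open S.

Lemma ZS1 : ZS S 1%g. Proof. by exists 1%g, 1%g; rewrite fscal1 mul1g. Qed.
Lemma ZSM x y : ZS S x -> ZS S y -> ZS S (x * y)%g.
Proof.
move=> [z [k [hk ->]]] [z' [k' [hk' ->]]]; exists (z * z')%g, (k * k')%g; split; first exact: SM.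
by rewrite fscalM -!mulgA; congr mulg; rewrite !mulgA fscalC.
Qed.
Lemma ZSV x : ZS S x -> ZS S (x^-1)%g.
Proof.
move=> [z [k [hk ->]]]; exists (z^-1)%g, (k^-1)%g; split; first exact: SV.
by rewrite invMg fscalV -fscalV fscalC.
Qed.
Lemma ZS_center z x : ZS S (fscal 2 z * x)%g <-> ZS S x.
Proof.
split=> [[a [k [hk e]]]|[a [k [hk ->]]]].
  by exists (z^-1 * a)%g, k; split=> //; rewrite fscalM fscalV -mulgA -e mulKg.
by exists (z * a)%g, k; split=> //; rewrite fscalM mulgA.
Qed.
Lemma ZS_sub k : S k -> ZS S k. Proof. by exists 1%g, k; rewrite fscal1 mul1g. Qed.
Lemma ZS_scal z : ZS S (fscal 2 z). Proof. by exists z, 1%g; rewrite mulg1. Qed.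

Lemma ZS_translate_open g : open [set x | ZS S (g^-1 * x)%g].
Proof.
rewrite (_ : [set _ | _] = \bigcup_(z in [set: GAf Fhat 1]) ((fun x => (fscal 2 z)^-1 * (g^-1 * x))%g @^-1` S)).
  apply: bigcup_open => z _; apply: open_comp => // x _.
  apply: (@continuous_comp _ _ _ (fun x : Gf => g^-1 * x)%g (fun x : Gf => (fscal 2 z)^-1 * x)%g); exact: GAf_mull_continuous.
apply/seteqP; split=> [x [z [k [hk e]]]|x [z _ h]]; first by exists z => //=; rewrite e mulKg.
by exists z, ((fscal 2 z)^-1 * (g^-1 * x))%g; split=> //; rewrite mulKVg.
Qed.
End Subgroup.

Lemma zopen_measurable (A : set Gf) : open A -> (forall z x, A (fscal 2 z * x)%g <-> A x) -> measurable (A : set QL).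
Proof.
move=> oA iA; rewrite qmeasurableE; split; first exact: borel_open.
by move=> c x [z _ <-]; exact: iA.
Qed.

Lemma levelV x : level K x -> level K (x^-1)%g. Proof. by move=> h v; exact: hKV. Qed.
Lemma levelM x y : level K x -> level K y -> level K (x * y)%g. Proof. by move=> h h' v; exact: hKM. Qed.
Lemma level1 : level K 1%g. Proof. by move=> v; exact: hK1. Qed.
Local Notation P := (ZS (level K)).

Lemma compact_cosets (A U : set Gf) : compact A -> open U -> U 1%g ->
  exists L : seq Gf, forall a, A a -> exists2 x, x \in L & U (x^-1 * a)%g.
Proof.
rewrite compact_cover => cA oU U1.
have [|a Aa|D' _ hD] := cA Gf setT (fun x => [set y | U (x^-1 * y)%g]).
- by move=> x _; apply: open_comp oU => y _; exact: GAf_mull_continuous.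
- by exists a => //=; rewrite mulVg.
by exists (enum_fset D') => a /hD[x /= xD hx]; exists x.
Qed.

Lemma translates_cover (g : Gf) (U : set Gf) : open U -> U 1%g ->
  exists L : seq Gf, forall k, level K k -> exists2 x, x \in L & U (x^-1 * (k * g))%g.
Proof.
move=> oU U1; have c : compact ((fun k => k * g)%g @` level K).
  by apply: continuous_compact => //; apply: continuous_subspaceT; exact: GAf_mulr_continuous.
have [L hL] := compact_cosets c oU U1; exists L => k hk; apply: hL; by exists k.
Qed.

Lemma lam_inv g A : measurable (A : set QL) -> lam [set x | A (x * g)%g] = lam A.
Proof. by move=> mA; have [[inv _ _ _] _] := hlam; apply: inv => //; rewrite -qmeasurableE. Qed.

Definition lamP (A : set Gf) : R := fine (lam A).

Section OpenSubgroup.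
Variable W : set Gf.
Hypothesis W1 : W 1%g.
Hypothesis WM : forall x y, W x -> W y -> W (x * y)%g.
Hypothesis WV : forall x, W x -> W (x^-1)%g.
Hypothesis Wo : open W.
Hypothesis WK : W `<=` level K.
Let Q := ZS W.
Let Q1 := ZS1 W1.
Let QM := @ZSM W WM.
Let QV := @ZSV W WV.

Lemma lcoset_measurable g : measurable ([set x | Q (g^-1 * x)%g] : set QL).
Proof.
apply: zopen_measurable; first exact: ZS_translate_open.
by move=> z x /=; rewrite mulgA -fscalC -mulgA; exact: ZS_center.
Qed.

Lemma rcoset_measurable g : measurable ([set x | Q (x * g)%g] : set QL).
Proof.
have h := lcoset_measurable 1%g.
rewrite qmeasurableE; apply: (@qborel_rtrans _ (fcenter Fhat) GAf_mulr_continuous g Q).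
rewrite -qmeasurableE (_ : Q = [set x | Q (1^-1 * x)%g]) //.
by apply/seteqP; split=> x /=; rewrite invg1 mul1g.
Qed.

Lemma Q_measurable : measurable (Q : set QL).
Proof. by have := rcoset_measurable 1%g; congr measurable; apply/seteqP; split=> x /=; rewrite mulg1. Qed.

Lemma rcoset_lam g : lam [set x | Q (x * g)%g] = lam Q.
Proof. by apply: lam_inv; exact: Q_measurable. Qed.

Lemma lamQ_fin : (lam Q < +oo)%E.
Proof.
have [_ e] := hlam; apply: (@le_lt_trans _ _ 1%E); last exact: ltry.
rewrite -e; apply: le_measure; rewrite ?inE; first exact: Q_measurable.
  apply: (zopen_measurable (A := ZS (@GAf_int R F Fhat 2))); last exact: ZS_center.
  have o : open (@GAf_int R F Fhat 2).
    have Gint1 : GAf_int (1%g : Gf) by move=> v; exact: (rint1 (fin_fam Fhat 2)).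
    rewrite openE => x hx.
    have : nbhs x [set y | level K (x^-1 * y)%g].
      by apply: (GAf_mull_continuous (c := (x^-1)%g)); apply: open_nbhs_nbhs; split=> //=; rewrite mulVg; exact: level1.
    apply: filterS => y /= hy v; rewrite -(mulKVg x y).
    by apply: (@rintM _ (fin_fam Fhat 2) v); [exact: hx|exact: (hKint (hy v))].
  rewrite (_ : ZS _ = \bigcup_(z in [set: GAf Fhat 1]) ((fun x => (fscal 2 z)^-1 * x)%g @^-1` @GAf_int R F Fhat 2)).
    by apply: bigcup_open => z _; apply: open_comp => // x _; exact: GAf_mull_continuous.
  apply/seteqP; split=> [x [z [k [hk ->]]]|x [z _ h]]; first by exists z => //=; rewrite mulKg.
  by exists z, ((fscal 2 z)^-1 * x)%g; split=> //; rewrite mulKVg.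
by move=> x [z [k [hk ->]]]; exists z, k; split=> // v; exact: (hKint (WK hk v)).
Qed.

Lemma lamQ_gt0 : (0 < lam Q)%E.
Proof.
rewrite lt0e measure_ge0 andbT; apply/eqP => m0.
have [[_ _ _ /negP h] _] := hlam; apply: h; apply/eqP.
have [B [Bo hB]] := GAf_base Fhat 2.
pose A (l : nat) : set QL := if pselect (exists g, B l `<=` [set x | Q (x * g)%g]) is left e
  then [set x | Q (x * projT1 (cid e))%g] else set0.
have A0 l : lam.-negligible (A l).
  rewrite /A; case: pselect => [e|_] /=; last exact: negligible_set0.
  by apply/negligibleP; [exact: rcoset_measurable|exact: (etrans (rcoset_lam _) m0)].
have := negligible_bigcup A0.
rewrite (_ : \bigcup_l A l = setT).
  by move=> [N [mN N0 TN]]; apply/eqP; rewrite -measure_le0 -N0; apply: le_measure; rewrite ?inE.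
apply/seteqP; split=> // x _.
have n : nbhs (x : Gf) [set y | Q (y * x^-1)%g].
  have := ZS_translate_open Wo 1%g; rewrite (_ : [set _ | _] = Q); last first.
    by apply/seteqP; split=> y /=; rewrite invg1 mul1g.
  by move=> oQ; apply: (GAf_mulr_continuous (c := (x^-1)%g)); apply: open_nbhs_nbhs; split=> //=; rewrite mulgV.
have [l Bx Bl] := hB _ _ n; exists l => //; rewrite /A; case: pselect => [e|[]] /=; last by exists (x^-1)%g.
exact: (projT2 (cid e)).
Qed.

Lemma lamP_gt0 : 0 < lamP Q.
Proof. by apply: fine_gt0; rewrite lamQ_gt0 lamQ_fin. Qed.

End OpenSubgroup.

(** ** Integrals of functions constant on cosets *)

Lemma int_list (I : Type) (L : seq I) (a : I -> C) (A : I -> set Gf) :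
  (forall i, measurable (A i : set QL)) -> (forall i, (lam (A i) < +oo)%E) ->
  cintegrable lam setT (fun x : QL => \sum_(i <- L) a i * (\1_(A i) x)%:C%C) /\
  cintegral lam setT (fun x : Gf => \sum_(i <- L) a i * (\1_(A i) x)%:C%C) = \sum_(i <- L) a i * (lamP (A i))%:C%C.
Proof.
move=> mA fA; have one i : cintegrable lam setT (fun x : QL => (\1_(A i) x)%:C%C : C) /\
    cint lam setT (fun x : QL => (\1_(A i) x)%:C%C : C) = (lamP (A i))%:C%C.
  have z0 : lam.-integrable setT (EFin \o (fun=> 0 : R)) by exact: integrable0.
  have i1 : lam.-integrable setT (fun x : QL => (\1_(A i) x)%:E).
    apply/integrableP; split; first by apply/measurable_EFinP; exact: measurable_indic.
    rewrite (eq_integral (fun x : QL => (\1_(A i) x)%:E)); first by rewrite integral_indic // setIT.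
    by move=> x _; rewrite /= ger0_norm // indicE; case: (_ \in _).
  split; first by split; [exact: i1|exact: z0].
  rewrite /cint /Rintegral /=; congr Complex; first by rewrite integral_indic // setIT.
  by rewrite integral0_eq.
elim: L => [|i L [IH1 IH2]].
  have e : (fun x : Gf => \sum_(i <- [::]) a i * (\1_(A i) x)%:C%C) = (fun=> 0 : C) by apply/funext => x; rewrite big_nil.
  rewrite e big_nil; have z0 : lam.-integrable setT (EFin \o (fun=> 0 : R)) by exact: integrable0.
  by split; [split|rewrite /cintegral /Rintegral /= !integral0_eq].
have e : (fun x : Gf => \sum_(j <- i :: L) a j * (\1_(A j) x)%:C%C) =
  (fun x => a i * (\1_(A i) x)%:C%C + \sum_(j <- L) a j * (\1_(A j) x)%:C%C) by apply/funext => x; rewrite big_cons.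
have [one1 one2] := one i; rewrite e big_cons -IH2; split; first exact: cintegrable_lin.
by apply: (etrans (cint_lin measurableT (a i) one1 IH1)); rewrite one2.
Qed.

Section Partition.
Variables (G : groupType) (Q : set G).
Hypothesis Q1 : Q 1%g.
Hypothesis QM : forall x y, Q x -> Q y -> Q (x * y)%g.
Hypothesis QV : forall x, Q x -> Q (x^-1)%g.
Lemma partition (T : G -> C) L y : pinv Q T -> distinct Q L -> covers Q L T ->
  T y = \sum_(g <- L) T g * (\1_[set x | Q (g^-1 * x)%g] y)%:C%C.
Proof.
move=> hT dL cL.
have hp : pinv Q (fun g => T g * (\1_[set x | Q (g^-1 * x)%g] y : R)%:C%C).
  move=> g p hp; rewrite hT //; congr (_ * _%:C%C); apply: indic_iff; split=> /= h.
    by rewrite -(mulKVg p (g^-1 * y)%g); apply: QM => //; move: h; rewrite invMg -mulgA.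
  by rewrite invMg -mulgA; apply: QM => //; exact: QV.
have hc : covers Q L (fun g => T g * (\1_[set x | Q (g^-1 * x)%g] y : R)%:C%C).
  by move=> g hg; apply: cL => e; apply: hg; rewrite e mul0r.
rewrite -(csumE Q1 QM QV hp dL hc) (@csum_one _ _ Q1 QM QV _ _ y hp).
  by rewrite indicE mem_set ?mulr1 //= mulVg.
move=> g; rewrite indicE; case: (pselect (Q (g^-1 * y)%g)) => h; last by rewrite memNset ?mulr0.
by move=> _; have := QV h; rewrite invMg invgK.
Qed.
End Partition.

Lemma lP1 : P 1%g. Proof. exact: (ZS1 level1). Qed.
Lemma lPM x y : P x -> P y -> P (x * y)%g. Proof. exact: (ZSM levelM). Qed.
Lemma lPV x : P x -> P (x^-1)%g. Proof. exact: (ZSV levelV). Qed.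

(** The cosets [ZWg] all have the same measure because [lam] is invariant
    under right translation. *)
Lemma int_left W (W1 : W 1%g) (WM : forall x y, W x -> W y -> W (x * y)%g) (WV : forall x, W x -> W (x^-1)%g)
  (Wo : open W) (WK : W `<=` level K) (T : Gf -> C) : fsup (ZS W) (fun g => T (g^-1)%g) ->
  cintegrable lam setT (T : QL -> C) /\
  cintegral lam setT T = (lamP (ZS W))%:C%C * csum (ZS W) (fun g => T (g^-1)%g).
Proof.
move=> ff; have q1 := ZS1 W1; have qM := ZSM WM; have qV := ZSV WV.
have [L [dL cL ->]] := fsup_list q1 qM qV ff; have [hf _] := ff.
have e : T = (fun x => \sum_(g <- L) T (g^-1)%g * (\1_[set x | ZS W (x * g)%g] x)%:C%C).
  apply/funext => x; rewrite -{1}(invgK x) (partition q1 qM qV (x^-1)%g hf dL cL).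
  apply: eq_bigr => g _; congr (_ * _%:C%C); apply: indic_iff; split=> /= h.
    by have := qV _ h; rewrite /= invMg !invgK.
  by rewrite -invMg; exact: qV.
have fin g : (lam [set x | ZS W (x * g)%g] < +oo)%E by rewrite rcoset_lam //; exact: lamQ_fin.
have [h1 h2] := int_list L (fun g => T (g^-1)%g) (rcoset_measurable Wo) fin.
rewrite [X in cintegrable _ _ X]e [X in cintegral _ _ X]e; split=> //.
by rewrite h2 mulr_sumr; apply: eq_bigr => g _; rewrite /lamP rcoset_lam // mulrC.
Qed.

(** The measure of the left coset of [g], which depends on [g] since [lam] is
    invariant under translations on the other side. *)
Definition delta (g : Gf) : R := lamP [set x | P (g^-1 * x)%g].

Lemma inv_cover W g (W1 : W 1%g) (Wo : open W) : exists L : seq Gf, forall x, P (g^-1 * x^-1)%g ->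
  exists2 y, y \in L & ZS W (y^-1 * x)%g.
Proof.
have [L hL] := translates_cover (g^-1)%g Wo W1; exists L => x [z [k [hk e]]].
have [y yL hy] := hL _ (levelV hk); exists y => //.
have -> : x = (fscal 2 z^-1 * (k^-1 * g^-1))%g.
  have : (x^-1 = g * (fscal 2 z * k))%g by rewrite -e mulKVg.
  by move=> /(congr1 (fun y : Gf => y^-1)%g); rewrite invgK !invMg => ->; rewrite -fscalV -fscalC mulgA.
by exists (z^-1)%g, (y^-1 * (k^-1 * g^-1))%g; split=> //; rewrite mulgA -fscalC -mulgA.
Qed.

(** A small normal subgroup of the level fixing the coset [gP] on the left. *)
Lemma small_normal g : exists W : set Gf, [/\ [/\ W 1%g, forall x y, W x -> W y -> W (x * y)%g,
    forall x, W x -> W (x^-1)%g, open W & W `<=` level K],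
  forall k w, level K k -> W (k^-1 * w * k)%g <-> W w & forall w, W w -> level K (g^-1 * w * g)%g].
Proof.
have n : nbhs (1%g : Gf) (level K `&` [set x | level K (g^-1 * x * g)%g]).
  apply: filterI; first by apply: open_nbhs_nbhs; split=> //; exact: level1.
  have c1 : {for (1%g : Gf), continuous (fun x : Gf => (g^-1 * x * g)%g)}.
    apply: (@continuous_comp _ _ _ (fun y : Gf => ((g^-1 * y)%g, g)) (fun p : Gf * Gf => p.1 * p.2)%g); last exact: GAf_mul_continuous.
    apply: pair_continuous; first exact: GAf_mull_continuous.
    exact: cst_continuous.
  by apply: c1; apply: open_nbhs_nbhs; split=> //=; rewrite mulg1 mulVg; exact: level1.
have [d hd dsub] := cong_base n; exists (cong Fhat 2 d).
have cc k w : level K k -> cong Fhat 2 d w -> cong Fhat 2 d (k * w * k^-1)%g.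
  by move=> hk hw; apply: (cong_conj hd) => // v; exact: (hKint (hk v)).
split; last by move=> w /dsub[].
- split; [exact: (cong1 Fhat 2 hd)|exact: (congM hd)|exact: (congV hd)|exact: (cong_open Fhat 2 hd)|].
  by move=> w /dsub[].
move=> k w hk; split=> h; last by have := cc _ _ (levelV hk) h; rewrite invgK.
by have := cc _ _ hk h; rewrite !mulgA mulgV mul1g mulgK.
Qed.

Lemma coset_count g W : [/\ W 1%g, forall x y, W x -> W y -> W (x * y)%g,
    forall x, W x -> W (x^-1)%g, open W & W `<=` level K] -> (forall w, W w -> level K (g^-1 * w * g)%g) ->
  [/\ fsup (ZS W) (fun x => (\1_[set y | P (g^-1 * y)%g] (x^-1)%g)%:C%C : C),
    (lam [set x | P (g^-1 * x)%g] < +oo)%E &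
    (delta g)%:C%C = (lamP (ZS W))%:C%C * csum (ZS W) (fun x => (\1_[set y | P (g^-1 * y)%g] (x^-1)%g)%:C%C : C)].
Proof.
move=> [W1 WM WV Wo WK] Wg.
have ff : fsup (ZS W) (fun x => (\1_[set y | P (g^-1 * y)%g] (x^-1)%g)%:C%C : C).
  split.
    move=> x p [z [q [hq ->]]]; congr (_%:C%C); apply: indic_iff; rewrite /= !invMg.
    have hz (h : Gf) : P (g^-1 * (q^-1 * (fscal 2 z)^-1 * h))%g <-> P (g^-1 * h)%g.
      have -> : (g^-1 * (q^-1 * (fscal 2 z)^-1 * h))%g = (fscal 2 z^-1 * ((g^-1 * q^-1 * g) * (g^-1 * h)))%g.
        by rewrite -fscalV -fscalC !mulgA -fscalC mulgK.
      rewrite ZS_center; have hk : P (g^-1 * q^-1 * g)%g by apply: ZS_sub; apply: Wg; exact: WV.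
      split=> h'; last exact: lPM.
      by rewrite -(mulKg (g^-1 * q^-1 * g)%g (g^-1 * h)%g); apply: lPM => //; exact: lPV.
    exact: hz.
  have [L hL] := inv_cover g W1 Wo; exists L => x hx; apply: hL; apply: contrapT => n; apply: hx.
  by rewrite indicE memNset.
have [i1 i2] := @int_left W W1 WM WV Wo WK (fun y : Gf => (\1_[set y | P (g^-1 * y)%g] y)%:C%C : C) ff.
have mg : measurable ([set x | P (g^-1 * x)%g] : set QL) by exact: lcoset_measurable.
have fin : (lam [set x | P (g^-1 * x)%g] < +oo)%E.
  have [/integrableP[_ h] _] := i1; apply: le_lt_trans h; rewrite -[X in lam X]setIT -integral_indic //.
  rewrite le_eqVlt; apply/orP; left; apply/eqP; apply: eq_integral => x _.
  by rewrite /= ger0_norm // indicE; case: (_ \in _).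
split=> //; rewrite -i2.
have [_] := int_list [:: tt] (fun=> 1 : C) (A := fun=> [set x | P (g^-1 * x)%g]) (fun=> mg) (fun=> fin).
rewrite big_seq1 mul1r => <-; congr (cintegral lam setT); apply/funext => x.
by rewrite big_seq1 mul1r.
Qed.

Lemma csum01 (G : groupType) (Q : set G) (Q1 : Q 1%g) (QM : forall x y, Q x -> Q y -> Q (x * y)%g)
  (QV : forall x, Q x -> Q (x^-1)%g) (A : G -> bool) : fsup Q (fun x => (A x)%:R%:C%C : C) ->
  exists n : nat, csum Q (fun x => (A x)%:R%:C%C : C) = n%:R%:C%C.
Proof.
move=> ff; have [L [_ _ ->]] := fsup_list Q1 QM QV ff; exists (\sum_(x <- L) A x)%N.
by rewrite natr_sum (rmorph_sum (real_complex R)).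
Qed.

Lemma delta_fin g : (lam [set x | P (g^-1 * x)%g] < +oo)%E.
Proof. by have [W [hW _ Wg]] := small_normal g; have [_ h _] := coset_count hW Wg. Qed.

Lemma delta1 : delta 1%g = lamP P.
Proof. by rewrite /delta; congr (fine (lam _)); apply/seteqP; split=> x /=; rewrite invg1 mul1g. Qed.

Lemma delta_right g p : P p -> delta (g * p)%g = delta g.
Proof.
move=> hp; rewrite /delta; congr (fine (lam _)); apply/seteqP; split=> x /=; rewrite invMg -mulgA => h.
  by rewrite -(mulKVg p (g^-1 * x)%g); exact: lPM.
by apply: lPM => //; exact: lPV.
Qed.

Lemma delta_left g k : level K k -> delta (k * g)%g = delta g.
Proof.
move=> hk; have [W [hW Wn Wg]] := small_normal g; have [W1 WM WV Wo WK] := hW.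
have Wg' w : W w -> level K ((k * g)^-1 * w * (k * g))%g.
  move=> hw; rewrite (_ : (_ * _ * _)%g = (g^-1 * (k^-1 * w * k) * g)%g); last by rewrite invMg !mulgA.
  by apply: Wg; apply/Wn.
have [f1 _ e1] := coset_count hW Wg; have [f2 _ e2] := coset_count hW Wg'.
apply: (@complexI R); rewrite e1 e2; congr (_ * _).
have nz p : ZS W (k^-1 * p * k)%g <-> ZS W p.
  split=> -[z [q [hq e]]].
    exists z, (k * q * k^-1)%g; split; first by apply/(Wn k _ hk); rewrite !mulgA mulVg mul1g mulgKV.
    by rewrite !mulgA fscalC -(mulgA k) -e !mulgA mulgV mul1g mulgK.
  exists z, (k^-1 * q * k)%g; split; first exact/Wn.
  by rewrite e !mulgA fscalC.
have [_ <-] := csum_mulr (ZS1 W1) (ZSM WM) (ZSV WV) f1 nz.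
by apply: eq_csum => x; congr (_%:C%C); apply: indic_iff; rewrite /= !invMg mulgA.
Qed.

(** For a small [W] normal in the level, the cosets of [P] to be compared are
    finite unions of right cosets of [ZW], which all have the same measure. *)
Lemma delta_rational : exists delta0 : Gf -> rat, (forall g, 0 < delta0 g) /\
  forall g, delta g = lamP P * ratr (delta0 g).
Proof.
suff h g : exists q : rat, 0 < q /\ delta g = lamP P * ratr q.
  by have [q hq] := choice h; exists q; split=> g; have [] := hq g.
have [W [hW _ Wg]] := small_normal g; have [W1 WM WV Wo WK] := hW.
have Wg1 w : W w -> level K (1^-1 * w * 1)%g by move=> /WK; rewrite invg1 mul1g mulg1.
have q1 := ZS1 W1; have qM := ZSM WM; have qV := ZSV WV.
have [f1 _ e1] := coset_count hW Wg; have [f2 _ e2] := coset_count hW Wg1.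
have [n en] := csum01 q1 qM qV (A := fun x => (x^-1)%g \in [set y | P (g^-1 * y)%g]) f1.
have [m em] := csum01 q1 qM qV (A := fun x => (x^-1)%g \in [set y | P (1^-1 * y)%g]) f2.
rewrite [csum _ _]en -rmorphM in e1; rewrite [csum _ _]em -rmorphM delta1 in e2.
have {}e1 := @complexI R _ _ e1; have {}e2 := @complexI R _ _ e2.
have c0 : 0 < lamP (ZS W) by apply: lamP_gt0.
have g0 : 0 < delta g.
  apply: fine_gt0; rewrite delta_fin andbT.
  have p0 : (0 < lam (ZS W))%E by apply: lamQ_gt0.
  apply: (lt_le_trans p0); rewrite -(rcoset_lam Wo (g^-1)%g).
  apply: le_measure; rewrite ?inE; first exact: rcoset_measurable.
    exact: lcoset_measurable.
  move=> x /= [z [q [/Wg hq e]]]; exists z, (g^-1 * q * g)%g; split=> //.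
  by rewrite -[x](mulgVK g) e !mulgA -fscalC.
have d0 : 0 < lamP P by apply: lamP_gt0 => //; exact: level1.
have m0 : (0 : R) < m%:R by rewrite -(pmulr_rgt0 _ c0) -e2.
have n0 : (0 : R) < n%:R by rewrite -(pmulr_rgt0 _ c0) -e1.
exists (n%:R / m%:R); rewrite divr_gt0 ?ltr0n; last 2 first.
- by rewrite -(ltr0n R).
- by rewrite -(ltr0n R).
split=> //; rewrite rmorphM /= fmorphV /= !ratr_nat e1 e2 -mulrA; congr (_ * _).
by rewrite mulrC -mulrA mulVf ?mulr1 // gt_eqF.
Qed.

Lemma int_right (T : Gf -> C) : fsup P T ->
  cintegrable lam setT (T : QL -> C) /\ cintegral lam setT T = csum P (fun g => T g * (delta g)%:C%C).
Proof.
move=> ff; have [L [dL cL _]] := fsup_list lP1 lPM lPV ff; have [hf _] := ff.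
have e : T = (fun x => \sum_(g <- L) T g * (\1_[set x | P (g^-1 * x)%g] x)%:C%C).
  by apply/funext => x; exact: (partition lP1 lPM lPV x hf dL cL).
have [h1 h2] := int_list L T (lcoset_measurable hKopen) delta_fin.
rewrite [X in cintegrable _ _ X]e [X in cintegral _ _ X]e; split=> //; rewrite h2.
rewrite (@csumE _ _ lP1 lPM lPV _ L) //; first by move=> g p hp; rewrite hf // delta_right.
by move=> g hg; apply: cL => e'; apply: hg; rewrite e' mul0r.
Qed.

(** Inverting the variable in a sum of a biinvariant function amounts to
    inserting the modular factor. *)
Lemma csum_inv (T : Gf -> C) : fsup P T -> fsup P (fun g => T (g^-1)%g) ->
  (lamP P)%:C%C * csum P (fun g => T (g^-1)%g) = csum P (fun g => T g * (delta g)%:C%C).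
Proof.
move=> f1 f2; have [_ <-] := int_right f1.
by have [_ ->] := int_left level1 levelM levelV hKopen (@subset_refl _ _) f2.
Qed.

End FiniteMeasure.

(** * Linear functionals separate points *)

(** A maximal subspace not containing [y0] has codimension one. *)
Lemma separating_functional (R : realType) (V : lmodType R[i]) (y0 : V) : y0 <> 0 ->
  exists2 l : V -> R[i], algebraic_dual l & l y0 <> 0.
Proof.
move=> n0; pose T (A : set V) := (forall (a : R[i]) x y, A x -> A y -> A (a *: x + y)) /\ ~ A y0.
have [A [[Al Ay] Amax]] : exists A, T A /\ forall B, A `<` B -> ~ T B.
  apply: Zorn_bigcup => S ST tot; split=> [a x y [B SB Bx] [B' SB' By]|[B SB By]].
    have [s|s] := tot _ _ SB SB'.
      by exists B' => //; have [h _] := ST _ SB'; apply: h => //; exact: s.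
    by exists B => //; have [h _] := ST _ SB; apply: h => //; exact: s.
  by have [_] := ST _ SB; apply.
pose B x := A x \/ x = 0.
have Bl a x y : B x -> B y -> B (a *: x + y).
  move=> [hx|->] [hy|->]; rewrite ?scaler0 ?add0r; [left; exact: Al| |by left|by right].
  rewrite addr0; left; case: (eqVneq a 1) => [->|a1]; first by rewrite scale1r.
  by have := Al (a - 1) x x hx hx; rewrite scalerBl scale1r subrK.
have By : ~ B y0 by case.
have ex x : exists c : R[i], B (x - c *: y0).
  apply: contrapT => no; pose D z := exists (c : R[i]) b, B b /\ z = c *: x + b.
  have AD : A `<` D.
    split=> [z hz|/(_ x) h]; first by exists 0, z; rewrite scale0r add0r; split=> //; left.
    by apply: no; exists 0; rewrite scale0r subr0; left; apply: h; exists 1, 0; rewrite scale1r addr0; split=> //; right.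
  apply: (Amax D AD); split.
    move=> a u v [c [b [hb ->]]] [c' [b' [hb' ->]]]; exists (a * c + c'), (a *: b + b'); split; first exact: Bl.
    by rewrite scalerDr scalerA scalerDl addrACA.
  move=> [c [b [hb e]]]; case: (eqVneq c 0) => [c0|c0].
    by apply: By; rewrite e c0 scale0r add0r.
  apply: no; exists c^-1; rewrite e scalerDr scalerA mulVf // scale1r opprD addrA subrr add0r.
  by rewrite -scaleNr -[_ *: b]addr0; apply: Bl => //; right.
have Bz c : B (c *: y0) -> c = 0.
  move=> h; apply: contrapT => /eqP c0; apply: By.
  by have := Bl c^-1 _ 0 h (or_intror erefl); rewrite scalerA mulVf // scale1r addr0.
have uniq x c c' : B (x - c *: y0) -> B (x - c' *: y0) -> c = c'.
  move=> h h'; apply/eqP; rewrite -subr_eq0; apply/eqP; apply: Bz.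
  have := Bl (-1) _ _ h h'; rewrite scaleN1r opprB addrA subrK => hh.
  by rewrite scalerBl.
exists (fun x => projT1 (cid (ex x))).
  move=> a x y; apply: (uniq (a *: x + y)); first exact: (projT2 (cid (ex (a *: x + y)))).
  rewrite scalerDl opprD addrACA -scalerA -scalerBr; apply: Bl; [exact: (projT2 (cid (ex x)))|exact: (projT2 (cid (ex y)))].
move=> e; apply: By; have := projT2 (cid (ex y0)); by rewrite e scale0r subr0.
Qed.

(** * The Hecke algebra and its modules *)

Section HeckeAlgebra.
Variables (R : realType) (F : splittingFieldType rat).
Variable Fhat : forall v : finPlace F, completion R v.
Local Notation C := R[i].
Local Notation Gf := (GAf Fhat 2).
Variable lam : qmeasure R (fcenter Fhat).
Hypothesis hlam : fcenter_haar lam.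
Variable K : forall v : finPlace F, set (GL 2 (Fhat v)).
Arguments K : clear implicits.
Hypothesis hK1 : forall v, K v 1%g.
Hypothesis hKM : forall v g h, K v g -> K v h -> K v (g * h)%g.
Hypothesis hKV : forall v g, K v g -> K v (g^-1)%g.
Hypothesis hKint : forall v, K v `<=` @gl_integral R 2 (Fhat v).
Hypothesis hKopen : open (level K).
Hypothesis hKcompact : compact (level K).
Variable dl : Gf -> rat.
Hypothesis dl_gt0 : forall g, 0 < dl g.
Hypothesis dlE : forall g, delta lam K g = lamP lam (ZS (level K)) * ratr (dl g).
Variable omega : GAf Fhat 1 -> C.
Hypothesis om1 : omega 1%g = 1.
Hypothesis omM : forall x y, omega (x * y)%g = omega x * omega y.
Hypothesis omK : forall z, level K (fscal 2 z) -> omega z = 1.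
Local Notation P := (ZS (level K)).
Let p1 := lP1 hK1.
Let pM := @lPM _ _ _ _ hKM.
Let pV := @lPV _ _ _ _ hKV.
Let k1 := level1 hK1.
Let kM := @levelM _ _ _ _ hKM.
Let kV := @levelV _ _ _ _ hKV.
Local Notation E := (Gf -> C^o).
Local Notation act := Defs.act.

Lemma om0 z : omega z != 0.
Proof.
apply/eqP => e; have := omM z (z^-1)%g; rewrite mulgV om1 e mul0r => /eqP.
by rewrite oner_eq0.
Qed.
Lemma omV z : omega (z^-1)%g = (omega z)^-1.
Proof. by apply: (mulfI (om0 z)); rewrite -omM mulgV om1 divff // om0. Qed.

(** The Hecke algebra as a space of functions on the finite adelic points,
    without reference to tensors. *)
Record hk (phi : E) : Prop := {
  hk_bi : forall k k' g, level K k -> level K k' -> phi (k * g * k')%g = phi g;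
  hk_z : forall z g, phi (fscal 2 z * g)%g = (omega z)^-1 * phi g;
  hk_fin : exists L, covers P L (phi : Gf -> C) }.

Lemma hk_l phi k g : hk phi -> level K k -> phi (k * g)%g = phi g.
Proof. by move=> h hk'; rewrite -[(k * g)%g]mulg1 (hk_bi h). Qed.
Lemma hk_r phi k g : hk phi -> level K k -> phi (g * k)%g = phi g.
Proof. by move=> h hk'; rewrite -[(g * k)%g]mul1g mulgA (hk_bi h). Qed.

Lemma hk_subspace : subspace_of (hk : set E).
Proof.
split=> [|a f g hf hg].
  by split=> // [z g|]; [exact: esym (mulr0 _)|exists [::] => g []].
have e x : (a *: f + g) x = a * f x + g x by [].
split=> [k k' x hx hx'|z x|].
- by rewrite !e (hk_bi hf) // (hk_bi hg).
- by rewrite !e (hk_z hf) (hk_z hg) mulrDr mulrCA.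
have [L cL] := hk_fin hf; have [M cM] := hk_fin hg; exists (L ++ M) => x hx.
case: (pselect (f x = 0)) => [fx|/cL[y yL hy]]; last by exists y => //; rewrite mem_cat yL.
have /cM[y yM hy] : g x <> 0 by move=> gx; apply: hx; rewrite e fx gx mulr0 addr0.
by exists y => //; rewrite mem_cat yM orbT.
Qed.

Lemma dl_left g k : level K k -> dl (k * g)%g = dl g.
Proof.
move=> hk'; have := delta_left hlam hK1 hKM hKV hKint hKopen hKcompact g hk'; rewrite !dlE.
have c0 : lamP lam P != 0 by rewrite gt_eqF //; apply: lamP_gt0 => //.
by move=> /(mulfI c0)/(fmorph_inj (ratr : {rmorphism rat -> R})).
Qed.
Lemma dl_right g p : P p -> dl (g * p)%g = dl g.
Proof.
move=> hk'; have := delta_right lam hKM hKV g hk'; rewrite !dlE.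
have c0 : lamP lam P != 0 by rewrite gt_eqF //; apply: lamP_gt0 => //.
by move=> /(mulfI c0)/(fmorph_inj (ratr : {rmorphism rat -> R})).
Qed.

Definition dlC (g : Gf) : C := ratr (dl g).
Lemma dlC0 g : dlC g != 0. Proof. by rewrite fmorph_eq0 gt_eqF. Qed.
Lemma dlCE g : (delta lam K g)%:C%C = (lamP lam P)%:C%C * dlC g.
Proof. by rewrite dlE rmorphM /dlC /= (fmorph_rat (real_complex R)). Qed.

Lemma hk_weight phi (d : Gf -> C) : hk phi -> (forall g k, level K k -> d (k * g)%g = d g) ->
  (forall g p, P p -> d (g * p)%g = d g) -> hk (fun g => phi g * d g : C^o).
Proof.
move=> h dL dR; split=> [k k' g hx hx'|z g|].
- by rewrite (hk_bi h) // dR ?dL //; exact: ZS_sub.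
- by rewrite (hk_z h) fscalC dR ?mulrA //; exact: (ZS_scal k1).
have [L cL] := hk_fin h; exists L => g hg; apply: cL => e; apply: hg; by rewrite e mul0r.
Qed.
(** The operators of the problem are integrals, those used for the proof are
    sums over cosets. They differ by the measures of cosets, which are
    rational up to a common factor and hence compatible with conjugation. *)
Definition twist (phi : E) : E := fun g => phi g * dlC g.
Definition untwist (phi : E) : E := fun g => phi g * (dlC g)^-1.
Lemma hk_twist phi : hk phi -> hk (twist phi).
Proof. by move=> h; apply: (hk_weight h) => g k hx; rewrite /dlC; [rewrite dl_left|rewrite dl_right]. Qed.
Lemma hk_untwist phi : hk phi -> hk (untwist phi).
Proof. by move=> h; apply: (hk_weight h (d := fun g => (dlC g)^-1)) => g k hx; rewrite /dlC; [rewrite dl_left|rewrite dl_right]. Qed.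
Lemma untwistK phi : twist (untwist phi) = phi.
Proof. by apply/funext => g; rewrite /twist /untwist mulfVK // dlC0. Qed.

(** ** Convolution *)

(** Convolution, with the sum over cosets in place of the integral. *)
Definition mul (phi psi : E) : E := fun h => csum P (fun g => (phi g * psi (g^-1 * h)%g : C)).

Lemma mul_fsup phi psi h : hk phi -> hk psi -> fsup P (fun g => (phi g * psi (g^-1 * h)%g : C)).
Proof.
move=> hf hg; split.
  move=> g p [z [k [hx ->]]]; rewrite !invMg.
  have -> : (k^-1 * (fscal 2 z)^-1 * g^-1 * h)%g = (fscal 2 z^-1 * (k^-1 * (g^-1 * h)))%g.
    by rewrite -fscalV -fscalC !mulgA.
  rewrite (hk_z hg) (hk_l _ hg (kV hx)) omV invrK mulgA (hk_r _ hf hx) -fscalC (hk_z hf).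
  by rewrite mulrACA mulVf ?mul1r // om0.
have [L cL] := hk_fin hf; exists L => g hx; apply: cL => e; apply: hx; by rewrite e mul0r.
Qed.

Lemma hk_mul phi psi : hk phi -> hk psi -> hk (mul phi psi).
Proof.
move=> hf hg; split=> [k k' h hx hx'|z h|].
- rewrite /mul; have [_ <-] := csum_mull p1 pM pV k (mul_fsup (k * h * k')%g hf hg).
  apply: eq_csum => g; rewrite (hk_l _ hf hx) invMg -mulgA -[(k * h * k')%g]mulgA mulKg.
  by rewrite mulgA (hk_r _ hg hx').
- have [_ e] := csum_morph p1 pM pV (h := fun x : C => (omega z)^-1 * x) (mul_fsup h hf hg) (mulr0 _) (mulrDr _).
  rewrite /mul -e; apply: eq_csum => g /=.
  by rewrite mulgA -fscalC -mulgA (hk_z hg) mulrCA.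
have [L cL] := hk_fin hf; have [M cM] := hk_fin hg.
exists [seq (x * y)%g | x <- L, y <- M] => h hne.
have [g hgne] : exists g, phi g * psi (g^-1 * h)%g <> 0.
  apply: contrapT => no; apply: hne; rewrite /mul.
  rewrite (@csumE _ _ p1 pM pV _ [::]) ?big_nil //; first by have [] := mul_fsup h hf hg.
  by move=> g hx; case: no; exists g.
have /cL[x xL [z [k [hx e]]]] : phi g <> 0 by move=> e; apply: hgne; rewrite e mul0r.
have pne : psi (x^-1 * h)%g <> 0.
  move=> e'; apply: hgne; rewrite -(mulKVg x g) e !invMg -!mulgA -fscalV.
  have -> : (k^-1 * (fscal 2 z^-1 * (x^-1 * h)))%g = (fscal 2 z^-1 * (k^-1 * (x^-1 * h)))%g by rewrite mulgA -fscalC -mulgA.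
  by rewrite (hk_z hg) (hk_l _ hg (kV hx)) e' !mulr0.
have [y yM hy] := cM _ pne; exists (x * y)%g; first by apply/allpairsP; exists (x, y).
by rewrite invMg -mulgA.
Qed.

Lemma eqv_fsup (U : lmodType C) (T : Gf -> U) phi : hk phi ->
  (forall g z k, level K k -> T (g * (fscal 2 z * k))%g = omega z *: T g) -> fsup P (fun g => (phi g : C) *: T g).
Proof.
move=> h hT; split.
  move=> g p [z [k [hk' ->]]]; rewrite hT // mulgA (hk_r _ h hk') -fscalC (hk_z h).
  by rewrite scalerA mulrAC mulVf ?mul1r // om0.
have [L cL] := hk_fin h; exists L => g hg; apply: cL => e; apply: hg; by rewrite e scale0r.
Qed.

(** Composing the actions of two elements gives the action of their
    convolution. *)
Lemma conv_sum (U : lmodType C) (T : Gf -> U) phi psi : hk phi -> hk psi ->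
  (forall g z k, level K k -> T (g * (fscal 2 z * k))%g = omega z *: T g) ->
  csum P (fun g => (phi g : C) *: csum P (fun h => (psi h : C) *: T (g * h)%g)) =
  csum P (fun u => (mul phi psi u : C) *: T u).
Proof.
move=> h h' hT.
have [L cL] := hk_fin h; have [M cM] := hk_fin h'.
have e1 : csum P (fun g => (phi g : C) *: csum P (fun h => (psi h : C) *: T (g * h)%g)) =
    csum P (fun g => csum P (fun u => ((phi g : C) * psi (g^-1 * u)%g) *: T u)).
  apply: eq_csum => g.
  have f0 := eqv_fsup (T := fun u => T (g * u)%g) h' (fun u z k hk' => etrans (congr1 T (mulgA _ _ _)) (hT _ z k hk')).
  have [f1 <-] := csum_mull p1 pM pV (g^-1)%g f0.
  have [_ <-] := csum_morph p1 pM pV (h := fun v : U => (phi g : C) *: v) f1 (scaler0 _ _) (scalerDr _).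
  by apply: eq_csum => u /=; rewrite scalerA mulKVg.
have cov : exists S, forall g, covers P S (fun u => ((phi g : C) * psi (g^-1 * u)%g) *: T u).
  exists [seq (a * b)%g | a <- L, b <- M] => g u hne.
  have /cL[a aL [z [k [hk' e]]]] : phi g <> 0 by move=> e; apply: hne; rewrite e mul0r scale0r.
  have pne : psi (a^-1 * u)%g <> 0.
    move=> e'; apply: hne; rewrite -(mulKVg a g) e !invMg -!mulgA -fscalV.
    have -> : (k^-1 * (fscal 2 z^-1 * (a^-1 * u)))%g = (fscal 2 z^-1 * (k^-1 * (a^-1 * u)))%g by rewrite mulgA -fscalC -mulgA.
    by rewrite (hk_z h') (hk_l _ h' (kV hk')) e' !mulr0 scale0r.
  have [b bM hb] := cM _ pne; exists (a * b)%g; first by apply/allpairsP; exists (a, b).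
  by rewrite invMg -mulgA.
have [S cS] := cov.
rewrite e1 (@csum_exchange _ P P p1 pM pV p1 pM pV _ _ L S).
- apply: eq_csum => u; rewrite /mul.
  have [_ <-] := csum_morph p1 pM pV (h := fun t : C => t *: T u) (mul_fsup u h h') (scale0r _) (fun s t => scalerDl _ s t).
  by [].
- by move=> u g p hp; have [hi _] := mul_fsup u h h'; rewrite hi.
- move=> g u p [z [k [hk' ->]]]; rewrite hT // !mulgA (hk_r _ h' hk') -fscalC (hk_z h').
  by rewrite scalerA; congr (_ *: _); rewrite -mulrA; congr (_ * _); rewrite mulrAC mulVf ?om0 // mul1r.
- by move=> u g hne; apply: cL => e; apply: hne; rewrite e mul0r scale0r.
- exact: cS.
Qed.

(** ** The action on the invariants of a representation *)

Section Module.
Variable V : rep R Gf.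
Hypothesis Vz : forall z (x : V), act (fscal 2 z) x = omega z *: x.
Local Notation Uf := (@fixed R F Fhat K V).

Lemma act0 g : act g (0 : V) = 0.
Proof. by have := @act_lin _ _ V g (-1) 0 0; rewrite scaler0 addr0 scaleN1r addNr. Qed.
Lemma actD g (x y : V) : act g (x + y) = act g x + act g y.
Proof. by have := @act_lin _ _ V g 1 x y; rewrite !scale1r. Qed.
Lemma actZ g (a : C) (x : V) : act g (a *: x) = a *: act g x.
Proof. by have := @act_lin _ _ V g a x 0; rewrite !addr0 act0 addr0. Qed.

Lemma fixed_subspace : subspace_of Uf.
Proof.
split=> [g _|a x y hx hy g hg]; first exact: act0.
by rewrite act_lin hx // hy.
Qed.

Definition term (phi : E) (x : V) (g : Gf) : V := (phi g : C) *: act g x.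
Definition hact (phi : E) (x : V) : V := csum P (term phi x).

Lemma term_pinv phi x : hk phi -> Uf x -> pinv P (term phi x).
Proof.
move=> h hx g p [z [k [hk' ->]]]; rewrite /term mulgA (hk_r _ h hk') -fscalC (hk_z h) !Defs.actM hx // Vz.
by rewrite scalerA mulrAC mulVf ?mul1r // om0.
Qed.

Lemma term_fsup phi x : hk phi -> Uf x -> fsup P (term phi x).
Proof.
move=> h hx; split; first exact: term_pinv.
have [L cL] := hk_fin h; exists L => g hg; apply: cL => e; apply: hg; by rewrite /term e scale0r.
Qed.

Lemma hact_shift k phi x : hk phi -> Uf x ->
  act k (hact phi x) = csum P (fun g => (phi (k^-1 * g)%g : C) *: act g x).
Proof.
move=> h hx; have ff := term_fsup h hx.
have [f1 <-] := csum_morph p1 pM pV (h := act k) ff (act0 k) (actD k).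
have [_ <-] := csum_mull p1 pM pV (k^-1)%g f1.
by apply: eq_csum => g /=; rewrite /term actZ -Defs.actM mulKVg.
Qed.

Lemma hact_fixed phi x : hk phi -> Uf x -> Uf (hact phi x).
Proof.
move=> h hx k hk'; rewrite hact_shift //; apply: eq_csum => g.
by rewrite (hk_l _ h (kV hk')).
Qed.

Lemma hact_lin (a : C) phi psi x : hk phi -> hk psi -> Uf x ->
  hact (a *: phi + psi) x = a *: hact phi x + hact psi x.
Proof.
move=> h h' hx; have f1 := term_fsup h hx; have f2 := term_fsup h' hx.
have [f3 <-] := csum_morph p1 pM pV (h := fun v : V => a *: v) f1 (scaler0 _ _) (scalerDr _).
have [_ <-] := csum_add p1 pM pV f3 f2; apply: eq_csum => g.
by rewrite /term /= scalerDl scalerA.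
Qed.

Lemma hact0 phi : hk phi -> hact phi 0 = 0.
Proof.
move=> h; rewrite /hact (@csumE _ _ p1 pM pV _ [::]) ?big_nil //; first by apply: term_pinv => // g _; exact: act0.
by move=> g []; rewrite /term act0 scaler0.
Qed.

Lemma hact_mul phi psi x : hk phi -> hk psi -> Uf x -> hact (mul phi psi) x = hact phi (hact psi x).
Proof.
move=> h h' hx; rewrite /hact -[LHS](conv_sum (T := fun g => act g x) h h'); last first.
  by move=> g z k hk'; rewrite mulgA -fscalC -mulgA !Defs.actM hx // Vz.
apply: eq_csum => g; congr (_ *: _).
have [_ <-] := csum_morph p1 pM pV (h := act g) (term_fsup h' hx) (act0 g) (actD g).
by apply: eq_csum => u /=; rewrite /term actZ Defs.actM.
Qed.

(** The weak action is the action by sums over cosets, up to the measures of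
    the cosets. *)
Lemma hecke_actE phi x y : hk phi -> Uf x ->
  hecke_act lam phi x y <-> y = (lamP lam P)%:C%C *: hact (twist phi) x.
Proof.
move=> h hx; have ht := hk_twist h.
have key l : algebraic_dual l -> cintegral lam setT (fun g => phi g * l (act g x)) =
    l ((lamP lam P)%:C%C *: hact (twist phi) x).
  move=> hl; have l0 : l 0 = 0.
    by have := hl (-1) 0 0; rewrite scaler0 addr0 mulN1r addNr.
  have lD u v : l (u + v) = l u + l v by have := hl 1 u v; rewrite scale1r mul1r.
  have lZ a u : l (a *: u) = a * l u by have := hl a u 0; rewrite l0 !addr0.
  have [f1 _] := csum_morph p1 pM pV (h := l) (term_fsup h hx) l0 lD.
  have e1 : (l \o term phi x) = (fun g => phi g * l (act g x)) by apply/funext => g /=; rewrite lZ.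
  rewrite e1 in f1; have [_ ->] := int_right hlam hK1 hKM hKV hKint hKopen hKcompact f1.
  rewrite lZ -(csum_morph p1 pM pV (h := l) (term_fsup ht hx) l0 lD).2.
  have f2 := (csum_morph p1 pM pV (h := l) (term_fsup ht hx) l0 lD).1.
  rewrite -(csum_morph p1 pM pV (h := fun t : C => (lamP lam P)%:C%C * t) f2 (mulr0 _) (mulrDr _)).2.
  by apply: eq_csum => g /=; rewrite /term /twist lZ dlCE; ring.
split=> [hy|-> l hl]; last by rewrite key.
apply: contrapT => ne; have [l hl nl] := separating_functional (y0 := y - (lamP lam P)%:C%C *: hact (twist phi) x) (fun e => ne (subr0_eq e)).
apply: nl; have lB : l (y - (lamP lam P)%:C%C *: hact (twist phi) x) = l y - l ((lamP lam P)%:C%C *: hact (twist phi) x).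
  by rewrite addrC -scaleN1r hl mulN1r addrC.
by rewrite lB (hy l hl) key // subrr.
Qed.

(** ** Simplicity of the space of invariants *)

(** The character [omega], extended to the group generated by the centre and
    the level. *)
Definition cz (p : Gf) : C := if pselect (P p) is left e then omega (projT1 (cid e)) else 0.

Lemma czE z k : level K k -> cz (fscal 2 z * k)%g = omega z.
Proof.
move=> hk'; rewrite /cz; case: pselect => [e|[]] /=; last by exists z, k.
case: (cid e) => z' /= [k' [hk2 e']].
have ez : fscal 2 (z'^-1 * z)%g = (k' * k^-1)%g.
  by rewrite fscalM fscalV -[fscal 2 z](mulgK k) e' -mulgA mulKg.
have := omK (z := (z'^-1 * z)%g); rewrite ez => /(_ (kM hk2 (kV hk'))); rewrite omM omV.
by move=> /(congr1 (fun t => omega z' * t)); rewrite mulrA mulfV ?om0 // mul1r mulr1.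
Qed.

Lemma cz_out p : ~ P p -> cz p = 0.
Proof. by move=> n; rewrite /cz; case: pselect. Qed.

Lemma cz_z z p : cz (fscal 2 z * p)%g = omega z * cz p.
Proof.
case: (pselect (P p)) => [[z' [k [hk' ->]]]|n]; first by rewrite mulgA -fscalM !czE // omM.
by rewrite !cz_out ?mulr0 // => /ZS_center.
Qed.

Lemma cz_r p k : level K k -> cz (p * k)%g = cz p.
Proof.
move=> hk'; case: (pselect (P p)) => [[z' [q [hq ->]]]|n]; first by rewrite -mulgA !czE //; exact: kM.
rewrite !cz_out // => h; apply: n; rewrite -(mulgK k p); apply: pM => //; apply: ZS_sub; exact: kV.
Qed.

Lemma cz_l p k : level K k -> cz (k * p)%g = cz p.
Proof.
move=> hk'; case: (pselect (P p)) => [[z' [q [hq ->]]]|n].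
  by rewrite mulgA -fscalC -mulgA !czE //; exact: kM.
rewrite !cz_out // => h; apply: n; rewrite -(mulKg k p); apply: pM => //; apply: ZS_sub; exact: kV.
Qed.

Lemma cz1 : cz 1%g = 1.
Proof. by have := czE 1%g k1; rewrite fscal1 mul1g om1. Qed.

Definition eK (k : Gf) : C := (`[< level K k >])%:R%:C%C.
Lemma eK1 k : level K k -> eK k = 1. Proof. by move=> h; rewrite /eK asboolT. Qed.
Lemma eK0 k : ~ level K k -> eK k = 0. Proof. by move=> h; rewrite /eK asboolF. Qed.
Lemma eK_l k0 k : level K k0 -> eK (k0 * k)%g = eK k.
Proof.
move=> h; case: (pselect (level K k)) => h'; first by rewrite !eK1 //; exact: kM.
by rewrite !eK0 // => h2; apply: h'; rewrite -(mulKg k0 k); apply: kM => //; exact: kV.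
Qed.
Lemma eK_r k0 k : level K k0 -> eK (k * k0)%g = eK k.
Proof.
move=> h; case: (pselect (level K k)) => h'; first by rewrite !eK1 //; exact: kM.
by rewrite !eK0 // => h2; apply: h'; rewrite -(mulgK k0 k); apply: kM => //; exact: kV.
Qed.

Section Average.
Variable W : set Gf.
Hypothesis W1 : W 1%g.
Hypothesis WM : forall x y, W x -> W y -> W (x * y)%g.
Hypothesis WV : forall x, W x -> W (x^-1)%g.
Hypothesis Wo : open W.
Hypothesis WK : W `<=` level K.

Lemma avg_fsup (U : lmodType C) (f : Gf -> U) : (forall k w, level K k -> W w -> f (k * w)%g = f k) ->
  fsup W (fun k => eK k *: f k).
Proof.
move=> hf; split=> [k w hw|].
  rewrite eK_r; last exact: WK.
  by case: (pselect (level K k)) => h; [rewrite hf|rewrite eK0 // !scale0r].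
have [L hL] := compact_cosets hKcompact Wo W1; exists L => k hne; apply: hL.
by apply: contrapT => n; apply: hne; rewrite eK0 // scale0r.
Qed.

Definition mass : C := csum W eK.
Lemma mass_neq0 : mass != 0.
Proof.
have f0 := @avg_fsup C^o (fun=> 1) (fun _ _ _ _ => erefl).
have f1 : fsup W eK by move: f0; rewrite (_ : (fun k => eK k *: (1 : C^o)) = eK) //; apply/funext => k; exact: mulr1.
have [L [_ cL e]] := fsup_list W1 WM WV f1.
rewrite /mass e -(rmorph_sum (real_complex R)) -natr_sum fmorph_eq0 pnatr_eq0.
have /cL[x xL hx] : eK 1%g <> 0 by rewrite eK1 //; apply/eqP; exact: oner_neq0.
have kx : level K x by move: hx; rewrite mulg1 => /WK/kV; rewrite invgK.
by rewrite (big_rem x xL) /= asboolT.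
Qed.

Section OneCoset.
Variable g : Gf.
Hypothesis Wg : forall w, W w -> level K (g^-1 * w * g)%g.

Definition base (h : Gf) : C := (cz (g^-1 * h)%g)^-1.
(** The average over the level of the function supported on the coset of [g]:
    its action on an invariant vector is the average of one translate of that
    vector. *)
Definition chi : E := fun h => csum W (fun k => (eK k : C) *: (base (k^-1 * h)%g : C^o)).

Lemma base_w h w : W w -> base (w * h)%g = base h.
Proof.
move=> hw; rewrite /base; have -> : (g^-1 * (w * h))%g = ((g^-1 * w * g) * (g^-1 * h))%g by rewrite !mulgA mulgK.
by rewrite cz_l //; exact: Wg.
Qed.

Lemma chi_fsup h : fsup W (fun k => (eK k : C) *: (base (k^-1 * h)%g : C^o)).
Proof.
apply: (avg_fsup (f := fun k => (base (k^-1 * h)%g : C^o))) => k w _ hw.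
by rewrite invMg -mulgA base_w //; exact: WV.
Qed.

Lemma base_supp : exists L : seq Gf, forall k, level K k -> forall h, base (k^-1 * h)%g <> 0 -> exists2 x, x \in L & P (x^-1 * h)%g.
Proof.
have [L hL] := compact_cosets hKcompact Wo W1; exists [seq (a * g)%g | a <- L] => k hk' h hne.
have [a aL hw] := hL _ hk'; exists (a * g)%g; first exact: map_f.
apply: contrapT => n; apply: hne; rewrite -(mulKVg a k) invMg -mulgA base_w; last exact: WV.
by rewrite /base cz_out ?invr0 // mulgA -invMg.
Qed.

Lemma hk_chi : hk chi.
Proof.
split=> [k k' h hx hx'|z h|].
- rewrite /chi; have [_ <-] := csum_mull W1 WM WV k (chi_fsup (k * h * k')%g).
  apply: eq_csum => q; rewrite eK_l // invMg -mulgA -[(k * h * k')%g]mulgA mulKg /base.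
  by rewrite !mulgA cz_r.
- have [_ e] := csum_morph W1 WM WV (h := fun x : C => (omega z)^-1 * x) (chi_fsup h) (mulr0 _) (mulrDr _).
  rewrite /chi -e; apply: eq_csum => k /=; rewrite /base.
  have -> : (g^-1 * (k^-1 * (fscal 2 z * h)))%g = (fscal 2 z * (g^-1 * (k^-1 * h)))%g.
    by rewrite [(k^-1 * (_ * h))%g]mulgA -fscalC !mulgA -fscalC.
  by rewrite cz_z invfM /GRing.scale /= mulrCA.
have [L hL] := base_supp; exists L => h hne.
have [k hk' bk] : exists2 k, level K k & base (k^-1 * h)%g <> 0.
  apply: contrapT => no; apply: hne; rewrite /chi.
  rewrite (@csumE _ _ W1 WM WV _ [::]) ?big_nil //; first by have [] := chi_fsup h.
  move=> k hx; case: no; exists k; first by apply: contrapT => n; apply: hx; rewrite eK0 // scale0r.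
  by move=> e; apply: hx; rewrite e scaler0.
exact: (hL k hk').
Qed.

Lemma hact_chi x : Uf x -> hact chi x = csum W (fun k => eK k *: act (k * g)%g x).
Proof.
move=> hx; have [L hL] := base_supp; have [M hM] := compact_cosets hKcompact Wo W1.
have e1 : hact chi x = csum P (fun h => csum W (fun k => ((eK k : C) * base (k^-1 * h)%g) *: act h x)).
  apply: eq_csum => h; rewrite /term /chi.
  have [_ <-] := csum_morph W1 WM WV (h := fun t : C => t *: act h x) (chi_fsup h) (scale0r _) (fun s t => scalerDl _ s t).
  by [].
have pin k : pinv P (fun h => ((eK k : C) * base (k^-1 * h)%g) *: act h x).
  move=> h p [z [q [hq ->]]]; rewrite /base.
  have -> : (g^-1 * (k^-1 * (h * (fscal 2 z * q))))%g = (fscal 2 z * ((g^-1 * (k^-1 * h)) * q))%g.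
    by rewrite !mulgA -fscalC !mulgA.
  rewrite cz_z cz_r // invfM !Defs.actM hx // Vz actZ scalerA; congr (_ *: _).
  by rewrite -mulrA -[in RHS](mulr1 (cz _)^-1); congr (_ * _); rewrite mulrAC mulVf ?om0 // mul1r mulr1.
rewrite e1 (@csum_exchange _ P W p1 pM pV W1 WM WV _ _ L M) //.
- apply: eq_csum => k; case: (pselect (level K k)) => hk'; last first.
    rewrite eK0 // scale0r (@csumE _ _ p1 pM pV _ [::]) ?big_nil //; first by move=> h p _; rewrite !mul0r !scale0r.
    by move=> h []; rewrite mul0r scale0r.
  rewrite (@csum_one _ _ p1 pM pV _ _ (k * g)%g (pin k)).
    by rewrite mulKg /base mulVg cz1 invr1 mulr1.
  move=> h hne; apply: contrapT => n; apply: hne; rewrite /base cz_out ?invr0 ?mulr0 ?scale0r //.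
  by rewrite mulgA -invMg.
- move=> h k w hw; rewrite eK_r; last exact: WK.
  by rewrite invMg -mulgA base_w //; exact: WV.
- move=> k h hne; apply: (hL k); first by apply: contrapT => n; apply: hne; rewrite eK0 // mul0r scale0r.
  by move=> e; apply: hne; rewrite e mulr0 scale0r.
- move=> h k hne; apply: hM; by apply: contrapT => n; apply: hne; rewrite eK0 // mul0r scale0r.
Qed.

End OneCoset.

Lemma hact_average x (r : seq (C * Gf)) : Uf x -> (forall p, p \in r -> forall w, W w -> level K (p.2^-1 * w * p.2)%g) ->
  (forall w, W w -> act w (\sum_(p <- r) p.1 *: act p.2 x) = \sum_(p <- r) p.1 *: act p.2 x) /\
  exists2 phi, hk phi & hact phi x = csum W (fun k => eK k *: act k (\sum_(p <- r) p.1 *: act p.2 x)).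
Proof.
move=> hx; elim: r => [|[a g] r IH] hr.
  rewrite big_nil; split; first by move=> w _; exact: act0.
  have [h0 _] := hk_subspace; exists 0 => //.
  rewrite /hact !(@eq_csum _ _ _ _ (fun=> 0)); last 2 first.
  - by move=> k; rewrite act0 scaler0.
  - by move=> k; rewrite /term scale0r.
  by rewrite !(@csumE _ _ _ _ _ _ [::]) ?big_nil // => ? [].
have [IHw [phi hphi ephi]] := IH (fun p hp => hr p (mem_behead (s := (a, g) :: r) hp)).
have Wg := hr (a, g) (mem_head _ _); rewrite big_cons /=.
have gw w : W w -> act w (act g x) = act g x.
  by move=> hw; rewrite -Defs.actM -(mulKVg g (w * g)%g) Defs.actM [(g^-1 * _)%g]mulgA hx //; exact: Wg.
split; first by move=> w hw; rewrite actD actZ gw // IHw.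
exists (a *: chi g + phi); first by have [_ h] := hk_subspace; apply: h => //; exact: hk_chi.
rewrite hact_lin ?hact_chi //; last exact: hk_chi.
have f1 : fsup W (fun k => eK k *: act (k * g)%g x).
  apply: (avg_fsup (f := fun k => act (k * g)%g x)) => k w _ hw.
  by rewrite -mulgA !Defs.actM gw.
have f2 : fsup W (fun k => eK k *: act k (\sum_(p <- r) p.1 *: act p.2 x)).
  by apply: (avg_fsup (f := fun k => act k _)) => k w _ hw; rewrite Defs.actM IHw.
have [f3 <-] := csum_morph W1 WM WV (h := fun v : V => a *: v) f1 (scaler0 _ _) (scalerDr _).
rewrite ephi; have [_ <-] := csum_add W1 WM WV f3 f2; apply: eq_csum => k /=.
by rewrite actD actZ scalerDr Defs.actM !scalerA [a * _]mulrC.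
Qed.

End Average.

Lemma small_normals (r : seq Gf) : exists W : set Gf, [/\ W 1%g, forall x y, W x -> W y -> W (x * y)%g,
    forall x, W x -> W (x^-1)%g, open W & W `<=` level K] /\
  forall g w, g \in r -> W w -> level K (g^-1 * w * g)%g.
Proof.
elim: r => [|g r [W [[W1 WM WV Wo WK] Wr]]]; first by exists (level K); split=> //; split.
have [U [[U1 UM UV Uo UK] _ Ug]] := small_normal hK1 hKV hKint hKopen g.
exists (U `&` W); split; first split=> //.
- by move=> x y [h1 h2] [h3 h4]; split; [exact: UM|exact: WM].
- by move=> x [h1 h2]; split; [exact: UV|exact: WV].
- exact: openI.
- by move=> x [h1 h2]; exact: WK.
move=> h w; rewrite inE => /orP[/eqP ->|hr] [h1 h2]; [exact: Ug|exact: Wr].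
Qed.

(** Every vector is a combination of translates of [x]; averaging an invariant
    vector over the level leaves it unchanged and turns the combination into
    the action of an element of the Hecke algebra. *)
Theorem invariants_simple x y : irreducible V -> Uf x -> x <> 0 -> Uf y -> exists2 phi, hk phi & hact phi x = y.
Proof.
move=> [_ irr] hx x0 hy.
pose Y := [set v : V | exists r : seq (C * Gf), v = \sum_(p <- r) p.1 *: act p.2 x].
have YT : Y = setT.
  apply: irr.
  - split; first by exists [::]; rewrite big_nil.
    move=> a u v [r ->] [r' ->]; exists ([seq (a * p.1, p.2) | p <- r] ++ r').
    rewrite big_cat big_map scaler_sumr; congr (_ + _).
    by apply: eq_bigr => p _; rewrite scalerA.
  - move=> g v [r ->]; exists [seq (p.1, (g * p.2)%g) | p <- r]; rewrite big_map.
    by rewrite (big_morph (act g) (actD g) (act0 g)); apply: eq_bigr => p _; rewrite actZ Defs.actM.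
  - by exists x => //; exists [:: (1 : C, 1%g : Gf)]; rewrite big_seq1 scale1r Defs.act1.
have [r er] : Y y by rewrite YT.
have [W [[W1 WM WV Wo WK] Wr]] := small_normals [seq p.2 | p <- r].
have [yw [phi hphi ephi]] := hact_average W1 WM WV Wo WK hx (fun p hp w => Wr p.2 w (map_f _ hp)).
rewrite -er in ephi; exists (((mass W)^-1) *: phi + 0).
  by have [h0 h] := hk_subspace; apply: h.
have [h0 _] := hk_subspace; rewrite hact_lin // ephi.
have z0 : hact 0 x = 0.
  rewrite /hact (@eq_csum _ _ _ _ (fun=> 0)); last by move=> k; rewrite /term scale0r.
  by rewrite (@csumE _ _ p1 pM pV _ [::]) ?big_nil // => ? [].
rewrite z0 addr0 (@eq_csum _ _ _ _ (fun k => eK k *: y)); last first.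
  by move=> k; case: (pselect (level K k)) => h; [rewrite hy|rewrite eK0 // !scale0r].
have f0 := @avg_fsup W W1 Wo WK C^o (fun=> 1) (fun _ _ _ _ => erefl).
have f1 : fsup W eK by move: f0; rewrite (_ : (fun k => eK k *: (1 : C^o)) = eK) //; apply/funext => k; exact: mulr1.
have [_ ->] := csum_morph W1 WM WV (h := fun t : C => t *: y) f1 (scale0r _) (fun s t => scalerDl _ s t).
by rewrite scalerA mulVf ?scale1r //; exact: mass_neq0.
Qed.

End Module.
End HeckeAlgebra.

(** * The Hecke algebra acting on cusp forms *)

Lemma trace_square0 (K : fieldType) n (D : 'M[K]_n) : D *m D = 0 -> \tr D = 0.
Proof.
move=> h; have e : col_base D *m row_base D = D := mulmx_base D.
suff r0 : row_base D *m col_base D = 0 by rewrite -e mxtrace_mulC r0 mxtrace0.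
have z : col_base D *m (row_base D *m col_base D) *m row_base D = 0.
  have -> : col_base D *m (row_base D *m col_base D) *m row_base D =
    (col_base D *m row_base D) *m (col_base D *m row_base D) by rewrite !mulmxA.
  by rewrite e.
have fr : row_free (row_base D) by rewrite row_base_free.
have fc : row_full (col_base D) by rewrite col_base_full.
apply: (row_full_inj fc); rewrite mulmx0; apply: (row_free_inj fr); by rewrite /= mul0mx.
Qed.

Section Spectral.
Variables (R : realType) (F : splittingFieldType rat).
Variable Fhat : forall v : finPlace F, completion R v.
Hypothesis hgal : galois 1%AS {:F}.
Hypothesis hreal : totally_real R F.
Local Notation C := R[i].
Local Notation GA n := (GA Fhat n).
Local Notation GF n := (GF Fhat n).
Local Notation Gf := (GAf Fhat 2).
Local Notation form := (Defs.form Fhat).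
Variable mu : qmeasure R (adelic_center Fhat `|` GF 2).
Hypothesis hmu : invariant_measure setT mu.
Variable nu : qmeasure R (GF 2 `&` unipotent Fhat).
Hypothesis hnu : invariant_measure (unipotent Fhat) nu.
Variable lam : qmeasure R (fcenter Fhat).
Hypothesis hlam : fcenter_haar lam.
Variable K : forall v : finPlace F, set (GL 2 (Fhat v)).
Arguments K : clear implicits.
Hypothesis hK1 : forall v, K v 1%g.
Hypothesis hKM : forall v g h, K v g -> K v h -> K v (g * h)%g.
Hypothesis hKV : forall v g, K v g -> K v (g^-1)%g.
Hypothesis hKint : forall v, K v `<=` @gl_integral R 2 (Fhat v).
Hypothesis hKopen : open (level K).
Hypothesis hKcompact : compact (level K).
Variable dl : Gf -> rat.
Hypothesis dl_gt0 : forall g, 0 < dl g.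
Hypothesis dlE : forall g, delta lam K g = lamP lam (ZS (level K)) * ratr (dl g).
Variable om : GA 1 -> C.
Hypothesis gom : goodchar K om.
Variables (k : infPlace R F -> nat) (w : int).

Definition omf (z : GAf Fhat 1) : C := om (of_fin z).
Lemma omf1 : omf 1%g = 1. Proof. by rewrite /omf of_fin1 (gc1 gom). Qed.
Lemma omfM x y : omf (x * y)%g = omf x * omf y. Proof. by rewrite /omf of_finM (gcM gom). Qed.
Lemma omfK z : level K (fscal 2 z) -> omf z = 1. Proof. exact: (gc_K gom). Qed.

Local Notation P := (ZS (level K)).
Let p1 := lP1 hK1.
Let pM := @lPM _ _ _ _ hKM.
Let pV := @lPV _ _ _ _ hKV.
Let k1 := level1 hK1.
Let kM := @levelM _ _ _ _ hKM.
Let kV := @levelV _ _ _ _ hKV.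
Local Notation hk := (hk K omf).
Local Notation E := (Gf -> C^o).
Local Notation ip := (ip mu om).
Local Notation X := (L2 mu om).
Local Notation M := (L20kK mu nu om k w K).
Local Notation Lk := (L20k mu nu om k w).
Local Notation Rf := (@frtrans R F Fhat).
Local Notation c := (lamP lam P).
Let cC : C := c%:C%C.
Let psd := L2_psd hreal mu gom.
Let hX := psd_sub psd.
Let MX : M `<=` X := @L20kK_sub _ _ Fhat mu nu K om k w.
Let LX : Lk `<=` X := @L20k_sub _ _ Fhat mu nu om k w.
Let hM := L20kK_subspace hgal hreal hmu hnu gom k w.
Let hL := L20k_subspace hgal hreal hmu hnu gom k w.
Let RX g f : X f -> X (Rf g f) := @L2_frtrans _ _ Fhat hreal mu hmu K om gom g f.

Lemma c_gt0 : 0 < c. Proof. by apply: lamP_gt0 => //. Qed.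
Lemma cC0 : cC != 0. Proof. by rewrite fmorph_eq0 gt_eqF // c_gt0. Qed.

Definition wf (g : Gf) : C := (wt om (of_fin g))%:C%C.
Lemma wfM g h : wf (g * h)%g = wf g * wf h.
Proof. by rewrite /wf of_finM (wtM gom) (rmorphM (real_complex R)). Qed.
Lemma wf0 g : wf g != 0. Proof. by rewrite fmorph_eq0 gt_eqF // (wt_gt0 gom). Qed.
Lemma wf1 : wf 1%g = 1.
Proof. by apply: (mulfI (wf0 1%g)); rewrite -wfM mulg1 mulr1. Qed.
Lemma wfV g : wf (g^-1)%g = (wf g)^-1.
Proof. by apply: (mulfI (wf0 g)); rewrite -wfM mulgV wf1 divff // wf0. Qed.

(** A positive character is trivial on the compact level subgroup. *)
Lemma wf_level g : level K g -> wf g = 1.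
Proof.
have [d hd sd] := wt_small gom.
have [L hL'] := compact_cosets hKcompact (cong_open Fhat 2 hd) (cong1 Fhat 2 hd).
pose B : R := \sum_(x <- L) wt om (of_fin x).
have w0 x : 0 < wt om (of_fin x) := wt_gt0 gom _.
have bd x : level K x -> wt om (of_fin x) <= B.
  move=> hx; have [y yL hy] := hL' _ hx.
  have -> : wt om (of_fin x) = wt om (of_fin y).
    by rewrite -(mulKVg y x) of_finM (wtM gom) (sd _ hy) mulr1.
  rewrite /B (big_rem y yL) /= lerDl; apply: sumr_ge0 => z _; exact: ltW.
have pw x n : level K x -> wt om (of_fin x) ^+ n <= B.
  move=> hx; have [y hy ->] : exists2 y, level K y & wt om (of_fin x) ^+ n = wt om (of_fin y).
    elim: n => [|n [y hy IH]]; first by exists 1%g => //; rewrite expr0; have := wf1; rewrite /wf => /complexI.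
    by exists (x * y)%g; [exact: kM|rewrite of_finM (wtM gom) exprS IH].
  exact: bd.
have le x : level K x -> wt om (of_fin x) <= 1.
  move=> hx; rewrite leNgt; apply/negP => g1; have B0 : 0 < B := lt_le_trans (w0 x) (bd x hx).
  have lt1 : 0 <= (wt om (of_fin x))^-1 < 1 by rewrite invr_ge0 (ltW (w0 x)) invf_lt1.
  have [n hn] := geometric_small (2 * B) lt1.
  move: hn; rewrite exprVn ler_pdivrMl ?exprn_gt0 // mulr1 => h2.
  by have := le_trans h2 (pw x n hx); lra.
move=> hg; apply/eqP; rewrite /wf -(rmorph1 (real_complex R)) (inj_eq (@complexI R)) eq_le le //=.
have := le _ (kV hg); have := wfV g; rewrite /wf -(fmorphV (real_complex R)) => /complexI ->.
by rewrite invf_le1.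
Qed.

Lemma RfM g h f : Rf (g * h)%g f = Rf g (Rf h f).
Proof. by rewrite /frtrans of_finM rtransM. Qed.
Lemma ipR g f h : X f -> X h -> ip (Rf g f) (Rf g h) = wf g * ip f h.
Proof. exact: (ip_rtrans hreal hmu gom). Qed.
Lemma Rf_z z f : X f -> Rf (fscal 2 z) f = omf z *: f.
Proof.
move=> hf; apply/funext => x; rewrite /frtrans /rtrans -scal_of_fin -scalC (L2_center hf).
by [].
Qed.
Lemma ip_null y l : X y -> X l -> ipnull ip y -> ip y l = 0.
Proof. by move=> hy hl h; exact: (ipnull_orth psd hy hl h). Qed.
Lemma Rf_null g y : X y -> ipnull ip y -> ipnull ip (Rf g y).
Proof. by move=> hy h; rewrite /ipnull /= ipR // [ip y y]h mulr0. Qed.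
Lemma ip_eq y y' l : X y -> X y' -> X l -> ipnull ip (y - y') -> ip y l = ip y' l.
Proof.
move=> hy hy' hl h; apply/eqP; rewrite -subr_eq0 -(ipBl psd) //; apply/eqP; apply: ip_null => //.
exact: (subspaceB hX).
Qed.
Lemma ip_eqR g y y' l : X y -> X y' -> X l -> ipnull ip (y - y') -> ip (Rf g y) l = ip (Rf g y') l.
Proof.
move=> hy hy' hl h; apply: ip_eq; try exact: RX; first by [].
rewrite (_ : Rf g y - Rf g y' = Rf g (y - y')) //; apply: Rf_null => //; exact: (subspaceB hX).
Qed.

Lemma ip_eq2 y y' l : X y -> X y' -> X l -> ipnull ip (y - y') -> ip l y = ip l y'.
Proof. by move=> hy hy' hl h; rewrite (psd_herm psd hy hl) (psd_herm psd hy' hl) (ip_eq hy hy' hl h). Qed.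

(** ** Matrix coefficients *)

Definition mc (f l : form) (g : Gf) : C^o := ip (Rf g f) l.

Lemma mc_eqv f l g z q : M f -> X l -> level K q -> mc f l (g * (fscal 2 z * q))%g = omf z *: mc f l g.
Proof.
move=> hf hl hq; have fX := MX hf; have [_ fix_f] := hf.
have e : (g * (fscal 2 z * q))%g = (fscal 2 z * g * q)%g by rewrite mulgA fscalC.
rewrite /mc e [Rf (_ * q)%g f]RfM; rewrite (ip_eqR _ (RX q fX) fX hl (fix_f _ hq)) RfM Rf_z; last exact: RX.
by rewrite (ipZl psd) //; exact: RX.
Qed.

Definition hecke_pair (phi : E) (f l : form) : C := csum P (fun g => (phi g : C) *: mc f l g).

Lemma pair_fsup phi f l : hk phi -> M f -> X l -> fsup P (fun g => (phi g : C) *: mc f l g).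
Proof. by move=> h hf hl; apply: (eqv_fsup hK1 omf1 omfM h) => g z q; exact: mc_eqv. Qed.

Lemma pair_lin phi a f f' l : hk phi -> M f -> M f' -> X l -> hecke_pair phi (a *: f + f') l = a * hecke_pair phi f l + hecke_pair phi f' l.
Proof.
move=> h hf hf' hl; have f1 := pair_fsup h hf hl; have f2 := pair_fsup h hf' hl.
have [f3 <-] := csum_morph p1 pM pV (h := fun t : C => a * t) f1 (mulr0 _) (mulrDr _).
have [_ <-] := csum_add p1 pM pV f3 f2; apply: eq_csum => g.
rewrite /mc frtrans_lin (psd_lin psd) //; [|exact: RX (MX hf)|exact: RX (MX hf')].
by rewrite /GRing.scale /= mulrDr mulrCA.
Qed.

Lemma pair0 phi l : hk phi -> X l -> hecke_pair phi 0 l = 0.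
Proof.
move=> h hl; have M0 : M 0 by case: hM.
by have := pair_lin (-1) h M0 M0 hl; rewrite scaler0 addr0 mulN1r addNr.
Qed.

Lemma pair_null phi f f' l : M f -> M f' -> X l -> ipnull ip (f - f') -> hecke_pair phi f l = hecke_pair phi f' l.
Proof. by move=> hf hf' hl h; apply: eq_csum => g; rewrite /mc (ip_eqR _ (MX hf) (MX hf')). Qed.

Lemma pair_lincomb phi d (m : 'I_d -> form) (u : 'rV_d) l : hk phi -> (forall i, M (m i)) -> X l ->
  hecke_pair phi (lincomb m u) l = \sum_i u ord0 i * hecke_pair phi (m i) l.
Proof.
move=> h hm hl; rewrite /lincomb.
suff e (r : seq 'I_d) : M (\sum_(i <- r) u ord0 i *: m i) /\
    hecke_pair phi (\sum_(i <- r) u ord0 i *: m i) l = \sum_(i <- r) u ord0 i * hecke_pair phi (m i) l by have [_] := e (index_enum _).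
elim: r => [|i r [h1 h2]]; first by rewrite !big_nil pair0 //; split=> //; case: hM.
by rewrite !big_cons pair_lin // h2; split=> //; apply: (subspaceZD hM).
Qed.

(** ** Integrals of matrix coefficients of smooth forms *)

Definition hecke_int (psi : E) (b l : form) : C := cintegral lam setT (fun g => psi g * ip (Rf g b) l).

Lemma hform psi b y l : hecke_form mu lam om psi b y -> X l -> ip y l = hecke_int psi b l.
Proof. by move=> h hl; exact: (h (fun f => ip f l) (ex_intro2 _ _ l hl erefl)). Qed.

(** On forms invariant under the level the integrand is constant on the cosets
    of the level. *)
Lemma hecke_int_right psi f l : hk psi -> M f -> X l -> hecke_int psi f l = cC * hecke_pair (twist dl psi) f l.
Proof.
move=> h hf hl; have f1 := pair_fsup h hf hl.
have [_ e] := int_right hlam hK1 hKM hKV hKint hKopen hKcompact f1.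
rewrite /hecke_int -[LHS]/(cintegral lam setT (fun g => (psi g : C) *: mc f l g)) e.
have f2 := pair_fsup (hk_twist hlam hK1 hKM hKV hKint hKopen hKcompact dlE h) hf hl.
have [_ <-] := csum_morph p1 pM pV (h := fun t : C => cC * t) f2 (mulr0 _) (mulrDr _).
apply: eq_csum => g /=; rewrite (dlCE dlE) /twist /GRing.scale /= /cC; ring.
Qed.

Lemma inv_support phi (W : set Gf) (W1 : W 1%g) (Wo : open W) : hk phi ->
  exists L : seq Gf, forall g, phi (g^-1)%g <> 0 -> exists2 y, y \in L & ZS W (y^-1 * g)%g.
Proof.
move=> h; have [L cL] := hk_fin h.
have [N hN] := choice (fun x => @inv_cover _ _ Fhat K hKV hKcompact W x W1 Wo).
exists (flatten [seq N x | x <- L]) => g /cL[x xL hx]; have [y yN hy] := hN x g hx.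
by exists y => //; apply/flattenP; exists (N x) => //; exact: map_f.
Qed.

(** Against a smooth form the integrand is constant on the cosets of a small
    subgroup on the other side; this tests the operators on forms outside [M]. *)
Lemma Theta_left psi b l W : hk psi -> X b -> X l -> W 1%g -> open W -> W `<=` level K ->
  (forall x, W x -> W (x^-1)%g) -> (forall q, W q -> ipnull ip (Rf q l - l)) ->
  fsup (ZS W) (fun g => psi (g^-1)%g * ip (Rf (g^-1)%g b) l).
Proof.
move=> h hb hl W1 Wo WK WV Wl; split.
  move=> g p [z [q [hq ->]]]; have hq' := WV _ hq.
  have -> : ((g * (fscal 2 z * q))^-1 = fscal 2 z^-1 * (q^-1 * g^-1))%g.
    by rewrite !invMg -fscalV -fscalC -mulgA.
  rewrite (hk_z h) (hk_l hK1 _ h (WK _ hq')) RfM Rf_z; last exact: RX.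
  rewrite (omV omf1 omfM) invrK (ipZl psd) //; last exact: RX.
  rewrite mulrACA mulfV ?mul1r; last exact: (om0 omf1 omfM).
  congr (_ * _); rewrite RfM.
  have e : ip (Rf q^-1%g (Rf g^-1%g b)) l = ip (Rf q^-1%g (Rf g^-1%g b)) (Rf q^-1%g l).
    by apply/esym; apply: ip_eq2 => //; [exact: RX|exact: (RX _ (RX _ hb))|exact: Wl].
  by rewrite e ipR //; [rewrite wf_level ?mul1r //; exact: WK|exact: RX].
have [L hL'] := inv_support W1 Wo h; exists L => g hne; apply: hL'.
by move=> e; apply: hne; rewrite e mul0r.
Qed.

Lemma hecke_int_integrable psi b l : hk psi -> X b -> M l -> cintegrable lam setT (fun g => psi g * ip (Rf g b) l : C).
Proof.
move=> h hb hl; have [_ fl] := hl.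
have ff := @Theta_left psi b l (level K) h hb (MX hl) k1 hKopen (@subset_refl _ _) kV fl.
by have [] := @int_left _ _ Fhat lam hlam K hK1 hKint hKopen (level K) k1 kM kV hKopen (@subset_refl _ _) (fun g => psi g * ip (Rf g b) l) ff.
Qed.

Lemma hecke_int_lin psi a b b' l : hk psi -> X b -> X b' -> M l -> hecke_int psi (a *: b + b') l = a * hecke_int psi b l + hecke_int psi b' l.
Proof.
move=> h hb hb' hl; rewrite /hecke_int.
apply: (etrans _ (cint_lin measurableT a (hecke_int_integrable h hb hl) (hecke_int_integrable h hb' hl))).
apply: (f_equal (cintegral lam setT)); apply/funext => g.
by rewrite frtrans_lin (psd_lin psd) //; [ring|exact: RX|exact: RX|exact: MX].
Qed.

Lemma hecke_int_null psi b b' l : X b -> X b' -> X l -> ipnull ip (b - b') -> hecke_int psi b l = hecke_int psi b' l.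
Proof.
by move=> hb hb' hl h; congr (cintegral lam setT); apply/funext => g; rewrite (ip_eqR _ hb hb').
Qed.

Lemma hecke_int_sum psi n (b : 'I_n -> form) (a : 'I_n -> C) l : hk psi -> (forall i, X (b i)) -> M l ->
  hecke_int psi (\sum_i a i *: b i) l = \sum_i a i * hecke_int psi (b i) l.
Proof.
move=> h hb hl; have X0 : X 0 by case: hX.
have I0 : hecke_int psi 0 l = 0 by have := hecke_int_lin (-1) h X0 X0 hl; rewrite scaler0 addr0 mulN1r addNr.
suff e (r : seq 'I_n) : X (\sum_(i <- r) a i *: b i) /\
    hecke_int psi (\sum_(i <- r) a i *: b i) l = \sum_(i <- r) a i * hecke_int psi (b i) l by have [_] := e (index_enum _).
elim: r => [|i r [h1 h2]]; first by rewrite !big_nil I0.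
by rewrite !big_cons hecke_int_lin // h2; split=> //; apply: (subspaceZD hX).
Qed.

(** The values of the operators of the Hecke algebra are invariant under the
    level subgroup: this is tested against smooth forms, for which the integral
    is a sum over cosets of a small normal subgroup of the level. *)
Lemma hecke_form_level psi b y : hk psi -> Lk b -> Lk y -> hecke_form mu lam om psi b y -> M y.
Proof.
move=> h hb hy hf; split=> // q hq; have bX := LX hb; have yX := LX hy.
have zX : X (Rf q y - y) by apply: (subspaceB hX) => //; exact: RX.
apply: (smooth_orth hgal hreal hmu gom zX) => l hl [d hd sl].
have val l' : X l' -> ip y l' = hecke_int psi b l' by move=> hl'; exact: hform.
have [d' hd' sd'] : exists2 d', cgood d' & cong Fhat 2 d' `<=` level K `&` cong Fhat 2 d.
  apply: cong_base; apply: filterI; last exact: cong_nbhs.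
  by apply: open_nbhs_nbhs; split=> //; exact: k1.
pose W : set Gf := cong Fhat 2 d'.
have W1 : W 1%g := cong1 Fhat 2 hd'.
have WM := fun x y => @congM _ _ Fhat 2 d' hd' x y.
have WV := fun x => @congV _ _ Fhat 2 d' hd' x.
have Wo : open W := cong_open Fhat 2 hd'.
have WK : W `<=` level K by move=> x /sd'[].
pose T g := psi g * ip (Rf g b) l.
have fT : fsup (ZS W) (fun g => T (g^-1)%g).
  have X0 : X 0 by case: hX.
  by apply: Theta_left => // x /sd'[_ hx]; rewrite sl // subrr; exact: (ip0l psd X0).
have nz p : ZS W (q^-1^-1 * p * q^-1)%g <-> ZS W p.
  have cj a x : level K a -> W x -> W (a * x * a^-1)%g.
    by move=> ha hx; apply: (cong_conj hd') => // v; exact: (hKint (ha v)).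
  rewrite invgK; split=> -[z [x [hx e]]].
    exists z, (q^-1 * x * q)%g; split; first by have := cj _ _ (kV hq) hx; rewrite invgK.
    have ep : p = (q^-1 * (fscal 2 z * x) * q)%g by rewrite -e !mulgA mulVg mul1g mulgKV.
    by rewrite ep !mulgA fscalC.
  exists z, (q * x * q^-1)%g; split; first exact: cj.
  by rewrite e !mulgA fscalC.
have [fT' eT'] := csum_mulr (ZS1 W1) (ZSM WM) (ZSV WV) fT nz.
have eT : (fun g => T (g * q^-1)^-1%g) = (fun g => T (q * g^-1)%g) by apply/funext => g; rewrite invMg invgK.
rewrite eT in fT' eT'.
have [_ i1] := @int_left _ _ Fhat lam hlam K hK1 hKint hKopen W W1 WM WV Wo WK T fT.
have [_ i2] := @int_left _ _ Fhat lam hlam K hK1 hKint hKopen W W1 WM WV Wo WK (fun g => T (q * g)%g) fT'.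
rewrite (ipBl psd) //; last exact: RX.
have lq : l = Rf q (Rf q^-1%g l) by rewrite -RfM mulgV /frtrans of_fin1 rtrans1.
rewrite {1}lq ipR //; last exact: RX.
rewrite wf_level // mul1r !val //; last exact: RX.
apply/eqP; rewrite subr_eq0; apply/eqP; rewrite /hecke_int [RHS]i1 -eT' -i2; congr (cintegral lam setT); apply/funext => g.
rewrite /T (hk_l hK1 _ h hq) RfM {2}lq ipR //; [|exact: RX|exact: RX].
by rewrite wf_level // mul1r.
Qed.

Section Traces.
Hypothesis HT : forall phi, hk phi -> exists t, hecke_trace mu nu lam om k w phi t.

(** The definition of the trace of an operator includes the existence of its
    values. *)
Lemma hecke_exists phi f : hk phi -> M f -> exists2 y, M y & forall l, X l -> ip y l = hecke_pair phi f l.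
Proof.
move=> h hf; have hu := hk_untwist hlam hK1 hKM hKV hKint hKopen hKcompact dlE h.
have [t [n [b [A [hb _ hx _ _]]]]] := HT hu; have [a ha] := hx f hf.1.
have hy : Lk (\sum_i a i *: b i) by apply: (subspace_sum hL) => i _; apply: (subspaceZ hL).
have My := hecke_form_level hu hf.1 hy ha.
exists (cC^-1 *: \sum_i a i *: b i); first exact: (subspaceZ hM).
move=> l hl; rewrite (ipZl psd) //; last exact: LX.
have -> : ip (\sum_i a i *: b i) l = hecke_int (untwist dl phi) f l by exact: hform.
by rewrite hecke_int_right // untwistK // mulrA mulVf ?mul1r // cC0.
Qed.

(** The function supported on the level and the centre: its operator is the
    projector onto the forms invariant under the level, up to a constant. *)
Definition unitE : E := fun g => (cz K omf g)^-1.
Lemma hk_unitE : hk unitE.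
Proof.
split=> [q q' g hq hq'|z g|].
- by rewrite /unitE (cz_r hKM hKV omf1 omfM omfK) // (cz_l hKM hKV omf1 omfM omfK).
- by rewrite /unitE (cz_z hKM hKV omf1 omfM omfK) invfM.
exists [:: 1%g] => g hne; exists 1%g; first exact: mem_head.
by rewrite invg1 mul1g; apply: contrapT => n; apply: hne; rewrite /unitE cz_out // invr0.
Qed.

Lemma pair_unitE f l : M f -> X l -> hecke_pair unitE f l = ip f l.
Proof.
move=> hf hl; have [hp _] := pair_fsup hk_unitE hf hl.
rewrite /hecke_pair (@csum_one _ _ p1 pM pV _ _ 1%g hp).
  rewrite /unitE (cz1 hK1 hKM hKV omf1 omfM omfK) invr1 scale1r /mc /frtrans of_fin1 rtrans1 //.
move=> g hne; rewrite invg1 mul1g; apply: contrapT => n; apply: hne; rewrite /unitE cz_out // invr0 scale0r //.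
Qed.

(** The operator of [unitE] is the identity on [M] up to a factor and has
    finite rank, so [M] is spanned by finitely many forms up to null forms. *)
Lemma onb_M : exists d (m : 'I_d -> form), [/\ forall i, M (m i), orthonormal ip m
  & forall y, M y -> ipnull ip (y - lincomb m (coords ip m y))].
Proof.
have hu := hk_untwist hlam hK1 hKM hKV hKint hKopen hKcompact dlE hk_unitE.
have [t [n [b [A [hb _ hx _ _]]]]] := HT hu.
apply: (onb_exists psd (n := n) MX hM) => d m hm om'.
have rep i : exists a : 'I_n -> C, ipnull ip (cC *: m i - \sum_j a j *: b j).
  have [a ha] := hx (m i) (hm i).1; exists a.
  have hy : X (\sum_j a j *: b j) by apply: (subspace_sum hX) => j _; apply: (subspaceZ hX); exact: LX.
  have hz : X (cC *: m i - \sum_j a j *: b j) by apply: (subspaceB hX) => //; apply: (subspaceZ hX); exact: MX.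
  rewrite /ipnull /= (ipBl psd) //; last by apply: (subspaceZ hX); exact: MX.
  have -> : ip (\sum_j a j *: b j) (cC *: m i - \sum_j a j *: b j) = hecke_int (untwist dl unitE) (m i) (cC *: m i - \sum_j a j *: b j).
    by exact: hform.
  by rewrite hecke_int_right // untwistK // pair_unitE // (ipZl psd) ?subrr //; exact: MX.
have [a ha] := choice rep.
pose B := \matrix_(i, j) a i j : 'M[C]_(d, n).
suff fB : row_free B by rewrite -(eqP fB) rank_leq_col.
rewrite -kermx_eq0; apply/rowV0P => u /sub_kermxP uB.
have mX i : X (m i) := MX (hm i).
have bX j : X (b j) := LX (hb j).
have nu0 : forall l, X l -> cC * ip (lincomb m u) l = 0.
  move=> l hl; rewrite /lincomb (ip_suml psd) //; last by move=> i _; apply: (subspaceZ hX).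
  rewrite mulr_sumr (eq_bigr (fun i => \sum_j (u ord0 i * B i j) * ip (b j) l)); last first.
    move=> i _; rewrite (ipZl psd) // mulrCA -(ipZl psd) //.
    rewrite (ip_eq _ _ hl (ha i)); [|exact: (subspaceZ hX)|by apply: (subspace_sum hX) => j _; apply: (subspaceZ hX)].
    rewrite (ip_suml psd) //; last by move=> j _; apply: (subspaceZ hX).
    by rewrite mulr_sumr; apply: eq_bigr => j _; rewrite (ipZl psd) // mxE mulrA.
  rewrite exchange_big /= big1 // => j _; rewrite -mulr_suml.
  have := congr1 (fun N : 'rV_n => N ord0 j) uB; rewrite mxE [RHS]mxE => ->.
  by rewrite mul0r.
rewrite -(coords_lincomb psd u om' mX); apply/rowP => i; rewrite !mxE.
by have /eqP := nu0 _ (mX i); rewrite mulf_eq0 (negbTE cC0) /= => /eqP.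
Qed.

Section Basis.
Variables (d : nat) (m : 'I_d -> form).
Hypothesis hm : forall i, M (m i).
Hypothesis om_m : orthonormal ip m.
Hypothesis mM : forall y, M y -> ipnull ip (y - lincomb m (coords ip m y)).
Let mX i : X (m i) := MX (hm i).

(** The matrix of the Hecke operator in an orthonormal basis of the forms
    invariant under the level, acting on row vectors. *)
Definition hecke_mx (phi : E) : 'M[C]_d := \matrix_(i, j) hecke_pair phi (m i) (m j).

Lemma pair_coords phi f j : hk phi -> M f -> hecke_pair phi f (m j) = (coords ip m f *m hecke_mx phi) ord0 j.
Proof.
move=> h hf; rewrite (@pair_null phi f (lincomb m (coords ip m f))) //; [|exact: lincomb_in|exact: mM].
by rewrite pair_lincomb // mxE; apply: eq_bigr => i _; rewrite [hecke_mx _ _ _]mxE.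
Qed.

Lemma hecke_mx_lin a phi psi : hk phi -> hk psi -> hecke_mx (a *: phi + psi) = a *: hecke_mx phi + hecke_mx psi.
Proof.
move=> h h'; apply/matrixP => i j; rewrite !mxE.
have f1 := pair_fsup h (hm i) (mX j); have f2 := pair_fsup h' (hm i) (mX j).
have [f3 <-] := csum_morph p1 pM pV (h := fun t : C => a * t) f1 (mulr0 _) (mulrDr _).
have [_ <-] := csum_add p1 pM pV f3 f2; apply: eq_csum => g.
by rewrite /GRing.scale /= mulrDl mulrA.
Qed.

Lemma hecke_mx_mul phi psi : hk phi -> hk psi -> hecke_mx (mul K phi psi) = hecke_mx psi *m hecke_mx phi.
Proof.
move=> h h'; apply/matrixP => i j; rewrite mxE.
have [y hy ey] := hecke_exists h' (hm i).
have cy : row i (hecke_mx psi) = coords ip m y by apply/rowP => l; rewrite !mxE ey.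
have -> : (hecke_mx psi *m hecke_mx phi) i j = (coords ip m y *m hecke_mx phi) ord0 j.
  by rewrite -cy -row_mul [RHS]mxE.
rewrite -pair_coords // /hecke_pair -(conv_sum hK1 hKM hKV omf1 omfM h h'); last by move=> g z q; exact: mc_eqv.
apply: eq_csum => g; congr (_ *: _).
have yX := MX hy; rewrite /mc.
have jg : m j = Rf g (Rf g^-1%g (m j)) by rewrite -RfM mulgV /frtrans of_fin1 rtrans1.
rewrite {2}jg ipR //; last exact: RX.
rewrite ey; last exact: RX.
have f1 := pair_fsup h' (hm i) (RX g^-1%g (mX j)).
have [_ <-] := csum_morph p1 pM pV (h := fun t : C => wf g * t) f1 (mulr0 _) (mulrDr _).
apply: eq_csum => u /=; rewrite /GRing.scale /= mulrCA; congr (_ * _).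
by rewrite /mc -ipR //; [rewrite -jg -RfM|exact: RX|exact: RX].
Qed.

Definition star0 (phi : E) : E := fun g => (phi (g^-1)%g)^*%C * (wf g)^-1.
Lemma hk_star0 phi : hk phi -> hk (star0 phi).
Proof.
move=> h; split=> [q q' g hq hq'|z g|].
- rewrite /star0 !wfM (wf_level hq) (wf_level hq') mul1r mulr1 !invMg mulgA (hk_bi h) //; exact: kV.
- rewrite /star0 invMg -fscalV -fscalC (hk_z h) wfM (omV omf1 omfM) invrK rmorphM /=.
  have ez : wf (fscal 2 z) = omf z * (omf z)^*%C.
    rewrite /wf -scal_of_fin (wt_scal gom) -/(omf z) sqr_normcE; case: (omf z) => x y /=.
    by apply/eqP; rewrite eq_complex /=; apply/andP; split; apply/eqP; ring.
  rewrite ez; have o0 := om0 omf1 omfM z.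
  have o1 : (omf z)^*%C != 0 by rewrite conjc_eq0.
  by have w0 := wf0 g; rewrite !invfM; field; rewrite w0 o0 o1.
have [L hL'] := inv_support k1 hKopen h; exists L => g hne; apply: hL'.
by move=> e; apply: hne; rewrite /star0 e rmorph0 mul0r.
Qed.

(** The adjoint of translation by [g] is translation by its inverse up to
    [wf]; inverting the variable of a sum over cosets introduces the modular
    factor, whence the twist. *)
Lemma hecke_mx_star phi : hk phi -> exists2 psi, hk psi & hecke_mx psi = adjmx (hecke_mx phi).
Proof.
move=> h; have h0 := hk_star0 h; exists (twist dl (star0 phi)).
  exact: (hk_twist hlam hK1 hKM hKV hKint hKopen hKcompact dlE).
apply/matrixP => i j; rewrite !mxE.
pose T g : C := (star0 phi g : C) *: mc (m i) (m j) g.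
have f1 : fsup P T := pair_fsup h0 (hm i) (mX j).
have eT : (fun g => T (g^-1)%g) = conjc \o (fun g => (phi g : C) *: mc (m j) (m i) g).
  apply/funext => g; rewrite /T /star0 /= invgK wfV invrK /mc /GRing.scale /= rmorphM -mulrA; congr (_ * _).
  have jg : m j = Rf g^-1%g (Rf g (m j)) by rewrite -RfM mulVg /frtrans of_fin1 rtrans1.
  rewrite {1}jg ipR //; last exact: RX.
  rewrite wfV mulrA mulfV ?wf0 // mul1r.
  by rewrite (psd_herm psd) //; exact: RX.
have fj := pair_fsup h (hm j) (mX i).
have [f2 e2] := csum_morph p1 pM pV (h := conjc) fj (rmorph0 _) (rmorphD _).
rewrite -eT in f2 e2.
have := csum_inv hlam hK1 hKM hKV hKint hKopen hKcompact f1 f2; rewrite e2 => ee.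
apply: (mulfI cC0); rewrite -/cC in ee; rewrite -[(hecke_pair phi _ _)^*%C]/(_^*%C) [RHS]ee.
have f3 := pair_fsup (hk_twist hlam hK1 hKM hKV hKint hKopen hKcompact dlE h0) (hm i) (mX j).
rewrite -(csum_morph p1 pM pV (h := fun t : C => cC * t) f3 (mulr0 _) (mulrDr _)).2.
by apply: eq_csum => g /=; rewrite (dlCE dlE) /T /twist /GRing.scale /= /cC; ring.
Qed.

(** Let the operator have matrix [A] on a finite family [b] containing its
    image, [Q] express the images of the basis [m] of [M] through [b], and [S]
    express [b] through [m] after projection. The image lies in [M], which
    gives [A *m A = A *m S *m Q] and [Q *m A = Q *m S *m Q]. Hence [A - S *m
    Q] has square 0 and trace 0, and the trace of [S *m Q] is that of [Q *m
    S], the matrix of the operator on [M]. *)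
Lemma trace_hecke_mx phi t : hk phi -> hecke_trace mu nu lam om k w (untwist dl phi) t -> t = cC * \tr (hecke_mx phi).
Proof.
move=> h [n [b [A [hb bi hx hA ->]]]].
have hu := hk_untwist hlam hK1 hKM hKV hKint hKopen hKcompact dlE h.
set psi := untwist dl phi in hx hA hu.
have bX j : X (b j) := LX (hb j).
have sumX (a : 'I_n -> C) : Lk (\sum_j a j *: b j) by apply: (subspace_sum hL) => j _; apply: (subspaceZ hL).
have bM i : M (\sum_j A i j *: b j) := hecke_form_level hu (hb i) (sumX _) (hA i).
have [Q0 hQ0] := choice (fun l => hx (m l) (hm l).1).
have yM l : M (\sum_j Q0 l j *: b j) := hecke_form_level hu (hm l).1 (sumX _) (hQ0 l).
pose Q : 'M[C]_(d, n) := \matrix_(l, j) Q0 l j.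
pose S : 'M[C]_(n, d) := \matrix_(i, j) ip (b i) (m j).
have ipS (a : 'I_n -> C) j : ip (\sum_i a i *: b i) (m j) = \sum_i a i * S i j.
  rewrite (ip_suml psd) //; last by move=> i _; apply: (subspaceZ hX).
  by apply: eq_bigr => i _; rewrite (ipZl psd) // mxE.
have Ib i j : hecke_int psi (b i) (m j) = (A *m S) i j.
  by rewrite mxE -ipS; apply/esym; exact: (hform (hA i)).
have Im l j : hecke_int psi (m l) (m j) = (Q *m S) l j.
  rewrite mxE (eq_bigr (fun i => Q0 l i * S i j)); last by move=> i _; rewrite mxE.
  by rewrite -ipS; apply/esym; exact: (hform (hQ0 l)).
have QS : Q *m S = cC *: hecke_mx phi.
  apply/matrixP => l j; rewrite -Im hecke_int_right // untwistK // mxE; congr (_ * _).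
  by rewrite mxE.
(* A combination of the b lying in M is determined, as an element of M, by its
   coordinates; applying the operator to both expressions gives a relation. *)
have rel (a : 'rV[C]_n) : M (\sum_j a ord0 j *: b j) -> a *m A = a *m S *m Q.
  move=> ha; have ca : coords ip m (\sum_j a ord0 j *: b j) = a *m S.
    by apply/rowP => j; rewrite mxE ipS mxE.
  have na := mM ha; rewrite ca in na.
  have vX : X (lincomb m (a *m S)) by apply: lincomb_in.
  have eI j : hecke_int psi (\sum_i a ord0 i *: b i) (m j) = hecke_int psi (lincomb m (a *m S)) (m j).
    by apply: hecke_int_null => //; exact: LX (sumX _).
  pose u := a *m A - a *m S *m Q.
  suff u0 : u = 0 by apply/eqP; rewrite -subr_eq0; apply/eqP.
  have Mu : M (\sum_j u ord0 j *: b j).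
    have -> : \sum_j u ord0 j *: b j = \sum_i a ord0 i *: (\sum_j A i j *: b j) - \sum_l (a *m S) ord0 l *: (\sum_j Q0 l j *: b j).
      under [X in _ = X - _]eq_bigr do rewrite scaler_sumr.
      under [X in _ = _ - X]eq_bigr do rewrite scaler_sumr.
      rewrite exchange_big /= [X in _ = _ - X]exchange_big /= -sumrB; apply: eq_bigr => j _.
      rewrite /u !mxE scalerBl !scaler_suml; congr (_ - _); apply: eq_bigr => i _; rewrite scalerA //.
      by rewrite [Q i j]mxE.
    apply: (subspaceB hM); apply: (subspace_sum hM) => i _; exact: (subspaceZ hM).
  have cu : coords ip m (\sum_j u ord0 j *: b j) = 0.
    apply/rowP => j; rewrite mxE ipS [RHS]mxE.
    have -> : \sum_i u ord0 i * S i j = (u *m S) ord0 j by rewrite mxE.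
    rewrite /u mulmxBl -!mulmxA mxE [X in _ + X]mxE.
    have := eI j; rewrite hecke_int_sum // /lincomb hecke_int_sum //.
    rewrite (eq_bigr (fun i => a ord0 i * (A *m S) i j)); last by move=> i _; rewrite Ib.
    rewrite [RHS](eq_bigr (fun l => (a *m S) ord0 l * (Q *m S) l j)); last by move=> i _; rewrite Im.
    by rewrite !mulmxA => e; rewrite -!mulmxA mxE e mulmxA [X in _ - X]mxE subrr.
  have nz := mM Mu; rewrite cu in nz.
  have z0 : lincomb m 0 = 0 by rewrite /lincomb big1 // => i _; rewrite mxE scale0r.
  rewrite z0 subr0 in nz.
  by apply/rowP => i; rewrite [RHS]mxE; exact: (bi (fun j => u ord0 j) nz i).
have rA : A *m A = A *m S *m Q.
  apply/row_matrixP => i; rewrite !row_mul; apply: rel.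
  by rewrite (eq_bigr (fun j => A i j *: b j)) // => j _; rewrite mxE.
have rQ : Q *m A = Q *m S *m Q.
  apply/row_matrixP => i; rewrite !row_mul; apply: rel.
  by rewrite (eq_bigr (fun j => Q0 i j *: b j)) // => j _; rewrite !mxE.
have D0 : \tr (A - S *m Q) = 0.
  apply: trace_square0; rewrite mulmxBl !mulmxBr rA mulmxA subrr.
  by rewrite -!mulmxA rQ !mulmxA subrr subrr.
move: D0; rewrite linearB /= => /subr0_eq ->.
by rewrite mxtrace_mulC QS linearZ.
Qed.

End Basis.
End Traces.
End Spectral.

(** * Restricted tensor products of local Hecke algebras *)

Lemma proj_continuous (I : choiceType) (X : rpfam I) (oX : forall i, open (rint X i)) i :
  continuous (fun x : rprod X => x i).
Proof.
move=> x U /=; rewrite nbhsE => -[U' [oU' U'x] sU].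
have [V [oV fV] Vx] := isbox_around oX x.
pose W u : set (X u) := V u `&` [set y | forall e : u = i, U' (ecast t (X t) e y)].
apply/(rprod_nbhsP oX); exists W; split.
- split=> [u|].
    apply: openI; first exact: oV.
    case: (pselect (u = i)) => [e|ne]; last first.
      by rewrite (_ : mkset _ = setT); [exact: openT|apply/seteqP; split=> // y _ e; case: ne].
    subst u; rewrite (_ : mkset _ = U') //; apply/seteqP; split=> y h; first exact: (h erefl).
    by move=> e; rewrite (Prop_irrelevance e erefl).
  apply: (@sub_finite_set _ _ ([set u | V u <> rint X u] `|` [set i])); last by rewrite finite_setU.
  move=> u /= nu; case: (pselect (u = i)) => [->|ne]; [by right|left].
  move=> e; apply: nu; rewrite -e /W; apply/seteqP; split=> y; first by case.
  by move=> h; split=> // e'; case: ne.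
- by move=> u; split; [exact: Vx|move=> e; subst u; exact: U'x].
by move=> y /(_ i)[_ /(_ erefl)]; exact: sU.
Qed.

Lemma thin_list (T : eqType) (e : T -> T -> Prop) : (forall x, e x x) -> (forall x y, e x y -> e y x) ->
  (forall x y z, e x y -> e y z -> e x z) -> forall L : seq T, exists L' : seq T,
  [/\ uniq L', forall x, x \in L -> exists2 y, y \in L' & e y x
    & forall x y, x \in L' -> y \in L' -> e x y -> x = y].
Proof.
move=> er es et; elim=> [|a L [L' [u c d]]]; first by exists [::].
case: (pselect (exists2 y, y \in L' & e y a)) => [h|h].
  by exists L'; split=> // x; rewrite inE => /orP[/eqP -> //|/c].
exists (a :: L'); split=> /=.
- by rewrite u andbT; apply/negP => aL; apply: h; exists a.
- move=> x; rewrite inE => /orP[/eqP ->|/c[y yL hy]]; first by exists a => //; exact: mem_head.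
  by exists y => //; rewrite inE yL orbT.
move=> x y; rewrite !inE => /orP[/eqP ->|hx] /orP[/eqP ->|hy] // hxy; last exact: d.
  by case: h; exists y => //; exact: es.
by case: h; exists x.
Qed.

Lemma gl_scalV (R : realType) m (K : avField R) (z : GL 1 K) : gl_scal m (z^-1)%g = ((gl_scal m z)^-1)%g.
Proof. by apply: (mulgI (gl_scal m z)); rewrite mulgV -gl_scalM mulgV gl_scal1. Qed.

Section Tensor.
Variables (R : realType) (F : splittingFieldType rat).
Variable Fhat : forall v : finPlace F, completion R v.
Local Notation C := R[i].
Local Notation Gf := (GAf Fhat 2).
Variable K : forall v : finPlace F, set (GL 2 (Fhat v)).
Arguments K : clear implicits.
Hypothesis hK1 : forall v, K v 1%g.
Hypothesis hKM : forall v g h, K v g -> K v h -> K v (g * h)%g.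
Hypothesis hKV : forall v g, K v g -> K v (g^-1)%g.
Hypothesis hKint : forall v, K v `<=` @gl_integral R 2 (Fhat v).
Hypothesis hKopen : open (level K).
Hypothesis hKcompact : compact (level K).
Variable om : GA Fhat 1 -> C.
Hypothesis gom : goodchar K om.
Let k1 := level1 hK1.
Local Notation fplace := (finPlace F).

Definition sgl n v (x : GL n (Fhat v)) : GAf Fhat n := fin_part (@at_place R F Fhat n (inr v) x).
Lemma sglE n v (x : GL n (Fhat v)) : sgl x v = x. Proof. exact: dfwithin. Qed.
Lemma sglN n v (x : GL n (Fhat v)) u : v != u -> sgl x u = 1%g.
Proof. by move=> h; apply: dfwithout; apply: contra h => /eqP[->]. Qed.

Lemma sgl_level v (x : GL 2 (Fhat v)) : K v x -> level K (sgl x).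
Proof.
move=> hx u; have [e|ne] := eqVneq v u; last by rewrite sglN.
by subst u; rewrite sglE.
Qed.

Local Notation w v := (omega_at om (v := v)).
Lemma omega_at_sgl v (z : GL 1 (Fhat v)) : w v z = omf om (sgl z).
Proof.
rewrite /omega_at /local_char /omf; congr om; apply: GA_ext => -[t|u]; last by [].
exact: dfwithout.
Qed.
Lemma omega_at_K v (z : GL 1 (Fhat v)) : K v (gl_scal 2 z) -> w v z = 1.
Proof.
move=> h; rewrite omega_at_sgl; apply: (gc_K gom) => u; have [e|ne] := eqVneq v u.
  by subst u; rewrite (_ : fscal 2 _ v = gl_scal 2 (sgl z v)) // sglE.
rewrite (_ : fscal 2 _ u = gl_scal 2 (sgl z u)) // sglN // (_ : gl_scal 2 _ = 1%g) //; exact: gl_scal1.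
Qed.
Lemma sglM n v (x y : GL n (Fhat v)) : sgl (x * y)%g = (sgl x * sgl y)%g.
Proof.
apply: GAf_ext => u; have [e|ne] := eqVneq v u.
  by subst u; rewrite (_ : rval (_ * _)%g v = (sgl x v * sgl y v)%g) // !sglE.
by rewrite (_ : rval (sgl x * sgl y)%g u = (sgl x u * sgl y u)%g) // !sglN // mulg1.
Qed.
Lemma omega_atM v (x y : GL 1 (Fhat v)) : w v (x * y)%g = w v x * w v y.
Proof. by rewrite !omega_at_sgl sglM (omfM gom). Qed.
Lemma omega_at0 v (x : GL 1 (Fhat v)) : w v x != 0.
Proof. by rewrite omega_at_sgl; apply: (om0 (omf1 gom) (omfM gom)). Qed.
Lemma omega_at1 v : w v 1%g = 1.
Proof. by apply: (mulfI (omega_at0 (v := v) 1%g)); rewrite -omega_atM mulg1 mulr1. Qed.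

(** The level, being open, contains a box, and almost all sides of a box are
    the full integral groups. *)
Lemma level_ae (g : Gf) : finite_set [set v | ~ K v (g v)].
Proof.
have [V [[oV fV] V1 VK]] : exists V, [/\ isbox (X := fin_fam Fhat 2) V, box V (1%g : Gf) & box V `<=` level K].
  by apply/(rprod_nbhsP (@fin_rint_open R F Fhat 2)); apply: open_nbhs_nbhs; split=> //; exact: k1.
apply: (@sub_finite_set _ _ ([set v | V v <> rint (fin_fam Fhat 2) v] `|` [set v | ~ rint (fin_fam Fhat 2) v (g v)])).
  move=> v /= nK; apply: contrapT => /not_orP[/contrapT eV /contrapT ig]; apply: nK.
  rewrite -(sglE (g v)); apply: VK => u; have [e|ne] := eqVneq v u.
    by subst u; rewrite eV sglE.
  by rewrite sglN //; exact: V1.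
by rewrite finite_setU; split=> //; exact: (rvalP g).
Qed.

Lemma K_nbhs v : exists2 U : set (GL 2 (Fhat v)), open U & U 1%g /\ U `<=` K v.
Proof.
have [V [[oV fV] V1 VK]] : exists V, [/\ isbox (X := fin_fam Fhat 2) V, box V (1%g : Gf) & box V `<=` level K].
  by apply/(rprod_nbhsP (@fin_rint_open R F Fhat 2)); apply: open_nbhs_nbhs; split=> //; exact: k1.
exists (V v); first exact: oV.
split; first exact: V1.
move=> x hx; rewrite -(sglE x); apply: VK => u; have [e|ne] := eqVneq v u.
  by subst u; rewrite sglE.
by rewrite sglN //; exact: V1.
Qed.

Lemma K_compact v : compact (K v).
Proof.
have -> : K v = (fun g : Gf => g v) @` level K.
  apply/seteqP; split=> [x hx|x [g hg <-]]; last exact: hg.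
  by exists (sgl x); [exact: sgl_level|exact: sglE].
apply: continuous_compact => //; apply: continuous_subspaceT.
exact: (proj_continuous (@fin_rint_open R F Fhat 2)).
Qed.

Lemma common_list (S : set fplace) : finite_set S -> exists s : seq fplace, uniq s /\ forall v, v \notin s -> ~ S v.
Proof.
move=> /finite_seqP[s ->]; exists (undup s); split; first exact: undup_uniq.
by move=> v; rewrite mem_undup => /negP.
Qed.

Definition tensor (Phi : forall v, GL 2 (Fhat v) -> C) (g : Gf) : C :=
  \big[*%R/1]_(v \in [set: fplace]) Phi v (g v).

Lemma tensorE Phi (g : Gf) s : uniq s -> (forall v, v \notin s -> Phi v (g v) = 1) ->
  tensor Phi g = \prod_(v <- s) Phi v (g v).
Proof.
move=> us h; rewrite /tensor (@fsbigE _ _ _ _ _ s) //; last by move=> v _; exact: h.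
by apply: eq_bigl => v; rewrite in_setT.
Qed.

Lemma omega_prod (z : GAf Fhat 1) s : uniq s -> (forall v, v \notin s -> K v (gl_scal 2 (z v))) ->
  omf om z = \prod_(v <- s) w v (z v).
Proof.
move=> us h; pose s' := map (inr : fplace -> place R F) s.
have us' : uniq s' by rewrite map_inj_uniq // => ? ? [].
rewrite /omf (char_split (gc1 gom) (gcM gom) (of_fin z) us') big_map.
have -> : strips s' (of_fin z) = of_fin (fin_part (strips s' (of_fin z))).
  by apply: GA_ext => -[t|v] //=; rewrite stripsE; case: ifP.
rewrite [om (of_fin _)](gc_K gom) ?mulr1 // => v.
rewrite (_ : fscal 2 _ v = gl_scal 2 (strips s' (of_fin z) (inr v))) // stripsE.
rewrite mem_map; last by move=> ? ? [].
by case: ifP => [_|/negbT /h //]; rewrite gl_scal1; exact: hK1.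
Qed.

(** ** From tensors to functions *)

Section Pure.
Variable Phi : forall v, GL 2 (Fhat v) -> C.
Hypothesis hPhi : forall v, local_hecke om K (Phi (v := v)).
Hypothesis fPhi : finite_set [set v | ~ local_hecke_unit om K (Phi (v := v))].

Lemma unit_K v g : local_hecke_unit om K (Phi (v := v)) -> K v g -> Phi g = 1.
Proof.
move=> [h _] hg; have := h 1%g g hg; rewrite gl_scal1.
by rewrite mul1g omega_at1 invr1.
Qed.

Lemma tensor_neq0 g v : tensor (fun v => Phi (v := v)) g <> 0 -> Phi (g v) <> 0.
Proof.
have [s [us hs]] : exists s : seq fplace, uniq s /\ forall v, v \notin s -> ~ ([set v | ~ local_hecke_unit om K (Phi (v := v))] `|` [set v | ~ K v (g v)]) v.
  by apply: common_list; rewrite finite_setU; split=> //; exact: level_ae.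
have out u : u \notin s -> Phi (g u) = 1.
  by move=> /hs/not_orP[/contrapT h1 /contrapT h2]; exact: unit_K.
rewrite (tensorE us out) => /eqP; rewrite prodf_seq_neq0 => /allP h.
case: (boolP (v \in s)) => [/h /= /eqP //|/out ->]; apply/eqP; exact: oner_neq0.
Qed.

Definition reps (L : forall v : fplace, seq (GL 2 (Fhat v))) (s : seq fplace) : seq Gf :=
  foldr (fun v r => [seq (sgl x * y)%g | x <- L v, y <- r]) [:: 1%g] s.

Lemma repsP L s (x : forall v, GL 2 (Fhat v)) : uniq s -> (forall v, v \in s -> x v \in L v) ->
  exists2 r, r \in reps L s & forall v, r v = if v \in s then x v else 1%g.
Proof.
elim: s => [_ _|v s IH /= /andP[vs us] hx]; first by exists 1%g => //; exact: mem_head.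
have [|r rr er] := IH us; first by move=> u us'; apply: hx; rewrite inE us' orbT.
exists (sgl (x v) * r)%g; first by apply/allpairsP; exists (x v, r); split=> //; apply: hx; exact: mem_head.
move=> u; rewrite (_ : rval _ u = (sgl (x v) u * r u)%g) // er inE; have [e|ne] := eqVneq v u.
  by subst u; rewrite sglE (negPf vs) mulg1.
by rewrite (_ : sgl (x v) u = 1%g); [rewrite mul1g|exact: sglN].
Qed.

(** Finitely many cosets suffice locally at the finitely many exceptional
    places, and one coset at the others. *)
Lemma hk_tensor : hk K (omf om) (tensor (fun v => Phi (v := v))).
Proof.
split=> [k k' g hk hk'|z g|].
- apply: eq_fsbigr => v _; have [h _ _] := hPhi v; exact: (h _ _ _ (hk v) (hk' v)).
- have [s [us hs]] : exists s : seq fplace, uniq s /\ forall v, v \notin s -> ~ ([set v | ~ local_hecke_unit om K (Phi (v := v))] `|`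
      ([set v | ~ K v (g v)] `|` [set v | ~ K v (fscal 2 z v)])) v.
    by apply: common_list; rewrite !finite_setU; split=> //; split; exact: level_ae.
  rewrite (tensorE (g := g) us); last by move=> v /hs/not_orP[/contrapT h1 /not_orP[/contrapT h2 _]]; exact: unit_K.
  rewrite (tensorE us); last first.
    by move=> v /hs/not_orP[/contrapT h1 /not_orP[/contrapT h2 /contrapT h3]]; apply: unit_K => //; exact: hKM.
  rewrite (omega_prod us); last by move=> v /hs/not_orP[_ /not_orP[_ /contrapT]].
  rewrite -prodfV -big_split; apply: eq_bigr => v _ /=; have [_ h _] := hPhi v; exact: h.
have [s [us hs]] := common_list fPhi.
have cov v : exists L : seq (GL 2 (Fhat v)), forall g, Phi (v := v) g <> 0 ->
    exists z x, x \in L /\ K v (x^-1 * ((gl_scal 2 z)^-1 * g))%g.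
  have [_ _ [D [cD hD]]] := hPhi v; have [U oU [U1 UK]] := K_nbhs v.
  move: cD; rewrite compact_cover => cD.
  have [|a Da|L _ hL] := cD (GL 2 (Fhat v)) setT (fun x => [set y | U (x^-1 * y)%g]).
  - by move=> x _; apply: open_comp oU => y _; exact: gl_mull_continuous.
  - by exists a => //=; rewrite mulVg.
  exists (enum_fset L) => g /eqP /hD[z [d [Dd ->]]]; have [x /= xL hx] := hL d Dd.
  by exists z, x; split=> //; rewrite mulKg; exact: UK.
pose L v := projT1 (cid (cov v)); have hL v := projT2 (cid (cov v)).
exists (reps L s) => g gne.
have loc v : exists p : GL 1 (Fhat v) * GL 2 (Fhat v), [/\ v \in s -> p.2 \in L v, v \notin s -> p.2 = 1%g
    & K v (p.2^-1 * ((gl_scal 2 p.1)^-1 * g v))%g].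
  have ne := tensor_neq0 (v := v) gne; case: (boolP (v \in s)) => vs.
    by have [z [x [xL hx]]] := hL v _ ne; exists (z, x).
  have /contrapT[_ /(_ (g v))] := hs v vs; move/eqP in ne => /(_ ne)[z [k [hk e]]].
  by exists (z, 1%g); split=> //=; rewrite e mulKg invg1 mul1g.
pose p v := projT1 (cid (loc v)); have hp v := projT2 (cid (loc v)).
have zfin : finite_set [set v | ~ rint (fin_fam Fhat 1) v (p v).1].
  apply: (@sub_finite_set _ _ ([set` s] `|` [set v | ~ rint (fin_fam Fhat 2) v (g v)])); last first.
    by rewrite finite_setU; split; [exact: finite_seq|exact: (rvalP g)].
  move=> v /= nz; apply: contrapT => /not_orP[/negP vs /contrapT ig]; apply: nz.
  have [_ h2 h3] := hp v; move: h3; rewrite -/(p v) (h2 vs) invg1 mul1g => h3.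
  apply: scal_integral; rewrite -[gl_scal 2 _](mulgK ((gl_scal 2 (p v).1)^-1 * g v))%g mulKVg.
  by apply: (@rintM _ (fin_fam Fhat 2) v) => //; apply: (@rintV _ (fin_fam Fhat 2) v); exact: hKint.
pose z : GAf Fhat 1 := RProd (X := fin_fam Fhat 1) zfin.
have [r rr er] := repsP (L := L) (x := fun v => (p v).2) us (fun v vs => let: And3 h _ _ := hp v in h vs).
exists r => //; exists z, (r^-1 * ((fscal 2 z)^-1 * g))%g; split; last by rewrite mulgA fscalC -mulgA mulKVg.
move=> v; rewrite (_ : rval _ v = ((r v)^-1 * ((gl_scal 2 (p v).1)^-1 * g v))%g) //.
have [_ h2 h3] := hp v; rewrite er; case: ifP => [_|/negbT vs]; first exact: h3.
by move: h3; rewrite -/(p v) h2.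
Qed.
End Pure.

Lemma hecke_hk phi : hecke om K phi -> hk K (omf om) phi.
Proof.
move=> [n [Phi [h1 h2 e]]].
have -> : phi = (\sum_i (tensor (fun v => Phi i v) : Gf -> C^o)).
  by apply/funext => g; rewrite e fct_sumE.
by apply: (subspace_sum (hk_subspace K (omf om))) => i _; exact: hk_tensor.
Qed.

(** ** From functions to tensors *)

Section DoubleCoset.
Variable phi : Gf -> C^o.
Hypothesis hphi : hk K (omf om) phi.
Variable x : Gf.
Hypothesis px : phi x <> 0.

(** The local character is trivial on the central elements occurring in the
    stabilizer of the double coset of [x], as [phi x] does not vanish. *)
Lemma local_stab v (z : GL 1 (Fhat v)) k k' : K v k -> K v k' ->
  (gl_scal 2 z * k * x v * k')%g = x v -> w v z = 1.
Proof.
move=> hk hk' e; have ex : x = (fscal 2 (sgl z) * (sgl k * x * sgl k'))%g.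
  apply: GAf_ext => u; suff : (x u = gl_scal 2 (sgl z u) * (sgl k u * x u * sgl k' u) :> GL 2 (Fhat u))%g by [].
  have [eu|ne] := eqVneq v u; first by subst u; rewrite !sglE !mulgA e.
  by rewrite !sglN // mulg1 mul1g (_ : gl_scal 2 _ = 1%g) ?mul1g //; exact: gl_scal1.
have := hk_z hphi (sgl z) (sgl k * x * sgl k')%g; rewrite -ex (hk_bi hphi _ (sgl_level hk) (sgl_level hk')).
rewrite -omega_at_sgl => h; have w0 := omega_at0 z; apply: (mulIf (introN eqP px)).
by rewrite mul1r {1}h mulrA mulfV // mul1r.
Qed.

(** The double coset of [x v], together with the central element used to reach
    [h]. *)
Definition inD v (h : GL 2 (Fhat v)) (z : GL 1 (Fhat v)) : Prop :=
  exists k k', [/\ K v k, K v k' & h = (gl_scal 2 z * k * x v * k')%g].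
(** The local Hecke function supported on the double coset of the centre and
    the level through [x v] and normalized at [x v]. *)
Definition dc v (h : GL 2 (Fhat v)) : C :=
  if pselect (exists z, inD h z) is left e then (w v (projT1 (cid e)))^-1 else 0.

Lemma dcE v (h : GL 2 (Fhat v)) z : inD h z -> dc h = (w v z)^-1.
Proof.
move=> hz; rewrite /dc; case: pselect => [e|[]] /=; last by exists z.
case: (cid e) => z' /= hz'; congr (_^-1).
have [k [q [hk hq eh]]] := hz; have [k' [q' [hk' hq' eh']]] := hz'.
have : w v (z^-1 * z')%g = 1.
  apply: (@local_stab v _ (k^-1 * k')%g (q' * q^-1)%g); try by apply: hKM => //; exact: hKV.
  have -> : (gl_scal 2 (z^-1 * z') * (k^-1 * k') * x v * (q' * q^-1) =
     k^-1 * (gl_scal 2 (z^-1)%g * (gl_scal 2 z' * k' * x v * q')) * q^-1)%g.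
    by rewrite !mulgA gl_scalC gl_scalM !mulgA.
  by rewrite -eh' eh gl_scalV -!mulgA !mulKg mulgV mulg1.
rewrite omega_atM => e1; apply: (mulfI (omega_at0 (z^-1)%g)); rewrite e1 -omega_atM mulVg omega_at1 //.
Qed.

Lemma dc_out v (h : GL 2 (Fhat v)) : ~ (exists z, inD h z) -> dc h = 0.
Proof. by move=> n; rewrite /dc; case: pselect. Qed.

Lemma dc_local v : local_hecke om K (@dc v).
Proof.
have bi k k' (h : GL 2 (Fhat v)) z : K v k -> K v k' -> inD h z -> inD (k * h * k')%g z.
  move=> hk hk' [q [q' [hq hq' ->]]]; exists (k * q)%g, (q' * k')%g; split; [exact: hKM|exact: hKM|].
  by rewrite !mulgA gl_scalC.
have zz a (h : GL 2 (Fhat v)) z : inD h z -> inD (gl_scal 2 a * h)%g (a * z)%g.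
  by move=> [q [q' [hq hq' ->]]]; exists q, q'; split=> //; rewrite gl_scalM !mulgA.
split.
- move=> k k' h hk hk'; case: (pselect (exists z, inD h z)) => [[z hz]|n].
    by rewrite (dcE hz) (dcE (bi _ _ _ _ hk hk' hz)).
  rewrite !dc_out // => -[z hz]; apply: n; exists z.
  by have := bi _ _ _ _ (hKV hk) (hKV hk') hz; rewrite -mulgA mulgK mulKg.
- move=> a h; case: (pselect (exists z, inD h z)) => [[z hz]|n].
    by rewrite (dcE hz) (dcE (zz a _ _ hz)) omega_atM invfM.
  rewrite !dc_out ?mulr0 // => -[z hz]; apply: n; exists (a^-1 * z)%g.
  have := zz (a^-1)%g _ _ hz; rewrite mulgA -gl_scalM mulVg gl_scal1 mul1g //.
exists ((fun p : GL 2 (Fhat v) * GL 2 (Fhat v) => p.1 * p.2)%g @` (((fun p : GL 2 (Fhat v) * GL 2 (Fhat v) => p.1 * p.2)%g @` (K v `*` [set x v])) `*` K v)).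
split.
  have cm (A : set (GL 2 (Fhat v) * GL 2 (Fhat v))) : compact A -> compact ((fun p : GL 2 (Fhat v) * GL 2 (Fhat v) => p.1 * p.2)%g @` A).
    by move=> cA; apply: continuous_compact => //; apply: continuous_subspaceT; exact: gl_mul_continuous.
  apply: (cm); apply: compact_setX; last exact: K_compact.
  by apply: (cm); apply: compact_setX; [exact: K_compact|exact: compact_set1].
move=> h hne; have [z [k [k' [hk hk' ->]]]] : exists z, inD h z by apply: contrapT => n; rewrite dc_out ?eqxx in hne.
exists z, (k * x v * k')%g; split; last by rewrite !mulgA.
exists ((k * x v)%g, k') => //; split=> //=; by exists (k, x v).
Qed.

Lemma dc_unit v : K v (x v) -> local_hecke_unit om K (@dc v).
Proof.
move=> hx; split=> [z k hk|h hne].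
  apply: dcE; exists (k * (x v)^-1)%g, 1%g; split=> //; first by apply: hKM => //; exact: hKV.
  by rewrite mulg1 -!mulgA mulVg mulg1.
have [z [k [k' [hk hk' ->]]]] : exists z, inD h z by apply: contrapT => n; rewrite dc_out ?eqxx in hne.
by exists z, (k * x v * k')%g; rewrite !mulgA; split=> //; apply: hKM => //; exact: hKM.
Qed.

(** The value [phi x] is carried by the single place [v0]. *)
Definition coeff v0 v (h : GL 2 (Fhat v)) : C := (if v == v0 then phi x else 1) * dc h.

Lemma coeff_local v0 v : local_hecke om K (@coeff v0 v).
Proof.
have [h1 h2 [D [cD hD]]] := dc_local v; split.
- by move=> k k' h hk hk'; rewrite /coeff h1.
- by move=> z h; rewrite /coeff h2 mulrCA.
exists D; split=> // h hne; apply: hD; apply: contraNneq hne => e; by rewrite /coeff e mulr0.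
Qed.

Lemma coeff_unit v0 : finite_set [set v | ~ local_hecke_unit om K (@coeff v0 v)].
Proof.
apply: (@sub_finite_set _ _ ([set v | ~ K v (x v)] `|` [set v0])).
  move=> v /= n; apply: contrapT => /not_orP[/contrapT hx /eqP ne]; apply: n.
  rewrite (_ : @coeff v0 v = @dc v); first exact: dc_unit.
  by apply/funext => h; rewrite /coeff (negPf ne) mul1r.
by rewrite finite_setU; split; [exact: level_ae|exact: finite_set1].
Qed.

Lemma coeff_in v0 g z k k' : level K k -> level K k' -> g = (fscal 2 z * k * x * k')%g ->
  tensor (@coeff v0) g = phi g.
Proof.
move=> hk hk' eg; have loc v : inD (g v) (z v) by exists (k v), (k' v); split=> //; rewrite eg.
have [s [us hs]] : exists s : seq fplace, uniq s /\ forall v, v \notin s -> ~ ([set v | ~ K v (fscal 2 z v)] `|` [set v0]) v.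
  by apply: common_list; rewrite finite_setU; split; [exact: level_ae|exact: finite_set1].
have sv0 : v0 \in s by apply: contrapT => /negP /hs; apply; right.
have val v : coeff v0 (g v) = (if v == v0 then phi x else 1) * (w v (z v))^-1 by rewrite /coeff (dcE (loc v)).
rewrite (tensorE us); last first.
  move=> v vs; have /not_orP[/contrapT h1 /eqP h2] := hs v vs.
  by rewrite val (negPf h2) mul1r omega_at_K ?invr1.
rewrite (eq_bigr _ (fun v _ => val v)) big_split /=.
rewrite (bigD1_seq v0) //= eqxx big1 ?mulr1; last by move=> v /negPf ->.
have -> : g = (fscal 2 z * (k * x * k'))%g by rewrite eg !mulgA.
rewrite (hk_z hphi) (hk_bi hphi _ hk hk') mulrC; congr (_ * _).
by rewrite prodfV (omega_prod us) // => v /hs/not_orP[/contrapT].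
Qed.

Lemma coeff_out v0 g : tensor (@coeff v0) g <> 0 -> exists z k k', [/\ level K k, level K k' & g = (fscal 2 z * k * x * k')%g].
Proof.
move=> gne; have ne v := @tensor_neq0 (@coeff v0) (coeff_unit v0) g v gne.
have loc v : exists p : GL 1 (Fhat v) * (GL 2 (Fhat v) * GL 2 (Fhat v)),
    [/\ K v p.2.1, K v p.2.2 & g v = (gl_scal 2 p.1 * p.2.1 * x v * p.2.2)%g].
  have [z [k [k' [h1 h2 h3]]]] : exists z, inD (g v) z.
    by apply: contrapT => n; apply: (ne v); rewrite /coeff dc_out // mulr0.
  by exists (z, (k, k')).
pose p v := projT1 (cid (loc v)); have hp v : [/\ K v (p v).2.1, K v (p v).2.2 & g v = (gl_scal 2 (p v).1 * (p v).2.1 * x v * (p v).2.2)%g] := projT2 (cid (loc v)).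
have fin0 (A : forall v, GL 2 (Fhat v)) : (forall v, K v (A v)) -> finite_set [set v | ~ rint (fin_fam Fhat 2) v (A v)].
  by move=> hA; rewrite (_ : [set _ | _] = set0) // -subset0 => v /=; apply; exact: hKint.
have hp1 v : K v (p v).2.1 by have [] := hp v.
have hp2 v : K v (p v).2.2 by have [] := hp v.
pose k : Gf := RProd (X := fin_fam Fhat 2) (fin0 (fun v => (p v).2.1) hp1).
pose k' : Gf := RProd (X := fin_fam Fhat 2) (fin0 (fun v => (p v).2.2) hp2).
have zfin : finite_set [set v | ~ rint (fin_fam Fhat 1) v (p v).1].
  apply: (@sub_finite_set _ _ ([set v | ~ rint (fin_fam Fhat 2) v (g v)] `|` [set v | ~ rint (fin_fam Fhat 2) v (x v)])).
    move=> v /= nz; apply: contrapT => /not_orP[/contrapT ig /contrapT ix]; apply: nz.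
    have [h1 h2 h3] := hp v; apply: scal_integral.
    have h4 : g v = (gl_scal 2 (p v).1 * ((p v).2.1 * x v * (p v).2.2))%g by rewrite h3 !mulgA.
    have -> : gl_scal 2 (p v).1 = (g v * ((p v).2.1 * x v * (p v).2.2)^-1)%g by rewrite h4 mulgK.
    apply: (@rintM _ (fin_fam Fhat 2) v) => //; apply: (@rintV _ (fin_fam Fhat 2) v).
    by apply: (@rintM _ (fin_fam Fhat 2) v); [apply: (@rintM _ (fin_fam Fhat 2) v) => //|]; exact: hKint.
  by rewrite finite_setU; split; exact: rvalP.
pose z : GAf Fhat 1 := RProd (X := fin_fam Fhat 1) zfin.
exists z, k, k'; split; [by move=> v; have [] := hp v|by move=> v; have [] := hp v|].
by apply: GAf_ext => v; have [_ _ ->] := hp v.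
Qed.

End DoubleCoset.

(** A Hecke function is a finite sum of functions supported on one double
    coset, and such a function is a tensor: its value at [x], put at one
    place, times the local functions [dc]. *)
Lemma hk_hecke phi : hk K (omf om) phi -> hecke om K phi.
Proof.
move=> h; have [v0 _] := finPlace_exists F; have [L cL] := hk_fin h.
pose e (x g : Gf) := exists z k k', [/\ level K k, level K k' & g = (fscal 2 z * k * x * k')%g].
have kM := levelM hKM; have kV := levelV hKV.
have er x : e x x by exists 1%g, 1%g, 1%g; split; [exact: k1|exact: k1|rewrite fscal1 !mul1g mulg1].
have et x y z : e x y -> e y z -> e x z.
  move=> [a [k [k' [h1 h2 ->]]]] [b [q [q' [h3 h4 ->]]]]; exists (b * a)%g, (q * k)%g, (k' * q')%g.
  split; [exact: kM|exact: kM|]; rewrite fscalM !mulgA.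
  by rewrite -(mulgA (fscal 2 b) q) -[(q * fscal 2 a)%g]fscalC mulgA.
have es x y : e x y -> e y x.
  move=> [a [k [k' [h1 h2 ->]]]]; exists (a^-1)%g, (k^-1)%g, (k'^-1)%g; split; [exact: kV|exact: kV|].
  by rewrite !mulgA mulgK -[(_ * fscal 2 a)%g]fscalC !mulgA -fscalM mulgV fscal1 mul1g mulVg mul1g.
have [L0 [u0 c0 d0]] := thin_list er es et L.
pose L1 := [seq x <- L0 | phi x != 0].
have L1P (i : 'I_(size L1)) : phi (nth 1%g L1 i) <> 0.
  by apply/eqP; have := mem_nth 1%g (ltn_ord i); rewrite mem_filter => /andP[].
exists (size L1), (fun i v => @coeff phi (nth 1%g L1 i) v0 v); split.
- by move=> i v; exact: (coeff_local h (L1P i)).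
- by move=> i; exact: (coeff_unit h (L1P i)).
move=> g; rewrite -[RHS]/(\sum_(i < size L1) tensor (@coeff phi (nth 1%g L1 i) v0) g).
have vin x : phi x <> 0 -> e x g -> tensor (@coeff phi x v0) g = phi g.
  by move=> px [z [k [k' [h1 h2 h3]]]]; exact: (coeff_in h px v0 h1 h2 h3).
have vout x : phi x <> 0 -> ~ e x g -> tensor (@coeff phi x v0) g = 0.
  by move=> px n; apply: contrapT => ne; apply: n; exact: (coeff_out h px ne).
rewrite -(big_mkord xpredT (fun i => tensor (@coeff phi (nth 1%g L1 i) v0) g)) -(big_nth 1%g xpredT (fun x => tensor (@coeff phi x v0) g)).
have inL1 x : x \in L1 -> x \in L0 /\ phi x <> 0 by rewrite mem_filter => /andP[/eqP].
case: (pselect (exists2 x, x \in L1 & e x g)) => [[x xL xg]|no].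
  have [xL0 px] := inL1 _ xL.
  rewrite (bigD1_seq x) ?filter_uniq //= vin // big_seq_cond big1 ?addr0 // => y /andP[/inL1[yL0 py] yx].
  apply: vout => // yg; case/eqP: yx; apply: d0 => //; exact: (et _ _ _ yg (es _ _ xg)).
rewrite big_seq big1; last by move=> y yL; apply: vout; [have [] := inL1 _ yL|move=> yg; apply: no; exists y].
apply: contrapT => gne; have [y yL [z [k [hk ek]]]] := cL _ gne; have [x xL0 xy] := c0 _ yL.
have yg : e y g.
  by exists z, 1%g, k; split=> //; rewrite mulg1 fscalC -mulgA -ek mulKVg.
have xg := et _ _ _ xy yg; apply: no; exists x => //; rewrite mem_filter xL0 andbT.
apply/eqP => px; apply: gne; have [a [q [q' [h1 h2 ->]]]] := xg.
have -> : (fscal 2 a * q * x * q')%g = (fscal 2 a * (q * x * q'))%g by rewrite !mulgA.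
by rewrite (hk_z h) (hk_bi h _ h1 h2) px mulr0.
Qed.

End Tensor.

(** * Conjugation *)

Section Final.
Variables (R : realType) (F : splittingFieldType rat).
Hypothesis hreal : totally_real R F.
Hypothesis hgal : galois 1%AS {:F}.
Variable Fhat : forall v : finPlace F, completion R v.
Local Notation C := R[i].
Local Notation Gf := (GAf Fhat 2).
Local Notation form := (Defs.form Fhat).
Variable mu : qmeasure R (adelic_center Fhat `|` GF Fhat 2).
Hypothesis hmu : invariant_measure setT mu.
Variable nu : qmeasure R (GF Fhat 2 `&` unipotent Fhat).
Hypothesis hnu : invariant_measure (unipotent Fhat) nu.
Variable lam : qmeasure R (fcenter Fhat).
Hypothesis hlam : fcenter_haar lam.
Variable K : forall v : finPlace F, set (GL 2 (Fhat v)).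
Arguments K : clear implicits.
Hypothesis hK1 : forall v, K v 1%g.
Hypothesis hKM : forall v g h, K v g -> K v h -> K v (g * h)%g.
Hypothesis hKV : forall v g, K v g -> K v (g^-1)%g.
Hypothesis hKint : forall v, K v `<=` @gl_integral R 2 (Fhat v).
Hypothesis hKopen : open (level K).
Hypothesis hKcompact : compact (level K).
Variables (om om' : GA Fhat 1 -> C) (k k' : infPlace R F -> nat) (w : int) (s : autC R).
Hypothesis gom : goodchar K om.
Hypothesis gom' : goodchar K om'.
Hypothesis conj_om : forall z, om' (of_fin z) = sig s (om (of_fin z)).
Hypothesis heckeP : forall phi, hk K (omf om) phi -> hecke om K phi.
Hypothesis heckeP' : forall phi, hecke om' K phi -> hk K (omf om') phi.
Hypothesis htrace : forall phi : Gf -> C, hecke om K phi ->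
  exists2 t : C, hecke_trace mu nu lam om k w phi t & hecke_trace mu nu lam om' k' w (fun g => sig s (phi g)) (sig s t).
Variable dl : Gf -> rat.
Hypothesis dl_gt0 : forall g, 0 < dl g.
Hypothesis dlE : forall g, delta lam K g = lamP lam (ZS (level K)) * ratr (dl g).

Local Notation P := (ZS (level K)).
Let p1 := lP1 hK1.
Let pM := @lPM _ _ _ _ hKM.
Let pV := @lPV _ _ _ _ hKV.
Local Notation H := (hk K (omf om)).
Local Notation H' := (hk K (omf om')).
Local Notation E := (Gf -> C^o).
Local Notation M := (L20kK mu nu om k w K).
Local Notation M' := (L20kK mu nu om' k' w K).
Local Notation c := ((lamP lam P)%:C%C : C).
Local Notation act := Defs.act.
Let c0 : c != 0 := cC0 hlam hK1 hKint hKopen.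
Let o1 := omf1 gom. Let oM := omfM gom. Let oK := omfK gom.
Let o1' := omf1 gom'. Let oM' := omfM gom'. Let oK' := omfK gom'.

Definition cj (f : C -> C) (phi : E) : E := fun g => f (phi g).

Lemma cj_hk phi : H phi -> H' (cj (sig s) phi).
Proof.
move=> h; split=> [q q' g hq hq'|z g|]; rewrite /cj; first by rewrite (hk_bi h).
  by rewrite (hk_z h) rmorphM fmorphV /omf conj_om.
have [L cL] := hk_fin h; exists L => g hg; apply: cL => e; apply: hg; by rewrite e rmorph0.
Qed.

Lemma cjV_hk phi : H' phi -> H (cj (sigV s) phi).
Proof.
move=> h; split=> [q q' g hq hq'|z g|]; rewrite /cj; first by rewrite (hk_bi h).
  by rewrite (hk_z h) rmorphM fmorphV /omf conj_om sigK.
have [L cL] := hk_fin h; exists L => g hg; apply: cL => e; apply: hg; by rewrite e rmorph0.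
Qed.

Lemma cjK phi : cj (sig s) (cj (sigV s) phi) = phi.
Proof. by apply/funext => g; rewrite /cj sigVK. Qed.

Lemma cj_mul phi psi : H phi -> H psi -> cj (sig s) (mul K phi psi) = mul K (cj (sig s) phi) (cj (sig s) psi).
Proof.
move=> h h'; apply/funext => u; rewrite /cj /mul.
have ff := mul_fsup hK1 hKV o1 oM u h h'.
have [_ <-] := csum_morph p1 pM pV (h := sig s) ff (rmorph0 _) (rmorphD _).
by apply: eq_csum => g /=; rewrite rmorphM.
Qed.

Lemma cj_untwist phi : cj (sig s) (untwist dl phi) = untwist dl (cj (sig s) phi).
Proof. by apply/funext => g; rewrite /cj /untwist rmorphM fmorphV /dlC fmorph_rat. Qed.

Lemma HT phi : H phi -> exists t, hecke_trace mu nu lam om k w phi t.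
Proof. by move=> /heckeP/htrace[t ht _]; exists t. Qed.
Lemma HT' phi : H' phi -> exists t, hecke_trace mu nu lam om' k' w phi t.
Proof.
move=> /cjV_hk/heckeP/htrace[t _ ht]; exists (sig s t).
by move: ht; rewrite -[X in hecke_trace _ _ _ _ _ _ X]/(cj (sig s) (cj (sigV s) phi)) cjK.
Qed.

Definition pw (phi : E) n : E := iter n (fun psi => mul K phi psi) phi.

Section OneRep.
Variable V : rep R Gf.
Hypothesis Vsm : smooth V.
Hypothesis Virr : irreducible V.
Hypothesis Vz : forall z (x : V), act (fscal 2 z) x = omf om z *: x.
Hypothesis Vfix : exists2 x : V, fixed K x & x <> 0.
Variable j : V -> form.
Hypothesis jM : forall x, fixed K x -> M (j x).
Hypothesis jlin : forall (a : C) x y, fixed K x -> fixed K y -> ipnull (ip mu om) (j (a *: x + y) - (a *: j x + j y)).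
Hypothesis jinj : forall x, fixed K x -> ipnull (ip mu om) (j x) -> x = 0.
Hypothesis jact : forall phi x y, hecke om K phi -> fixed K x -> fixed K y ->
  hecke_act lam phi x y -> hecke_form mu lam om phi (j x) (j y).
Let U := conj_rep s V.

Lemma conj_Vz z (x : U) : act (fscal 2 z) x = omf om' z *: x.
Proof.
by rewrite [LHS](Vz z x) /omf conj_om /GRing.scale /= /conj_scale sigK.
Qed.

Lemma conj_irr : irreducible U.
Proof.
have [ex irr] := Virr; split=> // Y [Y0 Yl] Yact Yne; apply: irr => //.
split=> // a x y hx hy; have := Yl (sig s a) x y hx hy.
by rewrite {1}/GRing.scale /= /conj_scale sigK.
Qed.

Lemma conj_hact psi (x : V) : hact K (V := U) psi x = hact K (V := V) (cj (sigV s) psi) x.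
Proof. by []. Qed.

Variables (d : nat) (m : 'I_d -> form).
Hypothesis hm : forall i, M (m i).
Hypothesis om_m : orthonormal (ip mu om) m.
Hypothesis mM : forall y, M y -> ipnull (ip mu om) (y - lincomb m (coords (ip mu om) m y)).
Variables (d' : nat) (m' : 'I_d' -> form).
Hypothesis hm' : forall i, M' (m' i).
Hypothesis om_m' : orthonormal (ip mu om') m'.
Hypothesis mM' : forall y, M' y -> ipnull (ip mu om') (y - lincomb m' (coords (ip mu om') m' y)).
Local Notation rho := (hecke_mx mu K om m).
Local Notation rho' := (hecke_mx mu K om' m').

Let rhoM phi psi (h : H phi) (h' : H psi) : rho (mul K phi psi) = rho psi *m rho phi.
Proof. by apply: (hecke_mx_mul hgal hreal hmu hnu hlam hK1 hKM hKV hKint hKopen hKcompact dl_gt0 dlE gom HT hm mM). Qed.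
Let rhoM' phi psi (h : H' phi) (h' : H' psi) : rho' (mul K phi psi) = rho' psi *m rho' phi.
Proof. by apply: (hecke_mx_mul hgal hreal hmu hnu hlam hK1 hKM hKV hKint hKopen hKcompact dl_gt0 dlE gom' HT' hm' mM'). Qed.

Lemma pw_hk phi n : H phi -> H (pw phi n).
Proof. by move=> h; elim: n => //= n IH; exact: (hk_mul hK1 hKM hKV o1 oM h IH). Qed.

Lemma hecke_mx_pw phi n : H phi -> rho (pw phi n) = rho phi ^+ n.+1.
Proof.
move=> h; elim: n => [|n IH]; first by rewrite expr1.
rewrite /pw iterS -/(pw phi n) rhoM //; last exact: pw_hk.
by rewrite IH [RHS]exprSr.
Qed.

(** By the hypothesis on traces the trace of [rho phi ^+ n.+1] is sent by [s]
    to that of a power of [rho' (cj (sig s) phi)], which is 0. *)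
Lemma conj_trace0 phi n : H phi -> rho' (cj (sig s) phi) = 0 -> \tr (rho phi ^+ n.+1) = 0.
Proof.
move=> h r0; have hp := pw_hk n h.
have hu := hk_untwist hlam hK1 hKM hKV hKint hKopen hKcompact dlE hp.
have [t ht ht'] := htrace (heckeP hu).
have e := trace_hecke_mx hgal hreal hmu hnu hlam hK1 hKM hKV hKint hKopen hKcompact dl_gt0 dlE gom hm mM hp ht.
rewrite -[X in hecke_trace _ _ _ _ _ _ X]/(cj (sig s) (untwist dl (pw phi n))) cj_untwist in ht'.
have e' := trace_hecke_mx hgal hreal hmu hnu hlam hK1 hKM hKV hKint hKopen hKcompact dl_gt0 dlE gom' hm' mM' (cj_hk hp) ht'.
have r0' : rho' (cj (sig s) (pw phi n)) = 0.
  case: n hp hu ht e ht' e' => // n hp hu ht e ht' e'.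
  rewrite /= cj_mul //; last exact: pw_hk.
  by rewrite rhoM' ?r0 ?mulmx0 //; apply: cj_hk => //; exact: pw_hk.
move: e'; rewrite r0' mxtrace0 mulr0 => /eqP; rewrite fmorph_eq0 => /eqP t0.
move: e; rewrite t0 hecke_mx_pw // => /esym/eqP; rewrite mulf_eq0 (negbTE c0) /= => /eqP //.
Qed.

(** The embedding of the invariants into the forms intertwines the two
    actions, so that fixed vectors have fixed coordinates. *)
Lemma j_coords phi x : H phi -> fixed K x -> hact K (V := V) phi x = x ->
  coords (ip mu om) m (j x) *m rho phi = coords (ip mu om) m (j x).
Proof.
move=> h hx ex; have hu := hk_untwist hlam hK1 hKM hKV hKint hKopen hKcompact dlE h.
have MX := @L20kK_sub _ _ Fhat mu nu K om k w.
have psd := L2_psd hreal mu gom; have hX := psd_sub psd.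
have fs := fixed_subspace K V.
have hcx : fixed K (c *: x) by apply: (subspaceZ fs).
have f0 : fixed K (0 : V) by case: fs.
have ha : hecke_act lam (untwist dl phi) x (c *: x).
  apply/(hecke_actE hlam hK1 hKM hKV hKint hKopen hKcompact dlE o1 oM Vz _ hu hx).
  by rewrite untwistK // ex.
have hf := jact (heckeP hu) hx hcx ha.
have j0 : ipnull (ip mu om) (j 0).
  have := jlin (-1) f0 f0; rewrite scaler0 addr0 scaleN1r addNr subr0 //.
have jcx l : L2 mu om l -> ip mu om (j (c *: x)) l = c * ip mu om (j x) l.
  move=> hl; have h1 := jlin c hx f0; rewrite addr0 in h1.
  have jx2 := MX _ (jM hx); have j02 := MX _ (jM f0).
  have hZ := subspaceZ hX c jx2; have hD := subspaceD hX hZ j02.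
  rewrite (ip_eq hreal gom (MX _ (jM hcx)) hD hl h1) (ipDl psd hZ j02 hl) (ipZl psd _ jx2 hl).
  by rewrite (ipnull_orth psd j02 hl j0) addr0.
apply/rowP => i; rewrite -(pair_coords hgal hreal hmu hnu hK1 hKM hKV gom hm mM i h (jM hx)) mxE.
have mi := MX _ (hm i).
apply: (mulfI c0); rewrite -jcx // (hform hf mi).
by rewrite (hecke_int_right hreal hmu hlam hK1 hKM hKV hKint hKopen hKcompact dlE gom hu (jM hx) mi) untwistK.
Qed.

(** If [f] did not kill [x], then some [phi] in the left ideal of [f] would
    fix [x]. Its conjugate still acts by 0 on the conjugate space of forms, so
    that all its powers have trace 0; but the coordinates of the form attached
    to [x] are an eigenvector with eigenvalue 1. *)
Lemma kill (f : E) (x : U) : H' f -> rho' f = 0 -> fixed K x -> hact K (V := U) f x = 0.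
Proof.
move=> hf rf hx; apply: contrapT => ne.
have [g hg eg] := @simple_return R E U H' (mul K) (fixed K (V := U)) (hact K (V := U))
  (fun f x h hx => hact_fixed hK1 hKM hKV o1' oM' conj_Vz h hx)
  (fun f g x h h' hx => hact_mul hK1 hKM hKV o1' oM' conj_Vz h h' hx)
  (fun x y hx x0 hy => invariants_simple hK1 hKM hKV hKint hKopen hKcompact o1' oM' oK' conj_Vz conj_irr hx x0 hy)
  f x hf hx ne.
have hgf := hk_mul hK1 hKM hKV o1' oM' hg hf.
pose phi := cj (sigV s) (mul K g f); have hphi : H phi := cjV_hk hgf.
have ex : hact K (V := V) phi x = x by rewrite -conj_hact.
have r0 : rho' (cj (sig s) phi) = 0 by rewrite cjK rhoM' // rf mul0mx.
have v0 := trace_powers_eigenvalue1 (fun n => conj_trace0 n hphi r0) (j_coords hphi hx ex).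
have := mM (jM hx); rewrite v0 /lincomb big1 ?subr0; last by move=> i _; rewrite mxE scale0r.
move=> /(jinj hx) x0; apply: ne; rewrite x0.
exact: (hact0 hK1 hKM hKV o1' oM' conj_Vz hf).
Qed.

Lemma conj_embedding : exists J : U -> 'rV[C]_d',
  [/\ forall (a : C) (x y : U), fixed K x -> fixed K y -> J (a *: x + y) = a *: J x + J y,
      forall x, fixed K x -> J x = 0 -> x = 0
    & forall f x, H' f -> fixed K x -> J (hact K (V := U) f x) = J x *m rho' f].
Proof.
have [u hu u0] := Vfix.
have simp := fun x y hx x0 hy => @invariants_simple R F Fhat K hK1 hKM hKV hKint hKopen hKcompact (omf om') o1' oM' oK' U conj_Vz x y conj_irr hx x0 hy.
have star f (hf : H' f) : exists2 g, H' g & rho' g = adjmx (rho' f).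
  exact: (hecke_mx_star hreal hmu hlam hK1 hKM hKV hKint hKopen hKcompact dlE gom' hm' hf).
have [J [J1 J2 J3]] := @simple_submodule_embeds R E U H' (mul K) (fixed K (V := U)) (hact K (V := U)) d' rho'
  (hk_subspace K (omf om')) (fun f g hf hg => hk_mul hK1 hKM hKV o1' oM' hf hg)
  (fun f x h hx => hact_fixed hK1 hKM hKV o1' oM' conj_Vz h hx)
  (fun a f g x hf hg hx => hact_lin hK1 hKM hKV o1' oM' conj_Vz a hf hg hx)
  (fun f hf => hact0 hK1 hKM hKV o1' oM' conj_Vz hf)
  (fun f g x h h' hx => hact_mul hK1 hKM hKV o1' oM' conj_Vz h h' hx)
  (fun a f g hf hg => hecke_mx_lin hreal hmu hK1 hKM hKV gom' hm' a hf hg)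
  rhoM' simp star kill u hu u0.
exists J; split=> // a x y hx hy.
have [f hf <-] := simp u x hu u0 hx; have [g hg <-] := simp u y hu u0 hy.
exact: J1.
Qed.

(** The embedding of the conjugate invariants into row vectors is turned into
    one into forms by means of the orthonormal basis. *)
Lemma conj_appears : appears mu nu lam om' k' w K U.
Proof.
have [J [J1 J2 J3]] := conj_embedding.
have hM := L20kK_subspace hgal hreal hmu hnu gom' k' w.
have MX := @L20kK_sub _ _ Fhat mu nu K om' k' w.
have psd := L2_psd hreal mu gom'; have hX := psd_sub psd.
have mX i : L2 mu om' (m' i) := MX _ (hm' i).
have lM x : M' (lincomb m' (J x)) by exact: lincomb_in.
exists (fun x => lincomb m' (J x)); split=> [x hx|a x y hx hy|x hx n0|phi x y hphi hx hy ha]; first exact: lM.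
- have -> : lincomb m' (J (a *: x + y)) = a *: lincomb m' (J x) + lincomb m' (J y).
    rewrite J1 // /lincomb scaler_sumr -big_split; apply: eq_bigr => i _.
    by rewrite !mxE scalerDl scalerA.
  by rewrite subrr; apply: (ip0l psd); case: hX.
- apply: J2 => //; rewrite -(coords_lincomb psd (J x) om_m' mX); apply/rowP => i; rewrite !mxE.
  by apply: (ipnull_orth psd) => //; exact: MX (lM x).
have h := heckeP' hphi.
have ht := hk_twist hlam hK1 hKM hKV hKint hKopen hKcompact dlE h.
have {ha}ey : y = c *: hact K (V := U) (twist dl phi) x.
  exact/(hecke_actE hlam hK1 hKM hKV hKint hKopen hKcompact dlE o1' oM' conj_Vz _ h hx).
move=> _ [l hl ->].
have [z hz ez] := hecke_exists hgal hreal hmu hnu hlam hK1 hKM hKV hKint hKopen hKcompact dl_gt0 dlE gom' HT' ht (lM x).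
have -> : cintegral lam setT (fun g => phi g * ip mu om' (frtrans g (lincomb m' (J x))) l) = c * ip mu om' z l.
  by rewrite ez //; exact: (hecke_int_right hreal hmu hlam hK1 hKM hKV hKint hKopen hKcompact dlE gom' h (lM x) hl).
have cz : coords (ip mu om') m' z = J x *m rho' (twist dl phi).
  apply/rowP => i; rewrite mxE ez; last exact: mX.
  rewrite (pair_lincomb hgal hreal hmu hnu hK1 hKM hKV gom' _ ht hm' (mX i)) mxE.
  by apply: eq_bigr => i' _; rewrite [hecke_mx _ _ _ _ _ _ _]mxE.
have hU := hact_fixed hK1 hKM hKV o1' oM' conj_Vz ht hx.
have f0 : fixed K (0 : U) by case: (fixed_subspace K U).
have J0 : J 0 = 0.
  by have := J1 (-1) 0 0 f0 f0; rewrite scaler0 addr0 scaleN1r addNr.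
have eJ : J y = c *: coords (ip mu om') m' z.
  by rewrite ey cz -J3 // -[X in J X]addr0 J1 // J0 addr0.
have el : lincomb m' (J y) = c *: lincomb m' (coords (ip mu om') m' z).
  by rewrite eJ /lincomb scaler_sumr; apply: eq_bigr => i _; rewrite mxE scalerA.
have lX : L2 mu om' (lincomb m' (coords (ip mu om') m' z)) by apply: MX; exact: lincomb_in.
rewrite el (ipZl psd _ lX hl); congr (_ * _); apply/esym.
exact: (ip_eq hreal gom' (MX _ hz) lX hl (mM' hz)).
Qed.

End OneRep.

Theorem conj_in_Pi (V : rep R Gf) : in_Pi mu nu lam om k w K V -> in_Pi mu nu lam om' k' w K (conj_rep s V).
Proof.
move=> [[Vsm Virr] Vz Vfix [j [j1 j2 j3 j4]]].
have [d [m [hm om_m mM]]] := onb_M hgal hreal hmu hnu hlam hK1 hKM hKV hKint hKopen hKcompact dl_gt0 dlE gom HT.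
have [d' [m' [hm' om_m' mM']]] := onb_M hgal hreal hmu hnu hlam hK1 hKM hKV hKint hKopen hKcompact dl_gt0 dlE gom' HT'.
split.
- by split=> //; exact: conj_irr.
- exact: (conj_Vz Vz).
- exact: Vfix.
have := @conj_appears V Virr Vz Vfix j j1 j2 j3 j4 d m hm mM d' m' hm' om_m' mM'.
by [].
Qed.

Lemma conj_iso (V W : rep R Gf) : rep_iso V W -> rep_iso (conj_rep s V) (conj_rep s W).
Proof.
move=> [f [bf fl fa]]; exists f; split=> // a x y; exact: (fl (sigV s a) x y).
Qed.

End Final.

Theorem proposition0p1 (R : realType) (F : splittingFieldType rat)
  (hreal : totally_real R F) (hgal : galois 1%AS {:F})
  (Fhat : forall v : finPlace F, completion R v)
  (mu : qmeasure R (adelic_center Fhat `|` GF Fhat 2))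
  (hmu : invariant_measure setT mu)
  (nu : qmeasure R (GF Fhat 2 `&` unipotent Fhat))
  (hnu : invariant_measure (unipotent Fhat) nu)
  (lam : qmeasure R (fcenter Fhat)) (hlam : fcenter_haar lam)
  (K : forall v : finPlace F, set (GL 2 (Fhat v)))
  (hK1 : forall v, K v 1%g)
  (hKM : forall v g h, K v g -> K v h -> K v (g * h)%g)
  (hKV : forall v g, K v g -> K v (g^-1)%g)
  (hKint : forall v, K v `<=` @gl_integral R 2 (Fhat v))
  (hKopen : open (level K)) (hKcompact : compact (level K))
  (omega : GA Fhat 1 -> R[i]) (homega : idele_class_character omega)
  (hKomega : forall v (z : GL 1 (Fhat v)),
     K v (gl_scal 2 z) -> omega_at omega z = 1)
  (k : infPlace R F -> nat) (hk : forall v, (2 <= k v)%N)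
  (w : int)
  (hw : forall (v : infPlace R F) (z : GL 1 (realAV R)),
     local_char Fhat omega (inl v) z = (`|gl1val z : R| ^ w)%:C%C \/
     local_char Fhat omega (inl v) z = - (`|gl1val z : R| ^ w)%:C%C)
  (hsign : forall (v : infPlace R F) (z : GL 1 (realAV R)),
     (gl1val z : R) = -1 -> local_char Fhat omega (inl v) z = (-1) ^+ k v)
  (hAlg : forall v, ((k v)%:Z = w %[mod 2])%Z)
  (s : autC R)
  (htrace : forall phi : GAf Fhat 2 -> R[i], hecke omega K phi ->
     exists2 t : R[i],
       hecke_trace mu nu lam omega k w phi t
     & hecke_trace mu nu lam (conj_char s omega) (conj_weight s k) w
         (fun g => sig s (phi g)) (sig s t)) :
  (forall V : rep R (GAf Fhat 2),
     in_Pi mu nu lam omega k w K V ->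
     in_Pi mu nu lam (conj_char s omega) (conj_weight s k) w K
       (conj_rep s V)) /\
  (forall V W : rep R (GAf Fhat 2),
     in_Pi mu nu lam omega k w K V -> in_Pi mu nu lam omega k w K W ->
     rep_iso V W -> rep_iso (conj_rep s V) (conj_rep s W)).
Proof.
pose gom := omega_good hgal homega hKint hKomega hw hsign hAlg.
pose gom' := conj_char_good hgal hreal homega hKint hKomega hw hsign hAlg s.
have [dl [dl0 dlE]] := delta_rational hlam hK1 hKM hKV hKint hKopen hKcompact.
split=> [V hV|V W _ _ e]; last exact: conj_iso.
apply: (conj_in_Pi hreal hgal hmu hnu hlam hK1 hKM hKV hKint hKopen hKcompact gom gom'
  (conj_char_fin homega s) _ _ htrace dl0 dlE hV).
  by move=> phi; exact: (hk_hecke hK1 hKM hKV hKint hKopen hKcompact gom).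
by move=> phi; exact: (hecke_hk hK1 hKM hKint hKopen gom').
Qed.
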